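(* For every spatial dimension $n\ge6$, there are expanding vacuum developments and Einstein–massless-scalar developments with nonconstant scalar field ($g=-\mathrm dt^2+h_t$ with $h_t$ left-invariant, $\phi=\phi(t)$, $\operatorname{Ric}_g=\mathrm d\phi\otimes\mathrm d\phi$, on $(0,\infty)\times\mathsf N_n$ with past end $t\downarrow0$) on $$\mathsf N_n=H_3\times H_3\times\mathbb R^{n-6}$$ which are globally $C^0$-inextendible on every discrete left quotient, future timelike and null geodesically complete, and satisfy $\kappa_{\rm opt}(T)\to0$ as $T\downarrow0$ while $\kappa_{\rm an}(T)=\infty$ on every past tail (i.e. for every $T>0$).
   Context: $H_3$ is the three-dimensional Heisenberg group. Vacuum means constant $\phi$. Filling constants, for $g=-\mathrm dt^2+h_t$ on a simply connected two-step nilpotent group with Lie algebra $\mathfrak n$, center $Z$, $V=\mathfrak n/Z$, induced bracket $\mathsf b:\Lambda^2V\to Z$: $A_t=h_t|_Z$, and $H_t$ is the quotient inner product of $h_t$ on $V$. For a compact interval $I\subset(0,T)$ and $\xi\in W^{1,2}_0(I;V)$ put $Q_I(\xi)=\frac12\int_I\mathsf b(\xi,\dot\xi)\,\mathrm dt$, $$\kappa_{\rm opt}(T)=\sup_I\sup_{\xi\ne0}\sup_{0\ne\lambda\in Z^*}\frac{|\lambda(Q_I(\xi))|}{\int_IH_t(\dot\xi,\dot\xi)\sqrt{A_t^{-1}(\lambda,\lambda)}\,\mathrm dt},\qquad\kappa_{\rm an}(T)=\sup_I\sup_{Q_I(\xi)\ne0}\left(\int_I\frac{H_t(\dot\xi,\dot\xi)}{\sqrt{A_t(Q_I(\xi),Q_I(\xi))}}\,\mathrm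 dt\right)^{-1}.$$ Globally $C^0$-inextendible: there is no connected Hausdorff second-countable smooth manifold of the same dimension with a continuous Lorentzian metric admitting a smooth isometric embedding of the spacetime onto a proper open subset. Discrete left quotients include the trivial one. *)

(* Defs.v *)
From HB Require Import structures.
From mathcomp Require Import all_boot all_order all_algebra.
From mathcomp Require Import mxrepresentation generic_quotient.
From mathcomp Require Import ring.
From mathcomp Require Import all_classical all_reals all_analysis.

Set Implicit Arguments.
Unset Strict Implicit.
Unset Printing Implicit Defensive.

Import Order.TTheory GRing.Theory Num.Theory.
Import numFieldNormedType.Exports.

Local Open Scope classical_set_scope.
Local Open Scope ring_scope.
Local Open Scope quotient_scope.

(* Only used with V finite-dimensional, where existence and continuity of all
   iterated directional derivatives is C^k regularity. *)
Fixpoint is_Ck (R : realType) (V W : normedModType R) (k : nat) (U : set V)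
    (f : V -> W) : Prop :=
  match k with
  | 0%N => forall x, U x -> {for x, continuous f}
  | k'.+1 => forall v, (forall x, U x -> derivable f x v) /\
                       is_Ck k' U (fun x => 'D_v f x)
  end.

Definition smooth_on (R : realType) (V W : normedModType R) (U : set V)
    (f : V -> W) : Prop :=
  forall k, is_Ck k U f.

Definition quad (R : realType) (d : nat) (A : 'M[R]_d) (u : 'rV[R]_d) : R :=
  (u *m A *m u^T) 0 0.

Definition inner_product (R : realType) (d : nat) (A : 'M[R]_d) : Prop :=
  A^T = A /\ forall u : 'rV[R]_d, u != 0 -> 0 < quad A u.

Definition lorentzian (R : realType) (d : nat) (A : 'M[R]_d) : Prop :=
  exists2 P : 'M[R]_d, P \in unitmx &
    P *m A *m P^T = diag_mx (\row_(i < d) (if i == 0%N :> nat then -1 else 1)).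

Definition partial (R : realType) (d : nat) (i : 'I_d) (f : 'rV[R]_d -> R)
    (x : 'rV[R]_d) : R :=
  'D_(delta_mx 0 i) f x.

Definition christoffel (R : realType) (d : nat) (g : 'rV[R]_d -> 'M[R]_d)
    (k i j : 'I_d) (x : 'rV[R]_d) : R :=
  2^-1 * \sum_(l < d) invmx (g x) k l *
    (partial i (fun y => g y j l) x + partial j (fun y => g y i l) x
     - partial l (fun y => g y i j) x).

Definition ricci (R : realType) (d : nat) (g : 'rV[R]_d -> 'M[R]_d)
    (i j : 'I_d) (x : 'rV[R]_d) : R :=
  \sum_(k < d) (partial k (christoffel g k i j) x
                - partial j (christoffel g k i k) x)
  + \sum_(k < d) \sum_(l < d)
      (christoffel g k k l x * christoffel g l i j x
       - christoffel g k j l x * christoffel g l i k x).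

(* [J] is meant to be open: derivatives are two-sided. *)
Definition geodesic_on (R : realType) (d : nat) (g : 'rV[R]_d -> 'M[R]_d)
    (D : set 'rV[R]_d) (J : set R) (c : R -> 'rV[R]_d) : Prop :=
  forall s, J s ->
    [/\ D (c s), derivable c s 1, derivable (derive1 c) s 1 &
      forall k, (derive1 (derive1 c) s) 0 k +
        \sum_(i < d) \sum_(j < d)
          christoffel g k i j (c s) * (derive1 c s) 0 i * (derive1 c s) 0 j = 0].

(* [chart_inv] is the inverse of [chart_fun] on [chart_dom]; both are
   irrelevant outside. *)
Record chart (R : realType) (d : nat) (M : Type) := Chart {
  chart_dom : set M;
  chart_fun :> M -> 'rV[R]_d;
  chart_inv : 'rV[R]_d -> M }.

(* A metric is given by its matrix in each chart of the atlas; the laws are in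
   [continuous_lorentzian_manifold]. *)
Record lorentz_data (R : realType) (d : nat) := LorentzData {
  ldata_space :> topologicalType;
  atlas : set (chart R d ldata_space);
  gmat : chart R d ldata_space -> 'rV[R]_d -> 'M[R]_d }.

Definition is_chart (R : realType) (d : nat) (M : topologicalType)
    (c : chart R d M) : Prop :=
  [/\ open (chart_dom c), open (c @` chart_dom c),
      (forall p, chart_dom c p -> chart_inv c (c p) = p),
      (forall p, chart_dom c p -> {for p, continuous c}) &
      (forall x, (c @` chart_dom c) x -> {for x, continuous (chart_inv c)})].

Definition in_charts (R : realType) (d : nat) (X Y : lorentz_data R d)
    (f : X -> Y) (c : chart R d X) (c' : chart R d Y) : 'rV[R]_d -> 'rV[R]_d :=
  fun x => c' (f (chart_inv c x)).

Definition smooth_map (R : realType) (d : nat) (X Y : lorentz_data R d)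
    (f : X -> Y) : Prop :=
  forall c c', @atlas R d X c -> @atlas R d Y c' ->
    smooth_on (c @` (chart_dom c `&` f @^-1` chart_dom c')) (in_charts f c c').

(* f^* g_Y = g_X; vectors are rows, so the differential acts by v |-> v *m J. *)
Definition isometric (R : realType) (d : nat) (X Y : lorentz_data R d)
    (f : X -> Y) : Prop :=
  forall c c', @atlas R d X c -> @atlas R d Y c' ->
    forall p, chart_dom c p -> chart_dom c' (f p) ->
      let J := jacobian (in_charts f c c') (c p) in
      gmat c (c p) = J *m gmat c' (c' (f p)) *m J^T.

(* Smoothness and isometry of the identity say that the transition maps are
   smooth and that the matrices [gmat] form one tensor field. *)
Definition continuous_lorentzian_manifold (R : realType) (d : nat)
    (X : lorentz_data R d) : Prop :=
  [/\ [/\ connected [set: X], hausdorff_space X & @second_countable X],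
      [/\ forall c, @atlas R d X c -> is_chart c,
          forall p : X, exists2 c, @atlas R d X c & chart_dom c p &
          smooth_map (fun p : X => p)] &
      [/\ isometric (fun p : X => p),
          forall c x, @atlas R d X c -> (c @` chart_dom c) x ->
            {for x, continuous (gmat c)} &
          forall c x, @atlas R d X c -> (c @` chart_dom c) x ->
            lorentzian (gmat c x)]].

(* Dimensions agree, so an embedding onto an open subset is the same as an
   injective continuous open map. *)
Definition smooth_isometric_open_embedding (R : realType) (d : nat)
    (X Y : lorentz_data R d) (f : X -> Y) : Prop :=
  [/\ injective f, continuous f, forall U : set X, open U -> open (f @` U),
      smooth_map f & isometric f].

Definition C0_inextendible (R : realType) (d : nat) (X : lorentz_data R d)
    : Prop :=
  ~ exists Y : lorentz_data R d, continuous_lorentzian_manifold Y /\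
      exists f : X -> Y, smooth_isometric_open_embedding f /\
                         range f <> [set: Y].

Definition sc_bracket (R : realType) (n : nat) (c : 'I_n -> 'I_n -> 'I_n -> R)
    (x y : 'rV[R]_n) : 'rV[R]_n :=
  \row_k \sum_i \sum_j c i j k * x 0 i * y 0 j.

Record two_step (R : realType) (n : nat) := TwoStep {
  sconst : 'I_n -> 'I_n -> 'I_n -> R;
  sconst_alt : forall x, sc_bracket sconst x x = 0;
  sconst_nil : forall x y z, sc_bracket sconst (sc_bracket sconst x y) z = 0 }.

Definition bracket (R : realType) (n : nat) (L : two_step R n) :
    'rV[R]_n -> 'rV[R]_n -> 'rV[R]_n :=
  sc_bracket (sconst L).

(* The simply connected group of [L] is 'rV[R]_n in exponential coordinates,
   with the Baker-Campbell-Hausdorff product, neutral element 0 and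
   inverse [- x]. *)
Definition gmul (R : realType) (n : nat) (L : two_step R n)
    (x y : 'rV[R]_n) : 'rV[R]_n :=
  x + y + 2^-1 *: bracket L x y.

Section GroupLaw.
Variables (R : realType) (n : nat) (L : two_step R n).

Lemma bracketDl x y z : bracket L (x + y) z = bracket L x z + bracket L y z.
Proof.
apply/rowP => k; rewrite !mxE -big_split; apply: eq_bigr => i _ /=.
rewrite -big_split; apply: eq_bigr => j _ /=.
by rewrite !mxE mulrDr mulrDl.
Qed.

Lemma bracketDr x y z : bracket L x (y + z) = bracket L x y + bracket L x z.
Proof.
apply/rowP => k; rewrite !mxE -big_split; apply: eq_bigr => i _ /=.
rewrite -big_split; apply: eq_bigr => j _ /=.
by rewrite !mxE mulrDr.
Qed.

Lemma bracketZl a x y : bracket L (a *: x) y = a *: bracket L x y.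
Proof.
apply/rowP => k; rewrite !mxE mulr_sumr; apply: eq_bigr => i _ /=.
rewrite mulr_sumr; apply: eq_bigr => j _ /=.
by rewrite !mxE !mulrA (mulrC _ a).
Qed.

Lemma bracketZr a x y : bracket L x (a *: y) = a *: bracket L x y.
Proof.
apply/rowP => k; rewrite !mxE mulr_sumr; apply: eq_bigr => i _ /=.
rewrite mulr_sumr; apply: eq_bigr => j _ /=.
by rewrite !mxE mulrCA !mulrA.
Qed.

Lemma bracketxx x : bracket L x x = 0. Proof. exact: sconst_alt. Qed.

Lemma bracketC x y : bracket L x y = - bracket L y x.
Proof.
have := bracketxx (x + y).
rewrite bracketDl !bracketDr !bracketxx add0r addr0 => /eqP.
by rewrite addr_eq0 => /eqP.
Qed.

Lemma bracket2l x y z : bracket L (bracket L x y) z = 0.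
Proof. exact: sconst_nil. Qed.

Lemma bracket2r x y z : bracket L x (bracket L y z) = 0.
Proof. by rewrite bracketC bracket2l oppr0. Qed.

Lemma bracketNl x y : bracket L (- x) y = - bracket L x y.
Proof. by rewrite -scaleN1r bracketZl scaleN1r. Qed.

Lemma gmulA x y z : gmul L x (gmul L y z) = gmul L (gmul L x y) z.
Proof.
rewrite /gmul !(bracketDl, bracketDr, bracketZl, bracketZr, bracket2l, bracket2r).
rewrite !scaler0 !addr0; move: (bracket L x y) (bracket L x z) (bracket L y z).
by move=> u v w; apply/rowP => k; rewrite !mxE; ring.
Qed.

Lemma gmul0 x : gmul L 0 x = x.
Proof. by rewrite /gmul -(scale0r 0) bracketZl !scale0r scaler0 add0r addr0. Qed.

Lemma gmulV x : gmul L (- x) x = 0.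
Proof. by rewrite /gmul bracketNl bracketxx oppr0 scaler0 addr0 addNr. Qed.

End GroupLaw.

Record discrete_subgroup (R : realType) (n : nat) (L : two_step R n) :=
  DiscreteSubgroup {
    dsg : set 'rV[R]_n;
    dsg1 : dsg 0;
    dsgM : forall x y, dsg x -> dsg y -> dsg (gmul L x y);
    dsgV : forall x, dsg x -> dsg (- x);
    dsg_discrete : forall x, dsg x -> \forall y \near x, dsg y -> y = x }.

Section LeftQuotient.
Variables (R : realType) (n : nat) (L : two_step R n).
Variable Gam : discrete_subgroup L.

Definition same_orbit (x y : 'rV[R]_n) : bool :=
  `[< exists2 g, dsg Gam g & y = gmul L g x >].

Lemma same_orbit_refl : reflexive same_orbit.
Proof. by move=> x; apply/asboolP; exists 0; [exact: dsg1|rewrite gmul0]. Qed.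

Lemma same_orbit_sym : symmetric same_orbit.
Proof.
suff H x y : same_orbit x y -> same_orbit y x.
  by move=> x y; apply/idP/idP; exact: H.
move=> /asboolP[g Gg ->]; apply/asboolP; exists (- g); first exact: dsgV.
by rewrite gmulA gmulV gmul0.
Qed.

Lemma same_orbit_trans : transitive same_orbit.
Proof.
move=> y x z /asboolP[g Gg ->] /asboolP[h Gh ->]; apply/asboolP.
by exists (gmul L h g); [exact: dsgM|rewrite gmulA].
Qed.

Canonical same_orbit_equiv :=
  EquivRel same_orbit same_orbit_refl same_orbit_sym same_orbit_trans.

Definition left_quotient := quotient_topology {eq_quot same_orbit_equiv}.

End LeftQuotient.

Definition tcoord (R : realType) (n : nat) (p : 'rV[R]_(1 + n)) : R :=
  lsubmx p 0 0.

Definition half_space (R : realType) (n : nat) : set 'rV[R]_(1 + n) :=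
  [set p | 0 < tcoord p].

(* The left-invariant metric with value [A] on the Lie algebra, at [x]: the
   pull-back of [A] by the differential at [x] of left translation by x^-1. *)
Definition left_invariant (R : realType) (n : nat) (L : two_step R n)
    (A : 'M[R]_n) (x : 'rV[R]_n) : 'M[R]_n :=
  let J := jacobian (gmul L (- x)) x in J *m A *m J^T.

Definition st_metric (R : realType) (n : nat) (L : two_step R n)
    (h : R -> 'M[R]_n) (p : 'rV[R]_(1 + n)) : 'M[R]_(1 + n) :=
  block_mx (-1)%:M 0 0 (left_invariant L (h (tcoord p)) (rsubmx p)).

Definition pos_times (R : realType) : set R := [set t | 0 < t].

Lemma one_pos_time (R : realType) : (1 : R) \in @pos_times R.
Proof. by rewrite inE /pos_times /= ltr01. Qed.

Section QuotientSpacetime.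
Variables (R : realType) (n : nat) (L : two_step R n).
Variables (Gam : discrete_subgroup L) (h : R -> 'M[R]_n).

Definition quotient_space : topologicalType :=
  (set_type (@pos_times R) * left_quotient Gam)%type.

(* The covering map (t, x) |-> (t, Gam x), with a junk value for t <= 0. *)
Definition st_proj (p : 'rV[R]_(1 + n)) : quotient_space :=
  (insubd (exist _ 1 (one_pos_time R) : set_type (@pos_times R)) (tcoord p),
   \pi_(left_quotient Gam) (rsubmx p)).

(* The charts are the local inverses of the covering map. *)
Definition quotient_atlas : set (chart R (1 + n) quotient_space) :=
  [set c | exists W : set 'rV[R]_(1 + n),
     [/\ open W, W `<=` @half_space R n, chart_dom c = st_proj @` W,
         (forall p, W p -> c (st_proj p) = p) &
         (forall p, W p -> chart_inv c p = st_proj p)]].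

Definition quotient_spacetime : lorentz_data R (1 + n) :=
  @LorentzData R (1 + n) quotient_space quotient_atlas
    (fun _ => st_metric L h).

End QuotientSpacetime.

Definition einstein_scalar_development (R : realType) (n : nat)
    (L : two_step R n) (h : R -> 'M[R]_n) (phi : R -> R) : Prop :=
  [/\ smooth_on (@pos_times R) h,
      smooth_on (@pos_times R) phi,
      (forall t, 0 < t -> inner_product (h t)) &
      forall p : 'rV[R]_(1 + n), half_space p -> forall i j,
        ricci (st_metric L h) i j p =
        partial i (fun q : 'rV[R]_(1 + n) => phi (tcoord q)) p *
        partial j (fun q : 'rV[R]_(1 + n) => phi (tcoord q)) p].

Definition constant_field (R : realType) (phi : R -> R) : Prop :=
  forall s t, 0 < s -> 0 < t -> phi s = phi t.

(* The mean curvature of each slice, tr (h^-1 h') / 2, is positive. *)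
Definition expanding (R : realType) (n : nat) (h : R -> 'M[R]_n) : Prop :=
  forall t, 0 < t -> 0 < \tr (invmx (h t) *m (derive1 h t)).

(* Future-directed geodesics whose squared velocity satisfies [P] extend to all
   larger affine parameters. *)
Definition future_complete (R : realType) (n : nat) (L : two_step R n)
    (h : R -> 'M[R]_n) (P : R -> Prop) : Prop :=
  forall (a b : R) (c : R -> 'rV[R]_(1 + n)), a < b ->
    geodesic_on (st_metric L h) (@half_space R n) `]a, b[ c ->
    (forall s, a < s < b ->
       P (quad (st_metric L h (c s)) (derive1 c s)) /\ 0 < tcoord (derive1 c s)) ->
    exists2 c' : R -> 'rV[R]_(1 + n),
      geodesic_on (st_metric L h) (@half_space R n) `]a, +oo[ c' &
      forall s, a < s < b -> c' s = c s.

Definition future_timelike_complete (R : realType) (n : nat)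
    (L : two_step R n) (h : R -> 'M[R]_n) : Prop :=
  future_complete L h (fun q => q < 0).

Definition future_null_complete (R : realType) (n : nat)
    (L : two_step R n) (h : R -> 'M[R]_n) : Prop :=
  future_complete L h (fun q => q = 0).

Section Filling.
Variables (R : realType) (n : nat) (L : two_step R n).

Local Notation mu := (@lebesgue_measure R).

(* The rows of [center] span the center Z. *)
Definition center : 'M[R]_n :=
  kermx (\matrix_(i < n) mxvec (\matrix_(j < n, k < n) sconst L i j k)).

(* Z and V = n / Z in coordinates, through val_submod / in_submod and
   val_factmod / in_factmod. *)
Definition dimZ : nat := \rank center.
Definition dimV : nat := \rank (cokermx center).

Definition bV (v w : 'rV[R]_dimV) : 'rV[R]_dimZ :=
  in_submod center
    (bracket L (val_factmod (U := center) v) (val_factmod (U := center) w)).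

Definition metricZ (A : 'M[R]_n) : 'M[R]_dimZ :=
  let B := val_submod (U := center) 1%:M in B *m A *m B^T.

Definition quotV (A : 'M[R]_n) (v : 'rV[R]_dimV) : R :=
  inf [set quad A u | u in [set u : 'rV[R]_n | in_factmod center u = v]].

(* xi is (the continuous representative of) an element of W^{1,2}_0([a,b]; V)
   with weak derivative dxi. *)
Definition W12_0 (a b : R) (xi dxi : R -> 'rV[R]_dimV) : Prop :=
  [/\ forall i, measurable_fun `[a, b] (fun t => dxi t 0 i),
      forall i, mu.-integrable `[a, b] (fun t => ((dxi t 0 i) ^+ 2)%:E),
      forall t i, a <= t <= b -> xi t 0 i = \int[mu]_(s in `[a, t]) dxi s 0 i &
      xi b = 0].

Definition fillQ (a b : R) (xi dxi : R -> 'rV[R]_dimV) : 'rV[R]_dimZ :=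
  \row_k (2^-1 * \int[mu]_(t in `[a, b]) bV (xi t) (dxi t) 0 k).

(* [lam] ranges over Z^* in dual coordinates. *)
Definition kappa_opt (h : R -> 'M[R]_n) (T : R) : \bar R :=
  ereal_sup [set r | exists a b xi dxi (lam : 'rV[R]_dimZ),
    [/\ [/\ 0 < a, a < b & b < T], W12_0 a b xi dxi,
        (exists2 t, a <= t <= b & xi t != 0), lam != 0 &
        r = (`|(lam *m (fillQ a b xi dxi)^T) 0 0| /
             \int[mu]_(t in `[a, b])
               (quotV (h t) (dxi t) *
                Num.sqrt (quad (invmx (metricZ (h t))) lam)))%:E]].

Definition kappa_an (h : R -> 'M[R]_n) (T : R) : \bar R :=
  ereal_sup [set r | exists a b xi dxi,
    [/\ [/\ 0 < a, a < b & b < T], W12_0 a b xi dxi,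
        fillQ a b xi dxi != 0 &
        r = ((\int[mu]_(t in `[a, b])
               (quotV (h t) (dxi t) /
                Num.sqrt (quad (metricZ (h t)) (fillQ a b xi dxi))))^-1)%:E]].

End Filling.

(* In the basis X1, Y1, Z1, X2, Y2, Z2, ... the only nonzero brackets are
   [X1, Y1] = Z1 and [X2, Y2] = Z2 (meaningful for 6 <= n). *)
Definition heis2_rel (i j k : nat) : bool :=
  (i, j, k) \in [:: (0, 1, 2); (3, 4, 5)]%N.

Definition heis2_sc (R : realType) (n : nat) (i j k : 'I_n) : R :=
  (heis2_rel i j k)%:R - (heis2_rel j i k)%:R.

Lemma heis2_alt (R : realType) (n : nat) (x : 'rV[R]_n) :
  sc_bracket (@heis2_sc R n) x x = 0.
Proof.
apply/rowP => k; rewrite !mxE.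
pose F (i j : 'I_n) := (heis2_rel i j k)%:R * x 0 i * x 0 j.
transitivity (\sum_i \sum_j F i j - \sum_i \sum_j F j i).
  rewrite -sumrB; apply: eq_bigr => i _; rewrite -sumrB; apply: eq_bigr => j _.
  by rewrite /F /heis2_sc; ring.
by rewrite [X in _ - X]exchange_big subrr.
Qed.

Lemma heis2_nil (R : realType) (n : nat) (x y z : 'rV[R]_n) :
  sc_bracket (@heis2_sc R n) (sc_bracket (@heis2_sc R n) x y) z = 0.
Proof.
apply/rowP => m; rewrite !mxE big1 // => k _; rewrite big1 // => l _.
rewrite !mxE; have [Hk|Hk] := boolP ((k : nat) \in [:: 2; 5]%N).
  have ->: heis2_sc R k l m = 0; last by rewrite !mul0r.
  rewrite /heis2_sc /heis2_rel !inE !xpair_eqE.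
  move: Hk; rewrite !inE => /orP[] /eqP->; rewrite /= !andbF /= ?subrr //.
have H0 (i j : 'I_n) : heis2_sc R i j k = 0.
  move: Hk; rewrite /heis2_sc /heis2_rel !inE !xpair_eqE negb_or => /andP[].
  by move=> /negbTE-> /negbTE->; rewrite !andbF subrr.
rewrite [X in _ * X * _]big1 ?mulr0 ?mul0r // => i _.
by rewrite big1 // => j _; rewrite H0 !mul0r.
Qed.

Definition heis2 (R : realType) (n : nat) : two_step R n :=
  TwoStep (@heis2_alt R n) (@heis2_nil R n).

(* Main.v *)
From HB Require Import structures.
Require Import Defs.
From mathcomp Require Import all_boot all_order all_algebra.
From mathcomp Require Import generic_quotient mxrepresentation.
From mathcomp Require Import ring lra.
From mathcomp Require Import all_classical all_reals all_analysis.
From mathcomp Require Import measurable_realfun.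
(** With u = s^(2q), q = 59/78 and dt/ds = (1 + u)^2, take h = diag(a_i^2),
    a_i^2 = C_i s^(2 p_i) (1 + u)^(2, 2, -2, 2, 2, -2, 0, ...): the Einstein
    equations become identities between the exponents p_i(m), with
    phi = A log s and A^2 = 1 - sum p_i^2, which vanishes at m = 6.

    Inextendibility: near a missing boundary point, pull a chart of the extension
    back by the covering map. A causal curve running to t = oo inside it is
    delayed to (sqrt (t^2 - c), x), still timelike as h grows slower than
    t^(3/2), and the delayed curves climb without bound; one running to t = 0
    is translated along X1, whose length blows up, while the chart keeps
    distances on a slice bounded.

    Completeness: central and flat momenta are constant, the two other pairs
    rotate, so t' = F(t) with F(t) <= (t / t1) F(t1).

    kappa_an is infinite because a loop in one Heisenberg factor at time t and a
    much earlier one in the other pay for the same vertical length. *)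

Set Implicit Arguments.
Unset Strict Implicit.
Unset Printing Implicit Defensive.
Import Order.TTheory GRing.Theory Num.Theory.
Import numFieldNormedType.Exports.
Local Open Scope classical_set_scope.
Local Open Scope ring_scope.

(** The metric of an extension is only continuous, so its geodesics cannot be relied on. It is
    probed through its light cones: on a small chart these lie between two fixed Euclidean cones,
    and straight segments in the narrow one take the role of geodesics. Left translations are
    isometries of the group but not of its quotients, so segments are lifted to the cover,
    translated there, and compared by the monotonicity of chart time.

    The exponents are dictated by p_Z - p_X - p_Y = q - 1 in both Heisenberg factors. Then a_Z /
    (a_X a_Y) is the same multiple of s^(q-1) (1 + u)^(-3) in both, one function u serves both sets
    of Einstein equations, and the integral of this ratio over (0, T) tends to 0, which bounds
    [kappa_opt]. In [kappa_an] an early loop costs about s^((77 + 4 m) / 78) divided by its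
    duration, which is small because the exponent exceeds 1. At m = 6 the field vanishes, at m = 3
    it does not; p_X = - m / 78 < 0 in the first factor is what makes X1 blow up. *)

Section Calculus.
Variable R : realType.

(** The set of s such that P holds on all of [a, s] has a supremum, which the last hypothesis
    includes and the middle one pushes further unless it is b. Both steps may use P on the whole
    earlier segment, as bootstrap arguments require: being in [O] up to s gives the estimate that
    keeps a curve in [O]. *)
Lemma real_induction (P : R -> Prop) (a b : R) :
  P a ->
  (forall s, a <= s < b -> (forall r, a <= r <= s -> P r) ->
     exists2 e, 0 < e & forall r, s < r < s + e -> r <= b -> P r) ->
  (forall s, a < s <= b -> (forall r, a <= r < s -> P r) -> P s) ->
  forall s, a <= s <= b -> P s.
Proof.
move=> Pa Pr Pl s0 /andP[as0 s0b].
pose A := [set s | a <= s <= b /\ forall r, a <= r <= s -> P r].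
have Aa : A a.
  by split; [rewrite lexx (le_trans as0)|move=> r; rewrite -eq_le => /eqP <-].
have supA : has_sup A.
  by split; [exists a|exists b => x [/andP[]]].
set S := sup A.
have aS : a <= S by apply: ub_le_sup => //; case: supA.
have Sb : S <= b by apply: ge_sup; [exists a|move=> x [/andP[]]].
have PS r : a <= r < S -> P r.
  move=> /andP[ar rS].
  have e0 : 0 < S - r by rewrite subr_gt0.
  have [x [_ Px]] := sup_adherent e0 supA.
  rewrite -/S opprB addrC subrK => rx.
  by apply: Px; rewrite ar ltW.
have PSS : P S.
  have [aS'|Sa] := ltP a S; first by apply: Pl => //; rewrite aS'.
  by have -> : S = a by apply/eqP; rewrite eq_le aS Sa.
have PS' r : a <= r <= S -> P r.
  move=> /andP[ar]; rewrite le_eqVlt => /orP[/eqP->//|rS].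
  by apply: PS; rewrite ar.
have [Sltb|bS] := ltP S b; last first.
  by apply: PS'; rewrite as0 (le_trans s0b).
have aSb : a <= S < b by rewrite aS.
have [e e0 Pe] := Pr S aSb PS'.
pose x := Num.min b (S + e / 2).
have Sx : S < x by rewrite lt_min Sltb ltrDl divr_gt0.
suff Ax : A x.
  have : x <= S by apply: ub_le_sup => //; case: supA.
  by rewrite leNgt Sx.
split; first by rewrite (le_trans aS (ltW Sx)) /x ge_min lexx.
move=> r /andP[ar rx]; have [rS|Sr] := leP r S; first by apply: PS'; rewrite ar.
have xb : x <= b by rewrite /x ge_min lexx.
apply: Pe (le_trans rx xb); rewrite Sr /= (le_lt_trans rx)//.
by rewrite /x gt_min; apply/orP; right; rewrite ltrD2l ltr_pdivrMr// ltr_pMr// ltr1n.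
Qed.

Lemma is_derive_continuous (V : normedModType R) (f : R -> V) (x : R) d :
  is_derive x (1 : R) f d -> {for x, continuous f}.
Proof.
by move=> [df _]; apply: differentiable_continuous; apply/derivable1_diffP.
Qed.

Lemma mono_derive (f f' : R -> R) (a b : R) : a <= b ->
  (forall s, a <= s <= b -> is_derive s (1 : R) f (f' s)) ->
  (forall s, a <= s <= b -> 0 <= f' s) -> f a <= f b.
Proof.
move=> ab df f0.
have dfo x : x \in `]a, b[ -> a <= x <= b.
  by rewrite in_itv /= => /andP[ax xb]; rewrite !ltW.
have [| |c cab] := @MVT_segment _ f f' a b ab.
- by move=> x /dfo /df.
- apply: continuous_in_subspaceT => x; rewrite inE /= in_itv /= => /df.
  exact: is_derive_continuous.
- move=> E; rewrite -subr_ge0 E mulr_ge0 ?subr_ge0 ?f0//.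
Qed.

(** Both [g - f] and [g + f] are nondecreasing. This serves as an integral estimate for derivatives
    that are only known pointwise. *)
Lemma abs_mono_derive (f f' g g' : R -> R) (a b : R) : a <= b ->
  (forall s, a <= s <= b -> is_derive s (1 : R) f (f' s)) ->
  (forall s, a <= s <= b -> is_derive s (1 : R) g (g' s)) ->
  (forall s, a <= s <= b -> `|f' s| <= g' s) -> `|f b - f a| <= g b - g a.
Proof.
move=> ab df dg fg.
have H1 : (g - f) a <= (g - f) b.
  apply: (@mono_derive _ (fun s => g' s - f' s)) => // s sab.
    by apply: is_deriveB; [exact: dg|exact: df].
  by have := fg s sab; rewrite ler_norml => /andP[_]; rewrite subr_ge0.
have H2 : (g + f) a <= (g + f) b.
  apply: (@mono_derive _ (fun s => g' s + f' s)) => // s sab.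
    by apply: is_deriveD; [exact: dg|exact: df].
  by have := fg s sab; rewrite ler_norml => /andP[+ _]; rewrite lerNl; lra.
have {H1}H1 : g a - f a <= g b - f b by [].
have {H2}H2 : g a + f a <= g b + f b by [].
rewrite ler_norml; apply/andP; split; lra.
Qed.

Lemma near_itv (s a b : R) : a < s < b -> \forall r \near s, a < r < b.
Proof.
move=> /andP[sa sb]; near=> r; apply/andP; split; near: r.
- exact: lt_nbhsr.
- exact: lt_nbhsl.
Unshelve. all: by end_near. Qed.

Lemma is_derive_coord m k (c : R -> 'M[R]_(m, k)) (s : R) v i j :
  is_derive s (1 : R) c v -> is_derive s (1 : R) (fun r => c r i j) (v i j).
Proof.
move=> [dc <-]; apply: DeriveDef; first by move/derivable_mxP: dc; exact.
by rewrite derive_mx// mxE.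
Qed.

Lemma is_derive_mx m k (c : R -> 'M[R]_(m, k)) (s : R) (v : 'M[R]_(m, k)) :
  (forall i j, is_derive s (1 : R) (fun r => c r i j) (v i j)) ->
  is_derive s (1 : R) c v.
Proof.
move=> H; have dc : derivable c s 1.
  by apply/derivable_mxP => i j; case: (H i j).
apply: DeriveDef => //; rewrite derive_mx//; apply/matrixP => i j.
by rewrite mxE; case: (H i j).
Qed.

Lemma is_derive_diff (V W : normedModType R) (c : R -> V) (f : V -> W)
    (s : R) v :
  is_derive s (1 : R) c v -> differentiable f (c s) ->
  is_derive s (1 : R) (f \o c) ('d f (c s) v).
Proof.
move=> [dc <-] df.
have dc' : differentiable c s by apply/derivable1_diffP.
have dfc : differentiable (f \o c) s by exact: differentiable_comp.
apply: DeriveDef; first by apply/derivable1_diffP.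
by rewrite deriveE// diff_comp//= deriveE.
Qed.

(** Compactness of [a, b] turns the neighbourhoods of t obtained for each s into one that works for
    all s. *)
Lemma tube (T : topologicalType) (f : R -> R -> T) (U : set T) (a b t : R) :
  open U ->
  (forall s, a <= s <= b -> {for (t, s), continuous (fun z : R * R => f z.1 z.2)}) ->
  (forall s, a <= s <= b -> U (f t s)) ->
  \forall t' \near t, forall s, a <= s <= b -> U (f t' s).
Proof.
move=> oU cf Uf.
have /compact_near_coveringP nc := @segment_compact R a b.
have := nc _ (nbhs t) (fun t' s => U (f t' s)) _.
move=> /(_ _)[|e /= e0 He].
  move=> s; rewrite /= in_itv /= => sab.
  have := cf s sab; move=> /(_ U) /=; rewrite nbhs_simpl /=.
  have nU : nbhs (f t s) U by apply: open_nbhs_nbhs; split => //; exact: Uf.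
  move=> /(_ nU) [[A B] /= [nA nB] AB].
  exists (B, A) => //= -[s' t'] [/= Bs' At'].
  exact: (AB (t', s')).
exists e => // t' te s sab; apply: (He t') => //=.
Qed.

End Calculus.

(** * Linear maps and matrix-valued functions *)

Section Linear.
Variable R : realType.

Lemma linear_mulmx a b (f : 'rV[R]_a -> 'rV[R]_b) : linear f ->
  exists A, forall v, f v = v *m A.
Proof.
move=> lf; pose B := GRing.isLinear.Build R _ _ _ f lf.
pose F : {linear 'rV[R]_a -> 'rV[R]_b} := HB.pack f B.
by exists (lin1_mx F) => v; rewrite mul_rV_lin1.
Qed.

Lemma is_derive_mulmx a b (A : 'M[R]_(a, b)) (c : R -> 'rV[R]_a) (s : R) v :
  is_derive s (1 : R) c v -> is_derive s (1 : R) (fun r => c r *m A) (v *m A).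
Proof.
move=> dc; apply: is_derive_mx => i j; rewrite (ord1 i).
have -> : (fun r => (c r *m A) 0 j) = \sum_k (fun r => A k j *: c r 0 k).
  by apply/funext => r; rewrite mxE fct_sumE; apply: eq_bigr => k _; exact: mulrC.
have -> : (v *m A) 0 j = \sum_k A k j *: v 0 k.
  by rewrite mxE; apply: eq_bigr => k _; exact: mulrC.
apply: is_derive_sum => k; apply: (is_deriveZ (f := fun r => c r 0 k)).
exact: is_derive_coord.
Qed.

Lemma is_derive_linear a b (f : 'rV[R]_a -> 'rV[R]_b) (c : R -> 'rV[R]_a)
    (s : R) v : linear f ->
  is_derive s (1 : R) c v -> is_derive s (1 : R) (fun r => f (c r)) (f v).
Proof.
move=> /linear_mulmx[A fA] dc; rewrite fA.
have -> : (fun r => f (c r)) = (fun r => c r *m A) by apply/funext => r.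
exact: is_derive_mulmx.
Qed.

Lemma cts_mx (T : topologicalType) m k (f : T -> 'M[R]_(m, k)) (x : T) :
  (forall i j, {for x, continuous (fun y => f y i j)}) -> {for x, continuous f}.
Proof.
move=> H; apply/cvgrPdist_lt => e e0.
have : \forall y \near x, forall i j, `|f x i j - f y i j| < e.
  apply: filter_forall => i; apply: filter_forall => j.
  by have /cvgrPdist_lt := H i j; apply.
apply: filterS => y Hy.
rewrite /Num.norm /= mx_normrE; apply: bigmax_lt => // -[i j] _ /=.
by rewrite !mxE.
Qed.

Lemma cts_sum (T : topologicalType) (I : Type) (r : seq I) (f : I -> T -> R)
    (x : T) : (forall i, {for x, continuous (f i)}) ->
  {for x, continuous (fun y => \sum_(i <- r) f i y)}.
Proof.
move=> cf; elim: r => [|i r IH].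
  have -> : (fun y => \sum_(i <- [::]) f i y) = cst 0.
    by apply/funext => y; rewrite big_nil.
  exact: cst_continuous.
have -> : (fun y => \sum_(i <- i :: r) f i y) =
    (fun y => f i y + \sum_(i <- r) f i y).
  by apply/funext => y; rewrite big_cons.
exact: (@continuousD R R T (f i)).
Qed.

Lemma cts_linear a b (f : 'rV[R]_a -> 'rV[R]_b) : linear f -> continuous f.
Proof.
move=> /linear_mulmx[A fA] x.
have -> : f = (fun v => v *m A) by apply/funext.
apply: cts_mx => i j; rewrite (ord1 i).
have -> : (fun v => (v *m A) 0 j) = (fun v : 'rV_a => \sum_k v 0 k * A k j).
  by apply/funext => r; rewrite mxE.
apply: cts_sum => k.
apply: (@continuousM _ _ (fun v : 'rV[R]_a => v 0 k) (cst (A k j))).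
  exact: coord_continuous.
exact: cst_continuous.
Qed.

End Linear.

(** * Coordinates (t, x) and the left-invariant quadratic form *)

Section Spacetime.
Variables (R : realType) (n : nat) (L : two_step R n).
Local Notation V := 'rV[R]_(1 + n).

Definition mk (t : R) (x : 'rV[R]_n) : V := row_mx t%:M x.

Lemma tcoord_mk t x : tcoord (mk t x) = t.
Proof. by rewrite /tcoord row_mxKl mxE eqxx. Qed.

Lemma rsubmx_mk t x : rsubmx (mk t x) = x.
Proof. by rewrite row_mxKr. Qed.

Lemma mk_eta (p : V) : mk (tcoord p) (rsubmx p) = p.
Proof.
rewrite /mk /tcoord -[RHS]hsubmxK; congr (row_mx _ _).
by apply/matrixP => i j; rewrite !ord1 !mxE eqxx.
Qed.

Lemma tcoordE (p : V) : tcoord p = p 0 (lshift n 0).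
Proof. by rewrite /tcoord mxE. Qed.

Lemma rsubmxE (p : V) i : rsubmx p 0 i = p 0 (rshift 1 i).
Proof. by rewrite mxE. Qed.

Lemma tcoordD (p q : V) : tcoord (p + q) = tcoord p + tcoord q.
Proof. by rewrite !tcoordE mxE. Qed.
Lemma tcoordN (p : V) : tcoord (- p) = - tcoord p.
Proof. by rewrite !tcoordE mxE. Qed.
Lemma tcoordZ a (p : V) : tcoord (a *: p) = a * tcoord p.
Proof. by rewrite !tcoordE mxE. Qed.
Lemma tcoord0 : tcoord (0 : V) = 0.
Proof. by rewrite tcoordE mxE. Qed.
Lemma rsubmxD (p q : V) : rsubmx (p + q) = rsubmx p + rsubmx q.
Proof. exact: linearD. Qed.
Lemma rsubmxN (p : V) : rsubmx (- p) = - rsubmx p.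
Proof. exact: linearN. Qed.
Lemma rsubmxZ a (p : V) : rsubmx (a *: p) = a *: rsubmx p.
Proof. exact: linearZ. Qed.

Definition txE := (tcoordD, tcoordN, tcoordZ, tcoord0, rsubmxD, rsubmxN,
  rsubmxZ, tcoord_mk, rsubmx_mk).

Lemma ord_tx (j : 'I_(1 + n)) : j = lshift n 0 \/ exists k, j = rshift 1 k.
Proof.
case: (splitP j) => k jk.
  by left; apply/val_inj => /=; rewrite jk (ord1 k).
by right; exists k; apply/val_inj.
Qed.

Lemma norm_ltP (p : V) e : 0 < e ->
  (`|p| < e <-> `|tcoord p| < e /\ forall i, `|rsubmx p 0 i| < e).
Proof.
move=> e0; rewrite {1}/Num.norm /= mx_normrE; split.
  move=> H; have Hij j : `|p 0 j| < e.
    by apply: le_lt_trans H; apply: (le_bigmax _ _ (0, j)).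
  by split => [|i]; rewrite ?tcoordE ?rsubmxE.
move=> [H0 H]; apply: bigmax_lt => // -[i j] _ /=; rewrite ord1.
by have [->|[k ->]] := ord_tx j; rewrite -?tcoordE -?rsubmxE.
Qed.

Lemma norm_leP (p : V) e : 0 <= e ->
  (`|p| <= e <-> `|tcoord p| <= e /\ forall i, `|rsubmx p 0 i| <= e).
Proof.
move=> e0; rewrite {1}/Num.norm /= mx_normrE; split.
  move=> H; have Hij j : `|p 0 j| <= e.
    by apply: le_trans H; apply: (le_bigmax _ _ (0, j)).
  by split => [|i]; rewrite ?tcoordE ?rsubmxE.
move=> [H0 H]; apply: bigmax_le => // -[i j] _ /=; rewrite ord1.
by have [->|[k ->]] := ord_tx j; rewrite -?tcoordE -?rsubmxE.
Qed.

Lemma rV_normP (k : nat) (x : 'rV[R]_k) e : 0 <= e ->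
  (`|x| <= e <-> forall i, `|x 0 i| <= e).
Proof.
move=> e0; rewrite {1}/Num.norm /= mx_normrE; split.
  by move=> H i; apply: le_trans H; apply: (le_bigmax _ _ (0, i)).
by move=> H; apply: bigmax_le => // -[i j] _ /=; rewrite ord1.
Qed.

Lemma norm_tcoord (p : V) : `|tcoord p| <= `|p|.
Proof. by have /norm_leP[] := lexx `|p|. Qed.

Lemma norm_rsubmx (p : V) : `|rsubmx p| <= `|p|.
Proof. by apply/rV_normP => //; have /norm_leP[] := lexx `|p|. Qed.

Lemma tcoord_cts : continuous (@tcoord R n).
Proof.
have -> : @tcoord R n = (fun p : V => p 0 (lshift n 0)).
  by apply/funext => p; rewrite tcoordE.
exact: coord_continuous.
Qed.

Lemma rsubmx_cts : continuous (rsubmx : V -> 'rV[R]_n).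
Proof. by apply: cts_linear => a u v; rewrite linearP. Qed.

Lemma mk_cts (T : topologicalType) (f : T -> R) (g : T -> 'rV[R]_n) x :
  {for x, continuous f} -> {for x, continuous g} ->
  {for x, continuous (fun y => mk (f y) (g y))}.
Proof.
move=> cf cg; apply: cts_mx => i j; rewrite (ord1 i).
have [->|[k ->]] := ord_tx j.
  suff -> : (fun y => mk (f y) (g y) 0 (lshift n 0)) = f by [].
  by apply/funext => y; rewrite -tcoordE tcoord_mk.
have -> : (fun y => mk (f y) (g y) 0 (rshift 1 k)) = (fun y => g y 0 k).
  by apply/funext => y; rewrite -rsubmxE rsubmx_mk.
apply: (@continuous_comp _ _ _ g (fun v => v 0 k)) => //.
exact: coord_continuous.
Qed.

Lemma is_derive_tcoord (c : R -> V) (s : R) v : is_derive s (1 : R) c v ->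
  is_derive s (1 : R) (fun r => tcoord (c r)) (tcoord v).
Proof.
move=> dc; rewrite tcoordE.
have -> : (fun r => tcoord (c r)) = (fun r => c r 0 (lshift n 0)).
  by apply/funext => r; rewrite tcoordE.
exact: is_derive_coord.
Qed.

Lemma is_derive_rsubmx (c : R -> V) (s : R) v : is_derive s (1 : R) c v ->
  is_derive s (1 : R) (fun r => rsubmx (c r)) (rsubmx v).
Proof. by apply: is_derive_linear => a p q; rewrite linearP. Qed.

Lemma is_derive_mk (f : R -> R) (g : R -> 'rV[R]_n) (s : R) df dg :
  is_derive s (1 : R) f df -> is_derive s (1 : R) g dg ->
  is_derive s (1 : R) (fun r => mk (f r) (g r)) (mk df dg).
Proof.
move=> Df Dg; apply: is_derive_mx => i j; rewrite (ord1 i).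
have [->|[k ->]] := ord_tx j.
  have -> : (fun y => mk (f y) (g y) 0 (lshift n 0)) = f.
    by apply/funext => y; rewrite -tcoordE tcoord_mk.
  by rewrite -tcoordE tcoord_mk.
have -> : (fun y => mk (f y) (g y) 0 (rshift 1 k)) = (fun y => g y 0 k).
  by apply/funext => y; rewrite -rsubmxE rsubmx_mk.
by rewrite -rsubmxE rsubmx_mk; exact: is_derive_coord.
Qed.

Definition sp (v : V) : R := \sum_i (rsubmx v 0 i) ^+ 2.

(** The Maurer-Cartan form: the differential at x of translation by the inverse of x sends v to v -
    [x, v] / 2. *)
Definition theta (p v : V) : 'rV[R]_n :=
  rsubmx v - 2^-1 *: bracket L (rsubmx p) (rsubmx v).

(** The diagonal coefficients are kept abstract, so that the causal arguments depend only on a few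
    inequalities for [H]. *)
Definition gq (H : 'I_n -> R -> R) (p v : V) : R :=
  - tcoord v ^+ 2 + \sum_i H i (tcoord p) * (theta p v 0 i) ^+ 2.

Definition ltr (g : 'rV[R]_n) (p : V) : V :=
  mk (tcoord p) (gmul L g (rsubmx p)).

(** The differential of [ltr g], the same at every point because the group product is affine in its
    second factor. *)
Definition dltr (g : 'rV[R]_n) (v : V) : V :=
  mk (tcoord v) (rsubmx v + 2^-1 *: bracket L g (rsubmx v)).

Lemma mkD t x t' x' : mk t x + mk t' x' = mk (t + t') (x + x').
Proof. by rewrite /mk add_row_mx raddfD. Qed.

Lemma mkZ a t x : a *: mk t x = mk (a * t) (a *: x).
Proof. by rewrite /mk scale_row_mx scale_scalar_mx. Qed.

Lemma dltr_linear g : linear (dltr g).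
Proof.
move=> a u v; rewrite /dltr !txE bracketDr bracketZr mkZ mkD.
congr (mk _ _); rewrite !scalerDr !scalerA (mulrC a) -!scalerA.
by rewrite -!addrA; congr (_ + _); rewrite [RHS]addrCA.
Qed.

Lemma ltrE g p : ltr g p = mk 0 g + dltr g p.
Proof. by rewrite /ltr /dltr mkD add0r /gmul addrA. Qed.

(** Left invariance: the terms with [g, v] cancel, and the others are iterated brackets. *)
Lemma theta_ltr g p v : theta (ltr g p) (dltr g v) = theta p v.
Proof.
rewrite /theta /ltr /dltr !txE /gmul !(bracketDl, bracketDr, bracketZl, bracketZr).
rewrite !(bracket2l, bracket2r) !scaler0 !addr0 scalerDr.
by rewrite opprD addrA addrK.
Qed.

Lemma gq_ltr H g p v : gq H (ltr g p) (dltr g v) = gq H p v.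
Proof. by rewrite /gq theta_ltr /dltr /ltr !txE. Qed.

Lemma is_derive_ltr g (c : R -> V) (s : R) v : is_derive s (1 : R) c v ->
  is_derive s (1 : R) (fun r => ltr g (c r)) (dltr g v).
Proof.
move=> dc; have -> : (fun r => ltr g (c r)) =
    (fun=> mk 0 g) + (fun r => dltr g (c r)).
  by apply/funext => r; rewrite ltrE.
rewrite -[dltr g v]add0r; apply: is_deriveD.
by apply: is_derive_linear => //; exact: dltr_linear.
Qed.

Lemma ltr_cts g : continuous (ltr g).
Proof.
move=> p; have -> : ltr g = (fun p => mk 0 g + dltr g p).
  by apply/funext => r; rewrite ltrE.
apply: (@continuousD _ _ _ (cst (mk 0 g))); first exact: cst_continuous.
by apply: cts_linear; exact: dltr_linear.
Qed.

Lemma gq_scale H p a v : gq H p (a *: v) = a ^+ 2 * gq H p v.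
Proof.
rewrite /gq txE mulrDr exprMn mulrN; congr (_ + _); rewrite mulr_sumr.
apply: eq_bigr => i _; have -> : theta p (a *: v) = a *: theta p v.
  by rewrite /theta txE bracketZr scalerBr !scalerA (mulrC a).
by rewrite mxE exprMn mulrCA.
Qed.

End Spacetime.

(** * Norm estimates for the bracket *)

Section BracketNorm.
Variables (R : realType) (n : nat) (L : two_step R n).

Definition sc_norm : R := \sum_k \sum_i \sum_j `|sconst L i j k|.

Lemma sc_norm_ge0 : 0 <= sc_norm.
Proof. by do 3![apply: sumr_ge0 => ? _]. Qed.

Lemma bracket_coord_le (x y : 'rV[R]_n) a b k :
  (forall i, `|x 0 i| <= a) -> (forall i, `|y 0 i| <= b) ->
  `|bracket L x y 0 k| <= sc_norm * a * b.
Proof.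
move=> xa yb; rewrite mxE.
apply: (le_trans (ler_norm_sum _ _ _)).
apply: (@le_trans _ _ (\sum_i \sum_j `|sconst L i j k| * (a * b))).
  apply: ler_sum => i _; apply: (le_trans (ler_norm_sum _ _ _)).
  apply: ler_sum => j _; rewrite !normrM -mulrA ler_wpM2l//.
  by rewrite ler_pM.
have ab : 0 <= a * b.
  by rewrite mulr_ge0// (le_trans _ (xa k), le_trans _ (yb k)).
have -> : \sum_i \sum_j `|sconst L i j k| * (a * b) =
   (\sum_i \sum_j `|sconst L i j k|) * (a * b).
  by rewrite mulr_suml; apply: eq_bigr => i _; rewrite mulr_suml.
rewrite -mulrA ler_wpM2r// /sc_norm [leRHS](bigD1 k)//= lerDl.
by do 3![apply: sumr_ge0 => ? _].
Qed.

Lemma bracket_norm_le (x y : 'rV[R]_n) :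
  `|bracket L x y| <= sc_norm * `|x| * `|y|.
Proof.
apply/rV_normP; first by rewrite !mulr_ge0// sc_norm_ge0.
move=> k; apply: bracket_coord_le => i.
  exact: (rV_normP x (normr_ge0 x)).1.
exact: (rV_normP y (normr_ge0 y)).1.
Qed.

End BracketNorm.

(** * Differentiability of lifts through a map with injective differential *)

Section LiftDerivative.
Variables (R : realType) (n : nat).
Local Notation V := 'rV[R]_n.

Lemma diff_near (f : V -> V) p e : differentiable f p -> 0 < e ->
  \forall q \near p, `|f q - f p - 'd f p (q - p)| <= e * `|q - p|.
Proof.
move=> df e0.
suff : \forall h \near (0 : V), `|f (p + h) - f p - 'd f p h| <= e * `|h|.
  move=> Hh; apply/nbhs0P; apply: filterS Hh => h.
  by rewrite (_ : p + h - p = h)// addrAC subrr add0r.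
have /eqaddoP /(_ e e0) := diff_locally df.
by apply: filterS => h /=; rewrite opprD addrA (addrC p).
Qed.

(** Only continuity of [c] is given. As [f] is the identity up to a small multiple of the
    displacement, |c(r) - c(s)| is at most twice |f(c(r)) - f(c(s))| near s, and the difference
    quotients of [c] inherit the limit of those of [f \o c]. *)
Lemma lift_derive_id (f : V -> V) (c : R -> V) (s : R) u :
  {for s, continuous c} -> differentiable f (c s) ->
  (forall v, 'd f (c s) v = v) ->
  is_derive s (1 : R) (f \o c) u -> is_derive s (1 : R) c u.
Proof.
move=> cc df dfid [dfc dfcE].
suff : (fun h : R => h^-1 *: (c (h *: (1 : R) + s) - c s)) @ 0^' --> u.
  move=> cu; apply: DeriveDef; first by apply/cvg_ex; exists u.
  apply: (@cvg_lim _ _ _ _ _ _ _ cu); exact: norm_hausdorff.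
have fcu : (fun h : R => h^-1 *: (f (c (h *: (1 : R) + s)) - f (c s))) @ 0^' --> u.
  by rewrite -dfcE; exact: dfc.
apply/cvgrPdist_le => e e0.
(* The bound 1/2 gives the factor 2 in [DD]; the other one makes the error, at most 2 e' (|u| + e),
   no more than e / 2. *)
pose e' := Num.min 2^-1 (e / (4 * (`|u| + e))).
have ue : 0 < `|u| + e by rewrite ltr_wpDl.
have e'0 : 0 < e' by rewrite lt_min invr_gt0 ltr0n /= divr_gt0// mulr_gt0.
have H1 : \forall h \near (0 : R)^', `|f (c (h *: (1 : R) + s)) - f (c s) -
    'd f (c s) (c (h *: (1 : R) + s) - c s)| <= e' * `|c (h *: (1 : R) + s) - c s|.
  have : \forall r \near s, `|f (c r) - f (c s) -
    'd f (c s) (c r - c s)| <= e' * `|c r - c s|.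
    exact: cc (diff_near df e'0).
  move=> /nbhs0P Hn; apply: nbhs_dnbhs; apply: filterS Hn => h.
  by rewrite /= /GRing.scale /= mulr1 (addrC h).
have e2 : 0 < e / 2 by rewrite divr_gt0.
have /cvgrPdist_le /(_ _ e2) H2 := fcu.
apply: filterS2 H1 H2 => h; rewrite dfid => Hh1 Hh2; move: Hh2 Hh1.
set y := c _; set D := f y - _; set Dl := y - c s => Hh2 Hh1.
have e'2 : e' <= 2^-1 by rewrite /e' ge_min lexx.
have e'4 : e' <= e / (4 * (`|u| + e)) by rewrite /e' ge_min lexx orbT.
have DD : `|Dl| <= 2 * `|D|.
  have : `|Dl| <= `|D| + `|D - Dl|.
    by rewrite -{1}[Dl](subKr D) (le_trans (ler_normB _ _)).
  have : e' * `|Dl| <= 2^-1 * `|Dl| by rewrite ler_wpM2r.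
  move: Hh1; lra.
have hD : `|h^-1 *: D| <= `|u| + e.
  rewrite -[_ *: D](subKr u) (le_trans (ler_normB _ _))// lerD2l.
  by apply: le_trans Hh2 _; rewrite ler_pdivrMr// ler_pMr// ler1n.
have hDD : `|h^-1 *: (D - Dl)| <= e / 2.
  rewrite normrZ; apply: (@le_trans _ _ (`|h^-1| * (e' * (2 * `|D|)))).
    by rewrite ler_wpM2l// (le_trans Hh1)// ler_wpM2l// ltW.
  have -> : `|h^-1| * (e' * (2 * `|D|)) = e' * (2 * `|h^-1 *: D|).
    by rewrite normrZ; ring.
  apply: (@le_trans _ _ (e / (4 * (`|u| + e)) * (2 * (`|u| + e)))).
    apply: ler_pM => //; first exact: ltW.
    by rewrite ler_pM2l.
  by rewrite le_eqVlt; apply/orP; left; apply/eqP; field; rewrite gt_eqF.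
have -> : u - h^-1 *: Dl = (u - h^-1 *: D) + h^-1 *: (D - Dl).
  by rewrite [h^-1 *: (D - Dl)]scalerBr addrA subrK.
apply: le_trans (ler_normD _ _) _; move: hDD Hh2; lra.
Qed.

(** Composing with the inverse matrix of the differential reduces to [lift_derive_id]; pointwise
    differentiability takes the place of an inverse function theorem. *)
Lemma lift_derive (Psi : V -> V) (c : R -> V) (s : R) w :
  {for s, continuous c} -> differentiable Psi (c s) ->
  (forall v, 'd Psi (c s) v = 0 -> v = 0) ->
  is_derive s (1 : R) (Psi \o c) w ->
  exists2 v, is_derive s (1 : R) c v & 'd Psi (c s) v = w.
Proof.
move=> cc dP injP dw.
have lP : linear ('d Psi (c s)) by move=> a u v; rewrite linearP.
have [A AE] := linear_mulmx lP.
have uA : A \in unitmx.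
  rewrite -row_free_unit; apply: inj_row_free => v vA.
  by apply: injP; rewrite AE.
pose k (y : V) := y *m invmx A.
have lk : linear k by move=> a u v; rewrite /k mulmxDl scalemxAl.
have dk := is_derive_linear lk dw.
have [K KE] : exists K : {linear V -> V}, K = k :> (V -> V).
  pose K : {linear V -> V} := HB.pack k (GRing.isLinear.Build R _ _ _ k lk).
  by exists K.
have ck : continuous K by rewrite KE; exact: cts_linear.
have dK x : differentiable K x by exact: linear_differentiable.
have dKP : differentiable (K \o Psi) (c s) by exact: differentiable_comp.
have dE v : 'd (K \o Psi) (c s) v = v.
  have /(congr1 (@^~ v)) /= -> := diff_comp dP (dK (Psi (c s))).
  have /(congr1 (@^~ ('d Psi (c s) v))) /= -> := diff_lin (Psi (c s)) ck.
  by rewrite KE AE; exact: mulmxK.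
rewrite -KE in dk.
exists (K w); first exact: (lift_derive_id cc dKP dE dk).
by rewrite AE KE /k mulmxKV.
Qed.

End LiftDerivative.

(** If q = g p with both points near [p0], then g = y - [y, x] / 2 for the small difference y of
    their group coordinates. So g is small, and discreteness at 0 forces g = 0. *)
Lemma deck_free (R : realType) (n : nat) (L : two_step R n) (Gam : discrete_subgroup L)
    (p0 : 'rV[R]_(1 + n)) : exists2 W, nbhs p0 W & forall p q g, W p -> W q -> dsg Gam g ->
  q = ltr L g p -> p = q.
Proof.
have [/= r r0 Hr] := (nbhs_ballP _ _).1 (dsg_discrete (dsg1 Gam)).
pose C := 1 + 2^-1 * (sc_norm L * (`|p0| + 1)).
have C1 : 1 <= C.
  by rewrite lerDl !mulr_ge0 ?sc_norm_ge0// addr_ge0.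
pose e := Num.min 1 (r / (2 * C)).
have e0 : 0 < e.
  by rewrite lt_min ltr01 divr_gt0// mulr_gt0// (lt_le_trans _ C1).
exists (ball p0 e); first exact: nbhsx_ballx.
move=> p q g; rewrite -!ball_normE /ball_ /= => Wp Wq Gg qg.
suff g0 : g = 0.
  by rewrite qg g0 /ltr gmul0 mk_eta.
apply: (Hr g) => //; rewrite -ball_normE /ball_ /= sub0r normrN.
set x := rsubmx p; set y := rsubmx q - x.
have yE : y = g + 2^-1 *: bracket L g x.
  by rewrite /y qg /ltr rsubmx_mk /gmul -/x addrAC addrK.
have gE : g = y - 2^-1 *: bracket L y x.
  rewrite {2}yE bracketDl bracketZl bracket2l scaler0 addr0.
  by rewrite yE addrK.
have xb : `|x| <= `|p0| + 1.
  apply: le_trans (norm_rsubmx p) _.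
  rewrite -[p](subrK p0) addrC (le_trans (ler_normD _ _))// lerD2l.
  by rewrite distrC ltW// (lt_le_trans Wp)// /e ge_min lexx.
have yb : `|y| < 2 * e.
  have -> : y = rsubmx (q - p) by rewrite /y !txE.
  apply: le_lt_trans (norm_rsubmx _) _.
  have -> : q - p = (q - p0) + (p0 - p) by rewrite addrA subrK.
  apply: le_lt_trans (ler_normD _ _) _.
  by rewrite (_ : 2 * e = e + e) ?ltrD// 1?distrC//; ring.
have yC : `|g| <= `|y| * C.
  rewrite {1}gE (le_trans (ler_normB _ _))// mulrDr mulr1 lerD2l.
  rewrite normrZ ger0_norm// mulrCA ler_wpM2l//.
  apply: (le_trans (bracket_norm_le _ _ _)).
  rewrite mulrAC [leRHS]mulrC ler_wpM2r// ler_wpM2l ?sc_norm_ge0//.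
apply: le_lt_trans yC _; have C0 : 0 < C by rewrite (lt_le_trans _ C1).
apply: (@lt_le_trans _ _ (2 * e * C)); first by rewrite ltr_pM2r.
have eC : e <= r / (2 * C) by rewrite /e ge_min lexx orbT.
apply: (@le_trans _ _ (2 * (r / (2 * C)) * C)).
  by rewrite ler_pM2r// ler_pM2l.
by rewrite le_eqVlt; apply/orP; left; apply/eqP; field; rewrite gt_eqF.
Qed.

(** * Charts of an extension seen from the cover *)

Section ExtChart.
Variables (R : realType) (n : nat) (L : two_step R n).
Variables (Gam : discrete_subgroup L) (H : 'I_n -> R -> R).
Local Notation V := 'rV[R]_(1 + n).
Implicit Types (p q v w y : V) (s r t a b : R).

Definition et : V := mk 1 0.

Definition eucl w := tcoord w ^+ 2 + sp w.

(* [psi] is a chart of the extension around a limit point (0, up to translation), composed with the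
   covering map; by [ec_cone] it carries the metric within [kap] of the Minkowski metric. *)
Record ext_chart (O : set V) (psi : V -> V) (dl kap : R) : Prop := ExtChart {
  ec_open : open O;
  ec_half : O `<=` @half_space R n;
  ec_diff : forall p, O p -> differentiable psi p;
  ec_inj : forall p, O p -> forall v, 'd psi p v = 0 -> v = 0;
  ec_bd : forall p, O p -> `|psi p| < dl;
  ec_cone : forall p, O p -> forall v,
    `|gq L H p v - (- tcoord ('d psi p v) ^+ 2 + sp ('d psi p v))| <=
      kap * eucl ('d psi p v);
  ec_opn : forall p (W : set V), O p -> nbhs p W ->
    \forall y \near psi p, exists2 p', (W `&` O) p' & psi p' = y;
  ec_cls : forall p y, half_space p -> `|y| < dl ->
    (forall e, 0 < e -> exists q, [/\ O q, `|q - p| < e & `|psi q - y| < e]) ->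
    O p /\ psi p = y;
  ec_deck : forall p p', O p -> O p' -> psi p = psi p' ->
    exists2 g, dsg Gam g & p' = ltr L g p;
  ec_inv : forall g p, dsg Gam g -> O p -> O (ltr L g p) /\ psi (ltr L g p) = psi p;
  ec_sig : forall p, O p -> 0 < tcoord ('d psi p et) }.

Variables (O : set V) (psi : V -> V) (dl : R).
Hypothesis EC : ext_chart O psi dl 4^-1.

Lemma psi_cts p : O p -> {for p, continuous psi}.
Proof. by move=> Op; apply: differentiable_continuous; exact: ec_diff EC _ Op. Qed.

Lemma near_O p : O p -> \forall q \near p, O q.
Proof. by move=> Op; apply: open_nbhs_nbhs; split => //; exact: ec_open EC. Qed.

Lemma loc_inj p0 : O p0 -> exists2 W, nbhs p0 W &
  forall p q, W p -> W q -> O p -> O q -> psi p = psi q -> p = q.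
Proof.
move=> Op0; have [W nW HW] := deck_free Gam p0; exists W => // p q Wp Wq Op Oq E.
by have [g Gg qg] := ec_deck EC Op Oq E; exact: HW Gg qg.
Qed.

(** [ec_opn] provides preimages in every neighbourhood and [loc_inj] makes them unique near [p0], so
    the section chosen pointwise is continuous. *)
Lemma local_inverse p0 : O p0 -> exists (e : R) (f : V -> V), [/\ 0 < e,
  f (psi p0) = p0 &
  forall y, `|y - psi p0| < e -> [/\ O (f y), psi (f y) = y & {for y, continuous f}]].
Proof.
move=> Op0; have [W nW injW] := loc_inj Op0.
have [/= r r0 rW] := (nbhs_ballP _ _).1 nW.
pose W0 := ball p0 r.
have W0o q : W0 q -> nbhs q W0.
  by move=> W0q; apply: open_nbhs_nbhs; split => //; exact: ball_open.
have W00 : W0 p0 by exact: ballxx.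
have [/= e e0 He] := (nbhs_ballP _ _).1 (ec_opn EC Op0 (W0o _ W00)).
pose f y := xget p0 [set p | (W0 `&` O) p /\ psi p = y].
have Hf y : `|y - psi p0| < e -> (W0 `&` O) (f y) /\ psi (f y) = y.
  move=> ye; have [|p' Wp' py] := He y; first by rewrite -ball_normE /ball_ /= distrC.
  by rewrite /f; case: xgetP => [p -> //|/(_ p')[]].
exists e, f; split => //.
  have [|[Wf Of] E] := Hf (psi p0); first by rewrite subrr normr0.
  by apply: injW => //; apply: rW.
move=> y ye; have [[Wf Of] E] := Hf y ye; split => //.
move=> N nN; have nN' : nbhs (f y) (N `&` W0) by apply: filterI => //; exact: W0o.
have := ec_opn EC Of nN'; rewrite E => H1; rewrite nbhs_simpl /=.
have H2 : \forall y' \near y, `|y' - psi p0| < e.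
  have : {for y, continuous (fun z : V => `|z - psi p0|)}.
    apply: (@continuous_comp _ _ _ (fun z : V => z - psi p0) Num.norm).
      by apply: continuousB => //; exact: cst_continuous.
    exact: norm_continuous.
  by move/cvgr_lt; apply.
apply: filterS2 H1 H2 => y' [q [[Nq Wq] Oq] qy'] ye'.
have [[Wf' Of'] E'] := Hf y' ye'.
suff E2 : q = f y' by rewrite /= -E2.
by apply: injW => //; [apply: rW|apply: rW|rewrite qy'].
Qed.

End ExtChart.

(** * Lifting curves through the chart map *)

Section Lifts.
Variables (R : realType) (n : nat) (L : two_step R n).
Variables (Gam : discrete_subgroup L) (H : 'I_n -> R -> R).
Local Notation V := 'rV[R]_(1 + n).
Implicit Types (p q v w y : V) (s r t a b : R).
Variables (O : set V) (psi : V -> V) (dl : R).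
Hypothesis EC : ext_chart Gam H O psi dl 4^-1.

(** The lifting equation is required in a neighbourhood of each s, hence slightly beyond the end
    points too: derivatives are two-sided, and this makes lifts differentiable on the closed
    interval. *)
Definition lift (c : R -> V) (a b : R) (ct : R -> V) :=
  forall s, a <= s <= b ->
    [/\ {for s, continuous ct}, O (ct s) & \forall r \near s, psi (ct r) = c r].

Lemma liftE c a b ct s : lift c a b ct -> a <= s <= b -> psi (ct s) = c s.
Proof. by move=> lc /lc[_ _ /nbhs_singleton]. Qed.

Lemma lift_sub c a b a' b' ct : a <= a' -> b' <= b -> lift c a b ct ->
  lift c a' b' ct.
Proof.
move=> aa bb lc s /andP[as_ sb]; apply: lc.
by rewrite (le_trans aa)// (le_trans sb).
Qed.

Lemma left_near (s e : R) (P : R -> Prop) : (\forall r \near s, P r) ->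
  e < s -> exists2 r, e < r < s & forall r', r <= r' <= s -> P r'.
Proof.
move=> /nbhs_ballP[/= d d0 Hd] es.
pose r := Num.max (s - d / 2) ((e + s) / 2).
have d2 : 0 < d / 2 by rewrite divr_gt0.
have r1 : r < s.
  rewrite /r gt_max; apply/andP; split; lra.
have r2 : e < r by rewrite /r lt_max; apply/orP; right; lra.
exists r; first by rewrite r2.
move=> r' /andP[rr' r's]; apply: Hd; rewrite -ball_normE /ball_ /=.
have : s - d / 2 <= r by rewrite /r le_max lexx.
move=> r3; rewrite ger0_norm ?subr_ge0//; lra.
Qed.

Lemma right_near (s : R) (P : R -> Prop) : (\forall r \near s, P r) ->
  exists2 e, 0 < e & forall r, s - e < r < s + e -> P r.
Proof.
move=> /nbhs_ballP[/= d d0 Hd]; exists d => // r /andP[r1 r2].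
by apply: Hd; rewrite -ball_normE /ball_ /= ltr_norml; lra.
Qed.

Lemma left_limit_eq (c1 c2 : R -> V) e s : e < s ->
  {for s, continuous c1} -> {for s, continuous c2} ->
  (forall r, e <= r < s -> c1 r = c2 r) -> c1 s = c2 s.
Proof.
move=> es k1 k2 E; apply/eqP; rewrite -subr_eq0 -normr_le0 leNgt; apply/negP => ne.
have k : {for s, continuous (fun r => `|c1 r - c2 r|)}.
  apply: (@continuous_comp _ _ _ (fun r => c1 r - c2 r) Num.norm).
    exact: continuousB.
  exact: norm_continuous.
have Hn : \forall r \near s, 0 < `|c1 r - c2 r| by move/cvgr_gt : k; apply.
have [r /andP[er rs] Hr] := left_near Hn es.
have := Hr r; rewrite lexx (ltW rs) E ?(ltW er)// subrr normr0 ltxx.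
by move=> /(_ isT).
Qed.

Lemma near_inj p0 : O p0 -> exists W : set V, [/\ open W, W p0,
  W `<=` O & forall p q, W p -> W q -> psi p = psi q -> p = q].
Proof.
move=> Op; have [W nW injW] := loc_inj EC Op.
exists (W^° `&` O); split.
- by apply: openI; [exact: open_interior|exact: ec_open EC].
- by split.
- by move=> ? [].
- by move=> p q [/interior_subset Wp Op'] [/interior_subset Wq Oq]; apply: injW.
Qed.

Lemma near_open (T : topologicalType) (c : R -> T) (W : set T) s :
  open W -> W (c s) -> {for s, continuous c} -> \forall r \near s, W (c r).
Proof.
move=> oW Ws cc; apply: (cc W); apply: open_nbhs_nbhs; split => //.
Qed.

Lemma lift_near_eq c s c1 c2 : c1 s = c2 s -> O (c1 s) ->
  {for s, continuous c1} -> {for s, continuous c2} ->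
  (\forall r \near s, psi (c1 r) = c r) -> (\forall r \near s, psi (c2 r) = c r) ->
  \forall r \near s, c1 r = c2 r.
Proof.
move=> Es O1 k1 k2 e1 e2; have [W [oW Wp WO injW]] := near_inj O1.
have w1 := near_open oW Wp k1; rewrite Es in Wp; have w2 := near_open oW Wp k2.
near=> r; apply: injW; [near: r; exact: w1|near: r; exact: w2|].
rewrite (_ : psi (c1 r) = c r); last by near: r; exact: e1.
by rewrite (_ : psi (c2 r) = c r)//; near: r; exact: e2.
Unshelve. all: by end_near. Qed.

(** Agreement of two lifts is an open condition by local injectivity of [psi] and a closed one by
    continuity. *)
Lemma lift_unique c a b c1 c2 : lift c a b c1 -> lift c a b c2 ->
  c1 a = c2 a -> forall s, a <= s <= b -> c1 s = c2 s.
Proof.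
move=> l1 l2 E; apply: real_induction => //.
- move=> s /andP[as_ sb] Hs.
  have sab : a <= s <= b by rewrite as_ ltW.
  have [k1 O1 e1] := l1 _ sab; have [k2 O2 e2] := l2 _ sab.
  have Es : c1 s = c2 s by apply: Hs; rewrite as_ lexx.
  have /right_near[e e0 He] := lift_near_eq Es O1 k1 k2 e1 e2.
  exists e => // r /andP[sr re] _; apply: He.
  by rewrite re andbT (lt_trans _ sr)// ltrBlDr ltrDl.
- move=> s /andP[as_ sb] Hs.
  have sab : a <= s <= b by rewrite ltW.
  have [k1 O1 e1] := l1 _ sab; have [k2 O2 e2] := l2 _ sab.
  exact: (left_limit_eq as_ k1 k2).
Qed.

(** Both pieces satisfy the lifting equation on both sides of s0, so they agree near s0 and the
    concatenation is a lift there. *)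
Lemma lift_glue c a b s0 c1 c2 : a <= s0 -> lift c a s0 c1 -> lift c s0 b c2 ->
  s0 <= b -> c1 s0 = c2 s0 ->
  exists ct, [/\ lift c a b ct, ct a = c1 a & ct b = c2 b].
Proof.
move=> as0 l1 l2 sb E.
have [k1 O1 e1] := l1 s0 ltac:(by rewrite as0 lexx).
have [k2 O2 e2] := l2 s0 ltac:(by rewrite sb lexx).
have ne := lift_near_eq E O1 k1 k2 e1 e2.
pose ct r := if r < s0 then c1 r else c2 r.
have n0 : \forall r \near s0, ct r = c2 r.
  by apply: filterS ne => r Er; rewrite /ct; case: ifP.
have nl r : r < s0 -> \forall r' \near r, ct r' = c1 r'.
  move=> rs; near=> r'; rewrite /ct ifT//; near: r'.
  exact: lt_nbhsl.
have nr r : s0 < r -> \forall r' \near r, ct r' = c2 r'.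
  move=> rs; near=> r'; rewrite /ct ifF//; apply/negbTE; rewrite -leNgt ltW//.
  by near: r'; exact: lt_nbhsr.
have tr (f g : R -> V) r : (\forall r' \near r, f r' = g r') ->
    [/\ {for r, continuous g}, O (g r) & \forall r' \near r, psi (g r') = c r'] ->
    [/\ {for r, continuous f}, O (f r) & \forall r' \near r, psi (f r') = c r'].
  move=> fg [kg Og eg]; have fgr := nbhs_singleton fg; split.
  - rewrite /prop_for /continuous_at fgr; apply: cvg_trans kg; apply: near_eq_cvg.
    by apply: filterS fg => x ->.
  - by rewrite fgr.
  - by apply: filterS2 fg eg => x -> ->.
exists ct; split.
- move=> r /andP[ar rb]; have [rs|sr|->] := ltgtP r s0.
  + by apply: tr (nl _ rs) _; apply: l1; rewrite ar ltW.
  + by apply: tr (nr _ sr) _; apply: l2; rewrite rb ltW.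
  + by apply: tr n0 _; apply: l2; rewrite lexx.
- rewrite /ct; case: ltP => // sa; have as_ : a = s0 by apply/eqP; rewrite eq_le as0.
  by rewrite as_ E.
- by rewrite /ct ltNge sb.
Unshelve. all: by end_near. Qed.

Lemma lift_section (c : R -> V) a b (f : V -> V) y0 e :
  (forall y, `|y - y0| < e -> [/\ O (f y), psi (f y) = y & {for y, continuous f}]) ->
  (forall s, a <= s <= b -> {for s, continuous c}) ->
  (forall s, a <= s <= b -> `|c s - y0| < e) ->
  lift c a b (f \o c).
Proof.
move=> Hf cc ce s sab; have [Of Ef kf] := Hf _ (ce s sab); split; [|exact: Of|].
  by apply: continuous_comp; [exact: cc|exact: kf].
have : {for s, continuous (fun r => `|c r - y0|)}.
  apply: (@continuous_comp _ _ _ (fun r => c r - y0) Num.norm).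
    by apply: continuousB; [exact: cc|exact: cst_continuous].
  exact: norm_continuous.
move/cvgr_lt/(_ _ (ce s sab)); apply: filterS => r re.
by have [] := Hf _ re.
Qed.

Lemma near_dist (c : R -> V) s e : {for s, continuous c} -> 0 < e ->
  \forall r \near s, `|c r - c s| < e.
Proof.
move=> /cvgrPdist_lt Hc e0; apply: filterS (Hc e e0) => r; by rewrite distrC.
Qed.

(** [psi] acts as a covering of its image, with orbits of [Gam] as fibres. The curve may be lifted
    up to the end because each of its points, limit times included, is assumed to have some
    preimage. *)
Lemma path_lifting c a b p0 : a <= b ->
  (forall s, a <= s <= b -> {for s, continuous c}) ->
  (forall s, a <= s <= b -> exists2 p, O p & psi p = c s) ->
  O p0 -> psi p0 = c a -> exists2 ct, lift c a b ct & ct a = p0.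
Proof.
move=> ab cc cU Op0 E0.
suff : forall s, a <= s <= b -> exists2 ct, lift c a s ct & ct a = p0.
  by apply; rewrite ab lexx.
apply: real_induction.
- have [e [f [e0 f0 Hf]]] := local_inverse EC Op0.
  exists (f \o c); last by rewrite /= -E0.
  apply: (lift_section Hf) => s /andP[as_ sa];
    have -> : s = a by apply/eqP; rewrite eq_le as_ sa.
    by apply: cc; rewrite lexx.
  by rewrite E0 subrr normr0.
- move=> s /andP[as_ sb] Hs.
  have [c1 l1 c1a] := Hs s ltac:(by rewrite as_ lexx).
  have [k1 O1 e1] := l1 s ltac:(by rewrite as_ lexx).
  have E1 := nbhs_singleton e1.
  have [e [f [e0 f0 Hf]]] := local_inverse EC O1.
  rewrite E1 in f0 Hf.
  have /right_near[d d0 Hd] := near_dist (cc s ltac:(by rewrite as_ ltW)) e0.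
  exists d => // r /andP[sr rd] rb.
  have l2 : lift c s r (f \o c).
    apply: (lift_section Hf) => x /andP[sx xr].
      by apply: cc; rewrite (le_trans as_)// (le_trans xr).
    apply: Hd; rewrite (le_lt_trans xr rd) andbT (lt_le_trans _ sx)//.
    by rewrite ltrBlDr ltrDl.
  have [|ct [lct cta _]] := lift_glue as_ l1 l2 (ltW sr) => //.
  by exists ct; rewrite ?cta.
- move=> s /andP[as_ sb] Hs.
  have [q Oq qs] := cU s ltac:(by rewrite sb ltW).
  have [e [f [e0 f0 Hf]]] := local_inverse EC Oq; rewrite qs in f0 Hf.
  have [r /andP[ar rs] Hr] := left_near (near_dist (cc s ltac:(by rewrite sb ltW)) e0) as_.
  have [c1 l1 c1a] := Hs r ltac:(by rewrite rs ltW).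
  have [Ofr Efr _] := Hf _ (Hr r ltac:(by rewrite lexx ltW)).
  have [_ O1 _] := l1 r ltac:(by rewrite lexx ltW).
  have E1 := liftE l1 (ltac:(by rewrite lexx ltW) : a <= r <= r).
  (* The section found at the limit time and the earlier lift may lie on different sheets; this deck
     translation matches them. *)
  have [g Gg gE] := ec_deck EC Ofr O1 ltac:(by rewrite Efr E1).
  pose f' y := ltr L g (f y).
  have Hf' y : `|y - c s| < e ->
      [/\ O (f' y), psi (f' y) = y & {for y, continuous f'}].
    move=> /Hf[Of Ef kf]; have [Og Eg] := ec_inv EC Gg Of; split => //.
      by rewrite /f' Eg.
    apply: continuous_comp => //; exact: ltr_cts.
  have l2 : lift c r s (f' \o c).
    apply: (lift_section Hf') => x /andP[rx xs].
      by apply: cc; rewrite (le_trans xs sb) (le_trans (ltW ar)).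
    by apply: Hr; rewrite rx.
  have [|ct [lct cta _]] := lift_glue (ltW ar) l1 l2 (ltW rs); first by rewrite gE.
  by exists ct; rewrite ?cta.
Qed.

(** Homotopy lifting: the end point of the lift of [c l] from the fixed [p0] depends continuously on
    l, so it follows the lift [E] of the end points once they agree at l = 0. It identifies a point
    itself and not merely its orbit under [Gam]. *)
Lemma lift_family (c ct : R -> R -> V) (E : R -> V) p0 :
  (forall l s, 0 <= l <= 1 -> 0 <= s <= 1 ->
     {for (l, s), continuous (fun z : R * R => c z.1 z.2)}) ->
  (forall l, 0 <= l <= 1 -> lift (c l) 0 1 (ct l) /\ ct l 0 = p0) ->
  (forall l, 0 <= l <= 1 -> [/\ {for l, continuous E}, O (E l) & psi (E l) = c l 1]) ->
  E 0 = ct 0 1 -> E 1 = ct 1 1.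
Proof.
move=> cc lc HE E0.
have H01 : 0 <= (1 : R) <= 1 by rewrite ler01 lexx.
have H00 : 0 <= (0 : R) <= 1 by rewrite ler01 lexx.
have ccl l s : 0 <= l <= 1 -> 0 <= s <= 1 -> {for s, continuous (c l)}.
  move=> hl hs; apply: (@continuous_comp _ _ _ (fun s => (l, s))
    (fun z : R * R => c z.1 z.2)); last exact: cc.
  exact: (cvg_pair (cvg_cst l) cvg_id).
have ccs l s : 0 <= l <= 1 -> 0 <= s <= 1 -> {for l, continuous (c ^~ s)}.
  move=> hl hs; apply: (@continuous_comp _ _ _ (fun l => (l, s))
    (fun z : R * R => c z.1 z.2)); last exact: cc.
  exact: (cvg_pair cvg_id (cvg_cst s)).
(* Continuity in the parameter, by induction along the curve; [step] carries it from s1 to s2 when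
   one local section covers that stretch. *)
have D l0 : 0 <= l0 <= 1 -> forall s, 0 <= s <= 1 -> forall W, nbhs (ct l0 s) W ->
    \forall l \near l0, 0 <= l <= 1 -> W (ct l s).
  move=> hl0.
  have step s1 s2 s3 (f : V -> V) e : 0 <= s1 -> s1 <= s2 -> s2 <= 1 -> 0 <= s3 <= 1 ->
      0 < e ->
      (forall y, `|y - c l0 s3| < e ->
        [/\ O (f y), psi (f y) = y & {for y, continuous f}]) ->
      (forall s, s1 <= s <= s2 -> `|c l0 s - c l0 s3| < e) ->
      f (c l0 s1) = ct l0 s1 ->
      (forall W, nbhs (ct l0 s1) W -> \forall l \near l0, 0 <= l <= 1 -> W (ct l s1)) ->
      forall W, nbhs (ct l0 s2) W -> \forall l \near l0, 0 <= l <= 1 -> W (ct l s2).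
    move=> s10 s12 s21 hs3 e0 Hf ce fE D1 W nW.
    have hs1 : 0 <= s1 <= 1 by rewrite s10 (le_trans s12).
    have hs2 : 0 <= s2 <= 1 by rewrite s21 (le_trans s10).
    have sub s : s1 <= s <= s2 -> 0 <= s <= 1.
      by move=> /andP[h1 h2]; rewrite (le_trans s10)// (le_trans h2).
    have fc s : s1 <= s <= s2 -> ct l0 s = f (c l0 s).
      move=> hs.
      have l1 : lift (c l0) s1 s2 (ct l0) by apply: lift_sub (lc _ hl0).1.
      have l2 : lift (c l0) s1 s2 (f \o c l0).
        by apply: (lift_section Hf) => // x hx; apply: ccl => //; exact: sub hx.
      exact: (lift_unique l1 l2).
    have [Of1 Ef1 kf1] := Hf _ (ce s1 ltac:(by rewrite lexx)).
    have [W1 [oW1 W1p W1O inj1]] := near_inj Of1.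
    have n1 : \forall l \near l0, 0 <= l <= 1 -> W1 (ct l s1).
      by apply: D1; rewrite -fE; apply: open_nbhs_nbhs; split.
    have n2 : \forall l \near l0, W1 (f (c l s1)).
      apply: (near_open (c := fun l => f (c l s1)) oW1) => //.
      by apply: (@continuous_comp _ _ _ (c ^~ s1) f) => //; exact: ccs.
    have n3 : \forall l \near l0, forall s, s1 <= s <= s2 -> `|c l s - c l0 s3| < e.
      apply: (@tube _ _ c [set y | `|y - c l0 s3| < e]) => //.
      - rewrite (_ : [set y | _] = ball (c l0 s3) e); first exact: ball_open.
        by apply/seteqP; split => z; rewrite -ball_normE /ball_ /= distrC.
      - by move=> s hs; apply: cc => //; exact: sub hs.
    have n4 : \forall l \near l0, W (f (c l s2)).
      have : {for l0, continuous (fun l => f (c l s2))}.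
        apply: (@continuous_comp _ _ _ (c ^~ s2) f); first exact: ccs.
        by have [] := Hf _ (ce s2 ltac:(by rewrite lexx s12)).
      by apply; rewrite -fc ?lexx ?s12.
    near=> l => hl; have [lcl _] := lc l hl.
    have h3 : forall s, s1 <= s <= s2 -> `|c l s - c l0 s3| < e by near: l; exact: n3.
    have -> : ct l s2 = f (c l s2); last by near: l; exact: n4.
    have l1 : lift (c l) s1 s2 (ct l) by apply: lift_sub lcl.
    have l2 : lift (c l) s1 s2 (f \o c l).
      by apply: (lift_section Hf) => // x hx; apply: ccl => //; exact: sub hx.
    apply: (lift_unique l1 l2); last by rewrite lexx s12.
    have h4 : 0 <= l <= 1 -> W1 (ct l s1) by near: l; exact: n1.
    apply: inj1; [exact: h4|by near: l; exact: n2|].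
    rewrite (liftE lcl hs1) /=.
    by have [_ -> _] := Hf _ (h3 s1 ltac:(by rewrite lexx s12)).
  apply: real_induction.
  - move=> W nW; near=> l => hl; rewrite (lc l hl).2 -(lc l0 hl0).2.
    exact: nbhs_singleton nW.
  - move=> s /andP[s0 s1] Hs; have hs : 0 <= s <= 1 by rewrite s0 ltW.
    have [_ O1 e1] := (lc l0 hl0).1 s hs.
    have [e [f [e0 f0 Hf]]] := local_inverse EC O1.
    rewrite (nbhs_singleton e1) in f0 Hf.
    have /right_near[d d0 Hd] := near_dist (ccl _ _ hl0 hs) e0.
    exists d => // r /andP[sr rd] rb.
    apply: (step s r s f e) => //; first exact: ltW.
      move=> x /andP[sx xr]; apply: Hd; rewrite (le_lt_trans xr rd) andbT.
      by rewrite (lt_le_trans _ sx)// ltrBlDr ltrDl.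
    by apply: Hs; rewrite s0 lexx.
  - move=> s /andP[s0 s1] Hs; have hs : 0 <= s <= 1 by rewrite s1 ltW.
    have [k1 O1 e1] := (lc l0 hl0).1 s hs.
    have [e [f [e0 f0 Hf]]] := local_inverse EC O1.
    rewrite (nbhs_singleton e1) in f0 Hf.
    have [Ofs Efs kfs] := Hf (c l0 s) ltac:(by rewrite subrr normr0).
    have kfc : {for s, continuous (f \o c l0)} by apply: continuous_comp => //; exact: ccl.
    have ne : \forall r \near s, (f \o c l0) r = ct l0 r.
      apply: (@lift_near_eq (c l0)) => //=.
      apply: filterS (near_dist (ccl _ _ hl0 hs) e0) => x /Hf[] //.
    have [r /andP[sr rs] Hr] := left_near (filterI ne (near_dist (ccl _ _ hl0 hs) e0)) s0.
    apply: (step r s s f e) => //; [exact: ltW|exact: ltW| | |].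
    + by move=> x hx; have [] := Hr x hx.
    + by have [] := Hr r ltac:(by rewrite lexx ltW).
    + by apply: Hs; rewrite rs ltW.
suff : forall l, 0 <= l <= 1 -> E l = ct l 1 by apply.
apply: real_induction => //.
- move=> l /andP[l0 l1] Hl; have hl : 0 <= l <= 1 by rewrite l0 ltW.
  have [kE OE EE] := HE l hl.
  have El : E l = ct l 1 by apply: Hl; rewrite l0 lexx.
  have [W [oW Wp WO injW]] := near_inj OE.
  have n1 := near_open oW Wp kE.
  rewrite El in Wp.
  have n2 := D l hl 1 H01 W (open_nbhs_nbhs (conj oW Wp)).
  have [d d0 Hd] := right_near (filterI n1 n2).
  exists d => // r /andP[lr rd] rb.
  have hr : 0 <= r <= 1 by rewrite rb (le_trans l0)// ltW.
  have [h1 h2] := Hd r ltac:(by rewrite rd (lt_trans _ lr)// ltrBlDr ltrDl).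
  apply: injW => //; first exact: h2.
  by have [_ _ ->] := HE r hr; rewrite (liftE (lc r hr).1 H01).
- move=> l /andP[l0 l1] Hl; have hl : 0 <= l <= 1 by rewrite l1 ltW.
  have [kE OE EE] := HE l hl.
  apply/eqP; rewrite -subr_eq0 -normr_le0 leNgt; apply/negP => d0.
  have d2 : 0 < `|E l - ct l 1| / 2 by rewrite divr_gt0.
  have n1 := near_dist kE d2.
  have n2 := D l hl 1 H01 _ (nbhsx_ballx (ct l 1) _ d2).
  have [r /andP[r0 rl] Hr] := left_near (filterI n1 n2) l0.
  have hr : 0 <= r <= 1 by rewrite (ltW r0) (le_trans (ltW rl)).
  have [h1] := Hr r ltac:(by rewrite lexx ltW).
  move=> /(_ hr); rewrite -ball_normE /ball_ /= -(Hl r) ?(ltW r0)// => h2.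
  have : `|E l - ct l 1| < `|E l - ct l 1|; last by rewrite ltxx.
  have := ler_normB (ct l 1 - E r) (E l - E r).
  rewrite opprB addrA subrK distrC (distrC (E l) (E r)) => h3.
  lra.
Unshelve. all: by end_near. Qed.

End Lifts.

(** * Causal curves in a chart of an extension *)

Section Causal.
Variables (R : realType) (n : nat) (L : two_step R n).
Variables (Gam : discrete_subgroup L) (H : 'I_n -> R -> R).
Local Notation V := 'rV[R]_(1 + n).
Implicit Types (p q v w y : V) (s r t a b : R).
Variables (O : set V) (psi : V -> V) (dl : R).
Hypothesis EC : ext_chart Gam H O psi dl 4^-1.

Lemma sp_ge0 w : 0 <= sp w.
Proof. by apply: sumr_ge0 => i _; exact: sqr_ge0. Qed.

Lemma sp_coord w i : (rsubmx w 0 i) ^+ 2 <= sp w.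
Proof.
by rewrite /sp (bigD1 i)//= lerDl; apply: sumr_ge0 => j _; exact: sqr_ge0.
Qed.

Lemma gq_comb p v a b :
  gq L H p (a *: et R n + b *: v) =
  - (a + b * tcoord v) ^+ 2 + b ^+ 2 * (gq L H p v + tcoord v ^+ 2).
Proof.
rewrite /gq !txE mulr1; congr (_ + _); rewrite addrAC addNr add0r mulr_sumr.
apply: eq_bigr => i _.
have -> : theta L p (a *: et R n + b *: v) = b *: theta L p v.
  rewrite /theta !txE scaler0 add0r bracketZr scalerBr !scalerA.
  by rewrite (mulrC b).
by rewrite mxE exprMn mulrCA.
Qed.

(** With tolerance 1/4 the cone condition yields 3/4 sp <= 5/4 t^2; slope 2 is a convenient weaker
    bound. *)
Lemma causal_wide p v : O p -> gq L H p v <= 0 ->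
  sp ('d psi p v) <= 4 * tcoord ('d psi p v) ^+ 2.
Proof.
move=> Op g0; have := ec_cone EC Op v; rewrite ler_norml /eucl => /andP[h1 h2].
have := sqr_ge0 (tcoord ('d psi p v)); have := sp_ge0 ('d psi p v).
lra.
Qed.

(** For slope at most 1/2 the cone condition bounds the form by (- 3/4 + 5/16) t^2. *)
Lemma narrow_timelike p v : O p ->
  sp ('d psi p v) <= tcoord ('d psi p v) ^+ 2 / 4 ->
  gq L H p v <= - (tcoord ('d psi p v) ^+ 2 / 4).
Proof.
move=> Op g0; have := ec_cone EC Op v; rewrite ler_norml /eucl => /andP[h1 h2].
have := sqr_ge0 (tcoord ('d psi p v)); have := sp_ge0 ('d psi p v).
lra.
Qed.

Lemma wide_coord p v i : O p -> gq L H p v <= 0 ->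
  `|rsubmx ('d psi p v) 0 i| <= 2 * `|tcoord ('d psi p v)|.
Proof.
move=> Op g0; rewrite -[2]ger0_norm// -normrM -ler_sqr ?nnegrE//.
rewrite !real_normK ?num_real// exprMn.
apply: le_trans (sp_coord _ _) _; have := causal_wide Op g0; lra.
Qed.

(** Otherwise some positive combination of v and [et] has zero chart time. It is timelike, as the
    sum of a future causal and a future timelike vector, whereas the cone condition makes gq at
    least 3/4 sp on vectors of zero chart time. *)
Lemma future_chart p v : O p -> gq L H p v <= 0 -> 0 <= tcoord v ->
  0 <= tcoord ('d psi p v).
Proof.
move=> Op g0 v0; rewrite leNgt; apply/negP => w0.
have s0 := ec_sig EC Op; set sg := tcoord ('d psi p (et R n)) in s0.
set w := tcoord _ in w0.
pose a := - w; pose b := sg.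
have a0 : 0 < a by rewrite oppr_gt0.
pose u := a *: et R n + b *: v.
have tu : tcoord ('d psi p u) = 0.
  by rewrite linearD !linearZ /= tcoordD !tcoordZ -/sg -/w /a /b; ring.
have gu : gq L H p u < 0.
  rewrite gq_comb.
  have h1 : b ^+ 2 * (gq L H p v + tcoord v ^+ 2) <= b ^+ 2 * tcoord v ^+ 2.
    by rewrite ler_wpM2l ?sqr_ge0// gerDr.
  have h2 : 0 <= a * (b * tcoord v) by rewrite !mulr_ge0// ltW.
  have h3 : 0 < a ^+ 2 by rewrite exprn_gt0.
  have -> : (a + b * tcoord v) ^+ 2 = a ^+ 2 + 2 * (a * (b * tcoord v)) + b ^+ 2 * tcoord v ^+ 2.
    by ring.
  lra.
have := ec_cone EC Op u; rewrite ler_norml /eucl tu expr0n /= => /andP[h1 h2].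
have := sp_ge0 ('d psi p u); lra.
Qed.

(** The sign [e] is 1 for future-directed and -1 for past-directed causal curves. *)
Definition tcurve (e : R) (c v : R -> V) a b := forall s, a <= s <= b ->
  [/\ is_derive s (1 : R) c (v s), O (c s), gq L H (c s) (v s) <= 0 &
      0 <= e * tcoord (v s)].

Lemma tcurve_sub e c (v : R -> V) a b a' b' : a <= a' -> b' <= b -> tcurve e c v a b ->
  tcurve e c v a' b'.
Proof.
move=> aa bb lc s /andP[as_ sb]; apply: lc.
by rewrite (le_trans aa)// (le_trans sb).
Qed.

Definition sgn (e : R) := e = 1 \/ e = -1.

Lemma sgn_sqr e : sgn e -> e ^+ 2 = 1.
Proof. by move=> [->|->]; rewrite ?sqrrN expr1n. Qed.

Lemma sgn_norm e x : sgn e -> 0 <= e * x -> `|x| = e * x.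
Proof.
by move=> [->|->]; rewrite ?mul1r ?mulN1r; [move/ger0_norm|rewrite oppr_ge0 => /ler0_norm].
Qed.

Lemma future_chart_sgn e p v : sgn e -> O p -> gq L H p v <= 0 ->
  0 <= e * tcoord v -> 0 <= e * tcoord ('d psi p v).
Proof.
move=> se Op g0 v0; rewrite -tcoordZ -linearZ; apply: future_chart => //.
  by rewrite gq_scale sgn_sqr// mul1r.
by rewrite tcoordZ.
Qed.

(** The a priori estimate behind every confinement argument: bounds on chart time at the two ends
    confine the whole curve, by slope 2. *)
Lemma tcurve_mono e c (v : R -> V) a b : sgn e -> a <= b -> tcurve e c v a b ->
  [/\ e * tcoord (c a) <= e * tcoord (c b),
      e * tcoord (psi (c a)) <= e * tcoord (psi (c b)) &
   forall i, `|rsubmx (psi (c b)) 0 i - rsubmx (psi (c a)) 0 i| <=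
     2 * (e * tcoord (psi (c b)) - e * tcoord (psi (c a)))].
Proof.
move=> se ab tc.
have D1 s : a <= s <= b -> is_derive s (1 : R) (fun r => e * tcoord (psi (c r)))
    (e * tcoord ('d psi (c s) (v s))).
  move=> /tc[dc Oc _ _].
  apply: (is_deriveZ (f := fun r => tcoord (psi (c r)))).
  exact: is_derive_tcoord (is_derive_diff dc (ec_diff EC Oc)).
split.
- apply: (@mono_derive _ (fun r => e * tcoord (c r)) (fun s => e * tcoord (v s)) _ _ ab).
    move=> s /tc[dc _ _ _]; apply: (is_deriveZ (f := fun r => tcoord (c r))).
    exact: is_derive_tcoord.
  by move=> s /tc[].
- apply: (@mono_derive _ (fun r => e * tcoord (psi (c r))) _ _ _ ab D1) => s /tc[dc Oc g0 v0].
  exact: future_chart_sgn.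
- move=> i; rewrite mulrBr.
  apply: (@abs_mono_derive _ (fun r => rsubmx (psi (c r)) 0 i) (fun s => rsubmx ('d psi (c s) (v s)) 0 i)
    (fun r => 2 * (e * tcoord (psi (c r)))) (fun s => 2 * (e * tcoord ('d psi (c s) (v s))))) => //.
  + move=> s /tc[dc Oc g0 v0]; apply: is_derive_coord.
    exact: is_derive_rsubmx (is_derive_diff dc (ec_diff EC Oc)).
  + by move=> s /D1; apply: (is_deriveZ (f := fun r => e * tcoord (psi (c r)))).
  + move=> s /tc[dc Oc g0 v0]; apply: (le_trans (wide_coord _ Oc g0)).
    by rewrite (sgn_norm se)//; exact: future_chart_sgn.
Qed.

Lemma cls_ball p r0 : half_space p -> r0 < dl ->
  (forall e, 0 < e -> exists q, [/\ O q, `|q - p| < e & `|psi q| <= r0]) ->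
  O p /\ `|psi p| <= r0.
Proof.
move=> hp r0d Hq.
pose A := [set q | O q /\ `|psi q| <= r0].
pose F := filter_from [set e : R | 0 < e] (fun e => psi @` [set q | A q /\ `|q - p| < e]).
have FF : ProperFilter F.
  apply: filter_from_proper; last first.
    move=> e e0; have [q [Oq qe qr]] := Hq e e0.
    by exists (psi q); exists q.
  apply: filter_from_filter; first by exists 1; exact: ltr01.
  move=> e1 e2 e10 e20; exists (Num.min e1 e2); first by rewrite /= lt_min e10.
  move=> x [q [Aq]]; rewrite lt_min => /andP[q1 q2] qx.
  by split; exists q.
have cK : compact [set y : V | `|y| <= r0].
  apply: bounded_closed_compact.
    by exists r0; split; [exact: num_real|] => M rM y /= /le_trans; apply; exact: ltW.
  rewrite (_ : [set y : V | _] = Num.norm @^-1` [set x | x <= r0])//.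
  apply: closed_comp; last exact: closed_le.
  by move=> y _; exact: norm_continuous.
have [|y [/= yr cy]] := cK F FF.
  by exists 1; [exact: ltr01|move=> _ [q [[Oq qr] _] <-]].
have [|Op E] := ec_cls EC hp (le_lt_trans yr r0d); last by rewrite E.
move=> e e0.
have /cy/(_ (nbhsx_ballx y e e0)) : F (psi @` [set q | A q /\ `|q - p| < e]) by exists e.
move=> [_ [[q [[Oq _] qe] <-]]]; rewrite -ball_normE /ball_ /= distrC => h.
by exists q.
Qed.

Definition tbox (m tau X : R) : set V :=
  [set p | m <= tcoord p <= tau /\ `|rsubmx p| <= X].

Lemma tbox_compact m tau X : compact (tbox m tau X).
Proof.
have [X0|X0] := ltP X 0.
  have -> : tbox m tau X = set0.
    apply/seteqP; split => // p [_ h]; have := le_lt_trans h X0.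
    by rewrite ltNge normr_ge0.
  exact: compact0.
apply: bounded_closed_compact.
  pose M := Num.max (Num.max `|m| `|tau|) X.
  exists M; split; first exact: num_real.
  move=> M' MM p [/andP[h1 h2] h3] /=.
  have MX : X <= M by rewrite /M le_max lexx orbT.
  apply: le_trans (ltW MM); apply/norm_leP; first exact: le_trans MX.
  split; last by move=> i; apply: (rV_normP _ _).1 => //; [exact: le_trans MX|exact: le_trans MX].
  rewrite /M le_max; apply/orP; left; rewrite le_max.
  have [p0|p0] := leP 0 (tcoord p).
    by apply/orP; right; rewrite ger0_norm// (le_trans h2)// ler_norm.
  apply/orP; left; rewrite ltr0_norm//; apply: le_trans (_ : - m <= _); first lra.
  by rewrite -normrN ler_norm.
have -> : tbox m tau X = (@tcoord R n) @^-1` `[m, tau] `&`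
    ((fun p => `|rsubmx p|) @^-1` [set x | x <= X]).
  by apply/seteqP; split => p /=; rewrite in_itv /=.
apply: closedI; apply: closed_comp.
- by move=> p _; exact: tcoord_cts.
- exact: interval_closed.
- move=> p _; apply: (@continuous_comp V 'rV[R]_n R rsubmx Num.norm).
    exact: rsubmx_cts.
  exact: norm_continuous.
- exact: closed_le.
Qed.

(** Counterpart of [cls_ball]: the images converge, and compactness of the box supplies a limit of
    the points, which m > 0 keeps in the half space. *)
Lemma cls_tbox m tau X y : 0 < m -> `|y| < dl ->
  (forall e, 0 < e -> exists p, [/\ O p, tbox m tau X p & `|psi p - y| < e]) ->
  exists2 p, O p & psi p = y.
Proof.
move=> m0 yd Hp.
pose F := filter_from [set e : R | 0 < e]
  (fun e => [set p | [/\ O p, tbox m tau X p & `|psi p - y| < e]]).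
have FF : ProperFilter F.
  apply: filter_from_proper; last by move=> e /Hp.
  apply: filter_from_filter; first by exists 1; exact: ltr01.
  move=> e1 e2 e10 e20; exists (Num.min e1 e2); first by rewrite /= lt_min e10.
  by move=> p [Op Kp]; rewrite lt_min => /andP[q1 q2]; split.
have [|p [Kp cp]] := @tbox_compact m tau X F FF.
  by exists 1; [exact: ltr01|move=> p []].
have hp : half_space p by have [/andP[h _] _] := Kp; apply: lt_le_trans h.
have [|Op E] := ec_cls EC hp yd; last by exists p.
move=> e e0.
have /cp/(_ (nbhsx_ballx p e e0)) :
  F [set p | [/\ O p, tbox m tau X p & `|psi p - y| < e]] by exists e.
move=> [q [[Oq _ h]]]; rewrite -ball_normE /ball_ /= distrC => h'.
by exists q.
Qed.

Lemma ltr_cts2 (u : 'rV[R]_n) p t0 :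
  {for (p, t0), continuous (fun z : V * R => ltr L (z.2 *: u) z.1)}.
Proof.
have -> : (fun z : V * R => ltr L (z.2 *: u) z.1) =
   (fun z => mk (tcoord z.1) (rsubmx z.1 +
      z.2 *: (u + 2^-1 *: bracket L u (rsubmx z.1)))).
  apply/funext => z; rewrite /ltr /gmul bracketZl; congr (mk _ _).
  by rewrite scalerDr (addrC (z.2 *: u)) -addrA !scalerA (mulrC z.2).
apply: mk_cts.
  apply: (@continuous_comp _ _ _ fst (@tcoord R n)); first exact: cvg_fst.
  exact: tcoord_cts.
have c1 : {for (p, t0), continuous (fun z : V * R => rsubmx z.1)}.
  apply: (@continuous_comp _ _ _ fst rsubmx); first exact: cvg_fst.
  exact: rsubmx_cts.
pose f2 x : 'rV[R]_n := u + 2^-1 *: bracket L u x.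
have cf2 : continuous f2.
  move=> x; have -> : f2 = (fun=> u) + (fun x => 2^-1 *: bracket L u x) by [].
  apply: continuousD; first exact: cst_continuous.
  by apply: cts_linear => a x' y; rewrite bracketDr bracketZr scalerDr !scalerA mulrC.
have c2 : {for (p, t0), continuous (fun z : V * R => f2 (rsubmx z.1))}.
  exact: (@continuous_comp (V * R)%type 'rV[R]_n 'rV[R]_n (fun z => rsubmx z.1) f2
    (p, t0) c1 (cf2 _)).
have c3 : {for (p, t0), continuous (fun z : V * R => z.2 *: f2 (rsubmx z.1))}.
  exact: (@continuousZ R 'rV[R]_n (V * R)%type (fun z => z.2) (fun z : V * R => f2 (rsubmx z.1))
    (p, t0) cvg_snd c2).
have -> : (fun z : V * R => rsubmx z.1 +
      z.2 *: (u + 2^-1 *: bracket L u (rsubmx z.1))) =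
    (fun z : V * R => rsubmx z.1) + (fun z : V * R => z.2 *: f2 (rsubmx z.1)) by [].
exact: continuousD c1 c3.
Qed.

(** The points in question form a compact set by [cls_ball], so translation is uniformly continuous
    on it. The translations along u are not assumed to be deck transformations, so [psi] does
    move. *)
Lemma ltr_uniform m tau X r0 e (u : 'rV[R]_n) : 0 < m -> r0 < dl -> 0 < e ->
  exists2 d, 0 < d & forall p, O p -> tbox m tau X p -> `|psi p| <= r0 ->
    forall z, `|z| < d -> O (ltr L (z *: u) p) /\ `|psi (ltr L (z *: u) p) - psi p| < e.
Proof.
move=> m0 r0d e0.
pose K := [set p | [/\ O p, tbox m tau X p & `|psi p| <= r0]].
have cK : compact K.
  apply: (subclosed_compact _ (@tbox_compact m tau X)); last by move=> p [].
  move=> p cp.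
  have Kp : tbox m tau X p.
    have clB : closed (tbox m tau X).
      by apply: compact_closed; [exact: norm_hausdorff|exact: tbox_compact].
    apply: clB => B /cp[q [[_ Kq _] Bq]]; by exists q.
  have hp : half_space p by have [/andP[h _] _] := Kp; apply: lt_le_trans h.
  have [|Op pr] := cls_ball hp r0d; last by split.
  move=> d d0; have [q [[Oq Kq qr]]] := cp _ (nbhsx_ballx p d d0).
  by rewrite -ball_normE /ball_ /= distrC => h; exists q.
have /compact_near_coveringP nc := cK.
have := nc _ (nbhs (0 : R)) (fun z p => O (ltr L (z *: u) p) /\
  `|psi (ltr L (z *: u) p) - psi p| < e) _.
case.
  move=> p [Op Kp pr].
  pose G (z : V * R) := ltr L (z.2 *: u) z.1.
  have G0 : G (p, 0) = p by rewrite /G /= scale0r /ltr gmul0 mk_eta.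
  have cG := ltr_cts2 (u := u) (p := p) (t0 := 0); rewrite -/G in cG.
  have n1 : \forall z \near ((p, 0) : V * R), O (G z).
    by apply: cG; rewrite G0; exact: near_O EC _ Op.
  have cpG : {for (p, 0 : R), continuous (psi \o G)}.
    by apply: continuous_comp => //; rewrite G0; exact: psi_cts EC _ Op.
  have cp1 : {for (p, 0 : R), continuous (psi \o fst)}.
    by apply: continuous_comp; [exact: cvg_fst|exact: psi_cts EC _ Op].
  have cN : {for (p, 0 : R), continuous (fun z => `|psi (G z) - psi z.1|)}.
    apply: (@continuous_comp _ _ _ (fun z => psi (G z) - psi z.1) Num.norm).
      exact: (@continuousB _ _ _ (psi \o G) (psi \o fst)).
    exact: norm_continuous.
  have n2 : \forall z \near ((p, 0) : V * R), `|psi (G z) - psi z.1| < e.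
    by move/cvgr_lt : cN; apply; rewrite /= G0 subrr normr0.
  exact: filterI n1 n2.
move=> d /= d0 Hd; exists d => // p Op Kp pr z zd.
by apply: Hd => //=; rewrite sub0r normrN.
Qed.

End Causal.

(** * Particle horizons and lifts of straight segments *)

Section Horizon.
Variables (R : realType) (n : nat) (L : two_step R n).
Variables (Gam : discrete_subgroup L) (H : 'I_n -> R -> R).
Local Notation V := 'rV[R]_(1 + n).
Implicit Types (p q v w y : V) (s r t a b : R).
Variables (O : set V) (psi : V -> V) (dl : R).
Hypothesis EC : ext_chart Gam H O psi dl 4^-1.
Variables (Bf bf : R -> R).
Hypothesis dB : forall t, 0 < t -> is_derive t (1 : R) Bf (bf t).
Hypothesis b_gt0 : forall t, 0 < t -> 0 < bf t.
Hypothesis HB1 : forall t i, 0 < t -> 1 <= H i t * bf t ^+ 2.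
Hypothesis B_bd : forall tau, exists M, forall t, 0 < t <= tau -> `|Bf t| <= M.

Lemma H_gt0 i t : 0 < t -> 0 < H i t.
Proof.
move=> t0; have := HB1 i t0; have b0 := b_gt0 t0.
rewrite ltNge => h; apply/negP => Hle; move: h; apply/negP; rewrite -ltNge.
by apply: le_lt_trans ltr01; rewrite mulr_le0_ge0// sqr_ge0.
Qed.

Lemma theta_bound p v i : 0 < tcoord p -> gq L H p v <= 0 ->
  `|theta L p v 0 i| <= bf (tcoord p) * `|tcoord v|.
Proof.
move=> t0 g0; have b0 := b_gt0 t0.
rewrite -[bf _]gtr0_norm// -normrM -ler_sqr ?nnegrE//.
rewrite !real_normK ?num_real// exprMn.
have h1 : H i (tcoord p) * theta L p v 0 i ^+ 2 <= tcoord v ^+ 2.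
  move: g0; rewrite /gq (bigD1 i)//=.
  set S := \sum_(_ | _) _; have S0 : 0 <= S.
    by apply: sumr_ge0 => j _; rewrite mulr_ge0 ?sqr_ge0// ltW// H_gt0.
  lra.
have h2 := HB1 i t0.
have h3 : bf (tcoord p) ^+ 2 * (H i (tcoord p) * theta L p v 0 i ^+ 2) <=
    bf (tcoord p) ^+ 2 * tcoord v ^+ 2 by rewrite ler_wpM2l ?sqr_ge0.
apply: le_trans h3; rewrite mulrA (mulrC (_ ^+ 2)) ler_peMl ?sqr_ge0//.
Qed.

Lemma bracket_deltaE (x y : 'rV[R]_n) k :
  bracket L x y 0 k = \sum_j y 0 j * bracket L x (delta_mx 0 j) 0 k.
Proof.
have l : linear (bracket L x) by move=> a u v; rewrite bracketDr bracketZr.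
have [A AE] := linear_mulmx l.
by rewrite AE mxE; apply: eq_bigr => j _; rewrite AE -rowE mxE.
Qed.

(** By [HB1], [bf] dominates each 1 / a_i, so the left-invariant velocity is at most the rate of
    [Bf]; as [Bf] stays bounded down to t = 0, causal curves travel a bounded distance even towards
    the singularity. The coordinates obey x' = theta + [x, theta] / 2 and are bounded in two
    stages. *)
Lemma horizon tau X : exists X', forall e (c v : R -> V) a b, sgn e -> a <= b ->
  (forall s, a <= s <= b -> [/\ is_derive s (1 : R) c (v s), 0 < tcoord (c s) <= tau,
     gq L H (c s) (v s) <= 0 & 0 <= e * tcoord (v s)]) ->
  `|rsubmx (c a)| <= X -> `|rsubmx (c b)| <= X'.
Proof.
have [M HM] := B_bd tau.
pose Z := sc_norm L * X + sc_norm L * (2 * M).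
pose X' := X + (1 + 2^-1 * (n%:R * Z)) * (2 * M).
exists X' => e c v a b se ab Hc xa.
have X0 : 0 <= X by apply: le_trans xa.
have M0 : 0 <= M.
  have [_ h _ _] := Hc a ltac:(by rewrite lexx).
  exact: le_trans (HM _ h).
have Z0 : 0 <= Z by rewrite addr_ge0 ?mulr_ge0 ?sc_norm_ge0.
have X'0 : 0 <= X'.
  by rewrite addr_ge0// !mulr_ge0// addr_ge0// !mulr_ge0.
pose be s := bf (tcoord (c s)) * `|tcoord (v s)|.
pose g s := e * Bf (tcoord (c s)).
have be0 s : a <= s <= b -> 0 <= be s.
  by move=> /Hc[_ /andP[t0 _] _ _]; rewrite mulr_ge0// ltW// b_gt0.
have dg s : a <= s <= b -> is_derive s (1 : R) g (be s).
  move=> /Hc[dc /andP[t0 _] _ v0].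
  rewrite /be (sgn_norm se v0).
  have -> : bf (tcoord (c s)) * (e * tcoord (v s)) =
      e *: (bf (tcoord (c s)) * tcoord (v s)) by rewrite /GRing.scale /=; ring.
  apply: (is_deriveZ (f := fun r => Bf (tcoord (c r)))).
  apply: (is_derive1_comp (f := Bf) (g := fun r => tcoord (c r))).
    exact: dB.
  exact: is_derive_tcoord.
have gb s : a <= s <= b -> `|g s - g a| <= 2 * M.
  have gM r : a <= r <= b -> `|g r| <= M.
    move=> /Hc[_ /HM h _ _]; rewrite normrM.
    by case: se => ->; rewrite ?normrN1 ?normr1 mul1r.
  move=> hs; apply: (le_trans (ler_normB _ _)).
  by rewrite (_ : 2 * M = M + M) ?lerD ?gM ?lexx//; ring.
have thb s i : a <= s <= b -> `|theta L (c s) (v s) 0 i| <= be s.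
  by move=> /Hc[_ /andP[t0 _] g0 _]; exact: theta_bound.
have sub s r : a <= s <= b -> a <= r <= s -> a <= r <= b.
  by move=> /andP[h1 h2] /andP[h3 h4]; rewrite h3 (le_trans h4).
have aa : a <= a <= b by rewrite lexx.
have vth s : rsubmx (v s) = theta L (c s) (v s) +
    2^-1 *: bracket L (rsubmx (c s)) (rsubmx (v s)).
  by rewrite /theta subrK.
(* First stage: [x, e_j] has derivative [theta, e_j] because iterated brackets vanish, so it is
   bounded before x is. *)
have zb s j k : a <= s <= b ->
    `|bracket L (rsubmx (c s)) (delta_mx 0 j) 0 k| <= Z.
  move=> hs; set z := bracket _ _ _ _ _.
  have -> : z = bracket L (rsubmx (c a)) (delta_mx 0 j) 0 k +
     (z - bracket L (rsubmx (c a)) (delta_mx 0 j) 0 k) by rewrite addrC subrK.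
  have d1 l : `|(delta_mx 0 j : 'rV[R]_n) 0 l| <= 1.
    by rewrite mxE; case: eqP => _; case: eqP => _; rewrite ?normr1 ?normr0.
  apply: (le_trans (ler_normD _ _)); apply: lerD.
    rewrite -[X in _ <= X]mulr1; apply: bracket_coord_le => // i.
    by apply: le_trans xa; exact: (rV_normP _ (normr_ge0 _)).1.
  apply: (@le_trans _ _ (sc_norm L * g s - sc_norm L * g a)); last first.
    rewrite -mulrBr ler_wpM2l ?sc_norm_ge0//.
    by apply: le_trans (gb s hs); exact: ler_norm.
  have [h1 h2] := andP hs.
  refine (@abs_mono_derive _ (fun r => bracket L (rsubmx (c r)) (delta_mx 0 j) 0 k)
    (fun r => bracket L (rsubmx (v r)) (delta_mx 0 j) 0 k)
    (fun r => sc_norm L * g r) (fun r => sc_norm L * be r) a s h1 _ _ _) =>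
    r /(sub _ _ hs) hr.
  - have [dc _ _ _] := Hc r hr.
    apply: is_derive_coord.
    apply: (is_derive_linear (f := fun x => bracket L x (delta_mx 0 j))).
      by move=> l x y; rewrite bracketDl bracketZl.
    exact: is_derive_rsubmx.
  - by apply: (is_deriveZ (f := g)); exact: dg.
  - rewrite vth bracketDl bracketZl bracket2l scaler0 addr0.
    by rewrite -[leRHS]mulr1; apply: bracket_coord_le => // i; exact: thb.
apply/rV_normP => // k.
rewrite -[_ 0 k](subrK (rsubmx (c a) 0 k)) addrC (le_trans (ler_normD _ _))//.
apply: lerD; first by apply: le_trans xa; exact: (rV_normP _ (normr_ge0 _)).1.
set K := 1 + _.
apply: (@le_trans _ _ (K * g b - K * g a)); last first.
  rewrite -mulrBr ler_wpM2l//; first by rewrite addr_ge0// !mulr_ge0.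
  by apply: le_trans (gb b _); [exact: ler_norm|rewrite ab lexx].
refine (@abs_mono_derive _ (fun r => rsubmx (c r) 0 k) (fun r => rsubmx (v r) 0 k)
    (fun r => K * g r) (fun r => K * be r) a b ab _ _ _) => r hr.
- by have [dc _ _ _] := Hc r hr; apply: is_derive_coord; exact: is_derive_rsubmx.
- by apply: (is_deriveZ (f := g)); exact: dg.
- have bth : bracket L (rsubmx (c r)) (rsubmx (v r)) =
      bracket L (rsubmx (c r)) (theta L (c r) (v r)).
    by rewrite {1}vth bracketDr bracketZr bracket2r scaler0 addr0.
  rewrite vth mxE (le_trans (ler_normD _ _))// mulrDl mul1r lerD ?thb//.
  rewrite mxE normrM ger0_norm ?invr_ge0// -mulrA ler_wpM2l ?invr_ge0//.
  rewrite bth bracket_deltaE (le_trans (ler_norm_sum _ _ _))//.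
  apply: (@le_trans _ _ (\sum_(j < n) be r * Z)); last first.
    by rewrite sumr_const card_ord -mulr_natl le_eqVlt; apply/orP; left; apply/eqP; ring.
  by apply: ler_sum => j _; rewrite normrM ler_pM ?thb ?zb.
Qed.

Lemma is_derive_mulr k s : is_derive s (1 : R) (fun r : R => r * k) k.
Proof.
have -> : (fun r : R => r * k) = k \*: (id : R -> R).
  by apply/funext => r; rewrite mulrC.
by apply: is_derive_eq; rewrite /GRing.scale /= mulr1.
Qed.

Lemma line_derive (A w : V) s : is_derive s (1 : R) (fun r => A + r *: w) w.
Proof.
rewrite -[X in is_derive _ _ _ X]add0r.
apply: (is_deriveD (f := fun=> A) (g := fun r => r *: w)).
apply: is_derive_mx => i j.
have -> : (fun r => (r *: w) i j) = (fun r => r * w i j).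
  by apply/funext => r; rewrite mxE.
exact: is_derive_mulr.
Qed.

Lemma line_cts (A w : V) s : {for s, continuous (fun r : R => A + r *: w)}.
Proof. exact: is_derive_continuous (line_derive A w s). Qed.

(** Slope at most 1/2 in the time direction [e]: by [narrow_timelike], a chart vector that is
    timelike at every point of the chart. *)
Definition narrow e w := 0 < e * tcoord w /\ sp w <= tcoord w ^+ 2 / 4.

(** The factor 1/2 in the last bound: gq is at most - t(w)^2 / 4 on the velocity v of the lift, and
    at least - t(v)^2 because its spatial part is nonnegative. *)
Lemma lift_line e A w a b c s : sgn e -> narrow e w ->
  lift O psi (fun r => A + r *: w) a b c -> a <= s <= b ->
  [/\ is_derive s (1 : R) c ('D_1 c s), 'd psi (c s) ('D_1 c s) = w,
   gq L H (c s) ('D_1 c s) <= - (tcoord w ^+ 2 / 4) &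
   e * tcoord w / 2 <= e * tcoord ('D_1 c s)].
Proof.
move=> se [w0 w1] lc hs; have [kc Oc nc] := lc s hs.
have dl' := line_derive A w s.
have nc' : \forall r \near s, A + r *: w = (psi \o c) r by apply: filterS nc => r.
have dpc : is_derive s (1 : R) (psi \o c) w.
  exact: near_eq_is_derive nc' dl'.
have [v dv vw] := lift_derive kc (ec_diff EC Oc) (ec_inj EC Oc) dpc.
have -> : 'D_1 c s = v by case: dv.
have gv : gq L H (c s) v <= - (tcoord w ^+ 2 / 4).
  by rewrite -vw; apply: narrow_timelike EC _ _ Oc _; rewrite vw.
have g0 : gq L H (c s) v <= 0.
  by apply: le_trans gv _; rewrite oppr_le0 divr_ge0 ?sqr_ge0.
have w2 : 0 < tcoord w ^+ 2.
  by rewrite exprn_even_gt0//=; apply: contraTneq w0 => ->; rewrite mulr0 ltxx.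
have ev : 0 <= e * tcoord v.
  rewrite leNgt; apply/negP => h.
  have sne : sgn (- e) by case: se => ->; [right|left]; rewrite ?opprK.
  have := future_chart_sgn EC sne Oc g0; rewrite vw !mulNr !oppr_ge0 => h'.
  by have := h' (ltW h); rewrite leNgt w0.
split => //.
have h1 : (tcoord w / 2) ^+ 2 <= tcoord v ^+ 2.
  have : - tcoord v ^+ 2 <= gq L H (c s) v.
    rewrite /gq lerDl; apply: sumr_ge0 => i _; rewrite mulr_ge0 ?sqr_ge0//.
    by rewrite ltW// H_gt0//; exact: (ec_half EC Oc).
  rewrite expr_div_n; lra.
rewrite -mulrA -(sgn_norm se ev) -(@sgn_norm _ e (tcoord w / 2)) //; last first.
  by rewrite mulrA divr_ge0// ltW.
by rewrite -ler_sqr ?nnegrE// !real_normK ?num_real.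
Qed.

Lemma lift_tcurve e A w a b c : sgn e -> narrow e w ->
  lift O psi (fun r => A + r *: w) a b c -> tcurve L H O e c (fun s => 'D_1 c s) a b.
Proof.
move=> se nw lc s hs; have [dc _ gc tc] := lift_line se nw lc hs.
have [_ Oc _] := lc s hs; split => //.
  by apply: le_trans gc _; rewrite oppr_le0 divr_ge0 ?sqr_ge0.
by apply: le_trans tc; rewrite divr_ge0// ltW// nw.1.
Qed.

Lemma tcoord_gain e A w a b c : sgn e -> narrow e w -> a <= b ->
  lift O psi (fun r => A + r *: w) a b c ->
  e * tcoord (c a) + (b - a) * (e * tcoord w / 2) <= e * tcoord (c b).
Proof.
move=> se nw ab lc; set k := e * tcoord w / 2.
rewrite -lerBrDl.
have : (fun r => e * tcoord (c r) - r * k) a <= (fun r => e * tcoord (c r) - r * k) b.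
  refine (@mono_derive _ (fun r => e * tcoord (c r) - r * k)
    (fun s => e * tcoord ('D_1 c s) - k) a b ab _ _).
    move=> s hs; have [dc _ _ _] := lift_line se nw lc hs.
    apply: (is_deriveB (f := fun r => e * tcoord (c r)) (g := fun r => r * k)).
      apply: (is_deriveZ (f := fun r => tcoord (c r))).
      exact: is_derive_tcoord.
    exact: is_derive_mulr.
  by move=> s hs; have [_ _ _] := lift_line se nw lc hs; rewrite subr_ge0.
rewrite /=; lra.
Qed.

(** Lifts over the segments [0, x] with x < 1 agree by uniqueness. At r the lift up to [G r], which
    lies beyond r, is used, so that near each s a single lift describes the curve. *)
Lemma path_lifting_o (c : R -> V) p0 :
  (forall s, 0 <= s < 1 -> {for s, continuous c}) ->
  (forall s, 0 <= s < 1 -> exists2 p, O p & psi p = c s) ->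
  O p0 -> psi p0 = c 0 ->
  exists2 ct, (forall b, b < 1 -> lift O psi c 0 b ct) & ct 0 = p0.
Proof.
move=> cc cU Op0 E0.
have Hex x : exists ct, 0 <= x < 1 -> lift O psi c 0 x ct /\ ct 0 = p0.
  have [/andP[x0 x1]|xn] := boolP (0 <= x < 1); last by exists (cst p0).
  have [| | ct lct ct0] := @path_lifting _ _ _ _ _ _ _ _ EC c 0 x p0 x0 _ _ Op0 E0.
  - by move=> s /andP[h1 h2]; apply: cc; rewrite h1 (le_lt_trans h2).
  - by move=> s /andP[h1 h2]; apply: cU; rewrite h1 (le_lt_trans h2).
  - by exists ct.
have [F HF] := choice Hex.
(* The maximum provides a segment for r slightly below 0, where a lift from 0 is still
   prescribed. *)
pose G r := (Num.max r 0 + 1) / 2.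
have HG r : r < 1 -> [/\ 0 <= G r, G r < 1 & r < G r].
  rewrite /G; case: (leP r 0) => h h1; split; lra.
pose ct r := F (G r) r.
exists ct; last first.
  rewrite /ct; have [g0 g1 _] := HG 0 ltr01.
  by have [_ ->] := HF (G 0) ltac:(by rewrite g0 g1).
move=> b b1 s /andP[s0 sb]; have s1 := le_lt_trans sb b1.
pose x := (s + 3) / 4.
have x1 : 0 <= x < 1 by rewrite /x; lra.
have [lx x0] := HF x x1.
have Gx r : r < s + (1 - s) / 2 -> G r <= x.
  by rewrite /G /x; case: (leP r 0) => h h'; lra.
have sx : 0 <= s <= x by rewrite s0 /x; lra.
have [kx Ox nx] := lx s sx.
have e0 : 0 < (1 - s) / 2 by lra.
have ctx r : 0 <= r < s + (1 - s) / 2 -> ct r = F x r.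
  move=> /andP[r0 r1]; have r11 : r < 1 by lra.
  have [g0 g1 rg] := HG r r11.
  have [lg G0] := HF (G r) ltac:(by rewrite g0 g1).
  apply: (lift_unique EC lg (c2 := F x)); [|by rewrite G0 x0|by rewrite r0 ltW].
  by apply: (lift_sub (lexx 0) (Gx _ r1) lx).
have near_ct : \forall r \near s, ct r = F x r.
  have [s00|s0'] := leP s 0; last first.
    have : \forall r \near s, 0 < r < s + (1 - s) / 2.
      by apply: near_itv; rewrite s0' ltrDl.
    by apply: filterS => r /andP[h1 h2]; apply: ctx; rewrite (ltW h1).
  have es : s = 0 by apply/eqP; rewrite eq_le s00.
  have [g0 g1 g2] := HG 0 ltr01.
  have [lg G0] := HF (G 0) ltac:(by rewrite g0 g1).
  have [kg Og ng] := lg 0 ltac:(by rewrite lexx).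
  rewrite es in kx Ox nx.
  have n1 := lift_near_eq EC (etrans G0 (esym x0)) Og kg kx ng nx.
  have n2 : \forall r \near (0 : R), -1 < r < 0 + (1 - s) / 2.
    by apply: near_itv; rewrite add0r es subr0; apply/andP; split; lra.
  rewrite es; apply: filterS2 n1 n2 => r n1r /andP[h1 h2].
  have [r0|r0] := leP 0 r; first by apply: ctx; rewrite r0 {1}es.
  by rewrite /ct -n1r /G maxxx max_r// ltW.
have ctsx := nbhs_singleton near_ct.
split.
- rewrite /prop_for /continuous_at ctsx; apply: cvg_trans kx; apply: near_eq_cvg.
  by apply: filterS near_ct => r ->.
- by rewrite ctsx.
- by apply: filterS2 near_ct nx => r -> ->.
Qed.

(** If the lift stayed in a slab of times, [horizon] would confine it to a box and [cls_tbox] would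
    put the missing end point into the image. *)
Lemma ray e A w p0 : sgn e -> narrow e w -> `|A + w| < dl ->
  (forall s, 0 <= s < 1 -> exists2 p, O p & psi p = A + s *: w) ->
  ~ (exists2 p, O p & psi p = A + w) -> O p0 -> psi p0 = A ->
  exists c, [/\ c 0 = p0, (forall b, b < 1 -> lift O psi (fun r => A + r *: w) 0 b c) &
   forall m tau, 0 < m -> exists2 s, 0 <= s < 1 & ~ (m <= tcoord (c s) <= tau)].
Proof.
move=> se nw Awd HU nU Op0 E0.
have [| |c lc c0] := @path_lifting_o (fun r => A + r *: w) p0 _ HU Op0.
- by move=> s _; exact: line_cts.
- by rewrite scale0r addr0.
exists c; split => // m tau m0; apply: contrapT => Hn; apply: nU.
have Ht s : 0 <= s < 1 -> m <= tcoord (c s) <= tau.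
  by move=> hs; apply: contrapT => h; apply: Hn; exists s.
have [X' HX] := horizon tau `|rsubmx p0|.
apply: (cls_tbox EC (m := m) (tau := tau) (X := X')) => // d d0.
pose s := Num.max 0 (1 - d / (2 * (`|w| + 1))).
have w1 : 0 < `|w| + 1 by rewrite ltr_wpDl.
have d1 : 0 < d / (2 * (`|w| + 1)) by rewrite divr_gt0// mulr_gt0.
have s0 : 0 <= s by rewrite /s le_max lexx.
have s1 : s < 1 by rewrite /s gt_max ltr01 ltrBlDr ltrDl.
have ls := lc s s1.
exists (c s); split.
- by have [] := ls s ltac:(by rewrite s0 lexx).
- split; first by apply: Ht; rewrite s0.
  apply: (HX e c (fun s => 'D_1 c s) 0 s se s0); last by rewrite c0.
  move=> r hr; have [dc _ _ _] := lift_line se nw ls hr.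
  have [_ _ g v] := lift_tcurve se nw ls hr.
  have /andP[r0 rs] := hr.
  have /andP[h1 h2] := Ht r ltac:(by rewrite r0 (le_lt_trans rs)).
  by split => //; rewrite (lt_le_trans m0 h1).
- rewrite (liftE ls) ?s0 ?lexx//.
  have -> : A + s *: w - (A + w) = - ((1 - s) *: w).
    by rewrite scalerBl scale1r opprB opprD addrACA subrr add0r.
  rewrite normrN normrZ ger0_norm ?subr_ge0 ?(ltW s1)//.
  have s2 : 1 - s <= d / (2 * (`|w| + 1)).
    by rewrite lerBlDl -lerBlDr /s le_max lexx orbT.
  apply: (@le_lt_trans _ _ (d / (2 * (`|w| + 1)) * (`|w| + 1))).
    by apply: ler_pM => //; [rewrite subr_ge0 ltW|rewrite lerDl].
  have -> : d / (2 * (`|w| + 1)) * (`|w| + 1) = d / 2 by field; rewrite gt_eqF.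
  by rewrite ltr_pdivrMr// ltr_pMr// ltr1n.
Qed.

Lemma leg e A w p0 : sgn e -> narrow e w ->
  (forall s, 0 <= s <= 1 -> exists2 p, O p & psi p = A + s *: w) ->
  O p0 -> psi p0 = A ->
  exists c, [/\ c 0 = p0, lift O psi (fun r => A + r *: w) 0 1 c &
    e * tcoord p0 + e * tcoord w / 2 <= e * tcoord (c 1)].
Proof.
move=> se nw HU Op0 E0.
have [| |c lc c0] := @path_lifting _ _ _ _ _ _ _ _ EC (fun r => A + r *: w) 0 1 p0 ler01 _ HU Op0.
- by move=> s _; exact: line_cts.
- by rewrite scale0r addr0.
exists c; split => //.
by have := tcoord_gain se nw ler01 lc; rewrite c0 subr0 mul1r.
Qed.

End Horizon.

(** * Elementary properties of the chart image *)

Section Broken.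
Variables (R : realType) (n : nat) (L : two_step R n).
Variables (Gam : discrete_subgroup L) (H : 'I_n -> R -> R).
Local Notation V := 'rV[R]_(1 + n).
Implicit Types (p q v w y : V) (s r t a b : R).
Variables (O : set V) (psi : V -> V) (dl : R).
Hypothesis EC : ext_chart Gam H O psi dl 4^-1.
Variables (Bf bf : R -> R).
Hypothesis dB : forall t, 0 < t -> is_derive t (1 : R) Bf (bf t).
Hypothesis b_gt0 : forall t, 0 < t -> 0 < bf t.
Hypothesis HB1 : forall t i, 0 < t -> 1 <= H i t * bf t ^+ 2.
Hypothesis B_bd : forall tau, exists M, forall t, 0 < t <= tau -> `|Bf t| <= M.

Definition chart_image y := exists2 p, O p & psi p = y.

Lemma chart_image_open : open chart_image.
Proof.
rewrite openE => y [p Op <-].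
apply: filterS (ec_opn EC Op (near_O EC Op)) => z [q [_ Oq] qz].
by exists q.
Qed.

Lemma chart_image_bd y : chart_image y -> `|y| < dl.
Proof. by move=> [p Op <-]; exact: ec_bd EC _ Op. Qed.

(** The time t is invariant under deck transformations, hence a function of the chart point. *)
Lemma tcoord_wd p q : O p -> O q -> psi p = psi q -> tcoord p = tcoord q.
Proof. by move=> Op Oq /(ec_deck EC Op Oq)[g _ ->]; rewrite /ltr tcoord_mk. Qed.

Lemma ball_convex (A B : V) s d : 0 <= s <= 1 -> `|A| < d -> `|B| < d ->
  `|A + s *: (B - A)| < d.
Proof.
move=> /andP[s0 s1] Ad Bd.
have -> : A + s *: (B - A) = (1 - s) *: A + s *: B.
  by rewrite scalerBr scalerBl scale1r addrA addrAC.
apply: le_lt_trans (ler_normD _ _) _; rewrite !normrZ ger0_norm ?subr_ge0//.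
rewrite (ger0_norm s0).
have [->|sn0] := eqVneq s 0; first by rewrite subr0 mul1r mul0r addr0.
have : s * `|B| < s * d by rewrite ltr_pM2l// lt_neqAle eq_sym sn0.
have : (1 - s) * `|A| <= (1 - s) * d by rewrite ler_wpM2l ?subr_ge0// ltW.
lra.
Qed.

Lemma narrow_scale (w : V) e k : 0 < k -> narrow e w -> narrow e (k *: w).
Proof.
move=> k0 [w0 w1]; split; first by rewrite tcoordZ mulrCA mulr_gt0.
rewrite tcoordZ exprMn -mulrA.
have -> : sp (k *: w) = k ^+ 2 * sp w.
  by rewrite /sp mulr_sumr; apply: eq_bigr => i _; rewrite rsubmxZ mxE exprMn.
by rewrite ler_wpM2l// sqr_ge0.
Qed.

End Broken.

(** * No missing end point towards the future *)

Section Future.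
Variables (R : realType) (n : nat) (L : two_step R n).
Variables (Gam : discrete_subgroup L) (H : 'I_n -> R -> R).
Local Notation V := 'rV[R]_(1 + n).
Implicit Types (p q v w y : V) (s r t a b : R).
Variables (O : set V) (psi : V -> V) (dl : R).
Hypothesis EC : ext_chart Gam H O psi dl 4^-1.
Variables (Bf bf : R -> R).
Hypothesis dB : forall t, 0 < t -> is_derive t (1 : R) Bf (bf t).
Hypothesis b_gt0 : forall t, 0 < t -> 0 < bf t.
Hypothesis HB1 : forall t i, 0 < t -> 1 <= H i t * bf t ^+ 2.
Hypothesis B_bd : forall tau, exists M, forall t, 0 < t <= tau -> `|Bf t| <= M.
Hypothesis Hexp : forall i k T, 0 < k -> k <= T ->
  H i k <= H i T * (1 + 3 / 4 * ((T / k) ^+ 2 - 1)).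

Lemma is_derive_sqrtB (f : R -> R) s (df k : R) : k < f s ^+ 2 -> 
  is_derive s (1 : R) f df ->
  is_derive s (1 : R) (fun r => Num.sqrt (f r ^+ 2 - k))
    (f s / Num.sqrt (f s ^+ 2 - k) * df).
Proof.
move=> kf Df.
have p0 : 0 < f s ^+ 2 - k by rewrite subr_gt0.
have D1 := is_deriveB (is_deriveM Df Df) (is_derive_cst k s (1 : R)).
have -> : (fun r => Num.sqrt (f r ^+ 2 - k)) = Num.sqrt \o (f * f - cst k).
  by apply/funext => r; rewrite expr2.
have p1 : 0 < (f * f - cst k) s by [].
have := is_derive1_comp (is_derive1_sqrt p1) D1.
move/is_derive_eq; apply; rewrite /GRing.scale /= -expr2.
by field; rewrite gt_eqF// sqrtr_gt0.
Qed.

Lemma is_derive_sqrtBk (c k : R) : k < c ->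
  is_derive k (1 : R) (fun r => Num.sqrt (c - r)) (- (2 * Num.sqrt (c - k))^-1).
Proof.
move=> kc; have p0 : 0 < c - k by rewrite subr_gt0.
have D1 := is_deriveB (is_derive_cst c k (1 : R)) (is_derive_id k (1 : R)).
have p1 : 0 < (cst c - id) k by [].
have -> : (fun r => Num.sqrt (c - r)) = Num.sqrt \o (cst c - id) by [].
have := is_derive1_comp (is_derive1_sqrt p1) D1.
by move/is_derive_eq; apply; rewrite sub0r mulrN1.
Qed.

(** The squared time component gains the factor z = (T / K)^2, while [Hexp] limits the growth of the
    spatial part to 1 + 3/4 (z - 1). The surplus (z - 1) / 4 equals k / (4 K^2), which is at least k
    / (4 T^2). *)
Lemma delayed_timelike p v (k T K : R) : 0 < tcoord p -> 0 <= k < tcoord p ^+ 2 ->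
  gq L H p v <= 0 -> T = tcoord p -> K = Num.sqrt (T ^+ 2 - k) ->
  gq L H (mk K (rsubmx p)) (mk (T / K * tcoord v) (rsubmx v)) <=
    - (k / (4 * T ^+ 2) * tcoord v ^+ 2).
Proof.
move=> T0 /andP[k0 kT] g0 TE KE; rewrite -TE in T0 kT.
have kk : 0 < T ^+ 2 - k by rewrite subr_gt0.
have K0 : 0 < K by rewrite KE sqrtr_gt0.
have K2 : K ^+ 2 = T ^+ 2 - k by rewrite KE sqr_sqrtr// ltW.
have KT : K <= T by rewrite -ler_sqr ?nnegrE ?(ltW K0) ?(ltW T0)// K2 gerBl.
rewrite /gq !txE.
have -> : theta L (mk K (rsubmx p)) (mk (T / K * tcoord v) (rsubmx v)) = theta L p v.
  by rewrite /theta !txE.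
set S := \sum_i _; set z := (T / K) ^+ 2.
have z1 : 1 <= z.
  by rewrite /z expr_div_n ler_pdivlMr ?exprn_gt0// mul1r ler_sqr ?nnegrE// ltW.
pose S' := \sum_i H i T * theta L p v 0 i ^+ 2.
have S'T : S' <= tcoord v ^+ 2 by move: g0; rewrite /gq -TE -/S'; lra.
have SS' : S <= S' * (1 + 3 / 4 * (z - 1)).
  rewrite /S /S' mulr_suml; apply: ler_sum => i _.
  by rewrite mulrAC ler_wpM2r ?sqr_ge0// Hexp.
have c0 : 0 <= 1 + 3 / 4 * (z - 1) by rewrite addr_ge0// mulr_ge0 ?subr_ge0//.
have SV : S <= tcoord v ^+ 2 * (1 + 3 / 4 * (z - 1)).
  by apply: le_trans SS' _; rewrite ler_wpM2r.
rewrite exprMn -/z.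
have zE : k / (4 * T ^+ 2) <= (z - 1) / 4.
  have -> : z - 1 = k / K ^+ 2.
    rewrite /z expr_div_n -[X in _ - X](@divff _ (K ^+ 2)) ?gt_eqF ?exprn_gt0//.
    by rewrite -mulrBl K2; congr (_ / _); ring.
  rewrite -mulrA ler_wpM2l// -invfM lef_pV2 ?posrE ?mulr_gt0 ?exprn_gt0//.
  by rewrite mulrC ler_pM2l// ler_sqr ?nnegrE// ltW.
have h : k / (4 * T ^+ 2) * tcoord v ^+ 2 <= (z - 1) / 4 * tcoord v ^+ 2.
  by rewrite ler_wpM2r ?sqr_ge0.
move: h SV; set q := tcoord v ^+ 2; set r := k / _ * q => h SV.
have -> : z * q = q * z by rewrite mulrC.
lra.
Qed.

(** Along the lift of the ray t is unbounded, for it increases and leaves every slab. The delayed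
    curves remain in the chart, where chart time is bounded; along the one delayed by [k0] it would
    however grow at least like a multiple of ln t. *)
Lemma future_end (A w : V) p0 : narrow 1 w -> A + w = 0 -> `|w| <= dl / 20 ->
  (forall s, 0 <= s < 1 -> chart_image O psi (A + s *: w)) -> ~ chart_image O psi 0 ->
  O p0 -> psi p0 = A -> False.
Proof.
move=> nw Aw wdl HU nU Op0 E0.
have s1 : sgn (1 : R) by left.
have sN1 : sgn (-1 : R) by right.
have dl0 : 0 < dl by apply: le_lt_trans (ec_bd EC Op0).
have Awd : `|A + w| < dl by rewrite Aw normr0.
have nU' : ~ chart_image O psi (A + w) by rewrite Aw.
have [c [c0 lc Hc]] := ray EC dB b_gt0 HB1 B_bd s1 nw Awd HU nU' Op0 E0.
set l := `|w|; have AE : A = - w by apply/eqP; rewrite -addr_eq0 Aw.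
have w0 : 0 < tcoord w by have [] := nw; rewrite mul1r.
have l0 : 0 < l by apply: lt_le_trans (norm_tcoord w); rewrite gtr0_norm.
pose t s := tcoord (c s).
have t_ge s : 0 <= s < 1 -> tcoord p0 <= t s.
  move=> /andP[s0 s1'].
  have T1 := lift_tcurve EC b_gt0 HB1 s1 nw (lc s s1').
  by have [+ _ _] := tcurve_mono EC s1 s0 T1; rewrite !mul1r c0.
have t00 : 0 < tcoord p0 by exact: (ec_half EC Op0).
have t_gt0 s : 0 <= s < 1 -> 0 < t s by move=> /t_ge; apply: lt_le_trans.
pose lam s k := mk (Num.sqrt (t s ^+ 2 - k)) (rsubmx (c s)).
(* A delay so small that the delayed starting points remain in the chart, within l of A. *)
have [k0 k00 [k0t Hk0]] : exists2 k0, 0 < k0 & k0 < tcoord p0 ^+ 2 /\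
    forall k, 0 <= k <= k0 -> O (lam 0 k) /\ `|psi (lam 0 k) - A| < l.
  have lam00 : lam 0 0 = p0.
    by rewrite /lam subr0 /t c0 sqrtr_sqr gtr0_norm// mk_eta.
  have cl : {for 0, continuous (lam 0)}.
    apply: mk_cts; last exact: cst_continuous.
    apply: (@continuous_comp _ _ _ (fun k => t 0 ^+ 2 - k) Num.sqrt).
      apply: (@continuousB R R R (fun=> t 0 ^+ 2) id); first exact: cst_continuous.
      by move=> ?.
    exact: sqrt_continuous.
  have n1 : \forall k \near (0 : R), O (lam 0 k).
    by apply: cl; rewrite lam00; exact: (near_O EC).
  have n2 : \forall k \near (0 : R), `|psi (lam 0 k) - A| < l.
    have cpl : {for (0 : R), continuous (psi \o lam 0)}.
      by apply: continuous_comp => //; rewrite lam00; exact: (psi_cts EC).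
    have := near_dist cpl l0; apply: filterS => k.
    by rewrite /= lam00 E0.
  have [d d0 Hd] := right_near (filterI n1 n2).
  exists (Num.min (d / 2) (tcoord p0 ^+ 2 / 2)).
    by rewrite lt_min !divr_gt0// exprn_gt0.
  split.
    rewrite gt_min; apply/orP; right.
    by rewrite ltr_pdivrMr// ltr_pMr ?exprn_gt0// ltr1n.
  move=> k /andP[k1 k2]; have k3 : k <= d / 2 by apply: le_trans k2 _; rewrite ge_min lexx.
  have [h1 h2] := Hd k ltac:(by apply/andP; split; lra).
  by split.
have kt s k : 0 <= s < 1 -> 0 <= k <= k0 -> k < t s ^+ 2.
  move=> hs /andP[k1 k2]; apply: le_lt_trans k2 _; apply: lt_le_trans k0t _.
  by rewrite ler_sqr ?nnegrE ?t_ge// ltW// t_gt0.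
have dc s : 0 <= s < 1 -> is_derive s (1 : R) c ('D_1 c s) /\
    gq L H (c s) ('D_1 c s) <= 0 /\ tcoord w / 2 <= tcoord ('D_1 c s).
  move=> /andP[h1 h2]; have hs : 0 <= s <= s by rewrite h1 lexx.
  have [d1 _ d2 d3] := lift_line EC b_gt0 HB1 s1 nw (lc s h2) hs.
  move: d3; rewrite !mul1r; split => //; split => //.
  by apply: le_trans d2 _; rewrite oppr_le0 divr_ge0// sqr_ge0.
pose v k s := mk (t s / Num.sqrt (t s ^+ 2 - k) * tcoord ('D_1 c s)) (rsubmx ('D_1 c s)).
have dlam k s : 0 <= s < 1 -> 0 <= k <= k0 ->
    [/\ is_derive s (1 : R) (fun r => lam r k) (v k s),
        gq L H (lam s k) (v k s) <= - (k / (4 * t s ^+ 2) * tcoord ('D_1 c s) ^+ 2) &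
        0 <= tcoord (v k s)].
  move=> hs hk; have [d1 [d2 d3]] := dc s hs; have kts := kt s k hs hk.
  have v0 : 0 <= tcoord ('D_1 c s) by apply: le_trans d3; rewrite divr_ge0// ltW.
  split.
  - apply: is_derive_mk; last exact: is_derive_rsubmx.
    by apply: (is_derive_sqrtB kts); exact: is_derive_tcoord.
  - have /andP[k1 k2] := hk.
    by apply: (delayed_timelike (p := c s)) => //; [exact: t_gt0|rewrite k1].
  - by rewrite tcoord_mk mulr_ge0// divr_ge0 ?sqrtr_ge0// ltW// t_gt0.
have half_lam s k : 0 <= s < 1 -> 0 <= k <= k0 -> half_space (lam s k).
  by move=> hs hk; rewrite /half_space /= tcoord_mk sqrtr_gt0 subr_gt0 kt.
(* In k the curve runs to the past from c(s), so chart time is nonpositive; in s it runs to the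
   future from [lam 0 k], so chart time is at least - 2 l. The slope bound adds 4 l to the spatial
   size l at c(s). *)
have AP s : 0 <= s < 1 -> (forall r, 0 <= r <= s -> forall k, 0 <= k <= k0 -> O (lam r k)) ->
    forall k, 0 <= k <= k0 -> `|psi (lam s k)| <= 5 * l /\ tcoord (psi (lam s k)) <= 0.
  move=> hs HO k hk; have /andP[s0 s1'] := hs; have /andP[k1 k2] := hk.
  have Tv : tcurve L H O (-1) (lam s) (fun r => mk (- (2 * Num.sqrt (t s ^+ 2 - r))^-1) 0) 0 k.
    move=> r /andP[r0 rk]; have hr : 0 <= r <= k0 by rewrite r0 (le_trans rk).
    split.
    - apply: (is_derive_mk (f := fun r => Num.sqrt (t s ^+ 2 - r)) (g := fun=> rsubmx (c s))).
        by apply: is_derive_sqrtBk; apply: kt.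
    - by apply: HO => //; rewrite s0 lexx.
    - rewrite /gq !txE big1 ?addr0; first by rewrite oppr_le0 sqr_ge0.
      move=> i _; have -> : theta L (lam s r) (mk (- (2 * Num.sqrt (t s ^+ 2 - r))^-1) 0) = 0.
        by rewrite /theta !txE -(scale0r 0) bracketZr !scale0r scaler0 subr0.
      by rewrite mxE expr0n mulr0.
    - by rewrite tcoord_mk mulN1r opprK invr_ge0 mulr_ge0// sqrtr_ge0.
  have Ts : tcurve L H O 1 (fun r => lam r k) (v k) 0 s.
    move=> r /andP[r0 rs]; have hr : 0 <= r < 1 by rewrite r0 (le_lt_trans rs).
    have [d1 d2 d3] := dlam k r hr hk; split => //; last by rewrite mul1r.
      by apply: HO => //; rewrite r0.
    apply: le_trans d2 _; rewrite oppr_le0 mulr_ge0 ?sqr_ge0// divr_ge0// mulr_ge0 ?sqr_ge0//.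
  have [_ a1 a2] := tcurve_mono EC sN1 k1 Tv.
  have [_ b1 _] := tcurve_mono EC s1 s0 Ts.
  have lam0 : lam s 0 = c s.
    by rewrite /lam subr0 sqrtr_sqr gtr0_norm ?t_gt0// mk_eta.
  have pc : psi (c s) = - (1 - s) *: w.
    rewrite (liftE (lc s s1')) ?s0 ?lexx// AE.
    by rewrite scaleNr scalerBl scale1r opprB addrC.
  rewrite lam0 pc !tcoordZ in a1 a2; rewrite !mul1r in b1; rewrite !mulN1r lerN2 in a1.
  have q1 : 0 <= 1 - s by lra.
  have q2 : 1 - s <= 1 by lra.
  have wl : tcoord w <= l by apply: le_trans (norm_tcoord w); exact: ler_norm.
  have q3 : (1 - s) * tcoord w <= l.
    by apply: le_trans wl; rewrite ler_piMl// ltW.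
  have q4 : 0 <= (1 - s) * tcoord w by rewrite mulr_ge0// ltW.
  have [_ h0] := Hk0 k hk.
  have h1 : - (2 * l) <= tcoord (psi (lam 0 k)).
    have : `|psi (lam 0 k)| <= 2 * l.
      rewrite -[psi _](subrK A) (le_trans (ler_normD _ _))//.
      by rewrite (_ : 2 * l = l + l) ?lerD ?(ltW h0)// ?AE ?normrN//; ring.
    move=> /(le_trans (norm_tcoord _)); rewrite ler_norml => /andP[h _]; lra.
  split; last by apply: le_trans a1 _; rewrite mulNr oppr_le0.
  apply/norm_leP; first by rewrite mulr_ge0// ltW.
  split; first by rewrite ler_norml; apply/andP; split; move: a1 b1; rewrite mulNr; lra.
  move=> i; have := a2 i; rewrite !mulN1r => a3.
  have q5 : `|rsubmx (- (1 - s) *: w) 0 i| <= l.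
    rewrite rsubmxZ mxE normrM normrN (ger0_norm q1).
    apply: (@le_trans _ _ (1 * l)); last by rewrite mul1r.
    apply: ler_pM => //; apply: le_trans (norm_rsubmx w).
    exact: (rV_normP _ (normr_ge0 _)).1.
  rewrite -[rsubmx _ 0 i](subrK (rsubmx (- (1 - s) *: w) 0 i)).
  apply: le_trans (ler_normD _ _) _.
  move: a1 b1 a3 q5; rewrite mulNr; lra.
have l5 : 5 * l < dl by move: wdl; rewrite -/l; lra.
(* Bootstrap: [tube] extends the interval, and [AP] with [cls_ball] closes it because 5 l < dl. *)
have stay s2 : s2 < 1 -> forall s, 0 <= s <= s2 -> forall k, 0 <= k <= k0 -> O (lam s k).
  move=> s21.
  have clam s k : 0 <= s < 1 -> 0 <= k <= k0 ->
      {for (s, k), continuous (fun z : R * R => lam z.1 z.2)}.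
    move=> hs hk; apply: mk_cts.
      apply: (@continuous_comp _ _ _ (fun z : R * R => t z.1 ^+ 2 - z.2) Num.sqrt).
        have ct : {for (s, k), continuous (fun z : R * R => t z.1 ^+ 2)}.
          have [d1 _] := dc s hs.
          have d2 := is_derive_tcoord d1.
          have kt1 : {for s, continuous (fun s => t s ^+ 2)}.
            apply: (@continuous_comp _ _ _ t (fun x => x ^+ 2)).
              exact: is_derive_continuous d2.
            exact: exprn_continuous.
          exact: (@continuous_comp (R * R)%type R R fst (fun s => t s ^+ 2) (s, k) cvg_fst kt1).
        have cs : {for (s, k), continuous (fun z : R * R => z.2)} by exact: cvg_snd.
        exact: continuousB ct cs.
      exact: sqrt_continuous.
    apply: (@continuous_comp (R * R)%type R 'rV[R]_n fst (fun s => rsubmx (c s))).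
      exact: cvg_fst.
    have [d1 _] := dc s hs; apply: (@continuous_comp _ _ _ c rsubmx).
      exact: is_derive_continuous d1.
    exact: rsubmx_cts.
  apply: real_induction.
  - by move=> k /Hk0[].
  - move=> s /andP[s0 ss2] HO.
    have hs : 0 <= s < 1 by rewrite s0 (lt_trans ss2).
    have n1 := @tube R _ lam O 0 k0 s (ec_open EC) (fun k hk => @clam s k hs hk)
      (fun k hk => HO s ltac:(by rewrite s0 lexx) k hk).
    have [e e0 He] := right_near n1.
    exists e => // r /andP[sr re] rs2 k hk; apply: He => //.
    by rewrite re andbT (lt_trans _ sr)// ltrBlDr ltrDl.
  - move=> s /andP[s0 ss2] HO k hk.
    have hs : 0 <= s < 1 by rewrite (ltW s0) (le_lt_trans ss2).
    suff [] : O (lam s k) /\ `|psi (lam s k)| <= 5 * l by [].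
    apply: (cls_ball EC) => //; first exact: half_lam.
    move=> e e0.
    have [d1 _ _] := dlam k s hs hk.
    have cl := is_derive_continuous d1.
    have [r /andP[r0 rs] Hr] := left_near (near_dist cl e0) s0.
    have h1 : `|lam r k - lam s k| < e by apply: Hr; rewrite lexx ltW.
    have hr : 0 <= r < 1 by rewrite (ltW r0) (lt_trans rs)// (le_lt_trans ss2).
    exists (lam r k); split => //.
      by apply: HO => //; rewrite rs ltW.
    have [] // := AP r hr _ k hk.
    move=> r' /andP[r'0 r'r] k' hk'; apply: HO => //.
    by rewrite r'0 (le_lt_trans r'r).
(* If y is the chart time, the cone condition gives - 5/4 y'^2 <= gq <= - k0 / (4 t^2) t'^2, hence
   y' >= a t' / t with room to spare. *)
pose a := Num.sqrt (k0 / 8).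
have a0 : 0 < a by rewrite sqrtr_gt0 divr_gt0.
(* The value of t at which a times the increase of ln t exhausts the room 3 l for chart time. *)
pose M := tcoord p0 * expR (3 * l / a).
have [s hs nts] := Hc (tcoord p0) M t00; apply: nts.
rewrite t_ge//=.
have /andP[s0 s1'] := hs.
have hk0 : 0 <= k0 <= k0 by rewrite lexx ltW.
have HO r : 0 <= r <= s -> forall k, 0 <= k <= k0 -> O (lam r k) by exact: stay.
have bt r : 0 <= r <= s -> 0 <= r < 1.
  by move=> /andP[h1 h2]; rewrite h1 (le_lt_trans h2).
have D r : 0 <= r <= s -> is_derive r (1 : R) (fun r => tcoord (psi (lam r k0)) - a * ln (t r))
   (tcoord ('d psi (lam r k0) (v k0 r)) - a * ((t r)^-1 * tcoord ('D_1 c r))).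
  move=> hr; have [d1 _ _] := dlam k0 r (bt r hr) hk0.
  have Or := HO r hr k0 hk0.
  apply: (is_deriveB (f := fun r => tcoord (psi (lam r k0))) (g := fun r => a * ln (t r))).
    exact: is_derive_tcoord (is_derive_diff d1 (ec_diff EC Or)).
  apply: (is_deriveZ (f := fun r => ln (t r))).
  apply: (is_derive1_comp (f := @ln R) (g := t)).
    by apply: is_derive1_ln; exact: t_gt0 (bt r hr).
  by have [d2 _] := dc r (bt r hr); exact: is_derive_tcoord.
have P r : 0 <= r <= s -> 0 <= tcoord ('d psi (lam r k0) (v k0 r)) -
    a * ((t r)^-1 * tcoord ('D_1 c r)).
  move=> hr; have hr1 := bt r hr; have [d1 d2 d3] := dlam k0 r hr1 hk0.
  have Or := HO r hr k0 hk0; have tr := t_gt0 r hr1.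
  have g0 : gq L H (lam r k0) (v k0 r) <= 0.
    by apply: le_trans d2 _; rewrite oppr_le0 mulr_ge0 ?sqr_ge0// divr_ge0 ?ltW// mulr_gt0// exprn_gt0.
  have f0 := future_chart EC Or g0 d3.
  have [_ [_ d4]] := dc r hr1.
  have v0 : 0 <= tcoord ('D_1 c r) by apply: le_trans d4; rewrite divr_ge0// ltW.
  rewrite subr_ge0 -ler_sqr ?nnegrE//; last first.
    by rewrite mulr_ge0 ?(ltW a0)// mulr_ge0// invr_ge0 ltW.
  have := ec_cone EC Or (v k0 r); rewrite ler_norml /eucl => /andP[h1 _].
  have spg := sp_ge0 ('d psi (lam r k0) (v k0 r)).
  have -> : (a * ((t r)^-1 * tcoord ('D_1 c r))) ^+ 2 =
      k0 / (4 * t r ^+ 2) * tcoord ('D_1 c r) ^+ 2 / 2.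
    rewrite !exprMn sqr_sqrtr; last by rewrite divr_ge0// ltW.
    by field; rewrite gt_eqF.
  have := sqr_ge0 (tcoord ('d psi (lam r k0) (v k0 r))).
  move: d2 h1 spg; lra.
have Mon : tcoord (psi (lam 0 k0)) - a * ln (t 0) <= tcoord (psi (lam s k0)) - a * ln (t s).
  exact: (@mono_derive _ (fun r => tcoord (psi (lam r k0)) - a * ln (t r)) _ 0 s s0 D P).
have [_ e1] := AP s hs HO k0 hk0.
have [e2 _] := AP 0 (ltac:(by rewrite lexx ltr01)) (fun r hr => HO r (ltac:(by move: hr => /andP[-> /le_trans ->]))) k0 hk0.
have e3 : - (3 * l) <= tcoord (psi (lam 0 k0)).
  have [_ h0] := Hk0 k0 hk0.
  have : `|psi (lam 0 k0)| <= 2 * l.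
    rewrite -[psi _](subrK A) (le_trans (ler_normD _ _))//.
    by rewrite (_ : 2 * l = l + l) ?lerD ?(ltW h0)// ?AE ?normrN//; ring.
  move=> /(le_trans (norm_tcoord _)); rewrite ler_norml => /andP[h _]; lra.
have e4 : a * (ln (t s) - ln (t 0)) <= 3 * l by rewrite mulrBr; lra.
have e5 : ln (t s) <= ln M.
  rewrite /M lnM ?posrE ?expR_gt0// expRK -lerBlDl.
  have -> : tcoord p0 = t 0 by rewrite /t c0.
  by rewrite ler_pdivlMr// mulrC.
by rewrite -ler_ln ?posrE ?t_gt0// mulr_gt0// expR_gt0.
Qed.

End Future.

(** * Recentring a chart *)

Section Shift.
Variables (R : realType) (n : nat) (L : two_step R n).
Variables (Gam : discrete_subgroup L) (H : 'I_n -> R -> R).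
Local Notation V := 'rV[R]_(1 + n).
Implicit Types (p q v w y : V) (s r t a b : R).
Variables (O : set V) (psi : V -> V) (dl : R).
Hypothesis EC : ext_chart Gam H O psi dl 4^-1.

Lemma diff_shift q p : O p -> differentiable (fun r : V => psi r - q) p /\
  forall v, 'd (fun r : V => psi r - q) p v = 'd psi p v.
Proof.
move=> Op; have d1 := ec_diff EC Op.
have d2 : differentiable (cst q : V -> V) p by exact: differentiable_cst.
have D1 : differentiable (fun r : V => psi r - q) p by exact: (differentiableB d1 d2).
split; first exact: D1.
move=> v.
have E1 := deriveE v d1.
have E2 := deriveE v D1.
apply: etrans (esym E2) _.
apply: etrans E1.
have d3 : is_derive p v (cst q : V -> V) 0 by exact: is_derive_cst.
have d4 : is_derive p v psi ('D_v psi p).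
  by apply: DeriveDef => //; exact: diff_derivable.
have [_ E3] := is_deriveB d4 d3.
by apply: etrans E3 _; exact: subr0.
Qed.

(** After recentring it is enough to treat a missing point at the origin. *)
Lemma ext_shift q : `|q| < dl ->
  ext_chart Gam H (O `&` [set p | `|psi p - q| < dl - `|q|])
    (fun p => psi p - q) (dl - `|q|) 4^-1.
Proof.
move=> qd; split.
- rewrite openE => p [Op /= Hp].
  have cp : {for p, continuous (fun r : V => `|psi r - q|)}.
    apply: (@continuous_comp _ _ _ (fun r : V => psi r - q) Num.norm).
      by apply: differentiable_continuous; have [] := diff_shift q Op.
    exact: norm_continuous.
  have n1 : \forall r \near p, O (r : V) by exact: (near_O EC).
  have n2 : \forall r \near p, `|psi (r : V) - q| < dl - `|q|.
    by apply: (cvgr_lt _ cp).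
  by apply: filterS2 n1 n2 => r; split.
- by move=> p [Op _]; exact: (ec_half EC Op).
- by move=> p [Op _]; have [] := diff_shift q Op.
- move=> p [Op _] v; have [_ ->] := diff_shift q Op.
  exact: (ec_inj EC Op).
- by move=> p [].
- move=> p [Op _] v; have [_ ->] := diff_shift q Op; exact: (ec_cone EC Op).
- move=> p W [Op /= Hp] nW.
  have := ec_opn EC Op nW.
  move=> /nbhs_ballP[/= e e0 He].
  apply/nbhs_ballP; exists (Num.min e (dl - `|q| - `|psi p - q|)).
    by rewrite /= lt_min e0 subr_gt0.
  move=> y; rewrite -ball_normE /ball_ /= lt_min => /andP[y1 y2].
  have [|p' [Wp' Op'] Ep'] := He (y + q).
    rewrite -ball_normE /ball_ /=.
    by rewrite (_ : psi p - (y + q) = psi p - q - y)// opprD addrA addrAC.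
  exists p'; last by rewrite Ep' addrK.
  do 2!split => //; rewrite /= Ep' addrK.
  rewrite -[y](subKr (psi p - q)) (le_lt_trans (ler_normB _ _))//.
  by rewrite -ltrBrDl.
- move=> p y hp yd Hq.
  have yqd : `|y + q| < dl by rewrite (le_lt_trans (ler_normD _ _))// -ltrBrDr.
  have [] := ec_cls EC hp yqd.
    move=> e /Hq[r [[Or _] r1 r2]]; exists r; split => //.
    by rewrite (_ : psi r - (y + q) = psi r - q - y)// opprD addrA addrAC.
  by move=> Op E; rewrite E addrK; do 2!split => //=; rewrite E addrK.
- move=> p p' [Op _] [Op' _] /addIr E; exact: (ec_deck EC Op Op' E).
- move=> g p Gg [Op Hp]; have [Og Eg] := ec_inv EC Gg Op.
  by rewrite Eg; do 2!split => //=; rewrite Eg.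
- move=> p [Op _]; have [_ ->] := diff_shift q Op; exact: (ec_sig EC Op).
Qed.

End Shift.

(** The image is open, so only a first missing point of the segment matters. Recentred there, the
    last piece of the segment, shortened to 1 / K of the radius, is a ray that ends at 0, and the
    hypothesis on such rays applies. *)
Lemma chart_image_line (R : realType) (n : nat) (L : two_step R n) (Gam : discrete_subgroup L)
    (H : 'I_n -> R -> R) (O : set 'rV[R]_(1 + n)) (psi : 'rV[R]_(1 + n) -> 'rV[R]_(1 + n)) (dl e K : R) A w :
  ext_chart Gam H O psi dl 4^-1 -> 1 < K ->
  (forall q v, `|q| < dl -> narrow e v -> `|v| <= (dl - `|q|) / K ->
    (forall r, 0 <= r < 1 ->
      chart_image (O `&` [set p | `|psi p - q| < dl - `|q|]) (fun p => psi p - q) (- v + r *: v)) ->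
    chart_image (O `&` [set p | `|psi p - q| < dl - `|q|]) (fun p => psi p - q) 0) ->
  chart_image O psi A -> narrow e w -> `|A + w| < dl -> chart_image O psi (A + w).
Proof.
move=> EC K1 Hend UA nw Awd; have Ad := chart_image_bd EC UA.
have sd (s : R) : 0 <= s <= 1 -> `|A + s *: w| < dl.
  by move=> hs; have := ball_convex hs Ad Awd; rewrite addrAC subrr add0r.
suff : forall s : R, 0 <= s <= 1 -> chart_image O psi (A + s *: w).
  by move=> /(_ 1); rewrite scale1r; apply; rewrite ler01 lexx.
apply: real_induction; first by rewrite scale0r addr0.
  move=> s /andP[s0 s1] Hs; have Us := Hs s ltac:(by rewrite s0 lexx).
  have n1 : \forall r \near s, chart_image O psi (A + r *: w).
    apply: (@near_open _ 'rV[R]_(1 + n) (fun r => A + r *: w)).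
    - exact: chart_image_open EC.
    - exact: Us.
    - exact: line_cts.
  have [c c0 Hc] := right_near n1.
  exists c => // r /andP[sr re] _; apply: Hc.
  by rewrite re andbT (lt_trans _ sr)// ltrBlDr ltrDl.
move=> s /andP[s0 s1] Hs.
pose q := A + s *: w; have qd : `|q| < dl by apply: sd; rewrite ltW.
pose dl' := dl - `|q|; have dl'0 : 0 < dl' by rewrite subr_gt0.
have w0 : 0 < `|w|.
  apply: lt_le_trans (norm_tcoord w); rewrite normr_gt0.
  by apply/eqP => t0; case: nw; rewrite t0 mulr0 ltxx.
have K0 : 0 < K by exact: lt_trans K1.
pose d := Num.min s (dl' / K / `|w|).
have d0 : 0 < d by rewrite lt_min s0 !divr_gt0.
have ds : d <= s by rewrite /d ge_min lexx.
have dw : `|d *: w| <= dl' / K.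
  by rewrite normrZ gtr0_norm// -ler_pdivlMr// /d ge_min lexx orbT.
have dw1 : `|d *: w| < dl' by apply: le_lt_trans dw _; rewrite ltr_pdivrMr// ltr_pMr.
have eq1 (r : R) : A + (s - d + r * d) *: w - q = - (d *: w) + r *: (d *: w).
  rewrite /q opprD addrACA subrr add0r -scalerBl scalerA -scaleNr -scalerDl.
  by congr (_ *: _); ring.
have [p [Op _] /eqP] : chart_image (O `&` [set p | `|psi p - q| < dl - `|q|]) (fun p => psi p - q) 0.
  apply: (Hend q (d *: w) qd (narrow_scale d0 nw) dw) => r hr; have /andP[r0 r1] := hr.
  have [p Op Ep] : chart_image O psi (A + (s - d + r * d) *: w).
    apply: Hs; have h1 : 0 <= r * d by rewrite mulr_ge0// ltW.
    have h2 : r * d < d by rewrite gtr_pMl.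
    by apply/andP; split; lra.
  exists p; last by rewrite Ep eq1.
  split => //=; rewrite Ep eq1 -scaleN1r -scalerDl normrZ.
  apply: le_lt_trans dw1; rewrite ler_piMl//.
  by rewrite ler_norml; apply/andP; split; lra.
by rewrite subr_eq0 => /eqP Ep; exists p.
Qed.

(** * Stability of the chart image under narrow future displacements *)

Section FutureClosed.
Variables (R : realType) (n : nat) (L : two_step R n).
Variables (Gam : discrete_subgroup L) (H : 'I_n -> R -> R).
Local Notation V := 'rV[R]_(1 + n).
Implicit Types (p q v w y : V) (s r t a b : R).
Variables (O : set V) (psi : V -> V) (dl : R).
Hypothesis EC : ext_chart Gam H O psi dl 4^-1.
Variables (Bf bf : R -> R).
Hypothesis dB : forall t, 0 < t -> is_derive t (1 : R) Bf (bf t).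
Hypothesis b_gt0 : forall t, 0 < t -> 0 < bf t.
Hypothesis HB1 : forall t i, 0 < t -> 1 <= H i t * bf t ^+ 2.
Hypothesis B_bd : forall tau, exists M, forall t, 0 < t <= tau -> `|Bf t| <= M.
Hypothesis Hexp : forall i k T, 0 < k -> k <= T ->
  H i k <= H i T * (1 + 3 / 4 * ((T / k) ^+ 2 - 1)).
Local Notation U := (chart_image O psi).

Lemma chart_image_future A w : U A -> narrow 1 w -> `|A + w| < dl -> U (A + w).
Proof.
apply: (chart_image_line (K := 20) EC) => [|q v qd nv vd UE]; first by rewrite ltr1n.
have [p0 Op0 Ep0] := UE 0 ltac:(by rewrite lexx ltr01).
rewrite scale0r addr0 in Ep0; apply: contrapT => nU.
exact: (future_end (ext_shift EC qd) dB b_gt0 HB1 B_bd Hexp nv (addNr v) vd UE nU Op0 Ep0).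
Qed.

(** The segment lifted from p need not end at q, but it ends in the orbit of q, and t does not
    distinguish the two. *)
Lemma tcoord_future p q : O p -> O q -> narrow 1 (psi q - psi p) ->
  tcoord p + tcoord (psi q - psi p) / 2 <= tcoord q.
Proof.
move=> Op Oq nw; set w := psi q - psi p in nw *.
have s1 : sgn (1 : R) by left.
have HU s : 0 <= s <= 1 -> U (psi p + s *: w).
  move=> /andP[s0 s1']; have [->|sn0] := eqVneq s 0.
    by rewrite scale0r addr0; exists p.
  have sp0 : 0 < s by rewrite lt_neqAle eq_sym sn0.
  apply: chart_image_future; [by exists p|exact: narrow_scale|].
  by apply: ball_convex; [rewrite s0|exact: (ec_bd EC)|exact: (ec_bd EC)].
have [c [c0 lc Hc]] := leg EC b_gt0 HB1 s1 nw HU Op erefl.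
rewrite !mul1r in Hc; apply: le_trans Hc _.
have H1 : 0 <= (1 : R) <= 1 by rewrite ler01 lexx.
have [_ Oc _] := lc 1 H1.
rewrite (tcoord_wd EC Oc Oq)// (liftE lc H1) scale1r /w.
by rewrite addrC subrK.
Qed.

(** Slices of t are thus achronal for the narrow cones, which makes them Lipschitz graphs. *)
Lemma tcoord_future_lt p q : O p -> O q -> narrow 1 (psi q - psi p) ->
  tcoord p < tcoord q.
Proof.
move=> Op Oq nw; apply: lt_le_trans (tcoord_future Op Oq nw).
by rewrite ltrDl divr_gt0//; case: nw; rewrite mul1r.
Qed.

Lemma sp_le (w : V) a : (forall i, `|rsubmx w 0 i| <= a) -> 0 <= a ->
  sp w <= (n.+1%:R * a) ^+ 2.
Proof.
move=> wa a0; apply: (@le_trans _ _ (\sum_(i < n) a ^+ 2)).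
  apply: ler_sum => i _; rewrite -[X in X <= _]real_normK ?num_real//.
  by rewrite ler_sqr ?nnegrE.
rewrite sumr_const card_ord exprMn -[_ *+ n]mulr_natl ler_wpM2r ?sqr_ge0//.
by rewrite -natrX ler_nat (leq_trans (leqnSn n))// leq_pmulr.
Qed.

(** The factor 2 (n + 1) turns a bound on each coordinate into slope at most 1/2. *)
Lemma narrow_box e (w : V) a : sgn e -> (forall i, `|rsubmx w 0 i| <= a) -> 0 <= a ->
  0 < e * tcoord w -> 2 * n.+1%:R * a <= e * tcoord w -> narrow e w.
Proof.
move=> se wa a0 w0 ha; split => //; apply: le_trans (sp_le wa a0) _.
have -> : tcoord w ^+ 2 = (e * tcoord w) ^+ 2 by rewrite exprMn (sgn_sqr se) mul1r.
have -> : (e * tcoord w) ^+ 2 / 4 = (e * tcoord w / 2) ^+ 2 by field.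
have w1 := ltW w0; have w2 : 0 <= e * tcoord w / 2 by rewrite divr_ge0.
rewrite ler_sqr ?nnegrE ?(mulr_ge0 (ler0n _ _) a0)//.
by rewrite ler_pdivlMr// mulrC mulrA.
Qed.

Lemma narrow_vert e k : sgn e -> 0 < e * k -> narrow e (mk k 0 : V).
Proof.
move=> se k0; apply: (@narrow_box e _ 0) => //; rewrite ?txE ?mulr0 ?(ltW k0)//.
by move=> i; rewrite mxE normr0.
Qed.

End FutureClosed.

Section Projections.
Variables (R : realType) (T : topologicalType) (f : R -> T).

Lemma cts_fst (s a : R) : {for s, continuous f} ->
  {for (s, a), continuous (fun y : R * R => f y.1)}.
Proof. by move=> cf; exact: (@continuous_comp (R * R)%type R T fst f (s, a) cvg_fst cf). Qed.

Lemma cts_snd (s a : R) : {for a, continuous f} ->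
  {for (s, a), continuous (fun y : R * R => f y.2)}.
Proof. by move=> cf; exact: (@continuous_comp (R * R)%type R T snd f (s, a) cvg_snd cf). Qed.

End Projections.

(** * Coordinates adapted to the slices of t *)

Section SliceMap.
Variables (R : realType) (n : nat) (L : two_step R n).
Variables (Gam : discrete_subgroup L) (H : 'I_n -> R -> R).
Local Notation V := 'rV[R]_(1 + n).
Implicit Types (p q v w y : V) (s r t a b : R).
Variables (O : set V) (psi : V -> V) (dl : R).
Hypothesis EC : ext_chart Gam H O psi dl 4^-1.

Lemma mk00 : mk 0 0 = 0 :> V.
Proof. by rewrite -[RHS]mk_eta tcoord0 linear0. Qed.

(** Time t is kept together with the spatial chart coordinates. A slice is only a Lipschitz graph in
    the chart, but in these coordinates it is flat, so that curves in it can be differentiated. *)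
Let Psi p := mk (tcoord p) (rsubmx (psi p)).

Lemma linear_diff m k (f : 'rV[R]_m -> 'rV[R]_k) x : linear f -> differentiable f x.
Proof.
move=> lf; pose K : {linear 'rV[R]_m -> 'rV[R]_k} :=
  HB.pack f (GRing.isLinear.Build R _ _ _ f lf).
have KE : f = K by [].
by rewrite KE; apply: linear_differentiable; rewrite -KE; exact: cts_linear.
Qed.

Lemma slice_diff p : O p -> differentiable Psi p /\
  forall v, 'd Psi p v = mk (tcoord v) (rsubmx ('d psi p v)).
Proof.
move=> Op; have dp := ec_diff EC Op.
pose f1 (p : V) : V := mk (tcoord p) 0; pose f2 (p : V) : V := mk 0 (rsubmx p).
have l1 : linear f1 by move=> a u v; rewrite /f1 !txE mkZ mkD scaler0 addr0.
have l2 : linear f2 by move=> a u v; rewrite /f2 !txE mkZ mkD mulr0 addr0.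
have D : differentiable Psi p.
  have -> : Psi = f1 + (f2 \o psi).
    by apply/funext => q; rewrite /Psi -[RHS]/(f1 q + f2 (psi q)) /f1 /f2 mkD addr0 add0r.
  apply: differentiableD; first exact: linear_diff.
  by apply: differentiable_comp => //; exact: linear_diff.
split=> // v.
suff Hq : forall q, q = p + 0 *: v -> differentiable Psi q -> differentiable psi q ->
    'd Psi q v = mk (tcoord v) (rsubmx ('d psi q v)).
  by apply: Hq => //; rewrite scale0r addr0.
move=> q -> D' dp'; have dc := line_derive p v 0.
have [_ d1] := is_derive_diff dc D'.
have [_ d2] := is_derive_mk (is_derive_tcoord dc) (is_derive_rsubmx (is_derive_diff dc dp')).
exact: etrans (esym d1) d2.
Qed.

Hypothesis Hpos : forall i t, 0 < t -> 0 < H i t.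

(** A kernel vector is tangent to a slice, so gq is nonnegative on it; its chart image is vertical,
    where the cone condition gives gq <= - 3/4 t^2. *)
Lemma slice_inj p v : O p -> 'd Psi p v = 0 -> v = 0.
Proof.
move=> Op; have [_ ->] := slice_diff Op => E.
have t0 : tcoord v = 0 by have := congr1 (@tcoord R n) E; rewrite !txE.
have r0 : rsubmx ('d psi p v) = 0 by have := congr1 rsubmx E; rewrite rsubmx_mk => ->; rewrite linear0.
have s0 : sp ('d psi p v) = 0 by rewrite /sp big1// => i _; rewrite r0 mxE expr0n.
have g0 : 0 <= gq L H p v.
  rewrite /gq t0 expr0n oppr0 add0r; apply: sumr_ge0 => i _.
  by rewrite mulr_ge0 ?sqr_ge0// ltW// Hpos//; exact: (ec_half EC Op).
have := ec_cone EC Op v; rewrite /eucl s0 !addr0 ler_norml => /andP[_ h].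
apply: (ec_inj EC Op); rewrite -[LHS]mk_eta r0.
suff -> : tcoord ('d psi p v) = 0 by exact: mk00.
apply/eqP; rewrite -sqrf_eq0 eq_le sqr_ge0 andbT; move: h g0.
have := sqr_ge0 (tcoord ('d psi p v)); lra.
Qed.

End SliceMap.

Lemma half_le8 (R : realFieldType) (l : R) : 0 < l -> l / 2 <= 8 * l.
Proof. by move=> ?; lra. Qed.

Lemma norm_low (R : realFieldType) (l x : R) : 0 < l -> x <= 5 / 4 * l -> - (2 * l) < x -> `|x| <= 8 * l.
Proof. by move=> *; rewrite ler_norml; apply/andP; split; lra. Qed.

Lemma norm_between (R : realFieldType) (l a x b : R) : 0 < l -> a <= x -> x <= b ->
  b <= - (l / 4) -> - (2 * l) <= a -> `|x| <= 12 * l.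
Proof. by move=> *; rewrite ler_norml; apply/andP; split; lra. Qed.

Lemma sum_between (R : realFieldType) (l a x b y z : R) : 0 < l -> y <= 2 * (x - a) -> z <= 7 * l ->
  x <= b -> b <= - (l / 4) -> - (2 * l) <= a -> y + z <= 12 * l.
Proof. by move=> *; lra. Qed.

(** * Past end points: slices as graphs and translates of the descent *)

Section Past.
Variables (R : realType) (n : nat) (L : two_step R n).
Variables (Gam : discrete_subgroup L) (H : 'I_n -> R -> R).
Local Notation V := 'rV[R]_(1 + n).
Implicit Types (p q v w y : V) (s r t a b : R).
Variables (O : set V) (psi : V -> V) (dl : R).
Hypothesis EC : ext_chart Gam H O psi dl 4^-1.
Variables (Bf bf : R -> R).
Hypothesis dB : forall t, 0 < t -> is_derive t (1 : R) Bf (bf t).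
Hypothesis b_gt0 : forall t, 0 < t -> 0 < bf t.
Hypothesis HB1 : forall t i, 0 < t -> 1 <= H i t * bf t ^+ 2.
Hypothesis B_bd : forall tau, exists M, forall t, 0 < t <= tau -> `|Bf t| <= M.
Hypothesis Hexp : forall i k T, 0 < k -> k <= T ->
  H i k <= H i T * (1 + 3 / 4 * ((T / k) ^+ 2 - 1)).
Variable i1 : 'I_n.
Hypothesis br1 : forall x y : 'rV[R]_n, bracket L x y 0 i1 = 0.
Hypothesis Hinf : forall M, exists2 T0, 0 < T0 & forall t, 0 < t < T0 -> M < H i1 t.
Local Notation U := (chart_image O psi).
Local Notation TF := (tcoord_future EC dB b_gt0 HB1 B_bd Hexp).
Local Notation TFlt := (tcoord_future_lt EC dB b_gt0 HB1 B_bd Hexp).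
Local Notation UF := (chart_image_future EC dB b_gt0 HB1 B_bd Hexp).

Lemma ltr_comp (u : 'rV[R]_n) a b p : ltr L (a *: u) (ltr L (b *: u) p) = ltr L ((a + b) *: u) p.
Proof.
rewrite /ltr !txE gmulA; congr (mk _ (gmul L _ _)).
by rewrite /gmul bracketZl bracketZr bracketxx !scaler0 addr0 scalerDl.
Qed.

Lemma ltr_0 (u : 'rV[R]_n) p : ltr L (0 *: u) p = p.
Proof. by rewrite /ltr scale0r gmul0 mk_eta. Qed.

(** A point of a thin future cone of the missing tip is a narrow future displacement of a point of
    the ray close enough to the tip. *)
Lemma cone_U (A w y : V) : narrow (-1) w -> A + w = 0 ->
  (forall s, 0 <= s < 1 -> U (A + s *: w)) ->
  `|y| < dl -> 0 < tcoord y -> sp y <= tcoord y ^+ 2 / 16 -> U y.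
Proof.
move=> [w0 w1] Aw HU yd y0 spy.
rewrite mulN1r in w0; set W := - tcoord w in w0.
(* So near the tip, the displacement loses at most a tenth of the time component of y. *)
pose e := Num.min 1 (tcoord y / (10 * W)).
have e0 : 0 < e by rewrite lt_min ltr01 divr_gt0// mulr_gt0.
have e1 : e <= 1 by rewrite /e ge_min lexx.
have eW : e * W <= tcoord y / 10.
  apply: (@le_trans _ _ (tcoord y / (10 * W) * W)).
    by rewrite ler_wpM2r ?(ltW w0)// /e ge_min lexx orbT.
  by rewrite le_eqVlt; apply/orP; left; apply/eqP; field; rewrite gt_eqF.
have E : y = A + (1 - e) *: w + (y + e *: w).
  have -> : A = - w by apply/eqP; rewrite -addr_eq0 Aw.
  by rewrite scalerBl scale1r addKr addrC addrK.
rewrite E; apply: UF; last by rewrite -E.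
  by apply: HU; lra.
have tE : tcoord (y + e *: w) = tcoord y - e * W by rewrite !txE /W mulrN opprK.
split; first by rewrite tE; lra.
have -> : tcoord (y + e *: w) = tcoord y - e * W by [].
have eW0 : 0 < e * W by rewrite mulr_gt0.
have h1 : sp (y + e *: w) <= 2 * sp y + 2 * (e ^+ 2 * sp w).
  rewrite /sp !mulr_sumr -big_split; apply: ler_sum => i _ /=.
  rewrite rsubmxD rsubmxZ [X in X ^+ 2 <= _]mxE [X in (_ + X) ^+ 2 <= _]mxE -subr_ge0.
  have -> : 2 * rsubmx y 0 i ^+ 2 + 2 * (e ^+ 2 * rsubmx w 0 i ^+ 2) -
    (rsubmx y 0 i + e * rsubmx w 0 i) ^+ 2 = (rsubmx y 0 i - e * rsubmx w 0 i) ^+ 2 by ring.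
  exact: sqr_ge0.
have h2 : e ^+ 2 * sp w <= (e * W) ^+ 2 / 4.
  by rewrite exprMn -(mulrA (e ^+ 2)) ler_wpM2l ?sqr_ge0// /W sqrrN.
apply: le_trans h1 _; set z := e * W in h2 eW eW0 *.
have h3 : z ^+ 2 <= (tcoord y / 10) ^+ 2 by rewrite ler_sqr ?nnegrE ?(ltW eW0)// divr_ge0// ltW.
have h4 : (tcoord y * (9 / 10)) ^+ 2 <= (tcoord y - z) ^+ 2.
  have h5 : 0 <= tcoord y * (9 / 10) by rewrite mulr_ge0// ltW.
  by rewrite ler_sqr ?nnegrE//; lra.
move: h3 h4 h2 spy; rewrite !(exprMn 2 (tcoord y)); have := sqr_ge0 (tcoord y); lra.
Qed.

Section Tip.
Hypothesis vert : forall k, 0 < k < dl -> U (mk k 0).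
Hypothesis U0 : ~ U 0.
Hypothesis dl_gt0 : 0 < dl.
Variables l K N : R.
Hypotheses (NE : N = n.+1%:R) (N1 : 1 <= N) (l0 : 0 < l).
Hypotheses (Kdl : K < dl) (KE : K = 20 * N * l) (Nl : l <= N * l).

Let K20 : 20 * l <= K. Proof. by move: Nl; rewrite KE; lra. Qed.
Let K0 : 0 < K. Proof. by move: K20 l0; lra. Qed.

Lemma mk_lt (k : R) (y : 'rV[R]_n) : `|k| <= K -> (forall i, `|y 0 i| <= 20 * l) ->
  `|mk k y| < dl.
Proof.
move=> kK yl; apply/norm_ltP => //; rewrite tcoord_mk; split.
  exact: le_lt_trans kK _.
move=> i; rewrite rsubmx_mk; apply: le_lt_trans (yl i) _.
exact: le_lt_trans K20 _.
Qed.

(** If the vertical segment from (K, y) to (- K, y) never met the slice of p, t would stay above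
    t(p) along it, so nothing could be missing and (- K, y) would be in the image; then 0, in its
    narrow future, would be too. K = 20 N l makes the displacements between heights K, - K and the
    axis narrow. *)
Lemma slice_exists (p : V) (y : 'rV[R]_n) k : O p -> psi p = mk k 0 -> 0 < k <= l ->
  (forall i, `|y 0 i| < 8 * l) ->
  exists h, exists2 q, O q & psi q = mk h y /\ tcoord q = tcoord p.
Proof.
move=> Op Ep /andP[k0 kl] yl; apply: contrapT => nex.
have yl2 i : `|y 0 i| <= 20 * l by apply: le_trans (ltW (yl i)) _; move: l0; lra.
have s1 : sgn (1 : R) by left.
have sN1 : sgn (-1 : R) by right.
have yl8 i : `|y 0 i| <= 8 * l by exact: ltW.
have l80 : 0 <= 8 * l by rewrite mulr_ge0// ltW.
have nK : narrow 1 (mk K y - mk k 0).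
  apply: (@narrow_box _ _ 1 _ (8 * l)) => //.
  - by move=> i; rewrite !txE subr0.
  - by rewrite mul1r !txE subr_gt0; move: K20 l0; lra.
  - rewrite mul1r !txE; rewrite -NE; move: K20 l0 Nl kl; rewrite KE; lra.
have ltK : `|mk K y| < dl by apply: mk_lt => //; rewrite gtr0_norm.
have [q Oq Eq] : U (mk K y).
  have -> : mk K y = mk k 0 + (mk K y - mk k 0) by rewrite addrC subrK.
  by apply: UF => //; [exists p|rewrite addrC subrK].
have Tq : tcoord p < tcoord q by apply: TFlt => //; rewrite Eq Ep.
pose w : V := mk (- (2 * K)) 0.
have nw : narrow (-1) w.
  by apply: narrow_vert => //; rewrite mulN1r opprK mulr_gt0.
have ptE r : mk K y + r *: w = mk (K - 2 * K * r) y.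
  by rewrite /w mkZ mkD scaler0 addr0 mulrN (mulrC r).
suff : forall r, 0 <= r <= 1 -> exists p', [/\ O p', psi p' = mk K y + r *: w & tcoord p < tcoord p'].
  move=> /(_ 1); rewrite ler01 lexx => /(_ isT)[p' [Op' Ep' _]].
  rewrite ptE mulr1 in Ep'; apply: U0.
  have -> : 0 = psi p' + - psi p' by rewrite addrN.
  apply: UF; [by exists p'| |by rewrite addrN normr0].
  rewrite Ep'; apply: (@narrow_box _ _ 1 _ (8 * l)) => //.
  - by move=> i; rewrite !txE mxE normrN.
  - by rewrite mul1r !txE; move: K0; lra.
  - by rewrite mul1r !txE -NE; move: Nl l0; rewrite KE; lra.
apply: real_induction.
- by exists q; split => //; rewrite scale0r addr0.
- move=> r /andP[r0 r1] Hr; have [p' [Op' Ep' Tp']] := Hr r ltac:(by rewrite r0 lexx).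
  have [e [f [e0 f0 Hf]]] := local_inverse EC Op'.
  have cl : {for r, continuous (fun s : R => mk K y + s *: w)} by exact: line_cts.
  have n1 := near_dist cl e0.
  have n2 : \forall s \near r, tcoord p < tcoord (f (mk K y + s *: w)).
    have cf : {for r, continuous (fun s => tcoord (f (mk K y + s *: w)))}.
      apply: (@continuous_comp _ _ _ (fun s => f (mk K y + s *: w)) (@tcoord R n)); last exact: tcoord_cts.
      apply: (@continuous_comp _ _ _ (fun s => mk K y + s *: w) f) => //.
      by have [] := Hf (mk K y + r *: w); rewrite ?Ep' ?subrr ?normr0.
    by apply: (cvgr_gt _ cf); rewrite -Ep' f0.
  have [d d0 Hd] := right_near (filterI n1 n2).
  exists d => // s /andP[sr sd] _.
  have [h1 h2] := Hd s ltac:(by rewrite sd andbT (lt_trans _ sr)// ltrBlDr ltrDl).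
  exists (f (mk K y + s *: w)); have [] := Hf (mk K y + s *: w); first by rewrite Ep'.
  by move=> ? ? _; split.
- move=> r /andP[r0 r1] Hr.
  have Kd : `|mk K y + r *: w| < dl.
    rewrite ptE; apply: mk_lt => //.
    have h1 : 0 <= K * r by rewrite mulr_ge0// ltW.
    have h2 : K * r <= K by rewrite ler_piMr// ltW.
    by rewrite ler_norml; apply/andP; split; move: h1 h2; rewrite -(mulrA 2); lra.
  have rw0 : narrow (-1) (r *: w) by exact: narrow_scale.
  have HU s : 0 <= s < 1 -> exists p', [/\ O p', psi p' = mk K y + s *: (r *: w) & tcoord p < tcoord p'].
    move=> /andP[s0 s1']; rewrite scalerA; apply: Hr.
    by rewrite mulr_ge0 ?(ltW r0)//= gtr_pMl.
  (* A missing point contradicts [ray], since before it t lies between t(p) > 0 and t(q). *)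
  have [[p' Op' Ep']|nU] := pselect (U (mk K y + r *: w)); last first.
    have HU' s : 0 <= s < 1 -> exists2 p, O p & psi p = mk K y + s *: (r *: w).
      by move=> /HU[p' [? ? _]]; exists p'.
    have [c [c0 lc Hc]] := ray EC dB b_gt0 HB1 B_bd sN1 rw0 Kd HU' nU Oq Eq.
    have [s hs nts] := Hc (tcoord p) (tcoord q) (ec_half EC Op); exfalso; apply: nts.
    have /andP[s0 s1'] := hs.
    have T1 := lift_tcurve EC b_gt0 HB1 sN1 rw0 (lc s s1').
    have [h1 _ _] := tcurve_mono EC sN1 s0 T1.
    rewrite c0 !mulN1r lerN2 in h1; rewrite h1 andbT.
    have [p' [Op' Ep' Tp']] := HU s hs.
    have hs2 : 0 <= s <= s by rewrite s0 lexx.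
    have [_ Oc _] := lc s s1' s hs2.
    by rewrite (tcoord_wd EC Oc Op') ?(ltW Tp')// (liftE (lc s s1') hs2).
  exists p'; split => //; rewrite lt_neqAle; apply/andP; split.
    apply/eqP => Tp'; apply: nex; exists (K - 2 * K * r); exists p' => //.
    by rewrite -ptE.
  rewrite leNgt; apply/negP => Tp'.
  have [e [f [e0 f0 Hf]]] := local_inverse EC Op'.
  have cl : {for r, continuous (fun s : R => mk K y + s *: w)} by exact: line_cts.
  have n1 := near_dist cl e0.
  have n2 : \forall s \near r, tcoord (f (mk K y + s *: w)) < tcoord p.
    have cf : {for r, continuous (fun s => tcoord (f (mk K y + s *: w)))}.
      apply: (@continuous_comp _ _ _ (fun s => f (mk K y + s *: w)) (@tcoord R n)); last exact: tcoord_cts.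
      apply: (@continuous_comp _ _ _ (fun s => mk K y + s *: w) f) => //.
      by have [] := Hf (mk K y + r *: w); rewrite ?Ep' ?subrr ?normr0.
    by apply: (cvgr_lt _ cf); rewrite -Ep' f0.
  have [s /andP[s0 sr] Hs] := left_near (filterI n1 n2) r0.
  have [h1 h2] := Hs s ltac:(by rewrite lexx ltW).
  have [p2 [Op2 Ep2 Tp2]] := Hr s ltac:(by rewrite (ltW s0)).
  have [] := Hf (mk K y + s *: w); first by rewrite Ep'.
  move=> Of Ef _; have := tcoord_wd EC Op2 Of; rewrite Ef => /(_ Ep2) E2.
  by move: Tp2; rewrite E2 => /lt_trans/(_ h2); rewrite ltxx.
Qed.

(** A steeper pair would differ by a narrow vector and be strictly ordered by t. *)
Lemma slice_lip p q : O p -> O q -> tcoord p = tcoord q ->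
  tcoord (psi q - psi p) ^+ 2 <= 4 * sp (psi q - psi p).
Proof.
move=> Op Oq E; rewrite leNgt; apply/negP => Hlt.
set d := tcoord _ in Hlt; have spd : sp (psi q - psi p) <= d ^+ 2 / 4 by lra.
have d0 : d != 0.
  by apply/eqP => d0; move: Hlt; rewrite d0 expr0n /= ltNge mulr_ge0// sp_ge0.
have [dp|dn] := ltP 0 d.
  have /(TFlt Op Oq) : narrow 1 (psi q - psi p) by split; rewrite ?mul1r.
  by rewrite E ltxx.
have dn' : d < 0 by rewrite lt_neqAle d0.
have spN : sp (psi p - psi q) = sp (psi q - psi p).
  by apply: eq_bigr => i _; rewrite -opprB !txE mxE sqrrN -!rsubmxN -rsubmxD.
have tN : tcoord (psi p - psi q) = - d by rewrite -opprB tcoordN.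
have /(TFlt Oq Op) : narrow 1 (psi p - psi q).
  by split; rewrite ?mul1r tN ?oppr_gt0// spN sqrrN.
by rewrite E ltxx.
Qed.

(** Translates of the past-directed descent g to the tip are again causal and past-directed, so
    their chart time is bounded above by its initial value. A lower bound - 2 l is improved to - l
    in [drop], which closes the bootstrap: translates of a fixed size z stay in the chart all the
    way to the tip. *)
Lemma translate_stay (u : 'rV[R]_n) (g : R -> V) :
  (forall b, b < 1 -> lift O psi (fun r => mk l 0 + r *: mk (- l) 0) 0 b g) ->
  exists2 z, 0 < z & forall s, 0 <= s < 1 -> forall a, 0 <= a <= z ->
    O (ltr L (a *: u) (g s)) /\
    (forall i, `|rsubmx (psi (ltr L (a *: u) (g s))) 0 i| <= 7 * l).
Proof.
move=> lg; have s1 : sgn (1 : R) by left.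
have sN1 : sgn (-1 : R) by right.
have nw : narrow (-1) (mk (- l) 0 : V) by apply: narrow_vert => //; rewrite mulN1r opprK.
have Tg s : s < 1 -> tcurve L H O (-1) g (fun s => 'D_1 g s) 0 s.
  by move=> hs; apply: (lift_tcurve EC b_gt0 HB1 sN1 nw (lg s hs)).
have Og s : 0 <= s < 1 -> O (g s).
  by move=> /andP[h1 h2]; have [|_ + _] := lg s h2 s; rewrite ?h1 ?lexx.
have Eg s : 0 <= s < 1 -> psi (g s) = mk ((1 - s) * l) 0.
  move=> /andP[h1 h2]; rewrite (liftE (lg s h2)) ?h1 ?lexx//.
  by rewrite mkZ mkD scaler0 addr0 mulrN mulrBl mul1r.
have h01 : 0 <= (0 : R) < 1 by rewrite lexx ltr01.
have O0 := Og 0 h01; have E0 := Eg 0 h01; rewrite subr0 mul1r in E0.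
set p0 := g 0 in O0 E0.
have K0dl : 0 < K < dl by rewrite K0.
have [qK OqK EqK] := vert K0dl.
pose tau := tcoord qK.
have tp0 : tcoord p0 < tau.
  apply: TFlt => //; rewrite EqK E0.
  have -> : mk K 0 - mk l 0 = mk (K - l) 0 :> V by rewrite -scaleN1r mkZ mkD mulN1r scaler0 addr0.
  by apply: narrow_vert => //; rewrite mul1r; move: K20 l0; lra.
have th0 : 0 < tcoord p0 by exact: (ec_half EC O0).
(* [X0] bounds the translated starting points, [X1] the translated descents, and [X2] the climbs
   that start from these. *)
pose X0 := 1 + `|rsubmx p0| + sc_norm L * `|rsubmx p0|.
have [X1 HX1] := horizon L dB b_gt0 HB1 B_bd tau X0.
have [X2 HX2] := horizon L dB b_gt0 HB1 B_bd tau X1.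
have l4 : 0 < l / 4 by rewrite divr_gt0.
have [z1 z10 Hz1] := ltr_uniform EC (tcoord p0) `|rsubmx p0| u th0 (ec_bd EC O0) l4.
have l8d : 8 * l < dl by apply: le_lt_trans Kdl; apply: le_trans K20; rewrite (ler_pM2r l0) ler_nat.
have [d d0 Hd] := ltr_uniform EC tau X2 u l4 l8d l4.
(* The three terms serve the starting points, the tops of the climbs in [drop], and the bound |a u|
   <= 1 behind [X0]. *)
pose z := Num.min (z1 / 2) (Num.min (d / 2) (`|u| + 1)^-1).
have z0 : 0 < z by rewrite !lt_min !divr_gt0//= invr_gt0 ltr_wpDl.
have zz1 : z < z1.
  by apply: (@le_lt_trans _ _ (z1 / 2)); [rewrite /z ge_min lexx|move: z10; lra].
have zd : z < d.
  by apply: (@le_lt_trans _ _ (d / 2)); [rewrite /z !ge_min lexx orbT|move: d0; lra].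
have zu : z <= (`|u| + 1)^-1 by rewrite /z !ge_min lexx !orbT.
exists z => //.
have S0 a : 0 <= a <= z -> O (ltr L (a *: u) p0) /\
    `|psi (ltr L (a *: u) p0) - mk l 0| < l / 4.
  move=> /andP[a0 az]; rewrite -E0; apply: Hz1 => //; first by split; rewrite ?lexx.
  by rewrite ger0_norm// (le_lt_trans az).
have XX a : 0 <= a <= z -> `|rsubmx (ltr L (a *: u) p0)| <= X0.
  move=> /andP[a0 az]; have au : `|a *: u| <= 1.
    rewrite normrZ ger0_norm//; apply: (@le_trans _ _ ((`|u| + 1)^-1 * (`|u| + 1))).
      by apply: ler_pM => //; [exact: le_trans zu|rewrite lerDl].
    by rewrite mulVf// gt_eqF// ltr_wpDl.
  rewrite /ltr rsubmx_mk /gmul; apply: le_trans (ler_normD _ _) _.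
  apply: lerD; first by apply: le_trans (ler_normD _ _) _; rewrite lerD2r.
  rewrite normrZ; apply: (@le_trans _ _ (`|bracket L (a *: u) (rsubmx p0)|)).
    by rewrite ler_piMl// ger0_norm ?invr_ge0 ?ler0n// invf_le1 ?ltr0n// ler1n.
  apply: le_trans (bracket_norm_le _ _ _) _; rewrite ler_wpM2r//.
  by rewrite ler_piMr// sc_norm_ge0.
pose G a s := ltr L (a *: u) (g s).
have TG a s : 0 <= s < 1 -> (forall r, 0 <= r <= s -> O (G a r)) ->
    tcurve L H O (-1) (G a) (fun r => dltr L (a *: u) ('D_1 g r)) 0 s.
  move=> /andP[s0 s1'] HO r hr; have [k1 _ k2 k3] := Tg s s1' r hr; split.
  - exact: is_derive_ltr.
  - exact: HO.
  - by rewrite gq_ltr.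
  - by rewrite /dltr tcoord_mk.
have tG a s : tcoord (G a s) = tcoord (g s) by rewrite /G /ltr tcoord_mk.
have tle s : 0 <= s < 1 -> 0 < tcoord (g s) <= tau.
  move=> hs; have /andP[s0 s1'] := hs; rewrite (ec_half EC (Og s hs)) /=.
  have [h1 _ _] := tcurve_mono EC sN1 s0 (Tg s s1').
  by rewrite !mulN1r lerN2 in h1; apply: le_trans h1 (ltW tp0).
have AP a s : 0 <= a <= z -> 0 <= s < 1 -> (forall r, 0 <= r <= s -> O (G a r)) ->
    -(2 * l) <= tcoord (psi (G a s)) ->
    tcoord (psi (G a s)) <= 5 / 4 * l /\ forall i, `|rsubmx (psi (G a s)) 0 i| <= 7 * l.
  move=> ha hs HO t2; have /andP[s0 s1'] := hs.
  have [_ h1 h2] := tcurve_mono EC sN1 s0 (TG a s hs HO).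
  have [_ /norm_ltP[//|h3 h4]] := S0 a ha.
  rewrite !mulN1r lerN2 in h1; rewrite !txE ltr_norml in h3; move: h3 => /andP[h3 h3'].
  rewrite -/(G a 0) in h3 h3' h4.
  split; first by move: h1 h3'; lra.
  move=> i; have := h2 i; rewrite !mulN1r => h5; have := h4 i; rewrite !txE subr0 => h6.
  rewrite -[rsubmx (psi (G a s)) 0 i](subrK (rsubmx (psi (G a 0)) 0 i)).
  apply: le_trans (ler_normD _ _) _; move: h5 h6 h1 h3' t2 l0; lra.
(* If a translate had fallen below - l, climb from it vertically to chart time - l / 2. This raises
   t to at least l / 4, so the top lies in a compact region where [ltr_uniform] applies. Undoing the
   translation gradually moves the top by less than l / 4, yet in the end produces a future-directed
   curve from g(s), whose chart time is positive, to a point of chart time at most - l / 4. *)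
have drop s : 0 <= s < 1 -> (forall a r, 0 <= a <= z -> 0 <= r <= s -> O (G a r)) ->
    (forall a, 0 <= a <= z -> -(2 * l) <= tcoord (psi (G a s))) ->
    forall a, 0 <= a <= z -> - l <= tcoord (psi (G a s)).
  move=> hs HO Ht a ha; rewrite leNgt; apply/negP => lt_l.
  have /andP[s0 s1'] := hs; have /andP[a0 az] := ha.
  have ss : 0 <= s <= s by rewrite s0 lexx.
  set e := psi (G a s) in lt_l.
  have Oe : O (G a s) by exact: HO.
  have e2 : -(2 * l) <= tcoord e by exact: Ht.
  have [_ e7] := AP a s ha hs (fun r hr => HO a r ha hr) e2.
  pose k := - (l / 2) - tcoord e.
  have k0 : 0 < k by rewrite /k; move: lt_l l0; lra.
  have nk : narrow 1 (mk k 0 : V) by apply: narrow_vert => //; rewrite mul1r.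
  have mE : e + mk k 0 = mk (- (l / 2)) (rsubmx e).
    by rewrite -{1}[e]mk_eta mkD addr0 /k addrC subrK.
  have md : `|e + mk k 0| < dl.
    rewrite mE; apply: mk_lt.
      rewrite normrN gtr0_norm ?divr_gt0//; move: K20 l0; lra.
    by move=> i; apply: le_trans (e7 i) _; rewrite (ler_pM2r l0) ler_nat.
  have HU r : 0 <= r <= 1 -> U (e + r *: mk k 0).
    move=> hr; have /andP[r0 r1] := hr.
    have [->|rn0] := eqVneq r 0; first by rewrite scale0r addr0; exists (G a s).
    apply: UF; first by exists (G a s).
      by apply: narrow_scale => //; rewrite lt_neqAle eq_sym rn0.
    have -> : r *: mk k 0 = r *: (e + mk k 0 - e) by rewrite addrC addKr.
    by apply: ball_convex => //; exact: (ec_bd EC Oe).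
  have [v [v0 lv Hv]] := leg EC b_gt0 HB1 s1 nk HU Oe erefl.
  have Tv := lift_tcurve EC b_gt0 HB1 s1 nk lv.
  have H1 : 0 <= (1 : R) <= 1 by rewrite ler01 lexx.
  have [_ OM _] := lv 1 H1; have EM := liftE lv H1; rewrite scale1r mE in EM.
  have spr x r : 0 <= x <= r -> 0 <= r - x by move=> /andP[]; rewrite subr_ge0.
  have tM1 : l / 4 <= tcoord (v 1).
    have := ec_half EC Oe; rewrite /half_space /=; move: Hv; rewrite !mul1r tcoord_mk /k.
    by move: lt_l; lra.
  have tM2 : tcoord (v 1) <= tau.
    apply: ltW; apply: TFlt => //; rewrite EqK EM.
    apply: (@narrow_box _ _ 1 _ (7 * l)) => //.
    - by move=> i; rewrite !txE sub0r mxE normrN.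
    - by rewrite mulr_ge0// ltW.
    - by rewrite mul1r !txE; move: K20 l0; lra.
    - by rewrite mul1r !txE -NE; move: Nl l0; rewrite KE; lra.
  have tv r : 0 <= r <= 1 -> 0 < tcoord (v r) <= tau.
    move=> hr; have /andP[r0 r1] := hr; have [_ Ov _] := lv r hr.
    rewrite (ec_half EC Ov) /=; apply: le_trans tM2.
    have [] := tcurve_mono EC s1 r1 (tcurve_sub r0 (lexx _) Tv).
    by rewrite !mul1r.
  have XG : `|rsubmx (G a s)| <= X1.
    apply: (HX1 (-1) (G a) (fun r => dltr L (a *: u) ('D_1 g r)) 0 s) => //; last exact: XX.
    move=> r hr; have [k1 _ k2 k3] := TG a s hs (fun r hr => HO a r ha hr) r hr.
    split => //; rewrite tG; apply: tle.
    by have /andP[r0 rs] := hr; rewrite r0 (le_lt_trans rs).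
  have Xv : `|rsubmx (v 1)| <= X2.
    apply: (HX2 1 v (fun r => 'D_1 v r) 0 1) => //; last by rewrite v0.
    by move=> r hr; have [k1 _ k2 k3] := Tv r hr; split => //; exact: tv.
  have M8 : `|psi (v 1)| <= 8 * l.
    rewrite EM; apply/norm_leP; first by rewrite mulr_ge0// ltW.
    rewrite tcoord_mk rsubmx_mk normrN gtr0_norm ?divr_gt0//; split; first exact: half_le8.
    by move=> i; apply: le_trans (e7 i) _; rewrite (ler_pM2r l0) ler_nat.
  have HM t : 0 <= t <= 1 -> O (ltr L ((- t * a) *: u) (v 1)) /\
      `|psi (ltr L ((- t * a) *: u) (v 1)) - psi (v 1)| < l / 4.
    move=> /andP[t0 t1]; apply: Hd => //; first by split => //; rewrite tM1.
    rewrite mulNr normrN ger0_norm ?mulr_ge0//; apply: le_lt_trans zd.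
    by apply: le_trans az; rewrite ler_piMl.
  pose F t r := ltr L ((- t * a) *: u) (v r).
  have F0 t : F t 0 = G ((1 - t) * a) s.
    by rewrite /F v0 ltr_comp; congr (ltr L (_ *: u) _); ring.
  have ha' t : 0 <= t <= 1 -> 0 <= (1 - t) * a <= z.
    move=> /andP[t0 t1]; rewrite mulr_ge0 ?subr_ge0//=; apply: le_trans az.
    by rewrite ler_piMl// gerBl.
  have TF1 t : (forall r, 0 <= r <= 1 -> O (F t r)) ->
      tcurve L H O 1 (F t) (fun r => dltr L ((- t * a) *: u) ('D_1 v r)) 0 1.
    move=> HOF r hr; have [k1 _ k2 k3] := Tv r hr; split.
    - exact: is_derive_ltr.
    - exact: HOF.
    - by rewrite gq_ltr.
    - by rewrite /dltr tcoord_mk.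
  have end_low t : 0 <= t <= 1 -> tcoord (psi (F t 1)) <= - (l / 4).
    move=> /HM[_ /norm_ltP[//|+ _]]; rewrite EM !txE ltr_norml => /andP[_ h].
    by move: h; rewrite -/(F t 1); lra.
  have APF t : 0 <= t <= 1 -> (forall r, 0 <= r <= 1 -> O (F t r)) ->
      forall r, 0 <= r <= 1 -> `|psi (F t r)| <= 12 * l.
    move=> ht HOF r hr; have /andP[r0 r1] := hr.
    have [_ b1 b2] := tcurve_mono EC s1 r0 (tcurve_sub (lexx _) r1 (TF1 t HOF)).
    have [_ c1 _] := tcurve_mono EC s1 r1 (tcurve_sub r0 (lexx _) (TF1 t HOF)).
    rewrite !mul1r in b1 c1; have el := end_low t ht.
    have st : -(2 * l) <= tcoord (psi (F t 0)) by rewrite F0; apply: Ht; exact: ha'.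
    have [_ si] := AP _ s (ha' t ht) hs (fun r hr => HO _ r (ha' t ht) hr) (Ht _ (ha' t ht)).
    rewrite -F0 in si.
    apply/norm_leP; first by rewrite mulr_ge0// ltW.
    split; first exact: norm_between l0 b1 c1 el st.
    move=> i; have := b2 i; rewrite !mul1r => b3.
    rewrite -[rsubmx (psi (F t r)) 0 i](subrK (rsubmx (psi (F t 0)) 0 i)).
    apply: le_trans (ler_normD _ _) _; exact: sum_between l0 b3 (si i) c1 el st.
  have cF t r : 0 <= r <= 1 -> {for (t, r), continuous (fun y : R * R => F y.1 y.2)}.
    move=> hr; have [cv _ _] := lv r hr.
    have c1 : {for (t, r), continuous (fun y : R * R => v y.2)}.
      exact: cts_snd.
    have c2 : {for (t, r), continuous (fun y : R * R => - y.1 * a)}.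
      have c3 : {for t, continuous (fun y : R => - y * a)}.
        apply: (@is_derive_continuous _ _ _ _ (- a)).
        have -> : (fun y : R => - y * a) = (fun y : R => y * - a).
          by apply/funext => y; rewrite mulNr mulrN.
        exact: is_derive_mulr.
      exact: (cts_fst (f := fun y : R => - y * a)).
    exact: (@continuous_comp _ _ _ (fun y : R * R => (v y.2, - y.1 * a))
      (fun z : V * R => ltr L (z.2 *: u) z.1) (t, r) (cvg_pair c1 c2) (@ltr_cts2 _ _ L u _ _)).
  have l12d : 12 * l < dl by apply: le_lt_trans Kdl; apply: le_trans K20; rewrite (ler_pM2r l0) ler_nat.
  have OF : forall t, 0 <= t <= 1 -> forall r, 0 <= r <= 1 -> O (F t r).
    apply: real_induction.
    - move=> r hr; rewrite /F oppr0 mul0r ltr_0; by have [] := lv r hr.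
    - move=> t /andP[t0 t1] HOF.
      have n1 := @tube R _ F O 0 1 t (ec_open EC) (fun r hr => @cF t r hr)
        (fun r hr => HOF t ltac:(by rewrite t0 lexx) r hr).
      have [q q0 Hq] := right_near n1.
      exists q => // t' /andP[tt' tq] _ r hr; apply: Hq => //.
      by rewrite tq andbT (lt_trans _ tt')// ltrBlDr ltrDl.
    - move=> t /andP[t0 t1] HOF r hr.
      suff [] : O (F t r) /\ `|psi (F t r)| <= 12 * l by [].
      apply: (cls_ball EC) => //.
        by rewrite /half_space /= /F /ltr tcoord_mk; have /andP[] := tv r hr.
      move=> q q0.
      have cl : {for t, continuous (fun t => F t r)}.
        apply: (@continuous_comp _ _ _ (fun t : R => (t, r)) (fun y : R * R => F y.1 y.2)); last exact: cF.
        exact: (cvg_pair cvg_id (cvg_cst r)).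
      have [t' /andP[t'0 t't] Ht'] := left_near (near_dist cl q0) t0.
      have h1 : `|F t' r - F t r| < q by apply: Ht'; rewrite lexx ltW.
      have ht' : 0 <= t' < t by rewrite (ltW t'0).
      exists (F t' r); split => //; first exact: HOF.
      apply: APF => //; last exact: HOF.
      by rewrite (ltW t'0) (le_trans (ltW t't)).
  have [_ + _] := tcurve_mono EC s1 ler01 (TF1 1 (OF 1 H1)).
  rewrite !mul1r F0 subrr mul0r /G ltr_0 (Eg s hs) tcoord_mk.
  have := end_low 1 H1; have : 0 < (1 - s) * l by rewrite mulr_gt0// subr_gt0.
  move: l0; lra.
have cG a s : 0 <= s < 1 -> {for (s, a), continuous (fun y : R * R => G y.2 y.1)}.
  move=> hs; have /andP[s0 s1'] := hs.
  have [cg _ _] := lg s s1' s ltac:(by rewrite s0 lexx).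
  have c1 : {for (s, a), continuous (fun y : R * R => g y.1)}.
    exact: cts_fst.
  have c2 : {for (s, a), continuous (fun y : R * R => y.2)} by exact: cvg_snd.
  exact: (@continuous_comp _ _ _ (fun y : R * R => (g y.1, y.2))
    (fun z : V * R => ltr L (z.2 *: u) z.1) (s, a) (cvg_pair c1 c2) (@ltr_cts2 _ _ L u _ _)).
(* The strict inequality makes the bootstrap region open. *)
pose W := [set p | O p /\ - (2 * l) < tcoord (psi p)].
have oW : open W.
  rewrite openE => p [Op Hp]; have n1 : \forall r \near p, O (r : V) by exact: (near_O EC).
  have n2 : \forall r \near p, - (2 * l) < tcoord (psi r).
    have cf : {for p, continuous (fun r : V => tcoord (psi r))}.
      apply: (@continuous_comp _ _ _ psi (@tcoord R n)); last exact: tcoord_cts.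
      exact: (psi_cts EC).
    by apply: (cvgr_gt _ cf).
  by apply: filterS2 n1 n2 => r; split.
have main s2 : s2 < 1 -> forall s, 0 <= s <= s2 -> forall a, 0 <= a <= z -> W (G a s).
  move=> s21; apply: real_induction.
  - move=> a ha; have [h1 /norm_ltP[//|+ _]] := S0 a ha.
    rewrite !txE ltr_norml => /andP[h2 _]; split => //; rewrite /G -/p0; move: h2 l0; lra.
  - move=> s /andP[s0 ss2] HW.
    have hs : 0 <= s < 1 by rewrite s0 (lt_trans ss2).
    have n1 := @tube R _ (fun s a => G a s) W 0 z s oW (fun a _ => @cG a s hs)
      (fun a ha => HW s ltac:(by rewrite s0 lexx) a ha).
    have [q q0 Hq] := right_near n1.
    exists q => // t' /andP[tt' tq] _ a ha; apply: Hq => //.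
    by rewrite tq andbT (lt_trans _ tt')// ltrBlDr ltrDl.
  - move=> s /andP[s0 ss2] HW.
    have hs : 0 <= s < 1 by rewrite (ltW s0) (le_lt_trans ss2).
    have st : forall a, 0 <= a <= z -> O (G a s) /\ - (2 * l) <= tcoord (psi (G a s)).
      move=> a ha.
      have cl : {for s, continuous (fun s => G a s)}.
        apply: (@continuous_comp _ _ _ (fun s : R => (s, a)) (fun y : R * R => G y.2 y.1)); last exact: cG.
        exact: (cvg_pair cvg_id (cvg_cst a)).
      have OGs : O (G a s).
        suff [] : O (G a s) /\ `|psi (G a s)| <= 8 * l by [].
        apply: (cls_ball EC) => //.
          by rewrite /half_space /= tG; have /andP[] := tle s hs.
        move=> q q0; have [r /andP[r0 rs] Hr] := left_near (near_dist cl q0) s0.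
        have h1 : `|G a r - G a s| < q by apply: Hr; rewrite lexx ltW.
        have hr : 0 <= r < s by rewrite (ltW r0).
        have [Or tr] := HW r hr a ha; exists (G a r); split => //.
        have hr1 : 0 <= r < 1 by rewrite (ltW r0) (lt_trans rs)//; have /andP[] := hs.
        have [|b1 b2] := AP a r ha hr1 _ (ltW tr).
          move=> r' /andP[r'0 r'r]; have [] // := HW r' _ a ha.
          by rewrite r'0 (le_lt_trans r'r).
        apply/norm_leP; first by rewrite mulr_ge0// ltW.
        split; first exact: norm_low l0 b1 tr.
        by move=> i; apply: le_trans (b2 i) _; rewrite (ler_pM2r l0) ler_nat.
      split=> //; rewrite leNgt; apply/negP => Hlt.
      have n2 : \forall r \near s, tcoord (psi (G a r)) < - (2 * l).
        have cf : {for s, continuous (fun r => tcoord (psi (G a r)))}.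
          apply: (@continuous_comp _ _ _ (fun r => psi (G a r)) (@tcoord R n)); last exact: tcoord_cts.
          by apply: (@continuous_comp _ _ _ (fun r => G a r) psi) => //; exact: (psi_cts EC).
        by apply: (cvgr_lt _ cf).
      have [r /andP[r0 rs] Hr] := left_near n2 s0.
      have := Hr r ltac:(by rewrite lexx ltW).
      have [_ tr] := HW r ltac:(by rewrite (ltW r0)) a ha.
      by move=> /(lt_trans tr); rewrite ltxx.
    move=> a ha; have [h1 h2] := st a ha; split => //.
    have HO a' r : 0 <= a' <= z -> 0 <= r <= s -> O (G a' r).
      move=> ha' /andP[r0 rs]; have [->|nrs] := eqVneq r s; first by have [] := st a' ha'.
      by have [|] := HW r _ a' ha'; rewrite ?r0 ?lt_neqAle ?nrs.
    have := drop s hs HO (fun a ha => (st a ha).2) a ha.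
    move: l0; lra.
move=> s hs a ha; have /andP[s0 s1'] := hs.
have Wr r : 0 <= r <= s -> W (G a r) by move=> hr; exact: (main s).
have ss : 0 <= s <= s by rewrite s0 lexx.
have [OG tG2] := Wr s ss; split=> //.
have [] // := AP a s ha hs (fun r hr => (Wr r hr).1) (ltW tG2).
Qed.

End Tip.
End Past.

Section LipschitzContinuity.
Variables (R : realType) (W : normedModType R) (G : W -> R).

Lemma cts_lip y C : (\forall y' \near y, `|G y - G y'| <= C * `|y - y'|) ->
  {for y, continuous G}.
Proof.
move=> H; apply/cvgrPdist_lt => e e0.
have e1 : 0 < e / (`|C| + 1) by rewrite divr_gt0// ltr_wpDl.
have n2 : \forall y' \near y, `|y - y'| < e / (`|C| + 1).
  by apply/nbhs_ballP; exists (e / (`|C| + 1)) => // y'; rewrite -ball_normE.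
apply: filterS2 H n2 => y' h1 h2; apply: le_lt_trans h1 _.
rewrite ltr_pdivlMr ?ltr_wpDl// mulrC in h2; apply: le_lt_trans h2.
by rewrite ler_wpM2r// (le_trans (ler_norm _))// lerDl.
Qed.

End LipschitzContinuity.

(** * The contradiction at a past end point *)

Section Past.
Variables (R : realType) (n : nat) (L : two_step R n).
Variables (Gam : discrete_subgroup L) (H : 'I_n -> R -> R).
Local Notation V := 'rV[R]_(1 + n).
Implicit Types (p q v w y : V) (s r t a b : R).
Variables (O : set V) (psi : V -> V) (dl : R).
Hypothesis EC : ext_chart Gam H O psi dl 4^-1.
Variables (Bf bf : R -> R).
Hypothesis dB : forall t, 0 < t -> is_derive t (1 : R) Bf (bf t).
Hypothesis b_gt0 : forall t, 0 < t -> 0 < bf t.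
Hypothesis HB1 : forall t i, 0 < t -> 1 <= H i t * bf t ^+ 2.
Hypothesis B_bd : forall tau, exists M, forall t, 0 < t <= tau -> `|Bf t| <= M.
Hypothesis Hexp : forall i k T, 0 < k -> k <= T ->
  H i k <= H i T * (1 + 3 / 4 * ((T / k) ^+ 2 - 1)).
Variable i1 : 'I_n.
Hypothesis br1 : forall x y : 'rV[R]_n, bracket L x y 0 i1 = 0.
Hypothesis Hinf : forall M, exists2 T0, 0 < T0 & forall t, 0 < t < T0 -> M < H i1 t.
Local Notation U := (chart_image O psi).

Section Tip.
Hypothesis vert : forall k, 0 < k < dl -> U (mk k 0).
Hypothesis U0 : ~ U 0.
Hypothesis dl_gt0 : 0 < dl.
Variables l K N : R.
Hypotheses (NE : N = n.+1%:R) (N1 : 1 <= N) (l0 : 0 < l).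
Hypotheses (Kdl : K < dl) (KE : K = 20 * N * l) (Nl : l <= N * l).

Let K20 : 20 * l <= K. Proof. by move: Nl; rewrite KE; lra. Qed.
Let K0 : 0 < K. Proof. by move: K20 l0; lra. Qed.

(** At a point g(s) of small t, translation by z along [i1] is compared with a straight segment of
    spatial chart coordinates, lifted into the slice through g(s). The segment is bounded in the
    chart, hence of bounded length, while H_i1 is as large as desired; so its [i1] displacement is
    below z, although it equals z. *)
Lemma tip_absurd : False.
Proof.
have sN1 : sgn (-1 : R) by right.
have nw : narrow (-1) (mk (- l) 0 : V) by apply: narrow_vert => //; rewrite mulN1r opprK.
have ld : l < dl by move: K20 Kdl l0; lra.
have lE s : mk l 0 + s *: mk (- l) 0 = mk ((1 - s) * l) 0 :> V.
  by rewrite mkZ mkD scaler0 addr0 mulrN mulrBl mul1r.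
have HU s : 0 <= s < 1 -> exists2 p, O p & psi p = mk l 0 + s *: mk (- l) 0.
  move=> /andP[s0 s1']; rewrite lE; apply: vert.
  rewrite mulr_gt0 ?subr_gt0//=; apply: le_lt_trans ld.
  by rewrite ler_piMl ?(ltW l0)//; move: s0; lra.
have Aw : mk l 0 + mk (- l) 0 = 0 :> V by rewrite mkD addrN addr0 mk00.
have [p0 Op0 Ep0] : exists2 p, O p & psi p = mk l 0.
  by have := HU 0; rewrite scale0r addr0 lexx ltr01; apply.
have Awd : `|mk l 0 + mk (- l) 0 : V| < dl by rewrite Aw normr0.
have nU : ~ (exists2 p, O p & psi p = mk l 0 + mk (- l) 0) by rewrite Aw.
have [g [g0 lg Hg]] := ray EC dB b_gt0 HB1 B_bd sN1 nw Awd HU nU Op0 Ep0.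
pose u : 'rV[R]_n := delta_mx 0 i1.
have [z z0 Hz] := translate_stay EC dB b_gt0 HB1 B_bd Hexp vert dl_gt0 NE l0 Kdl KE Nl u lg.
(* The squared length of the lifted segment is at most twice its squared spatial chart size, whose
   coordinates are at most 7 l. *)
pose C := 2 * (N * (7 * l)) ^+ 2.
have [T0 T00 HT] := Hinf (C / z ^+ 2).
have T2 : 0 < T0 / 2 by rewrite divr_gt0.
have [s hs nts] := Hg (T0 / 2) (tcoord p0) T2.
have /andP[s0 s1'] := hs; have ss : 0 <= s <= s by rewrite s0 lexx.
have Os : O (g s) by have [_ ? _] := lg s s1' s ss.
have Es : psi (g s) = mk ((1 - s) * l) 0 by rewrite (liftE (lg s s1') ss) lE.
set k := (1 - s) * l in Es.
have kl : 0 < k <= l.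
  by rewrite /k mulr_gt0 ?subr_gt0//= ler_piMl ?(ltW l0)//; move: s0; lra.
pose T := tcoord (g s); have Tpos : 0 < T by exact: (ec_half EC Os).
have TT0 : T < T0.
  rewrite ltNge; apply/negP => T0T; apply: nts; rewrite -/T; apply/andP; split.
    by move: T0T T2; lra.
  have [] := tcurve_mono EC sN1 s0 (lift_tcurve EC b_gt0 HB1 sN1 nw (lg s s1')).
  by rewrite g0 !mulN1r lerN2.
pose cube (y : 'rV[R]_n) := forall i, `|y 0 i| < 8 * l.
have l8 : 0 < 8 * l by rewrite mulr_gt0.
(* Over the cube the slice t = T is the graph of [G], Lipschitz by [slice_lip]. *)
have [G HG] : exists G : 'rV[R]_n -> R, forall y : 'rV[R]_n, cube y ->
    exists q, [/\ O q, psi q = mk (G y) y & tcoord q = T].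
  have /choice[G HG] : forall y : 'rV[R]_n, exists h, cube y -> exists q, [/\ O q, psi q = mk h y & tcoord q = T].
    move=> y; have [cy|nc] := pselect (cube y); last by exists 0.
    have [h [q Oq [Eq Tq]]] := slice_exists EC dB b_gt0 HB1 B_bd Hexp U0 dl_gt0 NE l0 Kdl KE Nl Os Es kl cy.
    by exists h => _; exists q.
  by exists G.
have cube0 : cube 0 by move=> i; rewrite mxE normr0.
have Glip (y y' : 'rV[R]_n) : cube y -> cube y' -> `|G y - G y'| <= 2 * N * `|y - y'|.
  move=> /HG[q [Oq Eq Tq]] /HG[q' [Oq' Eq' Tq']].
  have := slice_lip EC dB b_gt0 HB1 B_bd Hexp Oq' Oq (etrans Tq' (esym Tq)); rewrite Eq Eq' !txE => h.
  have h2 : sp (mk (G y) y - mk (G y') y') <= (N * `|y - y'|) ^+ 2.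
    rewrite NE; apply: sp_le => // i; rewrite !txE.
    exact: (rV_normP (y - y') (normr_ge0 _)).1.
  have N0 : 0 <= N by move: N1; lra.
  rewrite -ler_sqr ?nnegrE ?mulr_ge0//.
  rewrite real_normK ?num_real//; apply: le_trans h _.
  by rewrite -mulrA (exprMn 2 2); move: h2; lra.
have Gcts (y : 'rV[R]_n) : cube y -> {for y, continuous G}.
  move=> cy; apply: (@cts_lip _ _ G y (2 * N)).
  have n1 : \forall y' \near y, forall i, `|(y' : 'rV[R]_n) 0 i| < 8 * l.
    apply: (@filter_forall _ _ (fun i (y' : 'rV[R]_n) => `|y' 0 i| < 8 * l) (nbhs y) (nbhs_filter y)) => i.
    have cc : {for y, continuous (fun y' : 'rV[R]_n => `|y' 0 i|)}.
      apply: (@continuous_comp _ _ _ (fun y' : 'rV[R]_n => y' 0 i) Num.norm).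
        exact: coord_continuous.
      exact: norm_continuous.
    by apply: (cvgr_lt _ cc).
  by apply: filterS n1 => y'; exact: Glip.
have GT p : O p -> tcoord p = T -> cube (rsubmx (psi p)) -> psi p = mk (G (rsubmx (psi p))) (rsubmx (psi p)).
  move=> Op Tp cp; have [q [Oq Eq Tq]] := HG _ cp.
  have := slice_lip EC dB b_gt0 HB1 B_bd Hexp Op Oq (etrans Tp (esym Tq)).
  have -> : sp (psi q - psi p) = 0.
    by rewrite /sp big1// => i _; rewrite Eq !txE addrN mxE expr0n.
  rewrite mulr0 => h.
  have /eqP : tcoord (psi q - psi p) ^+ 2 = 0 by apply/eqP; rewrite eq_le h sqr_ge0.
  rewrite sqrf_eq0 Eq !txE subr_eq0 => /eqP E3; by rewrite E3 mk_eta.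
pose E r := ltr L ((r * z) *: u) (g s).
have E_0 : E 0 = g s by rewrite /E mul0r ltr_0.
have rz r : 0 <= r <= 1 -> 0 <= r * z <= z.
  by move=> /andP[r0 r1]; rewrite mulr_ge0 ?(ltW z0)//= ler_piMl// ltW.
have OE r : 0 <= r <= 1 -> O (E r) by move=> hr; have [] := Hz s hs _ (rz r hr).
have YE r : 0 <= r <= 1 -> forall i, `|rsubmx (psi (E r)) 0 i| <= 7 * l.
  by move=> hr; have [] := Hz s hs _ (rz r hr).
have TE r : tcoord (E r) = T by rewrite /E /ltr tcoord_mk.
pose Y r := rsubmx (psi (E r)).
have cubeY r x : 0 <= r <= 1 -> 0 <= x <= 1 -> cube (x *: Y r).
  move=> hr /andP[x0 x1] i; rewrite mxE normrM ger0_norm//.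
  apply: (@le_lt_trans _ _ (7 * l)); last by move: l0; lra.
  by apply: le_trans (YE r hr i); rewrite ler_piMl.
have cE r : {for r, continuous E}.
  have cz : {for r, continuous (fun r : R => r * z)}.
    by apply: is_derive_continuous; exact: is_derive_mulr.
  exact: (@continuous_comp _ _ _ (fun r : R => (g s, r * z)) (fun y : V * R => ltr L (y.2 *: u) y.1)
    r (cvg_pair (cvg_cst (g s)) cz) (@ltr_cts2 _ _ L u _ _)).
have cY r : 0 <= r <= 1 -> {for r, continuous Y}.
  move=> hr; apply: (@continuous_comp _ _ _ (psi \o E) rsubmx); last exact: rsubmx_cts.
  apply: (@continuous_comp _ _ _ E psi); first exact: cE.
  by apply: (psi_cts EC); exact: OE.
(* The segment from 0 to [Y r], raised to the graph. In r this is a homotopy with fixed starting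
   point whose end points are the chart images of the translates [E r]. *)
pose c r x := mk (G (x *: Y r)) (x *: Y r).
have cc r x : 0 <= r <= 1 -> 0 <= x <= 1 ->
    {for (r, x), continuous (fun y : R * R => c y.1 y.2)}.
  move=> hr hx.
  have c1 : {for (r, x), continuous (fun y : R * R => y.2 *: Y y.1)}.
    have c2 : {for (r, x), continuous (fun y : R * R => Y y.1)} by apply: cts_fst; exact: cY.
    have c3 : {for (r, x), continuous (fun y : R * R => y.2)} by exact: cvg_snd.
    exact: continuousZ c3 c2.
  apply: mk_cts => //.
  apply: (@continuous_comp _ _ _ (fun y : R * R => y.2 *: Y y.1) G) => //.
  by apply: Gcts; exact: cubeY.
have G0 : G 0 = k.
  have := GT (g s) Os erefl; rewrite Es rsubmx_mk => /(_ cube0) /(congr1 (@tcoord R n)).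
  by rewrite !txE.
have c_0 r : c r 0 = psi (g s) by rewrite /c scale0r G0 Es.
have [ct lc] : exists ct : R -> R -> V, forall r, 0 <= r <= 1 ->
    lift O psi (c r) 0 1 (ct r) /\ ct r 0 = g s.
  have /choice[ct Hct] : forall r, exists ct, 0 <= r <= 1 -> lift O psi (c r) 0 1 ct /\ ct 0 = g s.
    move=> r; have [hr|nr] := boolP (0 <= r <= 1); last by exists (fun=> 0).
    have k1 x : 0 <= x <= 1 -> {for x, continuous (c r)}.
      move=> hx; apply: (@continuous_comp _ _ _ (fun x : R => (r, x)) (fun y : R * R => c y.1 y.2)); last exact: cc.
      exact: (cvg_pair (cvg_cst r) cvg_id).
    have k2 x : 0 <= x <= 1 -> exists2 p, O p & psi p = c r x.
      by move=> hx; have [q [Oq Eq _]] := HG _ (cubeY r x hr hx); exists q.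
    have [ct l1 l2] := path_lifting EC ler01 k1 k2 Os (esym (c_0 r)).
    by exists ct.
  by exists ct.
have H00 : 0 <= (0 : R) <= 1 by rewrite ler01 lexx.
have H11 : 0 <= (1 : R) <= 1 by rewrite ler01 lexx.
(* Equality, not equality up to [Gam]: a deck translation would spoil the comparison of [i1]
   coordinates. *)
have E1 : E 1 = ct 1 1.
  apply: (lift_family EC (c := c) (p0 := g s)) => //.
    move=> r hr; split; [exact: cE|exact: OE|].
    rewrite /c scale1r; apply: GT; [exact: OE|exact: TE|].
    by have := cubeY r 1 hr H11; rewrite scale1r.
  have [l1 l2] := lc 0 H00.
  have l3 : lift O psi (c 0) 0 1 (fun=> g s).
    move=> x _; split => //; first exact: cst_continuous.
    apply/nbhs_ballP; exists 1; first exact: ltr01.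
    move=> x' _; by rewrite /c /Y E_0 Es rsubmx_mk scaler0 G0.
  by rewrite E_0; apply/esym; apply: (lift_unique EC l1 l3 l2).
have [l1 l2] := lc 1 H11; set cu := ct 1 in E1 l1 l2.
pose S := sp (psi (E 1)).
have SC : 2 * S <= C.
  by rewrite /C ler_pM2l// NE; apply: sp_le; [exact: YE|rewrite mulr_ge0// ltW].
have Hpos i t : 0 < t -> 0 < H i t by exact: (H_gt0 b_gt0 HB1).
have dcu (x : R) : 0 <= x <= 1 -> exists v, is_derive x (1 : R) cu v /\
    H i1 T * (rsubmx v 0 i1) ^+ 2 <= 2 * S.
  move=> hx; have [kx Ox nx] := l1 x hx.
  have ncube : \forall x' \near x, forall i, `|(x' *: Y 1) 0 i| < 8 * l.
    apply: (@filter_forall _ _ (fun i (x' : R) => `|(x' *: Y 1) 0 i| < 8 * l) (nbhs x) (nbhs_filter x)) => i.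
    have ccx : {for x, continuous (fun x' : R => `|(x' *: Y 1) 0 i|)}.
      apply: (@continuous_comp _ _ _ (fun x' : R => (x' *: Y 1) 0 i) Num.norm); last exact: norm_continuous.
      have -> : (fun x' : R => (x' *: Y 1) 0 i) = (fun x' : R => x' * Y 1 0 i).
        by apply/funext => x'; rewrite mxE.
      by apply: is_derive_continuous; exact: is_derive_mulr.
    by apply: (cvgr_lt _ ccx); exact: cubeY.
  have nO : \forall x' \near x, O (cu x') by apply: kx; exact: (near_O EC).
  (* In slice coordinates the lift is a straight line, so [lift_derive] differentiates it although
     [G] is only Lipschitz. *)
  have nE : \forall x' \near x, mk T 0 + x' *: mk 0 (Y 1) = mk (tcoord (cu x')) (rsubmx (psi (cu x'))).
    apply: filterS3 nx ncube nO => x' e1 e2 e3.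
    have [q [Oq Eq Tq]] := HG _ e2; rewrite e1 /c rsubmx_mk mkZ mkD mulr0 addr0 add0r.
    by rewrite -Tq (tcoord_wd EC Oq e3)// e1 Eq.
  have dline := line_derive (mk T 0) (mk 0 (Y 1)) x.
  have dPsi := near_eq_is_derive nE dline.
  have [DP DE] := slice_diff EC Ox.
  have [v dv Ev] := lift_derive kx DP (fun v => slice_inj EC Hpos Ox (v := v)) dPsi.
  exists v; split => //; rewrite DE in Ev.
  have tv : tcoord v = 0 by have := congr1 (@tcoord R n) Ev; rewrite !txE.
  have rv : rsubmx ('d psi (cu x) v) = Y 1 by have := congr1 rsubmx Ev; rewrite !txE.
  have sv : sp ('d psi (cu x) v) = S by rewrite /sp rv.
  have Tx : tcoord (cu x) = T.
    by have := congr1 (@tcoord R n) (nbhs_singleton nE); rewrite !txE mulr0 addr0.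
  have := ec_cone EC Ox v; rewrite /eucl sv ler_norml => /andP[_ h].
  have h1 : H i1 T * rsubmx v 0 i1 ^+ 2 <= gq L H (cu x) v.
    rewrite /gq tv expr0n oppr0 add0r (bigD1 i1)//= Tx.
    have -> : theta L (cu x) v 0 i1 = rsubmx v 0 i1.
      by rewrite /theta mxE [X in _ + X]mxE [X in _ + - X]mxE br1 mulr0 subr0.
    rewrite lerDl; apply: sumr_ge0 => i _.
    by rewrite mulr_ge0 ?sqr_ge0// ltW// Hpos.
  have S0 : 0 <= S by exact: sp_ge0.
  by move: h h1 S0; have := sqr_ge0 (tcoord ('d psi (cu x) v)); lra.
have /choice[v Hv] : forall x : R, exists v, 0 <= x <= 1 -> is_derive x (1 : R) cu v /\
    H i1 T * (rsubmx v 0 i1) ^+ 2 <= 2 * S.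
  move=> x; have [/dcu[v ?]|?] := boolP (0 <= x <= 1); last by exists 0.
  by exists v.
have HT0 : 0 < H i1 T by exact: Hpos.
pose B := Num.sqrt (2 * S / H i1 T).
have S0 : 0 <= 2 * S / H i1 T by rewrite divr_ge0 ?mulr_ge0 ?sp_ge0// ltW.
have D1 (x : R) : 0 <= x <= 1 -> is_derive x (1 : R) (fun x => rsubmx (cu x) 0 i1) (rsubmx (v x) 0 i1).
  by move=> /Hv[d1 _]; apply: is_derive_coord; exact: is_derive_rsubmx.
have D2 (x : R) : 0 <= x <= 1 -> is_derive x (1 : R) (fun x : R => x * B) B.
  by move=> _; exact: is_derive_mulr.
have D3 (x : R) : 0 <= x <= 1 -> `|rsubmx (v x) 0 i1| <= B.
  move=> /Hv[_ h]; rewrite -ler_sqr ?nnegrE ?sqrtr_ge0// sqr_sqrtr//.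
  by rewrite real_normK ?num_real// ler_pdivlMr// mulrC.
have := @abs_mono_derive R (fun x => rsubmx (cu x) 0 i1) (fun x => rsubmx (v x) 0 i1)
  (fun x => x * B) (fun=> B) 0 1 ler01 D1 D2 D3.
rewrite -E1 l2 mul1r mul0r subr0 /E /ltr rsubmx_mk /gmul mul1r.
have -> : (z *: u + rsubmx (g s) + 2^-1 *: bracket L (z *: u) (rsubmx (g s))) 0 i1 - rsubmx (g s) 0 i1 = z.
  rewrite mxE [X in X + _ - _]mxE [X in _ + X - _]mxE br1 mulr0 addr0 addrK.
  by rewrite !mxE !eqxx mulr1.
rewrite gtr0_norm// -ler_sqr ?nnegrE ?sqrtr_ge0 ?(ltW z0)// sqr_sqrtr// ler_pdivlMr// => h.
have := HT T; rewrite Tpos TT0 => /(_ isT).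
rewrite ltr_pdivrMr ?exprn_gt0// mulrC; move: h SC; lra.
Qed.

End Tip.
Lemma past_end (A w : V) : narrow (-1) w -> A + w = 0 ->
  (forall s, 0 <= s < 1 -> U (A + s *: w)) -> ~ U 0 -> False.
Proof.
move=> nw Aw HU nU.
have dl0 : 0 < dl.
  have [p Op Ep] := HU 0 ltac:(by rewrite lexx ltr01).
  by apply: le_lt_trans (ec_bd EC Op).
pose N : R := n.+1%:R; have N1 : 1 <= N by rewrite ler1n.
have N0 : 0 < N by apply: lt_le_trans N1.
pose l := dl / (100 * N); have l0 : 0 < l by rewrite divr_gt0// mulr_gt0.
apply: (@tip_absurd _ nU dl0 l (20 * N * l) N) => //.
- move=> k /andP[k0 kd]; apply: (cone_U EC dB b_gt0 HB1 B_bd Hexp nw Aw HU); rewrite ?txE//.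
    by apply/norm_ltP => //; rewrite !txE gtr0_norm//; split => // i; rewrite mxE normr0.
  by rewrite /sp big1 ?divr_ge0 ?sqr_ge0// => i _; rewrite rsubmx_mk mxE expr0n.
- by rewrite (_ : 20 * N * l = dl / 5); [lra|rewrite /l; field; rewrite gt_eqF].
- by rewrite ler_peMl// ltW.
Qed.

End Past.

(** * The centre of a chart belongs to the image *)

Section NoBoundary.
Variables (R : realType) (n : nat) (L : two_step R n).
Variables (Gam : discrete_subgroup L) (H : 'I_n -> R -> R).
Local Notation V := 'rV[R]_(1 + n).
Implicit Types (p q v w y : V) (s r t a b : R).
Variables (O : set V) (psi : V -> V) (dl : R).
Hypothesis EC : ext_chart Gam H O psi dl 4^-1.
Variables (Bf bf : R -> R).
Hypothesis dB : forall t, 0 < t -> is_derive t (1 : R) Bf (bf t).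
Hypothesis b_gt0 : forall t, 0 < t -> 0 < bf t.
Hypothesis HB1 : forall t i, 0 < t -> 1 <= H i t * bf t ^+ 2.
Hypothesis B_bd : forall tau, exists M, forall t, 0 < t <= tau -> `|Bf t| <= M.
Hypothesis Hexp : forall i k T, 0 < k -> k <= T ->
  H i k <= H i T * (1 + 3 / 4 * ((T / k) ^+ 2 - 1)).
Variable i1 : 'I_n.
Hypothesis br1 : forall x y : 'rV[R]_n, bracket L x y 0 i1 = 0.
Hypothesis Hinf : forall M, exists2 T0, 0 < T0 & forall t, 0 < t < T0 -> M < H i1 t.
Local Notation U := (chart_image O psi).

Lemma chart_image_past A w : U A -> narrow (-1) w -> `|A + w| < dl -> U (A + w).
Proof.
apply: (chart_image_line (K := 2) EC) => [|q v qd nv vd UE]; first by rewrite ltr1n.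
apply: contrapT => nU.
exact: (past_end (ext_shift EC qd) dB b_gt0 HB1 B_bd Hexp br1 Hinf nv (addNr v) UE nU).
Qed.

(** From a point of the image near 0 one goes up, and then straight down to 0. *)
Lemma ext_chart_closed : 0 < dl -> (forall e, 0 < e -> exists2 p, O p & `|psi p| < e) ->
  exists2 p, O p & psi p = 0.
Proof.
move=> dl0 Hcl; pose N : R := n.+1%:R; have N1 : 1 <= N by rewrite ler1n.
have N0 : 0 < N by apply: lt_le_trans N1.
pose a := dl / (10 * N); have a0 : 0 < a by rewrite divr_gt0// mulr_gt0.
have [p Op pa] := Hcl a a0.
have s1 : sgn (1 : R) by left.
have sN1 : sgn (-1 : R) by right.
have Na : N * a = dl / 10 by rewrite /a; field; rewrite gt_eqF.
have aN : a <= N * a by rewrite ler_peMl// ltW.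
(* The descent to 0 then drops by at least 3 N a against a spatial size a, and [narrow_box] asks for
   2 N a. *)
pose k := 4 * (N * a); have k0 : 0 < k by rewrite mulr_gt0// mulr_gt0.
have /norm_ltP[//|pt pr] := pa.
have U1 : U (psi p + mk k 0).
  apply: (chart_image_future EC dB b_gt0 HB1 B_bd Hexp); first by exists p.
    by apply: narrow_vert => //; rewrite mul1r.
  apply: le_lt_trans (ler_normD _ _) _.
  have : `|mk k 0 : V| <= k.
    apply/norm_leP; first exact: ltW.
    by rewrite tcoord_mk rsubmx_mk gtr0_norm//; split=> // i; rewrite mxE normr0 ltW.
  by move: pa aN; rewrite /k Na; lra.
have -> : (0 : V) = (psi p + mk k 0) + - (psi p + mk k 0) by rewrite addrN.
apply: chart_image_past => //; last by rewrite addrN normr0.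
apply: (@narrow_box _ _ (-1) _ a) => //.
- by move=> i; rewrite !txE addr0 mxE normrN ltW.
- exact: ltW.
- by move: pt; rewrite ltr_norml mulN1r !txE opprK => /andP[h _]; move: h aN k0; rewrite /k; lra.
- rewrite mulN1r !txE opprK -/N -mulrA; move: pt; rewrite ltr_norml => /andP[h _].
  by move: h aN; rewrite /k; lra.
Qed.

End NoBoundary.

(** * Time orientation of a chart *)

Section PreChart.
Variables (R : realType) (n : nat) (L : two_step R n).
Variables (Gam : discrete_subgroup L) (H : 'I_n -> R -> R).
Local Notation V := 'rV[R]_(1 + n).
Implicit Types (p q v w y : V) (s r t a b : R).

(** An [ext_chart] before a time orientation is chosen: continuity of the derivative along [et]
    stands in for the sign condition. *)
Record pre_chart (O : set V) (psi : V -> V) (dl : R) : Prop := PreChart {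
  pc_open : open O;
  pc_half : O `<=` @half_space R n;
  pc_diff : forall p, O p -> differentiable psi p;
  pc_inj : forall p, O p -> forall v, 'd psi p v = 0 -> v = 0;
  pc_bd : forall p, O p -> `|psi p| < dl;
  pc_cone : forall p, O p -> forall v,
    `|gq L H p v - (- tcoord ('d psi p v) ^+ 2 + sp ('d psi p v))| <=
      4^-1 * eucl ('d psi p v);
  pc_opn : forall p (W : set V), O p -> nbhs p W ->
    \forall y \near psi p, exists2 p', (W `&` O) p' & psi p' = y;
  pc_cls : forall p y, half_space p -> `|y| < dl ->
    (forall e, 0 < e -> exists q, [/\ O q, `|q - p| < e & `|psi q - y| < e]) ->
    O p /\ psi p = y;
  pc_deck : forall p p', O p -> O p' -> psi p = psi p' ->
    exists2 g, dsg Gam g & p' = ltr L g p;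
  pc_inv : forall g p, dsg Gam g -> O p -> O (ltr L g p) /\ psi (ltr L g p) = psi p;
  pc_sig : forall p, O p -> {for p, continuous (fun q => 'D_(et R n) psi q)} }.

Variables (O : set V) (psi : V -> V) (dl : R).
Hypothesis PC : pre_chart O psi dl.

Let sig p := tcoord ('D_(et R n) psi p).

Lemma sigE p : O p -> sig p = tcoord ('d psi p (et R n)).
Proof. by move=> Op; have E := deriveE (et R n) (pc_diff PC Op); exact: (congr1 (@tcoord R n) E). Qed.

Lemma sig_cts p : O p -> {for p, continuous sig}.
Proof.
move=> Op; apply: (@continuous_comp _ _ _ (fun q => 'D_(et R n) psi q) (@tcoord R n)).
  exact: pc_sig PC _ Op.
exact: tcoord_cts.
Qed.

Lemma gq_et p : gq L H p (et R n) = -1.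
Proof.
rewrite /gq /et !txE expr1n big1 ?addr0// => i _.
have -> : theta L p (mk 1 0) = 0 by rewrite /theta !txE -(scale0r 0) bracketZr !scale0r scaler0 subr0.
by rewrite mxE expr0n mulr0.
Qed.

(** On vectors of zero chart time gq is at least 3/4 sp, but gq is -1 on [et]. *)
Lemma sig_neq0 p : O p -> sig p != 0.
Proof.
move=> Op; apply/eqP => s0; have := pc_cone PC Op (et R n).
rewrite gq_et /eucl -(sigE Op) s0 expr0n /= oppr0 !add0r ler_norml => /andP[h _].
by have := sp_ge0 ('d psi p (et R n)); move: h; lra.
Qed.

(** Translation commutes with shifts of t, so [psi] takes the same values on the two vertical lines
    near their base points. *)
Lemma sig_ltr g p : dsg Gam g -> O p -> sig (ltr L g p) = sig p.
Proof.
move=> Gg Op; have [Og Eg] := pc_inv PC Gg Op.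
have key (c : R -> V) : O (c 0) -> is_derive (0 : R) (1 : R) c (et R n) ->
    (\forall s \near (0 : R), psi (c s) = psi (p + s *: et R n)) ->
    'D_(et R n) psi (c 0) = 'D_1 (fun s : R => psi (p + s *: et R n)) 0.
  move=> Oc dc nE; have Dq := pc_diff PC Oc.
  have D := is_derive_diff dc Dq.
  have [_ D2] := near_eq_is_derive nE D.
  exact: etrans (deriveE (et R n) Dq) (esym D2).
have E0 q : q + 0 *: et R n = q by rewrite scale0r addr0.
have E1 : 'D_(et R n) psi (ltr L g p) = 'D_1 (fun s : R => psi (p + s *: et R n)) 0.
  have := key (fun s => ltr L g p + s *: et R n); rewrite E0; apply => //.
    exact: line_derive.
  have n1 : \forall s \near (0 : R), O (p + s *: et R n).
    have cl : {for (0 : R), continuous (fun s : R => p + s *: et R n)} by exact: line_cts.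
    by apply: cl; rewrite E0; apply: open_nbhs_nbhs; split => //; exact: pc_open PC.
  apply: filterS n1 => s Os; have [_ <-] := pc_inv PC Gg Os; congr psi.
  by rewrite -[LHS]mk_eta /ltr /et !txE scaler0 !addr0.
have E2 : 'D_(et R n) psi p = 'D_1 (fun s : R => psi (p + s *: et R n)) 0.
  have := key (fun s => p + s *: et R n); rewrite E0; apply => //.
    exact: line_derive.
  by apply/nbhs_ballP; exists 1; first exact: ltr01.
by rewrite /sig E1 E2.
Qed.

(** The sign of [sig] splits [O] into two relatively open and closed pieces; multiplying the chart
    by e leaves all squares unchanged and orients the piece of sign e. *)
Lemma pre_ext e : sgn e -> ext_chart Gam H (O `&` [set p | 0 < e * sig p])
  (fun p => e *: psi p) dl 4^-1.
Proof.
move=> se; have e2 := sgn_sqr se; have en : `|e| = 1.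
  by case: se => ->; rewrite ?normrN normr1.
have en0 : e != 0 by rewrite -normr_gt0 en ltr01.
have ee : e * e = 1 by rewrite -expr2.
have dE p : O p -> differentiable (fun p => e *: psi p) p /\
    forall v, 'd (fun p => e *: psi p) p v = e *: 'd psi p v.
  move=> Op; have d1 := pc_diff PC Op.
  have d2 : differentiable (fun p => e *: psi p) p by exact: (differentiableZ e d1).
  split; first exact: d2.
  move=> v.
  have E1 := deriveE v d1.
  have E2 := deriveE v d2.
  have d3 : is_derive p v psi ('D_v psi p).
    by apply: DeriveDef => //; exact: diff_derivable.
  have [_ E3] := is_deriveZ e d3.
  apply: etrans (esym E2) _; apply: etrans E3 _.
  exact: (congr1 (fun x => e *: x) E1).
have nsig p : O p -> 0 < e * sig p -> \forall q \near p, 0 < e * sig q.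
  move=> Op h; have cc : {for p, continuous (fun q => e * sig q)}.
    have k1 : {for p, continuous (fun _ : V => e)} by exact: cst_continuous.
    exact: (continuousM k1 (sig_cts Op)).
  by apply: (cvgr_gt _ cc).
split.
- rewrite openE => p [Op /= Hp]; have n1 : \forall r \near p, O (r : V).
    by apply: open_nbhs_nbhs; split => //; exact: pc_open PC.
  by apply: filterS2 n1 (nsig p Op Hp) => r; split.
- by move=> p [Op _]; exact: pc_half PC _ Op.
- by move=> p [Op _]; have [] := dE p Op.
- move=> p [Op _] v; have [_ ->] := dE p Op.
  by move/eqP; rewrite scaler_eq0 (negbTE en0) /= => /eqP; exact: pc_inj PC _ Op _.
- by move=> p [Op _]; rewrite normrZ en mul1r; exact: pc_bd PC _ Op.
- move=> p [Op _] v; have [_ ->] := dE p Op.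
  have -> : sp (e *: 'd psi p v) = sp ('d psi p v).
    by apply: eq_bigr => i _; rewrite !txE mxE exprMn e2 mul1r.
  have -> : eucl (e *: 'd psi p v) = eucl ('d psi p v).
    rewrite /eucl tcoordZ exprMn e2 mul1r; congr (_ + _).
    by apply: eq_bigr => i _; rewrite !txE mxE exprMn e2 mul1r.
  rewrite tcoordZ exprMn e2 mul1r; exact: pc_cone PC _ Op _.
- move=> p W [Op /= Hp] nW.
  have n1 := nsig p Op Hp.
  have nW1 : nbhs p (W `&` [set q | 0 < e * sig q]) by exact: filterI.
  have := pc_opn PC Op nW1.
  move=> /nbhs_ballP[/= d d0 Hd]; apply/nbhs_ballP; exists d => // y.
  rewrite -ball_normE /ball_ /= => yd.
  have [|p' [[Wp' sp'] Op'] Ep'] := Hd (e *: y).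
    rewrite -ball_normE /ball_ /= -[psi p]scale1r -ee -scalerA -scalerBr normrZ en mul1r.
    exact: yd.
  by exists p' => //; rewrite Ep' scalerA ee scale1r.
- move=> p y hp yd Hq.
  have eyd : `|e *: y| < dl by rewrite normrZ en mul1r.
  have [|Op Ep] := pc_cls PC hp eyd.
    move=> x /Hq[q [[Oq _] q1 q2]]; exists q; split => //.
    rewrite -[psi q]scale1r -ee -scalerA -scalerBr normrZ en mul1r//.
  split; last by rewrite Ep scalerA ee scale1r.
  split => //=; rewrite lt_neqAle eq_sym mulf_neq0//=; last exact: sig_neq0.
  rewrite leNgt; apply/negP => Hlt.
  have cc : {for p, continuous (fun q => e * sig q)}.
    have k1 : {for p, continuous (fun _ : V => e)} by exact: cst_continuous.
    exact: (continuousM k1 (sig_cts Op)).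
  have n1 : \forall q \near p, e * sig q < 0 by apply: (cvgr_lt _ cc).
  have /nbhs_ballP[/= d d0 Hd] := n1.
  have [q [[Oq /= sq] q1 q2]] := Hq d d0.
  have := Hd q; rewrite -ball_normE /ball_ /= distrC => /(_ q1).
  by move=> /(lt_trans sq); rewrite ltxx.
- move=> p p' [Op _] [Op' _] /(scalerI en0) E; exact: pc_deck PC _ _ Op Op' E.
- move=> g p Gg [Op /= Hp]; have [Og Eg] := pc_inv PC Gg Op.
  have Es := sig_ltr Gg Op.
  by split; [split; [exact: Og|rewrite /= Es; exact: Hp]|rewrite Eg].
- by move=> p [Op /= Hp]; have [_ ->] := dE p Op; rewrite tcoordZ -(sigE Op).
Qed.

Variables (Bf bf : R -> R).
Hypothesis dB : forall t, 0 < t -> is_derive t (1 : R) Bf (bf t).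
Hypothesis b_gt0 : forall t, 0 < t -> 0 < bf t.
Hypothesis HB1 : forall t i, 0 < t -> 1 <= H i t * bf t ^+ 2.
Hypothesis B_bd : forall tau, exists M, forall t, 0 < t <= tau -> `|Bf t| <= M.
Hypothesis Hexp : forall i k T, 0 < k -> k <= T ->
  H i k <= H i T * (1 + 3 / 4 * ((T / k) ^+ 2 - 1)).
Variable i1 : 'I_n.
Hypothesis br1 : forall x y : 'rV[R]_n, bracket L x y 0 i1 = 0.
Hypothesis Hinf : forall M, exists2 T0, 0 < T0 & forall t, 0 < t < T0 -> M < H i1 t.

(** At least one of the two oriented pieces accumulates at 0. *)
Lemma pre_chart_closed : 0 < dl -> (forall e, 0 < e -> exists2 p, O p & `|psi p| < e) ->
  exists2 p, O p & psi p = 0.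
Proof.
move=> dl0 Hcl.
have key e : sgn e ->
    (forall d, 0 < d -> exists2 p, (O `&` [set p | 0 < e * sig p]) p & `|psi p| < d) ->
    exists2 p, O p & psi p = 0.
  move=> se Hd; have en : `|e| = 1 by case: se => ->; rewrite ?normrN normr1.
  have Hd' d : 0 < d -> exists2 p, (O `&` [set p | 0 < e * sig p]) p & `|e *: psi p| < d.
    by move=> /Hd[p Op pd]; exists p => //; rewrite normrZ en mul1r.
  have [p [Op _] /eqP] := ext_chart_closed (pre_ext se) dB b_gt0 HB1 B_bd Hexp br1 Hinf dl0 Hd'.
  rewrite scaler_eq0 -normr_eq0 en oner_eq0 /= => /eqP Ep; by exists p.
have [Hp|] := pselect (forall d, 0 < d ->
    exists2 p, (O `&` [set p | 0 < 1 * sig p]) p & `|psi p| < d).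
  by apply: (key 1) => //; left.
move=> /existsNP[d0 /not_implyP[d00 Hn]].
apply: (key (-1)); first by right.
move=> d d1; have [|p Op pd] := Hcl (Num.min d d0); first by rewrite lt_min d1.
move: pd; rewrite lt_min => /andP[pd pd0]; exists p => //; split => //=.
rewrite mulN1r oppr_gt0 lt_neqAle sig_neq0//= leNgt; apply/negP => sp0.
by apply: Hn; exists p => //; split => //=; rewrite mul1r.
Qed.

End PreChart.

(** * Continuous partial derivatives imply differentiability *)

Section C1.
Variables (R : realType) (m k : nat).
Implicit Types (f : 'rV[R]_m -> 'rV[R]_k) (p q w : 'rV[R]_m).

Lemma is_derive_line f q w (s : R) : derivable f (q + s *: w) w ->
  is_derive s (1 : R) (fun r : R => f (q + r *: w)) ('D_w f (q + s *: w)).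
Proof.
move=> df.
have E : (fun h : R => h^-1 *: (((fun r : R => f (q + r *: w)) \o shift s) (h *: (1 : R)) -
    f (q + s *: w))) =
    (fun h : R => h^-1 *: ((f \o shift (q + s *: w)) (h *: w) - f (q + s *: w))).
  apply/funext => h; congr (_ *: (f _ - _)) => /=.
  have -> : h%:A = h :> R by exact: mulr1.
  by rewrite scalerDl addrCA.
apply: DeriveDef; first by rewrite /derivable E.
by rewrite /derive E.
Qed.

Lemma segment_bound (g g' : R -> R) (c e : R) :
  (forall s, `|s| <= `|c| -> is_derive s (1 : R) g (g' s) /\ `|g' s| <= e) ->
  `|g c - g 0| <= e * `|c|.
Proof.
move=> Hg.
have D2 x : is_derive x (1 : R) (fun x : R => x * e) e by exact: is_derive_mulr.
have [c0|c0] := leP 0 c.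
  have b s : 0 <= s <= c -> `|s| <= `|c|.
    by move=> /andP[s0 sc]; rewrite !ger0_norm.
  have := @abs_mono_derive R g g' (fun x => x * e) (fun=> e) 0 c c0
    (fun s hs => (Hg s (b s hs)).1) (fun s _ => D2 s) (fun s hs => (Hg s (b s hs)).2).
  by rewrite mul0r subr0 (ger0_norm c0) mulrC.
have b s : c <= s <= 0 -> `|s| <= `|c|.
  by move=> /andP[sc s0]; rewrite ler0_norm// ltr0_norm// lerN2.
have := @abs_mono_derive R g g' (fun x => x * e) (fun=> e) c 0 (ltW c0)
  (fun s hs => (Hg s (b s hs)).1) (fun s _ => D2 s) (fun s hs => (Hg s (b s hs)).2).
by rewrite mul0r sub0r distrC (ltr0_norm c0) mulrN mulrC.
Qed.

(** Telescoping: [H j] keeps the first j coordinates of the increment, and each difference is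
    estimated along one axis by [segment_bound]. *)
Lemma C1_differentiable f p :
  (\forall q \near p, forall i, derivable f q (delta_mx 0 i)) ->
  (forall i, {for p, continuous ('D_(delta_mx 0 i) f)}) -> differentiable f p.
Proof.
move=> Hd Hc.
pose D (v : 'rV[R]_m) : 'rV[R]_k := \sum_i v 0 i *: 'D_(delta_mx 0 i) f p.
have lD : linear D.
  move=> a u v; rewrite /D scaler_sumr -big_split; apply: eq_bigr => i _ /=.
  by rewrite !mxE scalerDl scalerA.
pose K : {linear 'rV[R]_m -> 'rV[R]_k} :=
  HB.pack D (GRing.isLinear.Build R _ _ _ D lD).
have KE : D = K by [].
have cK : continuous K by rewrite -KE; exact: cts_linear.
suff E : f \o shift p = cst (f p) + K +o_ (0 : 'rV[R]_m) id.
  by apply/diff_locallyP; rewrite (diff_unique cK E); split.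
apply/eqaddoP => e e0.
pose e' := e / (m%:R + 1).
have m0 : 0 < m%:R + 1 :> R by rewrite ltr_wpDl.
have e'0 : 0 < e' by rewrite divr_gt0.
have n2 : \forall q \near p, forall i, `|'D_(delta_mx 0 i) f p - 'D_(delta_mx 0 i) f q| < e'.
  apply: (@filter_forall _ _ (fun i q => `|'D_(delta_mx 0 i) f p - 'D_(delta_mx 0 i) f q| < e')
    (nbhs p) (nbhs_filter p)) => i.
  by have /cvgrPdist_lt /(_ _ e'0) := Hc i.
have n3 := @filterI _ (nbhs p) (nbhs_filter p) _ _ Hd n2.
have [/= d d0 Hball] := (nbhs_ballP _ _).1 n3.
have Hq q : `|q - p| < d -> forall i, derivable f q (delta_mx 0 i) /\
    `|'D_(delta_mx 0 i) f p - 'D_(delta_mx 0 i) f q| < e'.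
  move=> qd i; have [|h1 h2] := Hball q; first by rewrite -ball_normE /ball_ /= distrC.
  by split.
apply/nbhs_ballP; exists d => // h.
rewrite -ball_normE /ball_ /= sub0r normrN => hd.
pose H (j : nat) : 'rV[R]_m := \row_i (if (i < j)%N then h 0 i else 0).
have H0 : H 0%N = 0 by apply/rowP => i; rewrite !mxE ltn0.
have Hm : H m = h by apply/rowP => i; rewrite mxE ltn_ord.
have hi i : `|h 0 i| <= `|h| by exact: (rV_normP h (normr_ge0 h)).1.
have HS (j : 'I_m) : H j.+1 = H j + h 0 j *: delta_mx 0 j.
  apply/rowP => i; rewrite !mxE eqxx /= ltnS leq_eqVlt.
  have [->|ij] := eqVneq i j; first by rewrite eqxx ltnn mulr1 add0r.
  have ij' : (i == j :> nat) = false := negbTE ij.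
  by rewrite ij' /= mulr0 addr0.
have Hdel (j : 'I_m) : D (delta_mx 0 j) = 'D_(delta_mx 0 j) f p.
  rewrite /D (bigD1 j)//= mxE !eqxx scale1r big1 ?addr0// => i ij.
  by rewrite mxE (negbTE ij) andbF scale0r.
suff key j : (j <= m)%N -> `|f (p + H j) - f p - D (H j)| <= j%:R * (e' * `|h|).
  have := key m (leqnn m); rewrite Hm => hh.
  have -> : (f \o shift p - (cst (f p) + K)) h = f (p + h) - f p - D h.
    by rewrite -[LHS]/(f (h + p) - (f p + D h)) opprD addrA (addrC h).
  apply: le_trans hh _; rewrite mulrA ler_wpM2r//.
  rewrite /e' mulrCA ler_piMr ?(ltW e0)// ler_pdivrMr// mul1r lerDl//.
elim: j => [_|j IH jm].
  by rewrite H0 addr0 subrr sub0r normrN mul0r -(scale0r 0) (_ : D (0 *: 0) = 0) ?normr0// scale0r /D big1// => i _; rewrite mxE scale0r.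
have IHj := IH (ltnW jm).
pose jo := Ordinal jm.
have HSj : H j.+1 = H j + h 0 jo *: delta_mx 0 jo by exact: (HS jo).
have DS : D (H j.+1) = D (H j) + h 0 jo *: 'D_(delta_mx 0 jo) f p.
  by rewrite HSj -Hdel addrC lD addrC.
have pt s i : `|s| <= `|h 0 jo| -> `|(H j + s *: delta_mx 0 jo) 0 i| <= `|h|.
  move=> sh; rewrite !mxE eqxx /=; have [->|ij] := eqVneq i jo.
    by rewrite ltnn add0r mulr1 (le_trans sh).
  by rewrite mulr0 addr0; case: ifP; rewrite ?normr0.
have near s : `|s| <= `|h 0 jo| -> `|p + H j + s *: delta_mx 0 jo - p| < d.
  move=> sh; rewrite addrAC (addrC p) addrK; apply: le_lt_trans hd.
  by apply/rV_normP => // i; exact: pt.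
have step : `|f (p + H j + h 0 jo *: delta_mx 0 jo) - f (p + H j) -
    h 0 jo *: 'D_(delta_mx 0 jo) f p| <= e' * `|h|.
  apply/rV_normP; first by rewrite mulr_ge0// ltW.
  move=> i; pose G (s : R) := f (p + H j + s *: delta_mx 0 jo) 0 i - s * 'D_(delta_mx 0 jo) f p 0 i.
  pose G' (s : R) := 'D_(delta_mx 0 jo) f (p + H j + s *: delta_mx 0 jo) 0 i - 'D_(delta_mx 0 jo) f p 0 i.
  have HG s : `|s| <= `|h 0 jo| -> is_derive s (1 : R) G (G' s) /\ `|G' s| <= e'.
    move=> sh; have [h1 h2] := Hq _ (near s sh) jo; split.
      have d1 : is_derive s (1 : R) (fun s : R => f (p + H j + s *: delta_mx 0 jo) 0 i)
          ('D_(delta_mx 0 jo) f (p + H j + s *: delta_mx 0 jo) 0 i).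
        by apply: is_derive_coord; exact: is_derive_line.
      have d2 := is_derive_mulr ('D_(delta_mx 0 jo) f p 0 i) s.
      exact: is_deriveB d1 d2.
    rewrite /G' distrC.
    have -> : 'D_(delta_mx 0 jo) f p 0 i - 'D_(delta_mx 0 jo) f (p + H j + s *: delta_mx 0 jo) 0 i =
      ('D_(delta_mx 0 jo) f p - 'D_(delta_mx 0 jo) f (p + H j + s *: delta_mx 0 jo)) 0 i by rewrite !mxE.
    apply: le_trans (ltW h2); exact: (rV_normP _ (normr_ge0 _)).1.
  have := segment_bound HG; rewrite /G scale0r addr0 mul0r subr0.
  have -> : (f (p + H j + h 0 jo *: delta_mx 0 jo) - f (p + H j) -
    h 0 jo *: 'D_(delta_mx 0 jo) f p) 0 i =
    f (p + H j + h 0 jo *: delta_mx 0 jo) 0 i - h 0 jo * 'D_(delta_mx 0 jo) f p 0 i - f (p + H j) 0 i.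
    by rewrite !mxE addrAC.
  move=> /le_trans; apply; rewrite ler_wpM2l// ltW//.
have -> : f (p + H j.+1) - f p - D (H j.+1) =
   (f (p + H j + h 0 jo *: delta_mx 0 jo) - f (p + H j) - h 0 jo *: 'D_(delta_mx 0 jo) f p) +
   (f (p + H j) - f p - D (H j)).
  rewrite DS HSj addrA; set x := f (_ + _ *: _); set y := f (p + H j); set z := f p.
  by apply/rowP => i; rewrite !mxE; ring.
apply: le_trans (ler_normD _ _) _; rewrite -natr1 mulrDl mul1r addrC.
exact: lerD.
Qed.

End C1.

(** * The covering map of the quotient spacetime *)

Section Covering.
Local Open Scope quotient_scope.
Variables (R : realType) (n : nat) (L : two_step R n).
Variables (Gam : discrete_subgroup L).
Local Notation V := 'rV[R]_(1 + n).
Implicit Types (p q : V).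
Local Notation proj := (st_proj Gam).

Lemma val_time (t : R) : 0 < t ->
  set_val (insubd (exist _ 1 (one_pos_time R) : set_type (@pos_times R)) t) = t.
Proof. by move=> t0; apply: insubdK; rewrite unfold_in /=; apply/mem_set. Qed.

Lemma pi_eqP (x y : 'rV[R]_n) : \pi_(left_quotient Gam) x = \pi_(left_quotient Gam) y <->
  exists2 g, dsg Gam g & y = gmul L g x.
Proof.
have E : reflect (\pi_(left_quotient Gam) x = \pi_(left_quotient Gam) y) (same_orbit Gam x y).
  exact: (@eqmodP _ (same_orbit_equiv Gam) x y).
by split=> [/E /asboolP //|h]; apply/E/asboolP.
Qed.

Lemma st_proj_eq p q : half_space p -> half_space q -> proj p = proj q ->
  exists2 g, dsg Gam g & q = ltr L g p.
Proof.
move=> hp hq E.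
have /(congr1 set_val) := congr1 fst E; rewrite /= !val_time// => Et.
have /= /pi_eqP[g Gg Eg] := congr1 snd E.
by exists g => //; rewrite /ltr Et -Eg mk_eta.
Qed.

Lemma st_proj_ltr g p : dsg Gam g -> proj (ltr L g p) = proj p.
Proof.
move=> Gg; rewrite /st_proj /ltr tcoord_mk rsubmx_mk; congr pair.
by apply/esym/pi_eqP; exists g.
Qed.

Lemma st_proj_surj (x : quotient_space Gam) : exists2 p, half_space p & proj p = x.
Proof.
case: x => t y; have t0 : 0 < set_val t by case: t => t' /= h; exact: (set_mem h).
exists (mk (set_val t) (repr y)); first by rewrite /half_space /= tcoord_mk.
rewrite /st_proj tcoord_mk rsubmx_mk reprK; congr pair.
by apply/val_inj; exact: val_time.
Qed.

Lemma st_proj_cts p : half_space p -> {for p, continuous proj}.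
Proof.
move=> hp.
have hn : \forall q \near p, 0 < tcoord q.
  by apply: (cvgr_gt _ (@tcoord_cts R n p)).
have c1 : {for p, continuous (fun q => (insubd (exist _ 1 (one_pos_time R) : set_type (@pos_times R)) (tcoord q) : set_type (@pos_times R)))}.
  move=> A; rewrite nbhsE => -[B [[C oC CB] Bp] BA].
  have Cp : C (tcoord p) by move: Bp; rewrite -CB /= val_time.
  have nC : \forall q \near p, C (tcoord q).
    by apply: (@tcoord_cts R n p); apply: open_nbhs_nbhs.
  apply: filterS2 hn nC => q q0 Cq; apply: BA; rewrite -CB /=.
  by rewrite val_time.
have c2 : {for p, continuous (fun q => \pi_(left_quotient Gam) (rsubmx q))}.
  apply: (@continuous_comp _ _ _ (rsubmx : V -> 'rV[R]_n) (\pi_(left_quotient Gam))).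
    exact: rsubmx_cts.
  exact: pi_continuous.
exact: (cvg_pair c1 c2).
Qed.

Lemma gmul_cts (g : 'rV[R]_n) : continuous (gmul L g).
Proof.
move=> x.
have -> : gmul L g = (fun y => g + (y + 2^-1 *: bracket L g y)).
  by apply/funext => y; rewrite /gmul addrA.
have -> : (fun y => g + (y + 2^-1 *: bracket L g y)) = cst g + (fun y => y + 2^-1 *: bracket L g y) by [].
apply: continuousD; first exact: cst_continuous.
apply: cts_linear => a u v; rewrite bracketDr bracketZr !scalerDr !scalerA (mulrC a).
by rewrite addrACA.
Qed.

(** The saturation of a ball is the union of its preimages under translations, which are
    continuous. *)
Lemma st_proj_open p W : half_space p -> nbhs p W ->
  nbhs (proj p) (proj @` (W `&` @half_space R n)).
Proof.
move=> hp /nbhs_ballP[/= e e0 He].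
pose A1 : set (set_type (@pos_times R)) := set_val @^-1` ball (tcoord p) e.
pose A2 : set (left_quotient Gam) := \pi_(left_quotient Gam) @` ball (rsubmx p) e.
have nA1 : nbhs (proj p).1 A1.
  apply: open_nbhs_nbhs; split; first by exists (ball (tcoord p) e) => //; exact: ball_open.
  by rewrite /A1 /= val_time//; exact: ballxx.
have nA2 : nbhs (proj p).2 A2.
  apply: open_nbhs_nbhs; split; last by exists (rsubmx p) => //; exact: ballxx.
  rewrite /open /= /quotient_open openE => y [x Bx /esym /pi_eqP[g Gg xg]].
  have : \forall y' \near y, ball (rsubmx p) e (gmul L g y').
    apply: (@gmul_cts g y); rewrite -xg.
    by apply: open_nbhs_nbhs; split => //; exact: ball_open.
  apply: filterS => y' By'; exists (gmul L g y') => //.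
  by apply/esym/pi_eqP; exists g.
exists (A1, A2) => //= -[t b] [/= A1t [x Bx xb]].
have t0 : 0 < set_val t by case: (t) => t' /= h; exact: (set_mem h).
exists (mk (set_val t) x).
  split; last by rewrite /half_space /= tcoord_mk.
  apply: He; move: A1t Bx; rewrite /A1 /= -!ball_normE /ball_ /= => A1t Bx.
  apply/norm_ltP => //; rewrite !txE; split => // i.
  apply: le_lt_trans Bx; exact: (rV_normP (rsubmx p - x) (normr_ge0 _)).1.
rewrite /st_proj tcoord_mk rsubmx_mk xb; congr pair.
by apply/val_inj; exact: val_time.
Qed.

End Covering.

Lemma open_boundary (T : topologicalType) (U : set T) : connected [set: T] ->
  open U -> U !=set0 -> U <> setT -> exists2 o, closure U o & ~ U o.
Proof.
move=> cT oU U0 UT; apply: contrapT => nex; apply: UT; apply: cT => //.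
  by exists U => //; rewrite setTI.
exists U; last by rewrite setTI.
move=> o co; apply: contrapT => nU; apply: nex; by exists o.
Qed.

Lemma near_eq_continuous (T U : topologicalType) (g g' : T -> U) p :
  (\forall q \near p, g' q = g q) -> {for p, continuous g'} -> {for p, continuous g}.
Proof.
move=> E cg A; rewrite -(nbhs_singleton E) => /cg nA.
by apply: filterS2 E nA => q /= -> .
Qed.

Lemma quad_mulmx (R : realType) k d (A : 'M[R]_d) (Q : 'M[R]_(k, d)) (w : 'rV[R]_k) :
  quad A (w *m Q) = quad (Q *m A *m Q^T) w.
Proof. by rewrite /quad trmx_mul !mulmxA. Qed.

(** * Comparison of quadratic forms *)

Section QuadraticForms.
Variables (R : realType) (n : nat).
Local Notation V := 'rV[R]_(1 + n).

Lemma quadE d (A : 'M[R]_d) (w : 'rV[R]_d) :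
  quad A w = \sum_i \sum_j A i j * w 0 i * w 0 j.
Proof.
rewrite /quad mxE exchange_big; apply: eq_bigr => j _.
rewrite !mxE mulr_suml; apply: eq_bigr => i _.
by rewrite (mulrC (w 0 i)).
Qed.

Lemma eucl_sum (w : V) : eucl w = \sum_i w 0 i ^+ 2.
Proof.
rewrite big_split_ord /= big_ord1 /eucl tcoordE; congr (_ + _).
by apply: eq_bigr => i _; rewrite rsubmxE.
Qed.

Lemma quad_eta (w : V) :
  quad (diag_mx (\row_(i < 1 + n) (if i == 0%N :> nat then -1 else 1))) w =
  - tcoord w ^+ 2 + sp w.
Proof.
rewrite quadE.
transitivity (\sum_(i < 1 + n) (if i == 0%N :> nat then -1 else 1) * w 0 i ^+ 2).
  apply: eq_bigr => i _; rewrite (bigD1 i)//= big1 ?addr0; last first.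
    move=> j ji; have ij : (i == j) = false by rewrite eq_sym (negbTE ji).
    by rewrite !mxE ij mulr0n !mul0r.
  by rewrite !mxE eqxx mulr1n expr2 mulrA.
rewrite big_split_ord /= big_ord1 /= mulN1r tcoordE; congr (_ + _).
by apply: eq_bigr => i _; rewrite mul1r rsubmxE.
Qed.

(** From |w_i w_j| <= (w_i^2 + w_j^2) / 2, summed over all pairs of indices. *)
Lemma quad_near (A B : 'M[R]_(1 + n)) (w : V) e :
  (forall i j, `|A i j - B i j| <= e) -> `|quad A w - quad B w| <= e * n.+1%:R * eucl w.
Proof.
move=> He.
have -> : quad A w - quad B w = \sum_i \sum_j (A i j - B i j) * w 0 i * w 0 j.
  rewrite !quadE -sumrB; apply: eq_bigr => i _; rewrite -sumrB.
  by apply: eq_bigr => j _; rewrite !mulrBl.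
apply: (@le_trans _ _ (\sum_i \sum_j e * ((w 0 i ^+ 2 + w 0 j ^+ 2) / 2))).
  apply: (le_trans (ler_norm_sum _ _ _)); apply: ler_sum => i _.
  apply: (le_trans (ler_norm_sum _ _ _)); apply: ler_sum => j _.
  rewrite -mulrA normrM; apply: ler_pM => //.
  rewrite normrM ler_pdivlMr// -[w 0 i ^+ 2]real_normK ?num_real//.
  rewrite -[w 0 j ^+ 2]real_normK ?num_real// -subr_ge0.
  have -> : `|w 0 i| ^+ 2 + `|w 0 j| ^+ 2 - `|w 0 i| * `|w 0 j| * 2 = (`|w 0 i| - `|w 0 j|) ^+ 2 by ring.
  exact: sqr_ge0.
rewrite eucl_sum.
have -> : \sum_(i < 1 + n) \sum_(j < 1 + n) e * ((w 0 i ^+ 2 + w 0 j ^+ 2) / 2) =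
  e * 2^-1 * (\sum_(i < 1 + n) \sum_(j < 1 + n) w 0 i ^+ 2 + \sum_(i < 1 + n) \sum_(j < 1 + n) w 0 j ^+ 2).
  rewrite -big_split mulr_sumr; apply: eq_bigr => i _ /=.
  rewrite -big_split mulr_sumr; apply: eq_bigr => j _ /=; ring.
have -> : \sum_(i < 1 + n) \sum_(j < 1 + n) w 0 i ^+ 2 = n.+1%:R * \sum_i w 0 i ^+ 2.
  by rewrite mulr_sumr; apply: eq_bigr => i _; rewrite sumr_const card_ord mulr_natl.
rewrite sumr_const card_ord -[X in _ * (_ + X)]mulr_natl.
rewrite (_ : (1 + n)%:R = n.+1%:R :> R)//; set S := \sum_i _.
by rewrite le_eqVlt; apply/orP; left; apply/eqP; field.
Qed.

End QuadraticForms.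

(** * From an isometric embedding to a chart on the cover *)

Section Extension.
Variables (R : realType) (n : nat) (L : two_step R n).
Variables (Gam : discrete_subgroup L) (h : R -> 'M[R]_n) (H : 'I_n -> R -> R).
Local Notation V := 'rV[R]_(1 + n).
Local Notation X := (quotient_spacetime Gam h).
Local Notation proj := (st_proj Gam : V -> X).
Implicit Types (p q v w : V).
Hypothesis hgq : forall p v, half_space p -> quad (st_metric L h p) v = gq L H p v.
Hypothesis Hpos : forall i t, 0 < t -> 0 < H i t.
Variables (Y : lorentz_data R (1 + n)) (f : X -> Y).
Hypothesis mY : continuous_lorentzian_manifold Y.
Hypothesis ef : smooth_isometric_open_embedding f.
Variable c' : chart R (1 + n) Y.
Hypothesis ac : atlas c'.
Variable o : Y.
Hypothesis oc : chart_dom c' o.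

Let cc : is_chart c'. Proof. by have [_ [/(_ c' ac)]] := mY. Qed.
Let odom : open (chart_dom c'). Proof. by case: cc. Qed.
Let oimg : open (c' @` chart_dom c'). Proof. by case: cc. Qed.
Let cK x : chart_dom c' x -> chart_inv c' (c' x) = x. Proof. by case: cc => _ _ + _ _; apply. Qed.
Let ccts x : chart_dom c' x -> {for x, continuous c'}. Proof. by case: cc => _ _ _ + _; apply. Qed.
Let icts y : (c' @` chart_dom c') y -> {for y, continuous (chart_inv c')}.
Proof. by case: cc => _ _ _ _; apply. Qed.

(** The embedding is read on the cover, where it is one map although the quotient has many
    charts. *)
Definition Fc p : V := c' (f (proj p)).
Definition Dom := [set p : V | half_space p /\ chart_dom c' (f (proj p))].

Lemma fproj_cts p : half_space p -> {for p, continuous (fun q => f (proj q))}.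
Proof.
move=> hp; have [_ cf _ _ _] := ef.
apply: (@continuous_comp _ _ _ proj f); last exact: cf.
exact: st_proj_cts.
Qed.

Lemma half_near p : half_space p -> \forall q \near p, half_space q.
Proof. by move=> hp; apply: (cvgr_gt _ (@tcoord_cts R n p)). Qed.

Lemma Dom_near p : Dom p -> \forall q \near p, Dom q.
Proof.
move=> [hp dp]; have n1 := half_near hp.
have n2 : \forall q \near p, chart_dom c' (f (proj q)).
  by apply: (fproj_cts hp); apply: open_nbhs_nbhs.
by apply: filterS2 n1 n2 => q; split.
Qed.

(** The inverse of the chart is [proj] on the whole cover, so that [in_charts f c c'] is [Fc] for
    each such chart. *)
Lemma local_chart p : half_space p -> exists c : chart R (1 + n) X,
  [/\ atlas c, chart_dom c (proj p), c (proj p) = p, chart_inv c = proj &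
      exists2 W, open W & W p /\ (forall q, W q -> chart_dom c (proj q) /\ c (proj q) = q)].
Proof.
move=> hp; have [W nW injW] := deck_free Gam p.
pose W' := W^° `&` @half_space R n.
have oW' : open W'.
  apply: openI; first exact: open_interior.
  by rewrite openE => q hq; exact: half_near.
have W'p : W' p by split.
have W'h : W' `<=` @half_space R n by move=> q [].
have inj q q' : W' q -> W' q' -> proj q = proj q' -> q = q'.
  move=> [/interior_subset Wq hq] [/interior_subset Wq' hq'] E.
  have [g Gg Eg] := st_proj_eq hq hq' E; exact: injW Wq Wq' Gg Eg.
pose c : chart R (1 + n) X := @Chart R (1 + n) X (proj @` W')
  (fun x => xget 0 [set q | W' q /\ proj q = x]) proj.
have cE q : W' q -> c (proj q) = q.
  move=> Wq; rewrite /c /=; case: xgetP => [q' -> [Wq' E]|/(_ q)[]//].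
  exact: inj.
exists c; split => //.
- by exists W'.
- by exists p.
- exact: cE.
- by exists W' => //; split => // q Wq; split; [exists q|exact: cE].
Qed.

Lemma Fc_C1 p v : Dom p -> (\forall q \near p, derivable Fc q v) /\
  {for p, continuous ('D_v Fc)}.
Proof.
move=> Dp; have [hp dp] := Dp.
have [c [acc cp Ec Einv [W oW [Wp HW]]]] := local_chart hp.
have [_ _ _ sf _] := ef.
have := sf c c' acc ac 1%N v.
have -> : in_charts f c c' = Fc by rewrite /in_charts Einv.
move=> [Hd Hc].
have nU : \forall q \near p, (c @` (chart_dom c `&` f @^-1` chart_dom c')) q.
  have n1 : \forall q \near p, W q by exact: open_nbhs_nbhs.
  apply: filterS2 n1 (Dom_near Dp) => q Wq [hq dq].
  by have [h1 h2] := HW q Wq; exists (proj q).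
split; first by apply: filterS nU => q; exact: Hd.
by apply: Hc; exact: (nbhs_singleton nU).
Qed.

Lemma Fc_diff p : Dom p -> differentiable Fc p.
Proof.
move=> Dp; apply: C1_differentiable.
  apply: (@filter_forall _ _ (fun i q => derivable Fc q (delta_mx 0 i))
    (nbhs p) (nbhs_filter p)) => i.
  by have [] := Fc_C1 (delta_mx 0 i) Dp.
by move=> i; have [] := Fc_C1 (delta_mx 0 i) Dp.
Qed.

Lemma Fc_isom p v : Dom p -> gq L H p v = quad (gmat c' (Fc p)) ('d Fc p v).
Proof.
move=> Dp; have [hp dp] := Dp.
have [c [acc cp Ec Einv _]] := local_chart hp.
have [_ _ _ _ isf] := ef.
have /= := isf c c' acc ac (proj p) cp dp; rewrite Ec.
have -> : in_charts f c c' = Fc by rewrite /in_charts Einv.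
rewrite -/(Fc p) => E; rewrite -hgq// [st_metric L h p]E -quad_mulmx.
by rewrite /jacobian mul_rV_lin1.
Qed.

Variable P : 'M[R]_(1 + n).
Hypothesis uP : P \in unitmx.
Hypothesis PE : P *m gmat c' (c' o) *m P^T =
  diag_mx (\row_(i < 1 + n) (if i == 0%N :> nat then -1 else 1)).

Definition psi p : V := (Fc p - c' o) *m invmx P.
Let aff (z : V) := c' o + z *m P.

Lemma aff_psi p : aff (psi p) = Fc p.
Proof. by rewrite /aff /psi mulmxKV// addrC subrK. Qed.

Lemma psi_aff z p : Fc p = aff z -> psi p = z.
Proof. by rewrite /psi => ->; rewrite /aff addrAC subrr add0r mulmxK. Qed.

Lemma aff_cts : continuous aff.
Proof.
move=> z; have -> : aff = cst (c' o) + (fun z => z *m P) by [].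
apply: continuousD; first exact: cst_continuous.
by apply: cts_linear => a u v; rewrite mulmxDl scalemxAl.
Qed.

Lemma psi_diff p : Dom p -> differentiable psi p /\
  forall v, 'd psi p v = 'd Fc p v *m invmx P.
Proof.
move=> Dp; have dF := Fc_diff Dp.
pose k (y : V) := y *m invmx P.
have lk : linear k by move=> a u v; rewrite /k mulmxDl scalemxAl.
have D : differentiable psi p.
  have -> : psi = (k \o Fc) - cst (k (c' o)).
    by apply/funext => q; rewrite /psi mulmxBl.
  apply: differentiableB; last exact: differentiable_cst.
  by apply: differentiable_comp => //; exact: linear_diff.
split=> // v.
suff Hq : forall q, q = p + 0 *: v -> differentiable psi q -> differentiable Fc q ->
    'd psi q v = 'd Fc q v *m invmx P.
  by apply: Hq => //; rewrite scale0r addr0.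
move=> q -> D' dF'; have dc := line_derive p v 0.
have [_ d1] := is_derive_diff dc D'.
have d2 := is_derive_linear lk (is_derive_diff dc dF').
have d3 := is_deriveB d2 (is_derive_cst (k (c' o)) (0 : R) (1 : R)).
have [_ d4] := d3.
apply: etrans (esym d1) _.
have -> : psi \o (fun r => p + r *: v) =
    (fun r => k ((Fc \o (fun r => p + r *: v)) r)) - cst (k (c' o)).
  by apply/funext => r; rewrite /= /psi mulmxBl.
by apply: etrans d4 _; rewrite subr0.
Qed.

(** Polarization against [et]: the cross term forces t(v) = 0, and positivity of the spatial part
    then kills v. *)
Lemma gq_inj p v : half_space p ->
  (forall s, gq L H p (v + s *: et R n) = gq L H p (s *: et R n)) -> v = 0.
Proof.
move=> hp E.
have E2 s : - (tcoord v + s) ^+ 2 + \sum_i H i (tcoord p) * theta L p v 0 i ^+ 2 = - s ^+ 2.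
  have := E s; rewrite gq_scale gq_et mulrN1 => <-.
  rewrite /gq /et !txE mulr1; congr (_ + _); apply: eq_bigr => i _.
  by congr (_ * (_ ^+ 2)); rewrite /theta !txE scaler0 addr0.
have S0 i : 0 <= H i (tcoord p) * theta L p v 0 i ^+ 2.
  by rewrite mulr_ge0 ?sqr_ge0// ltW// Hpos.
have v0 : tcoord v = 0.
  by have := E2 0; have := E2 1; lra.
have Sz : \sum_i H i (tcoord p) * theta L p v 0 i ^+ 2 = 0.
  by have := E2 0; rewrite v0; lra.
have th0 : theta L p v = 0.
  apply/rowP => i; rewrite [RHS]mxE.
  have /eqP := Sz; rewrite psumr_eq0// => /allP /(_ i (mem_index_enum _)) /eqP /eqP.
  by rewrite mulf_eq0 gt_eqF ?Hpos//= sqrf_eq0 => /eqP.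
have r0 : rsubmx v = 0.
  move: th0; rewrite /theta => /eqP; rewrite subr_eq0 => /eqP E3.
  by rewrite E3 {1}E3 bracketZr bracket2r !scaler0.
by rewrite -[LHS]mk_eta v0 r0 mk00.
Qed.

Lemma Fc_inj p v : Dom p -> 'd Fc p v = 0 -> v = 0.
Proof.
move=> Dp E; apply: (@gq_inj p) => [|s]; first by case: Dp.
by rewrite !(Fc_isom _ Dp) linearD E add0r.
Qed.

(** The matrix P makes the metric Minkowskian at [o], and continuity keeps it close. Entries within
    (4 (n + 1))^-1 give the tolerance 1/4 through [quad_near]. *)
Lemma chart_radius : exists2 dl, 0 < dl & forall z : V, `|z| < dl ->
  (c' @` chart_dom c') (aff z) /\
  forall w, `|quad (P *m gmat c' (aff z) *m P^T) w - (- tcoord w ^+ 2 + sp w)| <= 4^-1 * eucl w.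
Proof.
have E0 : aff 0 = c' o by rewrite /aff mul0mx addr0.
have im0 : (c' @` chart_dom c') (c' o) by exists o.
have n1 : \forall z \near (0 : V), (c' @` chart_dom c') (aff z).
  by apply: (@aff_cts 0); rewrite E0; exact: open_nbhs_nbhs.
pose e := (4 * n.+1%:R)^-1 : R.
have e0 : 0 < e by rewrite invr_gt0 mulr_gt0.
pose Gt (z : V) := P *m gmat c' (aff z) *m P^T.
have cG : {for (0 : V), continuous Gt}.
  have cg : {for (0 : V), continuous (fun z => gmat c' (aff z))}.
    apply: (@continuous_comp _ _ _ aff (gmat c')); first exact: aff_cts.
    by rewrite E0; have [_ _ [_ + _]] := mY; apply.
  apply: cts_mx => i j.
  have -> : (fun z => Gt z i j) = (fun z => \sum_k \sum_l P i l * gmat c' (aff z) l k * P j k).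
    apply/funext => z; rewrite /Gt mxE; apply: eq_bigr => k _.
    by rewrite [in LHS]mxE mulr_suml; apply: eq_bigr => l _; rewrite [P^T _ _]mxE.
  apply: cts_sum => k; apply: cts_sum => l.
  have cgl : {for (0 : V), continuous (fun z => gmat c' (aff z) l k)}.
    apply: (@continuous_comp _ _ _ (fun z => gmat c' (aff z)) (fun A : 'M[R]_(1 + n) => A l k)) => //.
    exact: coord_continuous.
  have k1 (x : R) : {for (0 : V), continuous (fun=> x : R)} by exact: cst_continuous.
  exact: (continuousM (continuousM (k1 _) cgl) (k1 _)).
have n2 : \forall z \near (0 : V), `|Gt 0 - Gt z| < e.
  by have /cvgrPdist_lt /(_ _ e0) := cG.
have n3 := @filterI _ (nbhs (0 : V)) (nbhs_filter (0 : V)) _ _ n1 n2.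
have [/= d d0 Hd] := (nbhs_ballP _ _).1 n3.
exists d => // z zd; have [|h1 h2] := Hd z.
  by rewrite -ball_normE /ball_ /= sub0r normrN.
split=> // w; rewrite -quad_eta -PE -[c' o]E0 -/(Gt 0) -/(Gt z).
have -> : 4^-1 * eucl w = e * n.+1%:R * eucl w.
  have N0 : n.+1%:R != 0 :> R by rewrite pnatr_eq0.
  by congr (_ * _); rewrite /e; move: N0; move: (n.+1%:R : R) => N N0; field.
apply: quad_near => i j.
have : `|(Gt 0 - Gt z) i j| <= `|Gt 0 - Gt z|.
  by rewrite [leRHS]/Num.norm /= mx_normrE; apply: (le_bigmax _ _ (i, j)).
have -> : (Gt 0 - Gt z) i j = Gt 0 i j - Gt z i j by rewrite !mxE.
by rewrite distrC => hh; exact: le_trans hh (ltW h2).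
Qed.

(** Injectivity of the embedding yields [pc_deck], and its openness [pc_opn]. *)
Lemma pre_chart_psi dl : (forall z : V, `|z| < dl -> (c' @` chart_dom c') (aff z) /\
  forall w, `|quad (P *m gmat c' (aff z) *m P^T) w - (- tcoord w ^+ 2 + sp w)| <= 4^-1 * eucl w) ->
  pre_chart Gam H (Dom `&` [set p | `|psi p| < dl]) psi dl.
Proof.
move=> Hdl; have [injf cf opf _ _] := ef.
have psic p : Dom p -> {for p, continuous psi}.
  by move=> Dp; apply: differentiable_continuous; have [] := psi_diff Dp.
have On p : (Dom `&` [set p | `|psi p| < dl]) p ->
    \forall q \near p, (Dom `&` [set p | `|psi p| < dl]) q.
  move=> [Dp /= pd].
  have cn : {for p, continuous (fun q => `|psi q|)}.
    by apply: (@continuous_comp _ _ _ psi Num.norm); [exact: psic|exact: norm_continuous].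
  have n2 : \forall q \near p, `|psi q| < dl by apply: (cvgr_lt _ cn).
  by apply: filterS2 (Dom_near Dp) n2 => q; split.
have cinj x y : chart_dom c' x -> chart_dom c' y -> c' x = c' y -> x = y.
  by move=> dx dy E; rewrite -(cK dx) -(cK dy) E.
split.
- by rewrite openE => p Op; exact: On.
- by move=> p [[]].
- by move=> p [Dp _]; have [] := psi_diff Dp.
- move=> p [Dp _] v; have [_ ->] := psi_diff Dp.
  move=> /(congr1 (mulmx^~ P)); rewrite mulmxKV// mul0mx.
  exact: Fc_inj.
- by move=> p [].
- move=> p [Dp /= pd] v; have [_ ->] := psi_diff Dp.
  rewrite (Fc_isom _ Dp) -aff_psi.
  have -> : 'd Fc p v = 'd Fc p v *m invmx P *m P by rewrite mulmxKV.
  by rewrite quad_mulmx mulmxK//; have [_] := Hdl _ pd; apply.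
- move=> p W Op nW; have [[hp dp] /= pd] := Op.
  set O := Dom `&` _ in Op *.
  have nN : nbhs p (W `&` O) := @filterI _ (nbhs p) (nbhs_filter p) _ _ nW (On p Op).
  have := st_proj_open Gam hp nN; rewrite nbhsE => -[B [oB Bp] HB].
  have nB : nbhs (f (proj p)) (f @` B).
    by apply: open_nbhs_nbhs; split; [exact: opf|exists (proj p)].
  have imp : (c' @` chart_dom c') (Fc p) by exists (f (proj p)).
  have n1 : \forall y \near Fc p, (f @` B) (chart_inv c' y).
    by apply: (icts imp); rewrite /Fc cK.
  have n2 : \forall y \near Fc p, (c' @` chart_dom c') y by exact: open_nbhs_nbhs.
  have nA (Q : set V) : (\forall y \near Fc p, Q y) -> \forall z \near psi p, Q (aff z).
    by move=> nQ; have := @aff_cts (psi p) Q; rewrite aff_psi; apply.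
  have n3 := nA _ n1; have n4 := nA _ n2.
  apply: filterS2 n3 n4 => z [x Bx fx] [y' dy' Ey'].
  have [p' [[Wp' Op'] hp'] Ep'] := HB x Bx.
  exists p' => //; apply: psi_aff; rewrite /Fc.
  by rewrite Ep' fx -Ey' cK.
- move=> p y hp yd Hq; have [[y' dy' Ey'] _] := Hdl y yd.
  (* The same images converge to f(proj(p)) and to the chart point of coordinate y, and Y is
     Hausdorff. *)
  have fpE : f (proj p) = y'.
    have [[_ hY _] _ _] := mY; apply: hY => A B nA nB.
    have n1 : \forall q \near p, A (f (proj q)) by exact: (fproj_cts hp).
    have n2 : \forall z \near y, B (chart_inv c' (aff z)).
      have c1 : {for y, continuous (fun z => chart_inv c' (aff z))}.
        apply: (@continuous_comp _ _ _ aff (chart_inv c')); first exact: aff_cts.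
        by apply: icts; exists y'.
      by apply: c1; rewrite -Ey' cK.
    have [/= e1 e10 H1] := (nbhs_ballP _ _).1 n1.
    have [/= e2 e20 H2] := (nbhs_ballP _ _).1 n2.
    have [|q [[[hq dq] qd] q1 q2]] := Hq (Num.min e1 e2); first by rewrite lt_min e10.
    move: q1 q2; rewrite !lt_min => /andP[q1 _] /andP[_ q2].
    exists (f (proj q)); split.
      by apply: H1; rewrite -ball_normE /ball_ /= distrC.
    have := H2 (psi q); rewrite -ball_normE /ball_ /= distrC => /(_ q2).
    by rewrite aff_psi /Fc cK.
  have Ep : psi p = y by apply: psi_aff; rewrite /Fc fpE.
  by split=> //; split; [split => //; rewrite fpE|rewrite /= Ep].
- move=> p p' [[hp dp] _] [[hp' dp'] _] E.
  apply: st_proj_eq => //; apply: injf; apply: cinj => //.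
  by rewrite -[LHS]/(Fc p) -aff_psi E aff_psi.
- move=> g p Gg [[hp dp] /= pd].
  have E : proj (ltr L g p) = proj p by exact: st_proj_ltr.
  have Ep : psi (ltr L g p) = psi p by rewrite /psi /Fc E.
  split=> //; split; last by rewrite /= Ep.
  by split; [rewrite /half_space /= /ltr tcoord_mk|rewrite E].
- move=> p [Dp pd]; set v := et R n.
  have n1 : \forall q \near p, 'D_v Fc q *m invmx P = 'D_v psi q.
    apply: filterS (Dom_near Dp) => q Dq.
    have [d1 d2] := psi_diff Dq.
    have e1 := deriveE v d1.
    have e2 := deriveE v (Fc_diff Dq).
    apply: etrans _ (esym e1); rewrite d2.
    exact: (congr1 (fun x => x *m invmx P) e2).
  apply: near_eq_continuous n1 _.
  have [_ c1] := Fc_C1 v Dp.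
  have c2 : continuous (fun x : V => x *m invmx P).
    by apply: cts_linear => a x y; rewrite mulmxDl scalemxAl.
  exact: (@continuous_comp V V V ('D_v Fc) (fun x : V => x *m invmx P) p c1 (c2 _)).
Qed.

End Extension.

(** * The inextendibility criterion *)

Section Inextendible.
Variables (R : realType) (n : nat) (L : two_step R n).
Variables (h : R -> 'M[R]_n) (H : 'I_n -> R -> R).
Local Notation V := 'rV[R]_(1 + n).
Implicit Types (t k T : R).
Hypothesis hgq : forall (p v : V), half_space p -> quad (st_metric L h p) v = gq L H p v.
Variables (Bf bf : R -> R).
Hypothesis dB : forall t, 0 < t -> is_derive t (1 : R) Bf (bf t).
Hypothesis b_gt0 : forall t, 0 < t -> 0 < bf t.
Hypothesis HB1 : forall t i, 0 < t -> 1 <= H i t * bf t ^+ 2.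
Hypothesis B_bd : forall tau, exists M, forall t, 0 < t <= tau -> `|Bf t| <= M.
Hypothesis Hexp : forall i k T, 0 < k -> k <= T ->
  H i k <= H i T * (1 + 3 / 4 * ((T / k) ^+ 2 - 1)).
Variable i1 : 'I_n.
Hypothesis br1 : forall x y : 'rV[R]_n, bracket L x y 0 i1 = 0.
Hypothesis Hinf : forall M, exists2 T0, 0 < T0 & forall t, 0 < t < T0 -> M < H i1 t.

(** Connectedness of Y gives a boundary point of a proper open image; in a chart centred there,
    [pre_chart_closed] puts that point into the image. *)
Theorem inextendible (Gam : discrete_subgroup L) :
  C0_inextendible (quotient_spacetime Gam h).
Proof.
move=> [Y [mY [f [ef rf]]]].
have [injf cf opf _ _] := ef.
have [[cY hY _] [iscY covY _] [_ _ lorY]] := mY.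
have Hpos i t : 0 < t -> 0 < H i t.
  by move=> t0; exact: (H_gt0 b_gt0 HB1).
have [bp co no] : exists2 bp, closure (range f) bp & ~ (range f) bp.
  apply: open_boundary => //; first by apply: opf; exact: openT.
  by exists (f (st_proj Gam (mk 1 0))); exists (st_proj Gam (mk 1 0)).
have [c' ac oc] := covY bp.
have [P uP PE] := lorY c' (c' bp) ac (ex_intro2 _ _ bp oc erefl).
have [dl dl0 Hdl] := chart_radius mY ac oc PE.
have PC := pre_chart_psi hgq Hpos mY ef ac uP Hdl.
have cK x : chart_dom c' x -> chart_inv c' (c' x) = x.
  by have [_ _ + _ _] := iscY c' ac; apply.
have Hcl e : 0 < e -> exists2 p, (Dom f c' `&` [set p | `|psi f c' bp P p| < dl]) p &
    `|psi f c' bp P p| < e.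
  move=> e0.
  have nO : nbhs bp [set q | chart_dom c' q /\ `|(c' q - c' bp) *m invmx P| < Num.min e dl].
    have [od _ _ cc _] := iscY c' ac.
    have n1 : \forall q \near bp, chart_dom c' q by exact: open_nbhs_nbhs.
    have cn : {for bp, continuous (fun q : Y => `|(c' q - c' bp) *m invmx P|)}.
      apply: (@continuous_comp _ _ _ (c' : Y -> V) (fun y : V => `|(y - c' bp) *m invmx P|)); first exact: cc.
      apply: (@continuous_comp _ _ _ (fun y : V => (y - c' bp) *m invmx P) Num.norm); last exact: norm_continuous.
      apply: (@continuous_comp _ _ _ (fun y : V => y - c' bp) (fun y : V => y *m invmx P)).
        apply: continuousB; [by move=> ?|exact: cst_continuous].
      by apply: cts_linear => a u v; rewrite mulmxDl scalemxAl.
    have n2 : \forall q \near bp, `|(c' q - c' bp) *m invmx P| < Num.min e dl.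
      by apply: (cvgr_lt _ cn); rewrite subrr mul0mx normr0 lt_min e0.
    by apply: filterS2 n1 n2 => q; split.
  have [q [[x _ xq] [dq qe]]] := co _ nO.
  have [p hp px] := st_proj_surj x; move: qe; rewrite lt_min => /andP[q1 q2].
  have Ep : psi f c' bp P p = (c' q - c' bp) *m invmx P by rewrite /psi /Fc px xq.
  by exists p; [split; [split => //; rewrite px xq|rewrite /= Ep]|rewrite Ep].
have [p [[hp dp] _] Ep] := pre_chart_closed PC dB b_gt0 HB1 B_bd Hexp br1 Hinf dl0 Hcl.
apply: no; exists (st_proj Gam p) => //.
rewrite -(cK _ dp) -(cK _ oc); congr (chart_inv c' _).
by rewrite -[LHS]/(Fc f c' p) -(aff_psi f c' bp uP p) Ep mul0mx addr0.
Qed.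

End Inextendible.

(** * The metrics *)

Section TimeChange.
Variable R : realType.
Implicit Types (x y t s : R).

(** Chosen so that [qe - 1] is the common value of p_Z - p_X - p_Y in the two Heisenberg factors. *)
Definition qe : R := 59 / 78.

(* [x] stands for [log s]: [Tm] is t as a function of x, and [ll], [kk] are log s, log (1 + u). *)
Definition Tm x : R := expR x + 2 / (2 * qe + 1) * expR ((2 * qe + 1) * x) +
  (4 * qe + 1)^-1 * expR ((4 * qe + 1) * x).

Lemma is_derive_expM (a : R) x : is_derive x (1 : R) (fun y => expR (a * y)) (a * expR (a * x)).
Proof.
have d1 : is_derive x (1 : R) (fun y : R => a * y) a.
  have -> : (fun y : R => a * y) = (fun y => y * a) by apply/funext => y; rewrite mulrC.
  exact: is_derive_mulr.
have := @is_derive1_comp R expR (fun y => a * y) x _ _ (is_derive_expR _) d1.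
by rewrite mulrC.
Qed.

Lemma Tm_derive x : is_derive x (1 : R) Tm (expR x * (1 + expR (2 * qe * x)) ^+ 2).
Proof.
have d1 := is_derive_expR x.
have d2 := is_deriveZ (2 / (2 * qe + 1)) (is_derive_expM (2 * qe + 1) x).
have d3 := is_deriveZ (4 * qe + 1)^-1 (is_derive_expM (4 * qe + 1) x).
have := is_deriveD (is_deriveD d1 d2) d3.
move/is_derive_eq; apply.
have e1 : expR ((2 * qe + 1) * x) = expR x * expR (2 * qe * x).
  by rewrite -expRD; congr expR; ring.
have e2 : expR ((4 * qe + 1) * x) = expR x * expR (2 * qe * x) ^+ 2.
  by rewrite -expRM_natl -expRD; congr expR; ring.
rewrite e1 e2 /GRing.scale /= /qe; move: (expR x) (expR (2 * (59 / 78) * x)) => X Y; by field.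
Qed.

Lemma Tm_cts : continuous Tm.
Proof. by move=> x; exact: is_derive_continuous (Tm_derive x). Qed.

Let cE1 : 2 / (2 * qe + 1) = 156 / 196 :> R. Proof. by rewrite /qe; field. Qed.
Let cE2 : (4 * qe + 1)^-1 = 78 / 314 :> R. Proof. by rewrite /qe; field. Qed.
Let q1 : 0 < 2 * qe + 1 :> R. Proof. by rewrite /qe; lra. Qed.
Let q2 : 0 < 4 * qe + 1 :> R. Proof. by rewrite /qe; lra. Qed.

Let c1p : 0 < 156 / 196 :> R. Proof. by lra. Qed.
Let c2p : 0 < 78 / 314 :> R. Proof. by lra. Qed.

Lemma Tm_mono x y : x < y -> Tm x < Tm y.
Proof.
move=> xy; rewrite /Tm ltrD// ?ltrD// ?ltr_expR//.
- by rewrite cE1 (ltr_pM2l c1p) ltr_expR (ltr_pM2l q1).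
- by rewrite cE2 (ltr_pM2l c2p) ltr_expR (ltr_pM2l q2).
Qed.

Lemma Tm_gt x : expR x < Tm x.
Proof.
rewrite /Tm cE1 cE2 -addrA ltrDl.
exact: addr_gt0 (mulr_gt0 c1p (expR_gt0 _)) (mulr_gt0 c2p (expR_gt0 _)).
Qed.

Lemma Tm_le x : x <= 0 -> Tm x <= 3 * expR x.
Proof.
move=> x0.
have h a : 1 <= a -> expR (a * x) <= expR x.
  by move=> a1; rewrite ler_expR -subr_ge0 -{1}[x]mul1r -mulrBl mulr_le0// subr_le0.
have h1 := h (2 * qe + 1) ltac:(rewrite /qe; lra).
have h2 := h (4 * qe + 1) ltac:(rewrite /qe; lra).
have := expR_gt0 x; have := expR_gt0 ((2 * qe + 1) * x); have := expR_gt0 ((4 * qe + 1) * x).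
move: h1 h2; rewrite /Tm cE1 cE2.
move: (expR x) (expR ((2 * qe + 1) * x)) (expR ((4 * qe + 1) * x)) => X Y Z; lra.
Qed.

Lemma Tm_surj t : 0 < t -> exists x, Tm x = t.
Proof.
move=> t0; pose y := Num.min 0 (ln (t / 3)).
have y1 : Tm y <= t.
  have y0 : y <= 0 by rewrite /y ge_min lexx.
  apply: le_trans (Tm_le y0) _.
  have : expR y <= expR (ln (t / 3)) by rewrite ler_expR /y ge_min lexx orbT.
  by rewrite lnK ?posrE ?divr_gt0//; lra.
have z1 : t <= Tm (ln t) by rewrite -{1}[t]lnK ?posrE// ltW// Tm_gt.
have yz : y <= ln t.
  rewrite leNgt; apply/negP => /Tm_mono h.
  by have := lt_le_trans h y1; rewrite ltNge z1.
have ct : {within `[y, ln t], continuous Tm}.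
  by apply: continuous_subspaceT => x; exact: Tm_cts.
have tI : Num.min (Tm y) (Tm (ln t)) <= t <= Num.max (Tm y) (Tm (ln t)).
  by rewrite ge_min y1 le_max z1 orbT.
by have [x _ <-] := IVT yz ct tI; exists x.
Qed.

Definition ll t : R := xget 0 [set x | Tm x = t].
Definition kk t : R := ln (1 + expR (2 * qe * ll t)).

Lemma llK t : 0 < t -> Tm (ll t) = t.
Proof.
by move=> /Tm_surj[x xt]; rewrite /ll; case: xgetP => [y -> //|/(_ x)].
Qed.

Lemma Tm_inj : injective Tm.
Proof.
move=> x y E; apply/eqP; rewrite eq_le !leNgt; apply/andP.
by split; apply/negP => /Tm_mono; rewrite E ltxx.
Qed.

Lemma TmK x : ll (Tm x) = x.
Proof. by apply: Tm_inj; rewrite llK// (lt_trans _ (Tm_gt x))// expR_gt0. Qed.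

Lemma ll_mono s t : 0 < s -> s <= t -> ll s <= ll t.
Proof.
move=> s0 st; rewrite leNgt; apply/negP => /Tm_mono.
by rewrite !llK ?(lt_le_trans s0)// ltNge st.
Qed.

Lemma ll_lt t : 0 < t -> expR (ll t) < t.
Proof. by move=> t0; have := Tm_gt (ll t); rewrite llK. Qed.

Lemma kk_arg t : 0 < 1 + expR (2 * qe * ll t).
Proof. by rewrite addr_gt0// expR_gt0. Qed.

Lemma expR_kk t : expR (kk t) = 1 + expR (2 * qe * ll t).
Proof. by rewrite /kk lnK// posrE kk_arg. Qed.

Lemma kk_ge0 t : 0 <= kk t.
Proof. by rewrite /kk ln_ge0// lerDl expR_ge0. Qed.

Lemma kk_ge t : 2 * qe * ll t <= kk t.
Proof. by rewrite -ler_expR expR_kk lerDr. Qed.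

Lemma kk_mono s t : 0 < s -> s <= t -> kk s <= kk t.
Proof.
move=> s0 st; rewrite -ler_expR !expR_kk lerD2l ler_expR ler_wpM2l ?ll_mono//.
by rewrite /qe; lra.
Qed.

(** The derivative s^-1 (1 + u)^-2 of log s, kept as one exponential so that products reduce to sums
    of exponents. *)
Definition dll t : R := expR (- ll t - 2 * kk t).
Definition dkk t : R := 2 * qe * expR ((2 * qe - 1) * ll t - 3 * kk t).

Lemma dll_gt0 t : 0 < dll t. Proof. exact: expR_gt0. Qed.
Lemma dkk_gt0 t : 0 < dkk t. Proof. by rewrite mulr_gt0 ?expR_gt0//; rewrite /qe; lra. Qed.

Lemma ll_derive t : 0 < t -> is_derive t (1 : R) ll (dll t).
Proof.
move=> t0; rewrite -{1}(llK t0).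
have -> : dll t = (expR (ll t) * (1 + expR (2 * qe * ll t)) ^+ 2)^-1.
  rewrite -expR_kk -expRM_natl -expRD -expRN; congr expR; ring.
apply: (@is_derive_inverse R Tm ll).
- apply: (@filterS _ _ (nbhs_filter (ll t)) setT); last exact: filterT.
  by move=> x _; exact: TmK.
- apply: (@filterS _ _ (nbhs_filter (ll t)) setT); last exact: filterT.
  by move=> x _; exact: Tm_cts.
- exact: Tm_derive.
- by rewrite gt_eqF// mulr_gt0 ?expR_gt0// exprn_gt0// kk_arg.
Qed.

Lemma kk_derive t : 0 < t -> is_derive t (1 : R) kk (dkk t).
Proof.
move=> t0.
have d1 := @is_derive1_comp R (fun y => expR (2 * qe * y)) ll t _ _ (is_derive_expM _ _) (ll_derive t0).
have d2 := is_deriveD (is_derive_cst (1 : R) t (1 : R)) d1.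
have := @is_derive1_comp R (@ln R) (fun y => 1 + expR (2 * qe * ll y)) t _ _
  (is_derive1_ln (kk_arg t)) d2.
move/is_derive_eq; apply; rewrite add0r -expR_kk -expRN /dkk /dll.
have -> : expR ((2 * qe - 1) * ll t - 3 * kk t) =
    expR (- kk t) * expR (2 * qe * ll t) * expR (- ll t - 2 * kk t).
  by rewrite -!expRD; congr expR; ring.
by move: (expR (- kk t)) (expR (2 * qe * ll t)) (expR (- ll t - 2 * kk t)) => X Y Z; ring.
Qed.

(** The monomial C s^a (1 + u)^b. Metric coefficients have this form, and by [mon_derive_mon] sums
    of such monomials are closed under d/dt. *)
Definition mon (C a b : R) t : R := C * expR (a * ll t + b * kk t).

Lemma exp_lin_derive (a b : R) t : 0 < t ->
  is_derive t (1 : R) (fun t => expR (a * ll t + b * kk t))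
    ((a * dll t + b * dkk t) * expR (a * ll t + b * kk t)).
Proof.
move=> t0.
have d1 := is_deriveD (is_deriveZ a (ll_derive t0)) (is_deriveZ b (kk_derive t0)).
have := @is_derive1_comp R expR (fun t => a * ll t + b * kk t) t _ _ (is_derive_expR _) d1.
by move/is_derive_eq; apply; rewrite mulrC.
Qed.

Lemma mon_derive (C a b : R) t : 0 < t ->
  is_derive t (1 : R) (mon C a b) ((a * dll t + b * dkk t) * mon C a b t).
Proof.
move=> t0; have := is_deriveZ C (exp_lin_derive a b t0).
by move/is_derive_eq; apply; rewrite /GRing.scale /= /mon; ring.
Qed.

Lemma mon_derive_mon (C a b : R) t : 0 < t ->
  is_derive t (1 : R) (mon C a b)
    (mon (C * a) (a - 1) (b - 2) t + mon (C * b * 2 * qe) (a + 2 * qe - 1) (b - 3) t).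
Proof.
move=> t0; have := mon_derive C a b t0; move/is_derive_eq; apply.
rewrite /mon /dll /dkk mulrDl; congr (_ + _).
  have -> : expR ((a - 1) * ll t + (b - 2) * kk t) =
     expR (- ll t - 2 * kk t) * expR (a * ll t + b * kk t).
    by rewrite -expRD; congr expR; ring.
  ring.
have -> : expR ((a + 2 * qe - 1) * ll t + (b - 3) * kk t) =
   expR ((2 * qe - 1) * ll t - 3 * kk t) * expR (a * ll t + b * kk t).
  by rewrite -expRD; congr expR; ring.
ring.
Qed.

(* The bound is an inequality between polynomials in u = exp(2q l) that holds coefficientwise. *)
Lemma time_log_bound t : 0 < t -> t * (62 / 78 * dll t + 2 * dkk t) <= 3 / 2.
Proof.
move=> t0; rewrite -{1}(llK t0).
set u := expR (2 * qe * ll t); have u0 : 0 < u by exact: expR_gt0.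
set s := expR (ll t); have s0 : 0 < s by exact: expR_gt0.
have e1 : expR ((2 * qe + 1) * ll t) = s * u.
  by rewrite /s /u -expRD; congr expR; ring.
have e2 : expR ((4 * qe + 1) * ll t) = s * u ^+ 2.
  by rewrite /s /u -expRM_natl -expRD; congr expR; ring.
have kE : expR (kk t) = 1 + u by rewrite expR_kk.
have d1 : dll t = (s * (1 + u) ^+ 2)^-1.
  by rewrite /dll -kE -expRM_natl -expRD -expRN; congr expR; ring.
have d2 : dkk t = 2 * qe * u / (s * (1 + u) ^+ 3).
  rewrite /dkk -kE -expRM_natl -expRD -expRN -(mulrA (2 * qe)) /u -expRD.
  by congr (_ * expR _); ring.
have u1 : 0 < 1 + u by rewrite addr_gt0.
rewrite /Tm e1 e2 d1 d2 -/s.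
have -> : (s + 2 / (2 * qe + 1) * (s * u) + (4 * qe + 1)^-1 * (s * u ^+ 2)) *
    (62 / 78 * (s * (1 + u) ^+ 2)^-1 + 2 * (2 * qe * u / (s * (1 + u) ^+ 3))) =
   (1 + 156 / 196 * u + 78 / 314 * u ^+ 2) * (62 / 78 + 298 / 78 * u) / (1 + u) ^+ 3.
  by rewrite /qe; field; rewrite !gt_eqF.
rewrite ler_pdivrMr ?exprn_gt0//.
have u2 : 0 <= u ^+ 2 by exact: sqr_ge0.
have u3 : 0 <= u ^+ 3 by rewrite exprn_ge0// ltW.
have -> : (1 + 156 / 196 * u + 78 / 314 * u ^+ 2) * (62 / 78 + 298 / 78 * u) =
  62 / 78 + (298 / 78 + 156 / 196 * (62 / 78)) * u +
  (156 / 196 * (298 / 78) + 78 / 314 * (62 / 78)) * u ^+ 2 + 78 / 314 * (298 / 78) * u ^+ 3 by ring.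
have -> : 3 / 2 * (1 + u) ^+ 3 = 3 / 2 + 9 / 2 * u + 9 / 2 * u ^+ 2 + 3 / 2 * u ^+ 3 by field.
move: (u ^+ 2) (u ^+ 3) u2 u3 u0 => v w; lra.
Qed.

(** Bernoulli's inequality Y^(3/4) <= 1 + 3/4 (Y - 1) for Y = exp y. *)
Lemma exp_concave y : 0 <= y -> expR (3 / 4 * y) <= 1 + 3 / 4 * (expR y - 1).
Proof.
move=> y0.
pose f y : R := 3 / 4 * expR y - expR (3 / 4 * y).
have D s : 0 <= s <= y -> is_derive s (1 : R) f (3 / 4 * expR s - 3 / 4 * expR (3 / 4 * s)).
  move=> _; exact: is_deriveB (is_deriveZ (3 / 4 : R) (is_derive_expR s)) (is_derive_expM _ _).
have P s : 0 <= s <= y -> 0 <= 3 / 4 * expR s - 3 / 4 * expR (3 / 4 * s).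
  by move=> /andP[s0 _]; rewrite subr_ge0 ler_pM2l// ler_expR; lra.
have := mono_derive y0 D P; rewrite /f mulr0 expR0; lra.
Qed.

(** By [time_log_bound], the logarithm of the monomial plus 3/2 ln s is nondecreasing, so its value
    at k is at most (t / k)^(3/2) times that at t; [exp_concave] with Y = (t / k)^2 gives the stated
    form. The bounds on a and b are attained by the coefficient of Z1 at m = 6. *)
Lemma mon_decay (C a b k t : R) : 0 < C -> - a <= 62 / 78 -> - b <= 2 -> 0 < k -> k <= t ->
  mon C a b k <= mon C a b t * (1 + 3 / 4 * ((t / k) ^+ 2 - 1)).
Proof.
move=> C0 ha hb k0 kt; have t0 : 0 < t by exact: lt_le_trans kt.
pose f s : R := (a * ll s + b * kk s) + 3 / 2 * ln s.
have pos s : k <= s <= t -> 0 < s by move=> /andP[ks _]; exact: lt_le_trans ks.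
have D s : k <= s <= t -> is_derive s (1 : R) f ((a * dll s + b * dkk s) + 3 / 2 * s^-1).
  move=> /pos s0.
  exact: is_deriveD (is_deriveD (is_deriveZ a (ll_derive s0)) (is_deriveZ b (kk_derive s0)))
    (is_deriveZ (3 / 2 : R) (is_derive1_ln s0)).
have P s : k <= s <= t -> 0 <= (a * dll s + b * dkk s) + 3 / 2 * s^-1.
  move=> /pos s0; have := time_log_bound s0; rewrite mulrC -ler_pdivlMr// => h.
  have h1 : - (a * dll s) <= 62 / 78 * dll s by rewrite -mulNr ler_pM2r// dll_gt0.
  have h2 : - (b * dkk s) <= 2 * dkk s by rewrite -mulNr ler_pM2r// dkk_gt0.
  by move: h h1 h2; lra.
have := mono_derive kt D P; rewrite /f => h.
have y0 : 0 <= 2 * (ln t - ln k) by rewrite mulr_ge0// subr_ge0 ler_ln.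
have := exp_concave y0.
have -> : expR (2 * (ln t - ln k)) = (t / k) ^+ 2.
  by rewrite expRM_natl expRB !lnK ?posrE.
have -> : 3 / 4 * (2 * (ln t - ln k)) = 3 / 2 * (ln t - ln k) by field.
move=> h2; apply: (@le_trans _ _ (mon C a b t * expR (3 / 2 * (ln t - ln k)))); last first.
  by rewrite ler_pM2l// mulr_gt0 ?expR_gt0.
rewrite /mon -mulrA ler_pM2l// -expRD ler_expR; move: h; lra.
Qed.

End TimeChange.

(** * Smoothness from closure under derivatives *)

Section SmoothFamily.
Variables (R : realType) (W : normedModType R) (G : set (R -> W)).
Hypothesis HG : forall f, G f -> exists2 f', G f' & forall t : R, 0 < t -> is_derive t (1 : R) f (f' t).
Hypothesis GZ : forall f (v : R), G f -> G (fun t => v *: f t).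

Lemma derive_dir (f : R -> W) (t v : R) d : is_derive t (1 : R) f d -> is_derive t v f (v *: d).
Proof.
move=> [df <-]; have df' : differentiable f t by apply/derivable1_diffP.
apply: DeriveDef; first exact: diff_derivable.
rewrite !deriveE// -[v in LHS]mulr1 -[v * 1]/(v *: (1 : R)).
exact: linearZ.
Qed.

(** [is_Ck] differentiates in every direction v, whence the closure under scaling. The induction
    runs over functions that agree with a member of the family for t > 0, as values elsewhere are
    unconstrained. *)
Lemma smooth_family f : G f -> smooth_on (@pos_times R) f.
Proof.
move=> Gf k.
suff : forall f g, G g -> (forall t, 0 < t -> f t = g t) -> is_Ck k (@pos_times R) f.
  by move=> /(_ f f Gf); apply.
have near_pos (t : R) : 0 < t -> \forall s \near t, 0 < s by move=> t0; exact: lt_nbhsr.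
elim: k => [|k IH] {Gf}f g Gg E /=; have [g' Gg' Dg] := HG Gg.
  move=> t t0; have n1 : \forall s \near t, g s = f s.
    by apply: filterS (near_pos t t0) => s s0; rewrite E.
  exact: is_derive_continuous (near_eq_is_derive n1 (Dg t t0)).
have Df (t : R) : 0 < t -> is_derive t (1 : R) f (g' t).
  move=> t0; have n1 : \forall s \near t, g s = f s.
    by apply: filterS (near_pos t t0) => s s0; rewrite E.
  exact: near_eq_is_derive n1 (Dg t t0).
move=> v; split; first by move=> t t0; have [] := derive_dir v (Df t t0).
apply: (IH _ (fun t => v *: g' t)); first exact: GZ.
by move=> t t0; have [_ ->] := derive_dir v (Df t t0).
Qed.

End SmoothFamily.

(** * The diagonal coefficients *)

Section Metric.
Variables (R : realType) (m : R) (n : nat).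
Hypothesis m_bd : 3 <= m <= 6.
Implicit Types (t : R) (i : nat).

(** Twice the exponents p_i. For every m they sum to 2, and al 2 - 2 al 0 = al 5 - 2 al 3 = 2 (q -
    1). *)
Definition al i : R := nth 0 [:: - m / 39; - m / 39; - (2 * m + 19) / 39;
  (29 + m) / 39; (29 + m) / 39; (39 + 2 * m) / 39] i.
Definition be i : R := nth 0 [:: 2; 2; -2; 2; 2; -2] i.
(** The constant 8 q^2 makes a_Z^2 / (a_X^2 a_Y^2) twice the expression computed in [y_eq]. *)
Definition cf i : R := nth 1 [:: 1; 1; 8 * qe R ^+ 2; 1; 1; 8 * qe R ^+ 2] i.
Definition hh i : R -> R := mon (cf i) (al i) (be i).
Definition hmat t : 'M[R]_n := diag_mx (\row_(i < n) hh i t).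

Lemma mP : 3 <= m /\ m <= 6. Proof. by move/andP: m_bd. Qed.

Lemma cf_ge1 i : 1 <= cf i.
Proof.
have q1 : 1 <= 8 * qe R ^+ 2 by rewrite /qe; lra.
by do 6![case: i => [|i] //]; rewrite /cf /= nth_nil.
Qed.

Lemma hh_gt0 i t : 0 < hh i t.
Proof. by rewrite mulr_gt0 ?expR_gt0// (lt_le_trans ltr01)// cf_ge1. Qed.

Lemma al_bd i : - al i <= 62 / 78 /\ al i <= 102 / 78.
Proof.
have [m1 m2] := mP.
by do 6![case: i => [|i]; first by rewrite /al /=; lra]; rewrite /al /= nth_nil; lra.
Qed.

Lemma be_bd i : -2 <= be i /\ be i <= 2.
Proof. by do 6![case: i => [|i]; first by rewrite /be /=; lra]; rewrite /be /= nth_nil; lra. Qed.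

Lemma hh_decay i k t : 0 < k -> k <= t -> hh i k <= hh i t * (1 + 3 / 4 * ((t / k) ^+ 2 - 1)).
Proof.
move=> k0 kt; apply: mon_decay => //; first exact: lt_le_trans ltr01 (cf_ge1 i).
  by have [] := al_bd i.
by have [] := be_bd i; lra.
Qed.

(** Its derivative is at least s^(-9/10) (1 + u)^2, which dominates every 1 / a_i; towards t = 0
    this works because all p_i are below 9/10. [Bh] itself stays bounded there, as the horizon
    estimate requires. *)
Definition Bh t : R := 10 * expR (10^-1 * ll t + 4 * kk t).
Definition bh t : R := (10^-1 * dll t + 4 * dkk t) * Bh t.

Lemma Bh_derive t : 0 < t -> is_derive t (1 : R) Bh (bh t).
Proof. exact: mon_derive. Qed.

Lemma bh_gt0 t : 0 < t -> 0 < bh t.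
Proof.
move=> t0; rewrite mulr_gt0 ?mulr_gt0 ?expR_gt0// addr_gt0// mulr_gt0 ?dll_gt0 ?dkk_gt0//.
Qed.

Lemma hh_bh i t : 0 < t -> 1 <= hh i t * bh t ^+ 2.
Proof.
move=> t0.
have b1 : expR (- (9 / 10) * ll t + 2 * kk t) <= bh t.
  rewrite /bh /Bh [leRHS]mulrDl; apply: (@le_trans _ _ (10^-1 * dll t * (10 * expR (10^-1 * ll t + 4 * kk t)))).
    have -> : 10^-1 * dll t * (10 * expR (10^-1 * ll t + 4 * kk t)) =
      dll t * expR (10^-1 * ll t + 4 * kk t) by field.
    rewrite /dll -expRD le_eqVlt; apply/orP; left; apply/eqP; congr expR; by field.
  have d0 := ltW (dkk_gt0 t); have x0 := expR_ge0 (10^-1 * ll t + 4 * kk t).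
  by rewrite lerDl !mulr_ge0.
have b2 : expR (- (9 / 10) * ll t + 2 * kk t) ^+ 2 <= bh t ^+ 2.
  by rewrite ler_sqr ?nnegrE ?expR_ge0 ?(ltW (bh_gt0 t0)).
have c1 := cf_ge1 i; have h0 := hh_gt0 i t.
apply: (@le_trans _ _ (hh i t * expR (- (9 / 10) * ll t + 2 * kk t) ^+ 2)); last by rewrite ler_pM2l.
rewrite /hh /mon -mulrA -expRM_natl -expRD.
(* For log s <= 0 both terms are nonnegative; for log s > 0 the negative coefficient is compensated
   by [kk_ge]. *)
have E0 : 0 <= (al i * ll t + be i * kk t + 2 * (- (9 / 10) * ll t + 2 * kk t)).
  have k0 := kk_ge0 t; have kl := kk_ge t; have [a1 a2] := al_bd i; have [b3 b4] := be_bd i.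
  have -> : al i * ll t + be i * kk t + 2 * (- (9 / 10) * ll t + 2 * kk t) =
    (al i - 9 / 5) * ll t + (be i + 4) * kk t by field.
  have h1 : 2 * kk t <= (be i + 4) * kk t by rewrite ler_wpM2r//; lra.
  have [l0|l0] := leP (ll t) 0.
    have h2 : 0 <= (al i - 9 / 5) * ll t by rewrite mulr_le0//; lra.
    by move: h1 h2 k0; lra.
  have h2 : (- (62 / 78) - 9 / 5) * ll t <= (al i - 9 / 5) * ll t by rewrite ler_pM2r//; lra.
  by move: h1 h2 kl l0; rewrite /qe; lra.
have e1 : 1 <= expR (al i * ll t + be i * kk t + 2 * (- (9 / 10) * ll t + 2 * kk t)).
  by rewrite -{1}expR0 ler_expR.
apply: le_trans c1 _; apply: ler_peMr e1; exact: le_trans ler01 (cf_ge1 i).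
Qed.

Lemma Bh_bd tau : exists M, forall t, 0 < t <= tau -> `|Bh t| <= M.
Proof.
exists (Bh tau) => t /andP[t0 tt]; rewrite ger0_norm; last by rewrite mulr_ge0// expR_ge0.
have h1 := ll_mono t0 tt; have h2 := kk_mono t0 tt.
have t10 : 0 < 10 :> R by [].
by rewrite (ler_pM2l t10) ler_expR; move: h1 h2; lra.
Qed.

Lemma hh0_infty M : exists2 T0, 0 < T0 & forall t, 0 < t < T0 -> M < hh 0 t.
Proof.
have [m1 m2] := mP.
pose M' := Num.max M 1; have M'0 : 0 < M' by rewrite lt_max ltr01 orbT.
(* The factor 13 = 39 / 3 inverts the slowest rate m / 39, reached at m = 3. *)
exists (expR (- (13 * (ln M' + 1)))); first exact: expR_gt0.
move=> t /andP[t0 tT]; have lt : ll t < - (13 * (ln M' + 1)).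
  by rewrite -ltr_expR; apply: lt_trans tT; exact: ll_lt.
have L0 : 0 <= ln M' by rewrite ln_ge0// le_max lexx orbT.
apply: (@le_lt_trans _ _ M'); first by rewrite le_max lexx.
rewrite -[M' in X in X < _]lnK ?posrE// /hh /mon /= mul1r ltr_expR /al /be /=.
have k0 := kk_ge0 t.
have h : ln M' + 1 < - m / 39 * ll t.
  have h1 : ll t < 0 by move: lt L0; lra.
  have : (- m / 39) * ll t >= (- 3 / 39) * ll t by rewrite ler_wnM2r ?(ltW h1)//; lra.
  by move: lt; lra.
by move: h k0; lra.
Qed.

Definition monsum (f : R -> R) := exists s : seq (R * R * R),
  f = fun t => \sum_(c <- s) mon c.1.1 c.1.2 c.2 t.

Lemma monsum_derive f : monsum f -> exists2 f', monsum f' &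
  forall t, 0 < t -> is_derive t (1 : R) f (f' t).
Proof.
move=> [s ->].
exists (fun t => \sum_(c <- [seq (c.1.1 * c.1.2, c.1.2 - 1, c.2 - 2) | c <- s] ++
    [seq (c.1.1 * c.2 * 2 * qe R, c.1.2 + 2 * qe R - 1, c.2 - 3) | c <- s])
    mon c.1.1 c.1.2 c.2 t); first by eexists.
move=> t t0.
have -> : \sum_(c <- [seq (c.1.1 * c.1.2, c.1.2 - 1, c.2 - 2) | c <- s] ++
    [seq (c.1.1 * c.2 * 2 * qe R, c.1.2 + 2 * qe R - 1, c.2 - 3) | c <- s])
    mon c.1.1 c.1.2 c.2 t = \sum_(c <- s) (mon (c.1.1 * c.1.2) (c.1.2 - 1) (c.2 - 2) t +
      mon (c.1.1 * c.2 * 2 * qe R) (c.1.2 + 2 * qe R - 1) (c.2 - 3) t).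
  by rewrite big_cat !big_map big_split.
elim: s => [|c s IH].
  rewrite big_nil (_ : (fun t => _) = cst 0); first exact: is_derive_cst.
  by apply/funext => x; rewrite big_nil.
rewrite big_cons (_ : (fun t => _) = mon c.1.1 c.1.2 c.2 +
    (fun t => \sum_(c <- s) mon c.1.1 c.1.2 c.2 t)); last first.
  by apply/funext => x; rewrite big_cons.
exact: is_deriveD (mon_derive_mon _ _ _ t0) IH.
Qed.

Lemma monsumZ f (v : R) : monsum f -> monsum (fun t => v * f t).
Proof.
move=> [s ->]; exists [seq (v * c.1.1, c.1.2, c.2) | c <- s].
apply/funext => t; rewrite big_map mulr_sumr; apply: eq_bigr => c _.
by rewrite /mon mulrA.
Qed.

Lemma monsum_mon C a b : monsum (mon C a b).
Proof. by exists [:: (C, a, b)]; apply/funext => t; rewrite big_seq1. Qed.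

Lemma hmat_smooth : smooth_on (@pos_times R) hmat.
Proof.
pose G (f : R -> 'M[R]_n) := forall i j : 'I_n, monsum (fun t => f t i j).
apply: (@smooth_family _ _ G).
- move=> f Gf.
  have /choice[F HF] : forall ij : 'I_n * 'I_n, exists f', monsum f' /\
      forall t, 0 < t -> is_derive t (1 : R) (fun t => f t ij.1 ij.2) (f' t).
    by move=> ij; have [f' ? ?] := monsum_derive (Gf ij.1 ij.2); exists f'.
  exists (fun t => \matrix_(i, j) F (i, j) t).
    move=> i j; have [h _] := HF (i, j); rewrite (_ : (fun t => _) = F (i, j))//.
    by apply/funext => t; rewrite mxE.
  move=> t t0; apply: is_derive_mx => i j; rewrite mxE.
  by have [_] := HF (i, j); apply.
- move=> f v Gf i j; rewrite (_ : (fun t => _) = (fun t => v * f t i j)); first exact: monsumZ.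
  by apply/funext => t; rewrite mxE.
move=> i j; have [ij|ij] := eqVneq i j.
  rewrite (_ : (fun t => _) = hh i); first exact: monsum_mon.
  by apply/funext => t; rewrite !mxE ij eqxx mulr1n.
rewrite (_ : (fun t => _) = mon 0 0 0); first exact: monsum_mon.
by apply/funext => t; rewrite !mxE (negbTE ij) mulr0n /mon mul0r.
Qed.

Lemma phi_smooth (A : R) : smooth_on (@pos_times R) (fun t => A * ll t).
Proof.
pose G (f : R -> R) := monsum f \/ exists v, f = fun t => v * ll t.
apply: (@smooth_family _ R G); last by right; exists A.
- move=> f [/monsum_derive[f' ? ?]|[v ->]]; first by exists f' => //; left.
  exists (mon v (-1) (-2)); first by left; exact: monsum_mon.
  move=> t t0; have := is_deriveZ v (ll_derive t0); move/is_derive_eq; apply.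
  by rewrite /GRing.scale /= /mon /dll; congr (_ * expR _); ring.
- move=> f v [/(monsumZ v)|[w ->]]; first by left.
  by right; exists (v * w); apply/funext => t; rewrite /GRing.scale /= mulrA.
Qed.

Lemma quad_diag (d : 'rV[R]_n) (u : 'rV[R]_n) : quad (diag_mx d) u = \sum_i d 0 i * u 0 i ^+ 2.
Proof.
rewrite /quad mxE; apply: eq_bigr => i _; rewrite mul_mx_diag !mxE; ring.
Qed.

Lemma quad_hmat t u : quad (hmat t) u = \sum_(i < n) hh i t * u 0 i ^+ 2.
Proof. by rewrite quad_diag; apply: eq_bigr => i _; rewrite mxE. Qed.

Lemma hmat_inner t : inner_product (hmat t).
Proof.
split; first by rewrite tr_diag_mx.
move=> u u0; rewrite quad_hmat lt_neqAle eq_sym; apply/andP; split; last first.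
  by apply: sumr_ge0 => i _; rewrite mulr_ge0 ?sqr_ge0// ltW// hh_gt0.
apply: contra u0 => /eqP E; apply/eqP/rowP => i; rewrite [RHS]mxE.
have /eqP := E; rewrite psumr_eq0; last first.
  by move=> j _; rewrite mulr_ge0 ?sqr_ge0// ltW// hh_gt0.
move=> /allP /(_ i (mem_index_enum _)) /eqP /eqP.
by rewrite mulf_eq0 gt_eqF ?hh_gt0//= sqrf_eq0 => /eqP.
Qed.

Lemma sum6 (F : nat -> R) : (6 <= n)%N -> (forall i, (6 <= i)%N -> F i = 0) ->
  \sum_(i < n) F i = F 0%N + F 1%N + F 2%N + F 3%N + F 4%N + F 5%N.
Proof.
move=> n6 F0; rewrite -(big_mkord xpredT F) (big_cat_nat (leq0n 6) n6)/=.
have -> : \sum_(6 <= i < n) F i = 0.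
  by rewrite big_nat_cond big1// => i /andP[/andP[i6 _] _]; exact: F0.
by rewrite addr0 !big_nat_recr //= big_geq// add0r.
Qed.

Lemma hmat_derive t : 0 < t ->
  is_derive t (1 : R) hmat (diag_mx (\row_(i < n) ((al i * dll t + be i * dkk t) * hh i t))).
Proof.
move=> t0; apply: is_derive_mx => i j; rewrite !mxE; have [->|ij] := eqVneq i j.
  rewrite (_ : (fun t => _) = hh j) ?mulr1n; first exact: mon_derive.
  by apply/funext => x; rewrite !mxE eqxx mulr1n.
rewrite (_ : (fun t => _) = cst 0) ?mulr0n; first exact: is_derive_cst.
by apply/funext => x; rewrite !mxE (negbTE ij) mulr0n.
Qed.

Lemma invmx_hmat t : invmx (hmat t) = diag_mx (\row_(i < n) (hh i t)^-1).
Proof.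
have E : hmat t *m diag_mx (\row_(i < n) (hh i t)^-1) = 1%:M.
  by rewrite mulmx_diag; apply/matrixP => i j; rewrite !mxE mulfV ?(lt0r_neq0 (hh_gt0 _ _)).
have [u _] := mulmx1_unit E.
by rewrite -[LHS]mulmx1 -E mulmxA mulVmx// mul1mx.
Qed.

(** The trace is 2 [dll] + 4 [dkk], as [al] sums to 2 and [be] to 4. *)
Lemma hmat_expanding : (6 <= n)%N -> expanding hmat.
Proof.
move=> n6 t t0; rewrite derive1E; have [_ ->] := hmat_derive t0.
rewrite invmx_hmat mulmx_diag mxtrace_diag.
rewrite (eq_bigr (fun i : 'I_n => al i * dll t + be i * dkk t)); last first.
  by move=> i _; rewrite !mxE mulrCA mulVf ?mulr1// gt_eqF ?hh_gt0.
rewrite (sum6 (F := fun i => al i * dll t + be i * dkk t))//; last first.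
  by do 6![case=> [//|]]; move=> i _; rewrite /al /be /= !nth_nil !mul0r addr0.
have h1 := dll_gt0 t; have h2 := dkk_gt0 t; rewrite /al /be /=.
move: (dll t) (dkk t) h1 h2 => x y x0 y0.
rewrite [X in 0 < X](_ : _ = 2 * x + 4 * y); last by field.
by rewrite addr_gt0// mulr_gt0.
Qed.

End Metric.

(** * Curvature of diagonal left-invariant families *)

Section MatrixDerivatives.
Variable R : realType.
Implicit Types (r s : R).

Lemma is_derive_bigsum (I : Type) (e : seq I) (f : I -> R -> R) (df : I -> R) s :
  (forall i, is_derive s (1 : R) (f i) (df i)) ->
  is_derive s (1 : R) (fun r => \sum_(i <- e) f i r) (\sum_(i <- e) df i).
Proof.
move=> Hf; elim: e => [|i e IH].
  rewrite big_nil (_ : (fun r => _) = cst 0); first exact: is_derive_cst.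
  by apply/funext => x; rewrite big_nil.
rewrite big_cons (_ : (fun r => _) = f i + (fun r => \sum_(i <- e) f i r)); last first.
  by apply/funext => x; rewrite big_cons.
exact: is_deriveD.
Qed.

Lemma is_derive_mul (f g : R -> R) (df dg : R) s :
  is_derive s (1 : R) f df -> is_derive s (1 : R) g dg ->
  is_derive s (1 : R) (fun r => f r * g r) (df * g s + f s * dg).
Proof.
move=> d1 d2; have := is_deriveM d1 d2; move/is_derive_eq; apply.
by rewrite /GRing.scale /= addrC (mulrC df).
Qed.

Lemma is_derive_mulmx2 a b c (A : R -> 'M[R]_(a, b)) (B : R -> 'M[R]_(b, c)) dA dB s :
  is_derive s (1 : R) A dA -> is_derive s (1 : R) B dB ->
  is_derive s (1 : R) (fun r => A r *m B r) (dA *m B s + A s *m dB).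
Proof.
move=> d1 d2; apply: is_derive_mx => i j.
rewrite (_ : (fun r => _) = (fun r => \sum_k A r i k * B r k j)); last first.
  by apply/funext => r; rewrite mxE.
rewrite mxE [X in X + _]mxE [X in _ + X]mxE -big_split /=.
by apply: is_derive_bigsum => k; apply: is_derive_mul; exact: is_derive_coord.
Qed.

Lemma is_derive_diag n (f : 'I_n -> R -> R) (df : 'I_n -> R) s :
  (forall i, is_derive s (1 : R) (f i) (df i)) ->
  is_derive s (1 : R) (fun r => diag_mx (\row_i f i r)) (diag_mx (\row_i df i)).
Proof.
move=> Hf; apply: is_derive_mx => i j; rewrite !mxE; have [->|ij] := eqVneq i j.
  rewrite (_ : (fun r => _) = f j) ?mulr1n//.
  by apply/funext => x; rewrite !mxE eqxx mulr1n.
rewrite (_ : (fun r => _) = cst 0) ?mulr0n; first exact: is_derive_cst.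
by apply/funext => x; rewrite !mxE (negbTE ij) mulr0n.
Qed.

Lemma is_derive_affine a b (A W : 'M[R]_(a, b)) s :
  is_derive s (1 : R) (fun r => A + r *: W) W.
Proof.
apply: is_derive_mx => i j.
rewrite (_ : (fun r => _) = cst (A i j) + (fun r => r * W i j)).
  by have := is_deriveD (is_derive_cst (A i j) s (1 : R)) (is_derive_mulr (W i j) s); rewrite add0r.
by apply/funext => r; rewrite !mxE.
Qed.

End MatrixDerivatives.

(** * Partial derivatives in the coordinates (t, x) *)

Section Partials.
Variables (R : realType) (n : nat).
Local Notation V := 'rV[R]_(1 + n).
Local Notation o0 := (lshift n (0 : 'I_1)).
Implicit Types (p q : V).

Lemma partial_line (f : V -> R) p i d :
  is_derive (0 : R) (1 : R) (fun r : R => f (p + r *: delta_mx 0 i)) d -> partial i f p = d.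
Proof.
move=> [_ <-]; rewrite /partial /derive.
suff -> : (fun h : R => h^-1 *: ((f \o shift p) (h *: delta_mx 0 i) - f p)) =
  (fun h : R => h^-1 *: (((fun r : R => f (p + r *: delta_mx 0 i)) \o shift (0 : R)) (h *: (1 : R)) -
     f (p + 0 *: delta_mx 0 i))) by [].
apply/funext => h /=; have -> : h%:A = h :> R by exact: mulr1.
by rewrite addr0 scale0r addr0 (addrC p).
Qed.

Lemma delta_t : delta_mx 0 o0 = mk 1 0 :> V.
Proof.
apply/rowP => j; rewrite mxE eqxx /=; have [->|[k ->]] := ord_tx j.
  by rewrite eqxx -tcoordE tcoord_mk.
by rewrite eq_rlshift -rsubmxE rsubmx_mk mxE.
Qed.

Lemma delta_x i : delta_mx 0 (rshift 1 i) = mk 0 (delta_mx 0 i) :> V.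
Proof.
apply/rowP => j; rewrite mxE eqxx /=; have [->|[k ->]] := ord_tx j.
  by rewrite eq_lrshift -tcoordE tcoord_mk.
by rewrite eq_rshift -rsubmxE rsubmx_mk mxE eqxx.
Qed.

Variables (f : V -> R) (F : R -> 'rV[R]_n -> R).
Hypothesis fF : forall q, half_space q -> f q = F (tcoord q) (rsubmx q).

Lemma partial_t p d : half_space p ->
  is_derive (tcoord p) (1 : R) (fun t => F t (rsubmx p)) d -> partial o0 f p = d.
Proof.
move=> hp D; apply: partial_line; rewrite delta_t.
have D0 : is_derive (0 : R) (1 : R) (fun r : R => F (tcoord p + r) (rsubmx p)) d.
  have d1 : is_derive (0 : R) (1 : R) (fun r : R => tcoord p + r) 1.
    have := is_deriveD (is_derive_cst (tcoord p) (0 : R) (1 : R)) (is_derive_id (0 : R) (1 : R)).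
    by move/is_derive_eq; apply; rewrite add0r.
  have D' : is_derive ((fun r : R => tcoord p + r) 0) (1 : R) (fun t => F t (rsubmx p)) d by rewrite addr0.
  have := @is_derive1_comp R (fun t => F t (rsubmx p)) (fun r => tcoord p + r) 0 _ _ D' d1.
  by rewrite mulr1.
apply: near_eq_is_derive D0.
have nh : \forall r \near (0 : R), 0 < tcoord p + r.
  have cc : {for (0 : R), continuous (fun r : R => tcoord p + r)}.
    exact: is_derive_continuous (is_deriveD (is_derive_cst (tcoord p) (0 : R) (1 : R)) (is_derive_id (0 : R) (1 : R))).
  by apply: (cvgr_gt _ cc); rewrite addr0.
apply: filterS nh => r hr; rewrite fF /half_space /= !txE ?mulr1 ?scaler0 ?addr0//.
Qed.

Lemma partial_x p i d : half_space p ->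
  is_derive (0 : R) (1 : R) (fun r : R => F (tcoord p) (rsubmx p + r *: delta_mx 0 i)) d ->
  partial (rshift 1 i) f p = d.
Proof.
move=> hp D; apply: partial_line; rewrite delta_x.
suff -> : (fun r : R => f (p + r *: mk 0 (delta_mx 0 i))) =
  (fun r : R => F (tcoord p) (rsubmx p + r *: delta_mx 0 i)) by [].
by apply/funext => r; rewrite fF /half_space /= !txE mulr0 addr0.
Qed.

End Partials.

(** * Christoffel symbols and Ricci tensor *)

Section LeftInvariantMetric.
Variables (R : realType) (n : nat) (L : two_step R n).
Local Notation V := 'rV[R]_(1 + n).
Local Notation c := (sconst L).
Implicit Types (x y : 'rV[R]_n) (t r : R).

(** The matrix of v -> [x, v] / 2 on rows. It squares to 0, so [Jm], the differential of translation
    by the inverse of x, has inverse [Em]. *)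
Definition Nm x : 'M[R]_n := \matrix_(j, a) (2^-1 * \sum_i c i j a * x 0 i).
Definition Jm x : 'M[R]_n := 1%:M - Nm x.
Definition Em x : 'M[R]_n := 1%:M + Nm x.

Lemma mul_Nm x v : v *m Nm x = 2^-1 *: bracket L x v.
Proof.
apply/rowP => k; rewrite !mxE exchange_big mulr_sumr; apply: eq_bigr => j _ /=.
rewrite !mxE mulrCA; congr (_ * _); rewrite mulr_sumr; apply: eq_bigr => i _.
by rewrite mulrC.
Qed.

Lemma jacobian_gmul x : jacobian (gmul L (- x)) x = Jm x.
Proof.
have E y : gmul L (- x) y = - x + y *m Jm x.
  by rewrite /gmul -addrA /Jm mulmxBr mulmx1 mul_Nm bracketNl scalerN.
have D : differentiable (gmul L (- x)) x.
  have -> : gmul L (- x) = cst (- x) + (fun y => y *m Jm x) by apply/funext => y; rewrite E.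
  apply: differentiableD; first exact: differentiable_cst.
  by apply: linear_diff => a u v; rewrite mulmxDl scalemxAl.
apply/row_matrixP => i; rewrite !rowE.
apply: etrans (esym (deriveEjacobian (delta_mx 0 i) D)) _.
have := is_derive_line (q := x) (s := 0) (w := delta_mx 0 i) (f := gmul L (- x)).
rewrite scale0r addr0 => /(_ (diff_derivable D)) [_ <-].
have d0 := is_derive_affine x (delta_mx 0 i) (0 : R).
have d1 := is_derive_mulmx (Jm x) d0.
have := is_deriveD (is_derive_cst (- x) (0 : R) (1 : R)) d1.
rewrite add0r => d2; rewrite (_ : (fun r : R => _) =
  cst (- x) + (fun r : R => (x + r *: delta_mx 0 i) *m Jm x)); first by case: d2.
by apply/funext => r; exact: E.
Qed.

Hypothesis cN : forall i j a, c i j a = - c j i a.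
Hypothesis c0 : forall i b a j k, c i b a * c j k b = 0.
Hypothesis cD : forall a d b e, a != d -> c b e a * c b e d = 0.
Hypothesis cE : forall i j b d, i != j -> c i b d * c j b d = 0.

Lemma c0' i b a j k : c b i a * c j k b = 0.
Proof. by rewrite cN mulNr c0 oppr0. Qed.

Lemma c00 i a : c i a a = 0.
Proof. by have /eqP := c0 i a a i a; rewrite mulf_eq0 orbb => /eqP. Qed.

Lemma c00' i a : c a i a = 0.
Proof. by rewrite cN c00 oppr0. Qed.

Lemma cii i a : c i i a = 0.
Proof.
have /eqP := cN i i a; rewrite -addr_eq0 -mulr2n mulrn_eq0 => /eqP; by [].
Qed.

(** The a-th component of the bracket as a bilinear form. *)
Definition Cm a : 'M[R]_n := \matrix_(i, b) c i b a.

Lemma Nm_delta m i a : Nm (delta_mx 0 m) i a = 2^-1 * c m i a.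
Proof.
rewrite mxE (bigD1 m)//= big1 => [|k km]; first by rewrite mxE !eqxx mulr1 addr0.
by rewrite mxE eqxx (negbTE km) mulr0.
Qed.

Lemma Nm_mul x y : Nm x *m Nm y = 0.
Proof.
apply/matrixP => i j; rewrite !mxE big1// => k _; rewrite !mxE mulrACA.
rewrite mulr_suml big1 ?mulr0// => p _; rewrite mulr_sumr big1// => r _.
by rewrite mulrACA [c p i k * _]mulrC c0 mul0r.
Qed.

Lemma Nm_Cm x a : Nm x *m Cm a = 0.
Proof.
apply/matrixP => i j; rewrite !mxE big1// => k _; rewrite !mxE -mulrA mulr_suml.
by rewrite big1 ?mulr0// => p _; rewrite mulrAC [c p i k * _]mulrC c0' mul0r.
Qed.

Lemma JmEm x : Jm x *m Em x = 1%:M.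
Proof. by rewrite mulmxBl !mulmxDr !mulmx1 !mul1mx Nm_mul addr0 addrK. Qed.

Lemma EmJm x : Em x *m Jm x = 1%:M.
Proof. by rewrite mulmxDl !mulmxBr !mulmx1 !mul1mx Nm_mul subr0 subrK. Qed.

Lemma EmCm x a : Em x *m Cm a = Cm a.
Proof. by rewrite mulmxDl mul1mx Nm_Cm addr0. Qed.

Lemma NmD x y (r : R) : Nm (x + r *: y) = Nm x + r *: Nm y.
Proof.
apply/matrixP => j a; rewrite !mxE mulrCA -mulrDr; congr (_ * _).
rewrite mulr_sumr -big_split; apply: eq_bigr => i _ /=; rewrite !mxE; ring.
Qed.

Lemma Jm_line x y : (fun r : R => Jm (x + r *: y)) = fun r => Jm x + r *: - Nm y.
Proof. by apply/funext => r; rewrite /Jm NmD scalerN opprD addrA. Qed.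

Lemma Em_line x y : (fun r : R => Em (x + r *: y)) = fun r => Em x + r *: Nm y.
Proof. by apply/funext => r; rewrite /Em NmD addrA. Qed.

Lemma Jm_derive x y : is_derive (0 : R) (1 : R) (fun r : R => Jm (x + r *: y)) (- Nm y).
Proof. rewrite Jm_line; exact: is_derive_affine. Qed.

Lemma Em_derive x y : is_derive (0 : R) (1 : R) (fun r : R => Em (x + r *: y)) (Nm y).
Proof. rewrite Em_line; exact: is_derive_affine. Qed.

Variables h hd hdd : 'I_n -> R -> R.
Hypothesis h_gt0 : forall i t, 0 < t -> 0 < h i t.
Hypothesis h_d : forall i (t : R), 0 < t -> is_derive t (1 : R) (h i) (hd i t).
Hypothesis hd_d : forall i (t : R), 0 < t -> is_derive t (1 : R) (hd i) (hdd i t).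

(** The expansion rate a_i' / a_i, with h_i = a_i^2. *)
Definition rr i t : R := hd i t / (2 * h i t).

Local Notation hm := (fun t : R => diag_mx (\row_i h i t) : 'M[R]_n).
Local Notation g := (st_metric L hm).
Local Notation Dh t := (diag_mx (\row_i h i t)).
Local Notation Dv t := (diag_mx (\row_i (h i t)^-1)).
Local Notation Dd t := (diag_mx (\row_i hd i t)).
Local Notation Dr t := (diag_mx (\row_i rr i t)).
Local Notation o0 := (lshift n (0 : 'I_1)).
Local Notation sp := (rshift 1).
Local Notation e_ := (delta_mx (0 : 'I_1)).

Implicit Types (p q : V) (m i j k l a b d : 'I_n).

Lemma gE p : g p = block_mx (-1)%:M 0 0 (Jm (rsubmx p) *m Dh (tcoord p) *m (Jm (rsubmx p))^T).
Proof. by rewrite /st_metric /left_invariant jacobian_gmul. Qed.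

Lemma Dhv t : 0 < t -> Dh t *m Dv t = 1%:M.
Proof.
move=> t0; rewrite mulmx_diag; apply/matrixP => i j.
by rewrite !mxE mulfV// lt0r_neq0// h_gt0.
Qed.

Definition ginv t x : 'M[R]_n := (Em x)^T *m Dv t *m Em x.

Lemma ginvE p : half_space p -> invmx (g p) = block_mx (-1)%:M 0 0 (ginv (tcoord p) (rsubmx p)).
Proof.
move=> hp.
have E : g p *m block_mx (-1)%:M 0 0 (ginv (tcoord p) (rsubmx p)) = 1%:M.
  rewrite gE mulmx_block !mul0mx !mulmx0 !addr0 !add0r /ginv.
  have -> : (-1)%:M *m (-1)%:M = 1%:M :> 'M[R]_1 by rewrite -scalar_mxM mulrNN mulr1.
  rewrite !mulmxA -(mulmxA _ (Jm _)^T) -trmx_mul EmJm trmx1 mulmx1.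
  by rewrite -(mulmxA _ _ (Dv _)) Dhv// mulmx1 JmEm -scalar_mx_block.
have [u _] := mulmx1_unit E.
by rewrite -[LHS]mulmx1 -E mulmxA mulVmx// mul1mx.
Qed.

Lemma g00 p : g p o0 o0 = -1. Proof. by rewrite gE block_mxEul mxE eqxx. Qed.
Lemma g0x p j : g p o0 (sp j) = 0. Proof. by rewrite gE block_mxEur mxE. Qed.
Lemma gx0 p j : g p (sp j) o0 = 0. Proof. by rewrite gE block_mxEdl mxE. Qed.
Definition gs t x : 'M[R]_n := Jm x *m Dh t *m (Jm x)^T.
Lemma gxx p i j : g p (sp i) (sp j) = gs (tcoord p) (rsubmx p) i j.
Proof. by rewrite gE block_mxEdr. Qed.

Lemma partial_cst (m : 'I_(1 + n)) (f : V -> R) p (a : R) : (forall q, f q = a) -> partial m f p = 0.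
Proof.
move=> fa; rewrite (_ : f = cst a); last by apply/funext => q; rewrite fa.
by rewrite /partial derive_cst.
Qed.

Lemma gs_t i j p : half_space p ->
  partial o0 (fun q => g q (sp i) (sp j)) p =
  (Jm (rsubmx p) *m Dd (tcoord p) *m (Jm (rsubmx p))^T) i j.
Proof.
move=> hp; apply: (@partial_t R n _ (fun t x => gs t x i j)) => //; first by move=> q _; exact: gxx.
apply: is_derive_coord.
have d1 := is_derive_diag (fun i => h_d i hp).
have d2 := is_derive_mulmx2 (is_derive_cst (Jm (rsubmx p)) (tcoord p) (1 : R)) d1.
have d3 := is_derive_mulmx2 d2 (is_derive_cst (Jm (rsubmx p))^T (tcoord p) (1 : R)).
move: d3; rewrite /= !(mul0mx, add0r, mulmx0, addr0); exact.
Qed.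

Lemma gs_x m i j p : half_space p ->
  partial (sp m) (fun q => g q (sp i) (sp j)) p =
  - 2^-1 * \sum_a h a (tcoord p) *
    (c m i a * Jm (rsubmx p) j a + Jm (rsubmx p) i a * c m j a).
Proof.
move=> hp; apply: (@partial_x R n _ (fun t x => gs t x i j)) => //; first by move=> q _; exact: gxx.
have JE (r : R) y : (Jm (rsubmx p + r *: y))^T = (Jm (rsubmx p))^T + r *: - (Nm y)^T.
  have := congr1 (fun f => f r) (Jm_line (rsubmx p) y) => /= ->.
  by rewrite linearD /= linearZ /= linearN.
have d1 := Jm_derive (rsubmx p) (e_ m).
have d2 : is_derive (0 : R) (1 : R) (fun r : R => (Jm (rsubmx p + r *: e_ m))^T) (- (Nm (e_ m))^T).
  rewrite (_ : (fun r => _) = (fun r => (Jm (rsubmx p))^T + r *: - (Nm (e_ m))^T)).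
    exact: is_derive_affine.
  by apply/funext => r; exact: JE.
have d3 := is_derive_mulmx2 d1 (is_derive_cst (Dh (tcoord p)) (0 : R) (1 : R)).
have d4 := is_derive_mulmx2 d3 d2.
have := is_derive_coord i j d4; move/is_derive_eq; apply.
rewrite mulmx0 addr0 scale0r addr0 !mulNmx mulmxN.
have S (A B : 'M[R]_n) : (A *m Dh (tcoord p) *m B^T) i j =
    \sum_a h a (tcoord p) * (A i a * B j a).
  by rewrite mxE; apply: eq_bigr => a _; rewrite mul_mx_diag !mxE; ring.
rewrite /cst 2![in LHS]mxE [X in _ + X]mxE !S mulr_sumr -!sumrN -big_split /=.
by apply: eq_bigr => a _; rewrite !Nm_delta; ring.
Qed.

(** The bracket form with its second index raised; the spatial Christoffel symbols [Gs] are bilinear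
    in it and [Jm]. [G0] and [Wm] carry the second fundamental form with lower and with mixed
    indices. *)
Definition Mm a t x : 'M[R]_n := Cm a *m Dv t *m Em x.
Definition G0 t x : 'M[R]_n := 2^-1 *: (Jm x *m Dd t *m (Jm x)^T).
Definition Wm t x : 'M[R]_n := Jm x *m Dr t *m Em x.
Definition Gs t x i j k : R := - 2^-1 * \sum_a h a t *
  (Mm a t x i k * Jm x j a + Mm a t x j k * Jm x i a).

Lemma chr0 p (i j : 'I_(1 + n)) : half_space p ->
  christoffel g o0 i j p = - 2^-1 * (partial i (fun q => g q j o0) p
    + partial j (fun q => g q i o0) p - partial o0 (fun q => g q i j) p).
Proof.
move=> hp; rewrite /christoffel ginvE// big_split_ord /= big_ord1 block_mxEul mxE eqxx.
rewrite big1; first by rewrite addr0 mulr1n mulN1r mulrN mulNr.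
by move=> l _; rewrite block_mxEur mxE mul0r.
Qed.

Lemma chrx p k (i j : 'I_(1 + n)) : half_space p ->
  christoffel g (sp k) i j p = 2^-1 * \sum_l ginv (tcoord p) (rsubmx p) k l *
   (partial i (fun q => g q j (sp l)) p
    + partial j (fun q => g q i (sp l)) p - partial (sp l) (fun q => g q i j) p).
Proof.
move=> hp; rewrite /christoffel ginvE// big_split_ord /= big_ord1 block_mxEdl mxE mul0r add0r.
by congr (_ * _); apply: eq_bigr => l _; rewrite block_mxEdr.
Qed.

Let p00 (m : 'I_(1 + n)) p : partial m (fun q => g q o0 o0) p = 0.
Proof. by apply: partial_cst => q; exact: g00. Qed.
Let p0x (m : 'I_(1 + n)) p j : partial m (fun q => g q o0 (sp j)) p = 0.
Proof. by apply: partial_cst => q; exact: g0x. Qed.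
Let px0 (m : 'I_(1 + n)) p j : partial m (fun q => g q (sp j) o0) p = 0.
Proof. by apply: partial_cst => q; exact: gx0. Qed.

Lemma chr_000 p : half_space p -> christoffel g o0 o0 o0 p = 0.
Proof. by move=> hp; rewrite chr0// !p00 !addr0 subr0 mulr0. Qed.
Lemma chr_00x p j : half_space p -> christoffel g o0 o0 (sp j) p = 0.
Proof. by move=> hp; rewrite chr0// p00 p0x px0 !addr0 subr0 mulr0. Qed.
Lemma chr_0x0 p j : half_space p -> christoffel g o0 (sp j) o0 p = 0.
Proof. by move=> hp; rewrite chr0// p00 px0 !addr0 subr0 mulr0. Qed.
Lemma chr_0xx p i j : half_space p ->
  christoffel g o0 (sp i) (sp j) p = G0 (tcoord p) (rsubmx p) i j.
Proof. by move=> hp; rewrite chr0// !px0 gs_t// add0r sub0r mulrNN [RHS]mxE. Qed.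
Lemma chr_x00 p k : half_space p -> christoffel g (sp k) o0 o0 p = 0.
Proof.
move=> hp; rewrite chrx// big1 ?mulr0// => l _.
by rewrite p00 !p0x addr0 subr0 mulr0.
Qed.

Lemma ginv_tr t x : (ginv t x)^T = ginv t x.
Proof. by rewrite /ginv !trmx_mul trmxK tr_diag_mx mulmxA. Qed.

Lemma ginvC t x k l : ginv t x k l = ginv t x l k.
Proof. by rewrite -{1}ginv_tr mxE. Qed.

Lemma WmE t x : 0 < t -> 2^-1 *: (Jm x *m Dd t *m (Jm x)^T *m ginv t x) = Wm t x.
Proof.
move=> t0; rewrite /ginv /Wm !mulmxA -(mulmxA _ (Jm _)^T) -trmx_mul EmJm trmx1 mulmx1.
rewrite -(mulmxA _ (Dd t)) mulmx_diag scalemxAl scalemxAr; congr (_ *m _ *m _).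
apply/matrixP => i j; rewrite !mxE mulrnAr; congr (_ *+ _); rewrite /rr invfM; ring.
Qed.

Lemma chr_x0x p k j : half_space p ->
  christoffel g (sp k) o0 (sp j) p = Wm (tcoord p) (rsubmx p) j k.
Proof.
move=> hp; rewrite chrx// -WmE// mxE mxE; congr (_ * _); apply: eq_bigr => l _.
by rewrite gs_t// !p0x addr0 subr0 mulrC ginvC.
Qed.

Lemma chr_xx0 p k j : half_space p ->
  christoffel g (sp k) (sp j) o0 p = Wm (tcoord p) (rsubmx p) j k.
Proof.
move=> hp; rewrite chrx// -WmE// mxE mxE; congr (_ * _); apply: eq_bigr => l _.
by rewrite gs_t// !p0x px0 add0r subr0 mulrC ginvC.
Qed.

Lemma chr_xxx p k i j : half_space p ->
  christoffel g (sp k) (sp i) (sp j) p = Gs (tcoord p) (rsubmx p) i j k.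
Proof.
move=> hp; rewrite chrx//.
set t := tcoord p; set x := rsubmx p.
have E l : partial (sp i) (fun q => g q (sp j) (sp l)) p
    + partial (sp j) (fun q => g q (sp i) (sp l)) p
    - partial (sp l) (fun q => g q (sp i) (sp j)) p =
    - \sum_a h a t * (c i l a * Jm x j a + c j l a * Jm x i a).
  rewrite !gs_x// -/t -/x -mulrDr -mulrBr -big_split -sumrB /= mulr_sumr -sumrN.
  apply: eq_bigr => a _; rewrite (cN j i) (cN l i) (cN l j).
  by move: (Jm x l a) (Jm x i a) (Jm x j a) (c i j a) (c i l a) (c j l a) (h a t) => *; field.
under eq_bigr do rewrite E mulrN.
rewrite sumrN mulrN -mulNr /Gs; congr (_ * _).
have M a b : \sum_l ginv t x k l * c b l a = Mm a t x b k.
  have : (Cm a *m ginv t x) b k = Mm a t x b k.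
    have -> : Cm a *m ginv t x = Mm a t x => //.
    rewrite /ginv /Mm !mulmxA; congr (_ *m _ *m _).
    apply/matrixP => u v; rewrite /Em linearD /= trmx1 mulmxDr mulmx1 [LHS]mxE.
    rewrite [X in _ + X]mxE big1 ?addr0// => w _; rewrite !mxE.
    by rewrite mulrCA mulr_sumr big1 ?mulr0// => z _; rewrite mulrA c0 mul0r.
  move=> <-; rewrite mxE; apply: eq_bigr => l _.
  by rewrite mulrC [Cm a b l]mxE ginvC.
under eq_bigr do rewrite mulr_sumr.
rewrite exchange_big; apply: eq_bigr => a _ /=.
rewrite -!M !mulr_suml -big_split mulr_sumr; apply: eq_bigr => l _ /=; ring.
Qed.

Lemma MmJm a t x : Mm a t x *m Jm x = Cm a *m Dv t.
Proof. by rewrite /Mm -mulmxA EmJm mulmx1. Qed.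

Lemma CmDv a t i b : (Cm a *m Dv t) i b = c i b a / h b t.
Proof. by rewrite mul_mx_diag !mxE. Qed.

Lemma tr_Mm a t x : \tr (Mm a t x) = 0.
Proof.
rewrite /Mm mxtrace_mulC !mulmxA EmCm /mxtrace big1// => i _.
by rewrite CmDv cii mul0r.
Qed.

(** This trace is the logarithmic derivative of the volume density along x, which is constant
    because the group is unimodular. *)
Lemma trace_Gs t x i : \sum_k Gs t x i k k = 0.
Proof.
rewrite -mulr_sumr exchange_big big1 ?mulr0//= => a _.
rewrite -mulr_sumr big_split /= -mulr_suml -/(\tr (Mm a t x)) tr_Mm mul0r addr0.
have -> : \sum_k Mm a t x i k * Jm x k a = (Mm a t x *m Jm x) i a by rewrite mxE.
by rewrite MmJm CmDv c00 mul0r mulr0.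
Qed.

Lemma trace_Wm t x : \tr (Wm t x) = \sum_a rr a t.
Proof.
rewrite /Wm mxtrace_mulC !mulmxA EmJm mul1mx mxtrace_diag.
by apply: eq_bigr => a _; rewrite mxE.
Qed.

Lemma divergence_free (F : 'I_n -> R -> R) (C : R -> R) (s d : R) :
  (forall k, derivable (F k) s 1) -> (forall r, \sum_k F k r = C r) ->
  is_derive s (1 : R) C d -> \sum_k 'D_1 (F k) s = d.
Proof.
move=> H HC [_ <-].
have D := is_derive_bigsum (index_enum 'I_n) (fun k => DeriveDef (H k) erefl).
have -> : C = fun r => \sum_k F k r by apply/funext => r; rewrite HC.
by case: D => _ ->.
Qed.

Lemma Mm_line a t x y : is_derive (0 : R) (1 : R) (fun r : R => Mm a t (x + r *: y))
  (Cm a *m Dv t *m Nm y).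
Proof.
have := is_derive_mulmx2 (is_derive_cst (Cm a *m Dv t) (0 : R) (1 : R)) (Em_derive x y).
by rewrite /= mul0mx add0r.
Qed.

Definition dGs t x i j k (y : 'rV[R]_n) : R := - 2^-1 * \sum_a h a t *
  (((Cm a *m Dv t *m Nm y) i k * Jm x j a + Mm a t x i k * (- Nm y j a)) +
   ((Cm a *m Dv t *m Nm y) j k * Jm x i a + Mm a t x j k * (- Nm y i a))).

Lemma Gs_line t x y i j k : is_derive (0 : R) (1 : R) (fun r : R => Gs t (x + r *: y) i j k)
  (dGs t x i j k y).
Proof.
apply: is_deriveZ; apply: is_derive_bigsum => a.
have dM u v := is_derive_coord u v (Mm_line a t x y).
have dJ u v := is_derive_coord u v (Jm_derive x y).
have := is_deriveZ (h a t) (is_deriveD (is_derive_mul (dM i k) (dJ j a)) (is_derive_mul (dM j k) (dJ i a))).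
by rewrite scale0r addr0 ![(- Nm y) _ _]mxE.
Qed.

Lemma divergence_Gs t x i j : \sum_k dGs t x i j k (e_ k) =
  - 2^-1 * \sum_a \sum_b h a t / h b t * (c i b a * c j b a).
Proof.
rewrite /dGs -mulr_sumr exchange_big; congr (_ * _); apply: eq_bigr => a _ /=.
have E1 u k : (Cm a *m Dv t *m Nm (e_ k)) u k = 0.
  by rewrite mxE big1// => b _; rewrite Nm_delta c00' !mulr0.
have E2 u v : \sum_k Mm a t x u k * - Nm (e_ k) v a =
    2^-1 * \sum_b c u b a * c v b a / h b t.
  have -> : \sum_k Mm a t x u k * - Nm (e_ k) v a = - 2^-1 * (Mm a t x *m Cm a) u v.
    rewrite mxE mulr_sumr; apply: eq_bigr => k _; rewrite Nm_delta [Cm a k v]mxE; ring.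
  rewrite /Mm -mulmxA EmCm mxE mulNr -mulrN -sumrN; congr (_ * _); apply: eq_bigr => b _.
  by rewrite CmDv [Cm a b v]mxE (cN b v) mulrN opprK mulrAC.
transitivity (h a t * (\sum_k Mm a t x i k * - Nm (e_ k) j a + \sum_k Mm a t x j k * - Nm (e_ k) i a)).
  rewrite -big_split mulr_sumr; apply: eq_bigr => k _ /=.
  by rewrite (E1 i) (E1 j) !mul0r !add0r.
rewrite !E2.
have -> : \sum_b c j b a * c i b a / h b t = \sum_b c i b a * c j b a / h b t.
  by apply: eq_bigr => b _; rewrite (mulrC (c j b a)).
have -> : 2^-1 * \sum_b c i b a * c j b a / h b t + 2^-1 * \sum_b c i b a * c j b a / h b t =
   \sum_b c i b a * c j b a / h b t by field.
rewrite mulr_sumr; apply: eq_bigr => b _; ring.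
Qed.

Lemma col_mulmx (A B : 'M[R]_n) a : A *m col a B = col a (A *m B).
Proof. by rewrite !colE mulmxA. Qed.

(** In its two contracted indices [Gs] is a combination of the matrices [B a i], so the double sum
    is a combination of traces of products. By [c0] only products of two [Mm] survive, and [cD]
    removes those with a <> d. *)
Lemma quadratic_Gs t x i j : \sum_k \sum_l Gs t x j l k * Gs t x i k l =
  - 4^-1 * \sum_a Jm x i a * Jm x j a * h a t ^+ 2 *
    \sum_b \sum_e c b e a ^+ 2 / (h b t * h e t).
Proof.
pose B a i : 'M[R]_n := col a (Jm x) *m row i (Mm a t x) + Jm x i a *: Mm a t x.
have GB u k l : Gs t x u k l = - 2^-1 * \sum_a h a t * B a u k l.
  rewrite /Gs; congr (_ * _); apply: eq_bigr => a _; rewrite !mxE big_ord1 !mxE; ring.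
have trc a u (P Y : 'M[R]_n) : \tr (col a (Jm x) *m row u P *m Y) = (P *m Y *m Jm x) u a.
  rewrite -mulmxA mxtrace_mulC -row_mul -row_mul col_mulmx /mxtrace big_ord1.
  by move: (P *m Y *m Jm x) => Z; rewrite !mxE.
have T a d : \tr (B a j *m B d i) = Jm x i d * Jm x j a *
    - (\sum_b \sum_e c b e a * c b e d / (h b t * h e t)).
  rewrite /B mulmxDl !mulmxDr -!scalemxAr -!scalemxAl !mxtraceD !mxtraceZ !trc.
  have -> : (Mm a t x *m (col d (Jm x) *m row i (Mm d t x)) *m Jm x) j a = 0.
    rewrite mulmxA col_mulmx -mulmxA -row_mul !MmJm.
    have cr (P Q : 'M[R]_n) : (col d P *m row i Q) j a = P j d * Q i a by rewrite mxE big_ord1 !mxE.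
    by rewrite cr !CmDv mulrACA (mulrC (c j d a)) c0 mul0r.
  have Z a' d' u v : (Mm a' t x *m Mm d' t x *m Jm x) u v = \sum_b c u b a' * c b v d' / (h b t * h v t).
    rewrite -mulmxA MmJm /Mm -(mulmxA _ (Em x)) (mulmxA (Em x)) EmCm mxE.
    by apply: eq_bigr => b _; rewrite !CmDv invfM mulrACA.
  have -> : (Mm a t x *m Mm d t x *m Jm x) j a = 0.
    by rewrite Z big1// => b _; rewrite (mulrC (c j b a)) c0 mul0r.
  have -> : \tr (Mm a t x *m (col d (Jm x) *m row i (Mm d t x))) = 0.
    rewrite mxtrace_mulC trc Z big1// => b _.
    by rewrite (mulrC (c i b d)) c0 mul0r.
  rewrite mulr0 !add0r mulr0 add0r mulrA; congr (_ * _).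
  rewrite /Mm -!mulmxA mxtrace_mulC -!mulmxA.
  have -> : \tr (Dv t *m (Em x *m (Cm d *m (Dv t *m (Em x *m Cm a))))) =
      \tr (Cm a *m Dv t *m (Cm d *m Dv t)).
    by rewrite EmCm (mulmxA (Em x)) EmCm !mulmxA mxtrace_mulC !mulmxA.
  rewrite -sumrN; apply: eq_bigr => b _; rewrite mxE -sumrN; apply: eq_bigr => e _.
  by rewrite !CmDv (cN e b d) invfM; ring.
transitivity (4^-1 * \tr ((\sum_a h a t *: B a j) *m (\sum_d h d t *: B d i))).
  rewrite /mxtrace exchange_big mulr_sumr; apply: eq_bigr => l _.
  rewrite mxE mulr_sumr; apply: eq_bigr => k _; rewrite !GB !summxE.
  under [X in _ = _ * (X * _)]eq_bigr do rewrite mxE.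
  under [X in _ = _ * (_ * X)]eq_bigr do rewrite mxE.
  by field.
rewrite mulmx_suml raddf_sum mulNr -mulrN -sumrN; congr (_ * _); apply: eq_bigr => a _ /=.
rewrite mulmx_sumr raddf_sum (bigD1 a)//= big1 => [|d da]; last first.
  rewrite -scalemxAr -scalemxAl !mxtraceZ T; rewrite [X in _ * (_ * (_ * - X))]big1 ?oppr0 ?mulr0// => b _.
  by rewrite big1// => e _; rewrite cD ?mul0r// eq_sym.
rewrite -scalemxAr -scalemxAl !mxtraceZ T addr0.
have -> : \sum_b \sum_e c b e a * c b e a / (h b t * h e t) =
  \sum_b \sum_e c b e a ^+ 2 / (h b t * h e t) by [].
by move: (\sum_b _) => S; ring.
Qed.

Lemma partial0 (m : 'I_(1 + n)) (f : V -> R) p : half_space p ->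
  (forall q, half_space q -> f q = 0) -> partial m f p = 0.
Proof.
move=> hp f0; have [->|[k ->]] := ord_tx m.
  by apply: (@partial_t R n f (fun _ _ => 0)) => //; exact: is_derive_cst.
by apply: (@partial_x R n f (fun _ _ => 0)) => //; exact: is_derive_cst.
Qed.

Definition trG (i : 'I_(1 + n)) p : R := \sum_k christoffel g k i k p.

Lemma trG_x p i : half_space p -> trG (sp i) p = 0.
Proof.
move=> hp; rewrite /trG big_split_ord /= big_ord1 chr_0x0// add0r.
by apply: etrans (trace_Gs (tcoord p) (rsubmx p) i); apply: eq_bigr => k _; rewrite chr_xxx.
Qed.

Lemma trG_0 p : half_space p -> trG o0 p = \sum_a rr a (tcoord p).
Proof.
move=> hp; rewrite /trG big_split_ord /= big_ord1 chr_000// add0r -(trace_Wm _ (rsubmx p)).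
by apply: eq_bigr => k _; rewrite chr_x0x.
Qed.

Lemma christoffelC p (k i j : 'I_(1 + n)) : christoffel g k i j p = christoffel g k j i p.
Proof.
rewrite /christoffel; congr (_ * _); apply: eq_bigr => l _; congr (_ * _).
rewrite [X in X - _]addrC; congr (_ - partial l _ p); apply/funext => q.
rewrite gE; have [->|[u ->]] := ord_tx i; have [->|[v ->]] := ord_tx j => //.
- by rewrite block_mxEur block_mxEdl !mxE.
- by rewrite block_mxEur block_mxEdl !mxE.
rewrite !block_mxEdr -/(gs (tcoord q) (rsubmx q)).
have gsT t x : (gs t x)^T = gs t x by rewrite /gs !trmx_mul trmxK tr_diag_mx mulmxA.
by rewrite -{1}gsT mxE.
Qed.

Lemma sum_split (d : nat) (A B : 'I_d -> R) (C D : 'I_d -> 'I_d -> R) :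
  \sum_k (A k - B k) + \sum_k \sum_l (C k l - D k l) =
  \sum_k A k - \sum_k B k + \sum_l \sum_k C k l - \sum_k \sum_l D k l.
Proof.
rewrite sumrB -[RHS]addrA [in RHS]exchange_big; congr (_ + _).
by rewrite -sumrB; apply: eq_bigr => k _; rewrite sumrB.
Qed.

(** Spatial traces of the Christoffel symbols vanish, so only the time index survives in the product
    with the trace. *)
Lemma ricciE p (i j : 'I_(1 + n)) : half_space p -> ricci g i j p =
  \sum_k partial k (christoffel g k i j) p - \sum_k partial j (christoffel g k i k) p
  + trG o0 p * christoffel g o0 i j p
  - \sum_k \sum_l christoffel g k j l p * christoffel g l i k p.
Proof.
move=> hp; apply: etrans (sum_split _ _ _ _) _; congr (_ + _ - _).
rewrite big_split_ord /= big_ord1 [X in _ + X]big1 => [|l _].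
  by rewrite addr0 -mulr_suml; congr (_ * _); apply: eq_bigr => k _; exact: christoffelC.
rewrite -mulr_suml; have -> : \sum_(k < 1 + n) christoffel g k k (sp l) p = trG (sp l) p.
  by apply: eq_bigr => k _; exact: christoffelC.
by rewrite trG_x// mul0r.
Qed.

Lemma ricci_eq p (i j : 'I_(1 + n)) (A B C D : R) : half_space p ->
  \sum_k partial k (christoffel g k i j) p = A ->
  \sum_k partial j (christoffel g k i k) p = B ->
  christoffel g o0 i j p = C ->
  \sum_k \sum_l christoffel g k j l p * christoffel g l i k p = D ->
  ricci g i j p = A - B + (\sum_a rr a (tcoord p)) * C - D.
Proof. by move=> hp <- <- <- <-; rewrite -trG_0//; exact: ricciE. Qed.

Definition rrd i t : R := (hdd i t * h i t - hd i t ^+ 2) / (2 * h i t ^+ 2).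

Lemma rr_derive i t : 0 < t -> is_derive t (1 : R) (rr i) (rrd i t).
Proof.
move=> t0; have h0 : h i t != 0 by rewrite gt_eqF ?h_gt0.
have h2 : 2 * h i t != 0 by rewrite mulf_neq0.
have d2 := is_deriveZ (2 : R) (h_d i t0).
have d3 := is_deriveV (f := fun t => 2 * h i t) h2 d2.
have := is_derive_mul (hd_d i t0) d3; move/is_derive_eq; apply.
by rewrite /rrd /GRing.scale /=; field.
Qed.

Lemma Dv_derive t : 0 < t -> exists D, is_derive t (1 : R) (fun t => Dv t : 'M[R]_n) D.
Proof.
move=> t0; eexists; apply: is_derive_diag => i.
by apply: is_deriveV; [rewrite gt_eqF ?h_gt0|exact: h_d].
Qed.

Lemma Wm_t t x k l : 0 < t -> derivable (fun t => Wm t x k l) t (1 : R).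
Proof.
move=> t0; have d1 := is_derive_diag (fun i => rr_derive i t0).
have := is_derive_mulmx2 (is_derive_mulmx2 (is_derive_cst (Jm x) t (1 : R)) d1) (is_derive_cst (Em x) t (1 : R)).
by move=> /(is_derive_coord k l) [].
Qed.

Lemma Gs_t t x i j k : 0 < t -> derivable (fun t => Gs t x i j k) t (1 : R).
Proof.
move=> t0; have [D dD] := Dv_derive t0.
have dM a u v := is_derive_coord u v (is_derive_mulmx2 (is_derive_mulmx2 (is_derive_cst (Cm a) t (1 : R)) dD)
  (is_derive_cst (Em x) t (1 : R))).
have dT a := is_derive_mul (h_d a t0) (is_deriveD
  (is_derive_mul (dM a i k) (is_derive_cst (Jm x j a) t (1 : R)))
  (is_derive_mul (dM a j k) (is_derive_cst (Jm x i a) t (1 : R)))).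
by have [] := is_deriveZ (- 2^-1 : R) (is_derive_bigsum (index_enum 'I_n) dT).
Qed.

Lemma partial_tr_00 p : half_space p ->
  \sum_k partial o0 (christoffel g k o0 k) p = \sum_a rrd a (tcoord p).
Proof.
move=> hp; rewrite big_split_ord /= big_ord1 (partial0 o0 hp) ?add0r; last exact: chr_000.
apply: etrans (@divergence_free (fun k t => Wm t (rsubmx p) k k) _ _ _
  (fun k => @Wm_t (tcoord p) (rsubmx p) k k hp)
  (fun r => trace_Wm r _) (is_derive_bigsum (index_enum 'I_n) (fun a => rr_derive a hp))).
apply: eq_bigr => k _; apply: (@partial_t R n _ (fun t x => Wm t x k k)) => //.
  by move=> q hq; rewrite chr_x0x.
exact: DeriveDef (@Wm_t (tcoord p) (rsubmx p) k k hp) erefl.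
Qed.

Lemma Wm_line t x y : is_derive (0 : R) (1 : R) (fun r : R => Wm t (x + r *: y))
  (- Nm y *m Dr t *m Em x + Jm x *m Dr t *m Nm y).
Proof.
have := is_derive_mulmx2 (is_derive_mulmx2 (Jm_derive x y) (is_derive_cst (Dr t) (0 : R) (1 : R))) (Em_derive x y).
by rewrite /= mulmx0 addr0 scale0r addr0.
Qed.

Lemma partial_tr_0x p j : half_space p -> \sum_k partial (sp j) (christoffel g k o0 k) p = 0.
Proof.
move=> hp; rewrite big_split_ord /= big_ord1 (partial0 _ hp) ?add0r; last exact: chr_000.
have H k : is_derive (0 : R) (1 : R) (fun r : R => Wm (tcoord p) (rsubmx p + r *: e_ j) k k) _ :=
  is_derive_coord k k (Wm_line (tcoord p) (rsubmx p) (e_ j)).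
have D k : derivable (fun r : R => Wm (tcoord p) (rsubmx p + r *: e_ j) k k) 0 1 by case: (H k).
apply: etrans (divergence_free D (fun r => trace_Wm _ _) (is_derive_cst _ _ _)).
apply: eq_bigr => k _; apply: (@partial_x R n _ (fun t x => Wm t x k k)) => //.
  by move=> q hq; rewrite chr_x0x.
Qed.

Lemma partial_tr_x0 p i : half_space p -> \sum_k partial o0 (christoffel g k (sp i) k) p = 0.
Proof.
move=> hp; rewrite big_split_ord /= big_ord1 (partial0 _ hp) ?add0r; last by move=> q; exact: chr_0x0.
apply: etrans (@divergence_free (fun k t => Gs t (rsubmx p) i k k) _ _ _
  (fun k => @Gs_t (tcoord p) (rsubmx p) i k k hp)
  (fun r => trace_Gs r _ i) (is_derive_cst _ _ _)).
apply: eq_bigr => k _; apply: (@partial_t R n _ (fun t x => Gs t x i k k)) => //.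
  by move=> q hq; rewrite chr_xxx.
exact: DeriveDef (@Gs_t (tcoord p) (rsubmx p) i k k hp) erefl.
Qed.

Lemma partial_tr_xx p i j : half_space p -> \sum_k partial (sp j) (christoffel g k (sp i) k) p = 0.
Proof.
move=> hp; rewrite big_split_ord /= big_ord1 (partial0 _ hp) ?add0r; last by move=> q; exact: chr_0x0.
have D k : derivable (fun r : R => Gs (tcoord p) (rsubmx p + r *: e_ j) i k k) 0 1.
  by case: (Gs_line (tcoord p) (rsubmx p) (e_ j) i k k).
apply: etrans (divergence_free D (fun r => trace_Gs _ _ i) (is_derive_cst _ _ _)).
apply: eq_bigr => k _; apply: (@partial_x R n _ (fun t x => Gs t x i k k)) => //.
  by move=> q hq; rewrite chr_xxx.
Qed.

Lemma quad_00 p : half_space p ->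
  \sum_k \sum_l christoffel g k o0 l p * christoffel g l o0 k p = \sum_a rr a (tcoord p) ^+ 2.
Proof.
move=> hp; rewrite big_split_ord /= big_ord1 big1 ?add0r; last first.
  move=> l _; have [->|[l' ->]] := ord_tx l; first by rewrite chr_000// mul0r.
  by rewrite chr_00x// mul0r.
transitivity (\tr (Wm (tcoord p) (rsubmx p) *m Wm (tcoord p) (rsubmx p))).
  apply: eq_bigr => k _; rewrite big_split_ord /= big_ord1 chr_x00// mul0r add0r mxE.
  by apply: eq_bigr => l _; rewrite !chr_x0x// mulrC.
rewrite /Wm mxtrace_mulC !mulmxA -(mulmxA _ (Em _)) EmJm mulmx1 mxtrace_mulC !mulmxA EmJm mul1mx.
by rewrite mulmx_diag mxtrace_diag; apply: eq_bigr => a _; rewrite !mxE expr2.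
Qed.

Lemma ricci_00 p : half_space p -> ricci g o0 o0 p =
  - \sum_a rrd a (tcoord p) - \sum_a rr a (tcoord p) ^+ 2.
Proof.
move=> hp; have D0 : \sum_k partial k (christoffel g k o0 o0) p = 0.
  rewrite big1// => k _; apply: partial0 => // q hq; have [->|[k' ->]] := ord_tx k.
    exact: chr_000.
  exact: chr_x00.
by rewrite (ricci_eq hp D0 (partial_tr_00 hp) (chr_000 hp) (quad_00 hp)) mulr0 addr0 sub0r.
Qed.

Lemma divergence_Wm t x j : \sum_k (- Nm (e_ k) *m Dr t *m Em x + Jm x *m Dr t *m Nm (e_ k)) j k = 0.
Proof.
have E1 k : (Jm x *m Dr t *m Nm (e_ k)) j k = 0.
  by rewrite mxE big1// => a _; rewrite Nm_delta c00' !mulr0.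
transitivity (- 2^-1 * \sum_a rr a t * (Em x *m Cm a) a j).
  under eq_bigr do rewrite mxE E1 addr0 !mulNmx mxE mxE.
  rewrite sumrN exchange_big mulr_sumr -sumrN; apply: eq_bigr => a _.
  rewrite mxE !mulr_sumr -sumrN; apply: eq_bigr => k _.
  rewrite mul_mx_diag mxE Nm_delta [Cm a k j]mxE mxE; ring.
by rewrite big1 ?mulr0// => a _; rewrite EmCm mxE c00' mulr0.
Qed.

Lemma divergence_0x p j : half_space p ->
  \sum_k partial (sp k) (christoffel g (sp k) o0 (sp j)) p = 0.
Proof.
move=> hp; apply: etrans (divergence_Wm (tcoord p) (rsubmx p) j); apply: eq_bigr => k _.
apply: (@partial_x R n _ (fun t x => Wm t x j k)) => //.
  by move=> q hq; rewrite chr_x0x.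
exact: is_derive_coord (Wm_line _ _ _).
Qed.

(** The core of the momentum constraint: everything contracts to the entries c j a a and c b b a,
    which are zero. *)
Lemma quad_0x p j : half_space p ->
  \sum_k \sum_l christoffel g k (sp j) l p * christoffel g l o0 k p = 0.
Proof.
move=> hp; rewrite big_split_ord /= big_ord1 big1 ?add0r; last first.
  move=> l _; have [->|[l' ->]] := ord_tx l; first by rewrite chr_0x0// mul0r.
  by rewrite chr_x00// mulr0.
pose t := tcoord p; pose x := rsubmx p.
transitivity (- 2^-1 * \sum_a h a t * ((Cm a *m Dv t *m Dr t) j a + \tr (Cm a *m Dv t *m Dr t) * Jm x j a)); last first.
  rewrite big1 ?mulr0// => a _; rewrite mul_mx_diag [X in X + _]mxE CmDv c00 !mul0r add0r.
  rewrite /mxtrace big1 ?mul0r ?mulr0// => b _.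
  by rewrite !mul_mx_diag !mxE cii !mul0r.
transitivity (\sum_k \sum_l Gs t x j l k * Wm t x k l).
  apply: eq_bigr => k _; rewrite big_split_ord /= big_ord1 chr_00x// mulr0 add0r.
  by apply: eq_bigr => l _; rewrite chr_x0x// chr_xxx.
have E1 a : (Cm a *m Dv t *m Dr t) j a = \sum_k (\sum_l Mm a t x j l * Wm t x l k) * Jm x k a.
  transitivity ((Mm a t x *m Wm t x *m Jm x) j a); last first.
    by rewrite mxE; apply: eq_bigr => k _; rewrite mxE.
  rewrite /Mm /Wm !mulmxA -(mulmxA (Cm a *m _) (Em x)) EmJm mulmx1.
  by rewrite -(mulmxA _ (Em x)) EmJm mulmx1.
have E2 a : \tr (Cm a *m Dv t *m Dr t) = \sum_k \sum_l Wm t x k l * Mm a t x l k.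
  transitivity (\tr (Wm t x *m Mm a t x)); last by apply: eq_bigr => k _; rewrite mxE.
  rewrite [RHS]mxtrace_mulC /Mm /Wm !mulmxA -(mulmxA _ (Em x)) EmJm mulmx1.
  by rewrite [RHS]mxtrace_mulC !mulmxA EmCm.
transitivity (\sum_a - 2^-1 * (h a t * \sum_k \sum_l
    (Mm a t x j k * Wm t x k l * Jm x l a + Wm t x k l * Mm a t x l k * Jm x j a))).
  transitivity (\sum_k \sum_l \sum_a - 2^-1 * (h a t *
    (Mm a t x j k * Wm t x k l * Jm x l a + Wm t x k l * Mm a t x l k * Jm x j a))).
    apply: eq_bigr => k _; apply: eq_bigr => l _.
    rewrite /Gs !mulr_sumr mulr_suml; apply: eq_bigr => a _; ring.
  under [RHS]eq_bigr do rewrite !mulr_sumr.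
  rewrite [RHS]exchange_big; apply: eq_bigr => k _ /=; rewrite exchange_big; apply: eq_bigr => a _ /=.
  by rewrite !mulr_sumr.
rewrite mulr_sumr; apply: eq_bigr => a _; congr (_ * (_ * _)).
under eq_bigr do rewrite big_split.
rewrite big_split /= exchange_big E1; congr (_ + _).
  by apply: eq_bigr => k _; rewrite mulr_suml.
by rewrite E2 mulr_suml; apply: eq_bigr => k _; rewrite mulr_suml.
Qed.

Lemma ricci_0x p j : half_space p -> ricci g o0 (sp j) p = 0.
Proof.
move=> hp; have D0 : \sum_k partial k (christoffel g k o0 (sp j)) p = 0.
  rewrite big_split_ord /= big_ord1 divergence_0x// addr0; apply: partial0 => // q.
  exact: chr_00x.
by rewrite (ricci_eq hp D0 (partial_tr_0x j hp) (chr_00x j hp) (quad_0x j hp)) mulr0 addr0 !subr0.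
Qed.

Lemma ricci_x0 p j : half_space p -> ricci g (sp j) o0 p = 0.
Proof.
move=> hp; have Q0 : \sum_k \sum_l christoffel g k o0 l p * christoffel g l (sp j) k p = 0.
  apply: etrans (quad_0x j hp); rewrite [RHS]exchange_big; apply: eq_bigr => k _; apply: eq_bigr => l _.
  exact: mulrC.
have D0 : \sum_k partial k (christoffel g k (sp j) o0) p = 0.
  rewrite big_split_ord /= big_ord1 -[RHS](divergence_0x j hp).
  rewrite (partial0 _ hp); last by move=> q; exact: chr_0x0.
  rewrite add0r; apply: eq_bigr => k _; congr (partial _ _ p); apply/funext => q.
  exact: christoffelC.
by rewrite (ricci_eq hp D0 (partial_tr_x0 j hp) (chr_0x0 j hp) Q0) mulr0 addr0 !subr0.
Qed.

Lemma quad_xx p i j : half_space p ->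
  \sum_k \sum_l christoffel g k (sp j) l p * christoffel g l (sp i) k p =
  \sum_a Jm (rsubmx p) i a * Jm (rsubmx p) j a * (rr a (tcoord p) * hd a (tcoord p)) +
  \sum_k \sum_l Gs (tcoord p) (rsubmx p) j l k * Gs (tcoord p) (rsubmx p) i k l.
Proof.
move=> hp; set t := tcoord p; set x := rsubmx p.
rewrite big_split_ord /= big_ord1 big_split_ord /= big_ord1 chr_0x0// mul0r add0r.
have W u v : \sum_k G0 t x u k * Wm t x v k =
    2^-1 * \sum_a Jm x u a * Jm x v a * (rr a t * hd a t).
  have -> : \sum_k G0 t x u k * Wm t x v k = 2^-1 * (Jm x *m (Dd t *m Dr t) *m (Jm x)^T) u v.
    have -> : Jm x *m (Dd t *m Dr t) *m (Jm x)^T = Jm x *m Dd t *m (Jm x)^T *m (Wm t x)^T.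
      by rewrite /Wm !trmx_mul tr_diag_mx !mulmxA -(mulmxA _ _ (Em x)^T) -trmx_mul EmJm trmx1 mulmx1.
    rewrite mxE mulr_sumr; apply: eq_bigr => k _.
    by rewrite [(Wm t x)^T k v]mxE /G0 [X in X * _]mxE mulrA.
  rewrite mulmx_diag mxE; congr (_ * _); apply: eq_bigr => a _.
  rewrite mul_mx_diag !mxE; ring.
have -> : \sum_(i0 < n) christoffel g o0 (sp j) (sp i0) p * christoffel g (sp i0) (sp i) o0 p =
   2^-1 * \sum_a Jm x j a * Jm x i a * (rr a t * hd a t).
  by rewrite -W; apply: eq_bigr => k _; rewrite chr_0xx// chr_xx0.
have -> : \sum_(i0 < n) \sum_(i1 < 1 + n) christoffel g (sp i0) (sp j) i1 p * christoffel g i1 (sp i) (sp i0) p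
   = 2^-1 * \sum_a Jm x i a * Jm x j a * (rr a t * hd a t) + \sum_k \sum_l Gs t x j l k * Gs t x i k l.
  rewrite -W -big_split; apply: eq_bigr => k _ /=; rewrite big_split_ord /= big_ord1.
  rewrite chr_xx0// chr_0xx// mulrC; congr (_ + _); apply: eq_bigr => l _.
  by rewrite !chr_xxx.
rewrite addrA; congr (_ + _).
under [X in _ * X + _]eq_bigr do rewrite (mulrC (Jm x j _)).
by field.
Qed.

Lemma partial_0xx p i j : half_space p -> partial o0 (christoffel g o0 (sp i) (sp j)) p =
  \sum_a Jm (rsubmx p) i a * Jm (rsubmx p) j a * (2^-1 * hdd a (tcoord p)).
Proof.
move=> hp; set t := tcoord p; set x := rsubmx p.
apply: (@partial_t R n _ (fun t x => G0 t x i j)) => //.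
  by move=> q hq; rewrite chr_0xx.
have d1 := is_derive_diag (fun i => hd_d i hp).
have d2 := is_derive_mulmx2 (is_derive_mulmx2 (is_derive_cst (Jm x) t (1 : R)) d1) (is_derive_cst (Jm x)^T t (1 : R)).
rewrite (_ : (fun t => _) = (fun t => 2^-1 *: (Jm x *m Dd t *m (Jm x)^T) i j)); last first.
  by apply/funext => s; rewrite mxE.
have := is_deriveZ (2^-1 : R) (is_derive_coord i j d2); move/is_derive_eq; apply.
rewrite mulmx0 addr0 mul0mx add0r mxE /GRing.scale /= mulr_sumr; apply: eq_bigr => a _.
rewrite mul_mx_diag !mxE; ring.
Qed.

(** The last sum comes out without conjugation by [Jm]; [ricci_scalar] brings it to the form of the
    first one, because [Nm] annihilates it. *)
Lemma ricci_xx p i j : half_space p -> ricci g (sp i) (sp j) p =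
  \sum_a Jm (rsubmx p) i a * Jm (rsubmx p) j a *
    (2^-1 * hdd a (tcoord p) + 2^-1 * (\sum_b rr b (tcoord p)) * hd a (tcoord p) -
     rr a (tcoord p) * hd a (tcoord p) + 4^-1 * h a (tcoord p) ^+ 2 *
      \sum_b \sum_e c b e a ^+ 2 / (h b (tcoord p) * h e (tcoord p))) -
  2^-1 * \sum_a \sum_b h a (tcoord p) / h b (tcoord p) * (c i b a * c j b a).
Proof.
move=> hp; have D0 : \sum_k partial k (christoffel g k (sp i) (sp j)) p =
   \sum_a Jm (rsubmx p) i a * Jm (rsubmx p) j a * (2^-1 * hdd a (tcoord p)) +
   - 2^-1 * \sum_a \sum_b h a (tcoord p) / h b (tcoord p) * (c i b a * c j b a).
  rewrite big_split_ord /= big_ord1 partial_0xx//; congr (_ + _).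
  apply: etrans (divergence_Gs (tcoord p) (rsubmx p) i j); apply: eq_bigr => k _.
  apply: (@partial_x R n _ (fun t x => Gs t x i j k)) => //.
    by move=> q hq; rewrite chr_xxx.
  exact: Gs_line.
rewrite (ricci_eq hp D0 (partial_tr_xx i j hp) (chr_0xx i j hp) (quad_xx i j hp)) quadratic_Gs.
have -> : G0 (tcoord p) (rsubmx p) i j =
    \sum_a Jm (rsubmx p) i a * Jm (rsubmx p) j a * (2^-1 * hd a (tcoord p)).
  rewrite mxE mxE mulr_sumr; apply: eq_bigr => a _; rewrite mul_mx_diag !mxE; ring.
move: (\sum_b rr b _) => K; set t := tcoord p; set x := rsubmx p.
set P := \sum_a \sum_b _.
pose S a := \sum_b \sum_e c b e a ^+ 2 / (h b t * h e t).
transitivity (\sum_a (Jm x i a * Jm x j a * (2^-1 * hdd a t) +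
  K * (Jm x i a * Jm x j a * (2^-1 * hd a t)) - Jm x i a * Jm x j a * (rr a t * hd a t) +
   4^-1 * (Jm x i a * Jm x j a * h a t ^+ 2 * S a)) - 2^-1 * P).
  rewrite !big_split /= sumrN -!mulr_sumr mulNr mulNr /t /x /S; ring.
congr (_ - _); apply: eq_bigr => a _; rewrite -/(S a); ring.
Qed.

(** Leaves one ordinary identity in t for the time direction and one for each spatial direction. The
    curvature term is diagonal by [cE], and conjugation by [Jm] fixes it since by [c0] it lives on
    directions that no bracket reaches. *)
Lemma ricci_scalar (f : R -> R) (df : R -> R) :
  (forall t : R, 0 < t -> is_derive t (1 : R) f (df t)) ->
  (forall t, 0 < t -> - \sum_a rrd a t - \sum_a rr a t ^+ 2 = df t ^+ 2) ->
  (forall a t, 0 < t -> 2^-1 * hdd a t + 2^-1 * (\sum_b rr b t) * hd a t - rr a t * hd a t +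
     4^-1 * h a t ^+ 2 * \sum_b \sum_e c b e a ^+ 2 / (h b t * h e t) =
     2^-1 * \sum_d \sum_b h d t / h b t * c a b d ^+ 2) ->
  forall p, half_space p -> forall (i j : 'I_(1 + n)), ricci g i j p =
    partial i (fun q : V => f (tcoord q)) p * partial j (fun q : V => f (tcoord q)) p.
Proof.
move=> Hf E0 E1 p hp i j.
have f0 : partial o0 (fun q : V => f (tcoord q)) p = df (tcoord p).
  by apply: (@partial_t R n _ (fun t _ => f t)) => //; exact: Hf.
have fx k : partial (sp k) (fun q : V => f (tcoord q)) p = 0.
  by apply: (@partial_x R n _ (fun t _ => f t)) => //; exact: is_derive_cst.
have [->|[i' ->]] := ord_tx i; have [->|[j' ->]] := ord_tx j.
- by rewrite ricci_00// f0 E0// expr2.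
- by rewrite ricci_0x// fx mulr0.
- by rewrite ricci_x0// fx mul0r.
rewrite ricci_xx// !fx mulr0; set t := tcoord p; set x := rsubmx p.
pose y d := \sum_e \sum_b h e t / h b t * c d b e ^+ 2.
under eq_bigr do rewrite E1//.
apply/eqP; rewrite subr_eq0; apply/eqP.
transitivity (2^-1 * (Jm x *m diag_mx (\row_d y d) *m (Jm x)^T) i' j').
  rewrite mxE mulr_sumr; apply: eq_bigr => a _; rewrite mul_mx_diag !mxE -/(y a); ring.
have N0 : Nm x *m diag_mx (\row_d y d) = 0.
  apply/matrixP => u v; rewrite mul_mx_diag !mxE -mulrA mulr_suml big1 ?mulr0// => k _.
  rewrite mulr_sumr big1// => e _; rewrite mulr_sumr big1// => b _.
  have C0 : c v b e * c k u v = 0 by exact: c0'.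
  have -> : c k u v * x 0 k * (h e t / h b t * c v b e ^+ 2) =
    x 0 k * (h e t / h b t) * c v b e * (c v b e * c k u v) by ring.
  by rewrite C0 mulr0.
have -> : Jm x *m diag_mx (\row_d y d) *m (Jm x)^T = diag_mx (\row_d y d).
  rewrite mulmxBl mul1mx N0 subr0; apply: trmx_inj.
  by rewrite trmx_mul trmxK tr_diag_mx mulmxBl mul1mx N0 subr0.
rewrite !mxE; congr (_ * _); have [<-|ij] := eqVneq i' j'.
  by rewrite mulr1n; apply: eq_bigr => a _; apply: eq_bigr => b _; rewrite expr2.
by rewrite mulr0n big1// => a _; rewrite big1// => b _; rewrite cE ?mulr0.
Qed.

End LeftInvariantMetric.

Lemma scale_coord (R : pzRingType) a b (k : R) (A : 'M[R]_(a, b)) i j : (k *: A) i j = k * A i j.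
Proof. by rewrite mxE. Qed.

Lemma derive1_is_derive (R : realType) (W : normedModType R) (f : R -> W) (s : R) :
  derivable f s 1 -> is_derive s (1 : R) f (derive1 f s).
Proof. by move=> df; rewrite derive1E; apply: DeriveDef. Qed.

(** * Geodesic equations in the left-invariant frame *)

Section GeodesicEquations.
Variables (R : realType) (n : nat) (L : two_step R n).
Local Notation V := 'rV[R]_(1 + n).
Local Notation c := (sconst L).
Hypothesis cN : forall i j a, c i j a = - c j i a.
Hypothesis c0 : forall i b a j k, c i b a * c j k b = 0.
Variables h hd : 'I_n -> R -> R.
Hypothesis h_gt0 : forall i t, 0 < t -> 0 < h i t.
Hypothesis h_d : forall i (t : R), 0 < t -> is_derive t (1 : R) (h i) (hd i t).
Implicit Types (t s : R) (x u th : 'rV[R]_n) (p w : V).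
Local Notation g := (st_metric L (fun t : R => diag_mx (\row_i h i t))).
Local Notation Dv t := (diag_mx (\row_i (h i t)^-1)).
Local Notation Dr t := (diag_mx (\row_i rr h hd i t)).

(** In terms of the left-invariant velocity [th], minus [spray0] is the acceleration of t, and
    [spray] is the force caused by the bracket. *)
Definition spray0 t th : R := 2^-1 * \sum_a hd a t * th 0 a ^+ 2.
Definition spray t x th : 'rV[R]_n := \sum_a (h a t * th 0 a) *: (th *m (Cm L a *m Dv t)).

Let sum2 (A : 'M[R]_n) u : \sum_i \sum_j A i j * u 0 i * u 0 j = (u *m A *m u^T) 0 0.
Proof.
rewrite mxE exchange_big; apply: eq_bigr => j _; rewrite [(u *m A) 0 j]mxE [u^T j 0]mxE mulr_suml.
by apply: eq_bigr => i _; rewrite (mulrC (u 0 i)).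
Qed.

Lemma contract_0 p w : half_space p ->
  \sum_i \sum_j christoffel g (lshift n 0) i j p * w 0 i * w 0 j =
  spray0 (tcoord p) (rsubmx w *m Jm L (rsubmx p)).
Proof.
move=> hp; rewrite big_split_ord /= big_ord1 big1 ?add0r; last first.
  move=> j _; have [->|[j' ->]] := ord_tx j; first by rewrite (chr_000 c0 h_gt0 hp) !mul0r.
  by rewrite (chr_00x c0 h_gt0 _ hp) !mul0r.
transitivity (\sum_i \sum_j G0 L hd (tcoord p) (rsubmx p) i j * rsubmx w 0 i * rsubmx w 0 j).
  apply: eq_bigr => i _; rewrite big_split_ord /= big_ord1 (chr_0x0 c0 h_gt0 _ hp) !mul0r add0r.
  by apply: eq_bigr => j _; rewrite (chr_0xx c0 h_gt0 h_d _ _ hp) !rsubmxE.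
rewrite sum2 /G0 -scalemxAr -scalemxAl mxE /spray0; congr (_ * _).
set u := rsubmx w; set J := Jm L _.
have -> : u *m (J *m diag_mx (\row_i hd i (tcoord p)) *m J^T) *m u^T =
  u *m J *m diag_mx (\row_i hd i (tcoord p)) *m (u *m J)^T by rewrite trmx_mul !mulmxA.
rewrite mxE; apply: eq_bigr => a _; rewrite mul_mx_diag mxE [(\row__ _) 0 a]mxE [(u *m J)^T a 0]mxE; ring.
Qed.

Lemma contract_x p w k : half_space p ->
  let th := rsubmx w *m Jm L (rsubmx p) in
  \sum_i \sum_j christoffel g (rshift 1 k) i j p * w 0 i * w 0 j =
  ((2 * tcoord w *: (th *m Dr (tcoord p)) - spray (tcoord p) (rsubmx p) th) *m Em L (rsubmx p)) 0 k.
Proof.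
move=> hp th; set t := tcoord p; set x := rsubmx p; set u := rsubmx w.
have uE : u = th *m Em L x by rewrite /th -mulmxA (JmEm c0) mulmx1.
have W : \sum_j Wm L h hd t x j k * u 0 j = (th *m Dr t *m Em L x) 0 k.
  have -> : th *m Dr t *m Em L x = u *m Wm L h hd t x by rewrite /Wm /th !mulmxA.
  by rewrite [RHS]mxE; apply: eq_bigr => j _; rewrite mulrC.
have S : \sum_i \sum_j Gs L h t x i j k * u 0 i * u 0 j = - (spray t x th *m Em L x) 0 k.
  have M a : (th *m (Cm L a *m Dv t) *m Em L x) 0 k = \sum_i u 0 i * Mm L h a t x i k.
    transitivity ((u *m Mm L h a t x) 0 k); last by rewrite mxE.
    rewrite /Mm uE !mulmxA -(mulmxA th (Em L x)) (EmCm cN c0).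
    by [].
  have T a : th 0 a = \sum_j u 0 j * Jm L x j a by rewrite mxE.
  transitivity (\sum_a - 2^-1 * (h a t * (\sum_i \sum_j
      ((u 0 i * Mm L h a t x i k) * (u 0 j * Jm L x j a) + (u 0 j * Mm L h a t x j k) * (u 0 i * Jm L x i a))))).
    transitivity (\sum_i \sum_j \sum_a - 2^-1 * (h a t *
      ((u 0 i * Mm L h a t x i k) * (u 0 j * Jm L x j a) + (u 0 j * Mm L h a t x j k) * (u 0 i * Jm L x i a)))).
      apply: eq_bigr => i _; apply: eq_bigr => j _; rewrite /Gs mulr_sumr !mulr_suml.
      by apply: eq_bigr => a _; ring.
    under [RHS]eq_bigr do rewrite !mulr_sumr.
    rewrite [RHS]exchange_big; apply: eq_bigr => i _ /=; rewrite exchange_big; apply: eq_bigr => a _ /=.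
    by rewrite !mulr_sumr.
  rewrite /spray mulmx_suml summxE -sumrN; apply: eq_bigr => a _.
  rewrite -scalemxAl scale_coord M T.
  have E (f g0 : 'I_n -> R) : \sum_i \sum_j (f i * g0 j + f j * g0 i) = 2 * ((\sum_i f i) * \sum_j g0 j).
    have h1 : \sum_i \sum_j f i * g0 j = (\sum_i f i) * \sum_j g0 j.
      by rewrite mulr_suml; apply: eq_bigr => i _; rewrite mulr_sumr.
    have h2 : \sum_i \sum_j f j * g0 i = (\sum_i f i) * \sum_j g0 j.
      by rewrite exchange_big.
    under eq_bigr do rewrite big_split; rewrite big_split /= h1 h2; ring.
  rewrite E; move: (\sum_i _) (\sum_j _) => A B; by field.
rewrite big_split_ord /= big_ord1 big_split_ord /= big_ord1 (chr_x00 c0 h_gt0 _ hp) !mul0r add0r.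
have -> : \sum_(i < n) christoffel g (rshift 1 k) (lshift n 0) (rshift 1 i) p * w 0 (lshift n 0) * w 0 (rshift 1 i)
  = tcoord w * (th *m Dr t *m Em L x) 0 k.
  rewrite -W mulr_sumr; apply: eq_bigr => j _.
  by rewrite (chr_x0x c0 h_gt0 h_d _ _ hp) (tcoordE w) /u rsubmxE; ring.
have -> : \sum_(i < n) \sum_(j < 1 + n) christoffel g (rshift 1 k) (rshift 1 i) j p * w 0 (rshift 1 i) * w 0 j
  = tcoord w * (th *m Dr t *m Em L x) 0 k - (spray t x th *m Em L x) 0 k.
  rewrite -W -S mulr_sumr -big_split; apply: eq_bigr => i _ /=.
  rewrite big_split_ord /= big_ord1 (chr_xx0 c0 h_gt0 h_d _ _ hp) (tcoordE w) /u.
  congr (_ + _); first by rewrite rsubmxE; ring.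
  by apply: eq_bigr => j _; rewrite (chr_xxx cN c0 h_gt0 _ _ _ hp) !rsubmxE.
rewrite mulmxBl -scalemxAl [RHS]mxE [X in _ = X + _]mxE [X in _ = _ + X]mxE; ring.
Qed.

Lemma Em_deriv (X : R -> 'rV[R]_n) U s : is_derive s (1 : R) X U ->
  is_derive s (1 : R) (fun r => Em L (X r)) (Nm L U).
Proof.
move=> dX; apply: is_derive_mx => j a.
rewrite (_ : (fun r => _) = (fun r => (1%:M : 'M[R]_n) j a + 2^-1 * \sum_i X r 0 i * c i j a)); last first.
  apply/funext => r; rewrite /Em mxE [X in _ + X]mxE; congr (_ + _ * _).
  by apply: eq_bigr => i _; rewrite mulrC.
have d1 i := is_derive_mul (is_derive_coord 0 i dX) (is_derive_cst (c i j a) s (1 : R)).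
have := is_deriveD (is_derive_cst ((1%:M : 'M[R]_n) j a) s (1 : R))
   (is_deriveZ (2^-1 : R) (is_derive_bigsum (index_enum 'I_n) d1)).
move/is_derive_eq; apply; rewrite add0r mxE /GRing.scale /=; congr (_ * _).
by apply: eq_bigr => i _; rewrite mulr0 addr0 mulrC.
Qed.

Lemma Jm_deriv (X : R -> 'rV[R]_n) U s : is_derive s (1 : R) X U ->
  is_derive s (1 : R) (fun r => Jm L (X r)) (- Nm L U).
Proof.
move=> dX; have d1 := is_deriveB (is_derive_cst (2 *: (1%:M : 'M[R]_n)) s (1 : R)) (Em_deriv dX).
rewrite sub0r in d1; rewrite (_ : (fun r => _) = cst (2 *: (1%:M : 'M[R]_n)) - (fun r => Em L (X r)))//.
apply/funext => r; rewrite /Jm -[RHS]/(2 *: 1%:M - Em L (X r)) /Em opprD addrA.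
by congr (_ - _); rewrite scaler_nat mulr2n addrK.
Qed.

(** The coordinate velocity u + [x, u] / 2 differs from u by a bracket, so the derivative of the
    frame along it annihilates u. *)
Lemma th_Nm x u : u *m Nm L (u *m Em L x) = 0.
Proof.
rewrite mul_Nm mulmxDr mulmx1 mul_Nm bracketDl bracketxx bracketZl bracket2l.
by rewrite scaler0 addr0 scaler0.
Qed.

Section Intro.
Variables (J : set R) (T Td Tdd : R -> R) (X th thd : R -> 'rV[R]_n).
Hypothesis oJ : open J.
Hypothesis T0 : forall s, J s -> 0 < T s.
Hypothesis dT : forall s : R, J s -> is_derive s (1 : R) T (Td s).
Hypothesis dTd : forall s : R, J s -> is_derive s (1 : R) Td (Tdd s).
Hypothesis dX : forall s : R, J s -> is_derive s (1 : R) X (th s *m Em L (X s)).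
Hypothesis dth : forall s : R, J s -> is_derive s (1 : R) th (thd s).
Hypothesis E0 : forall s, J s -> Tdd s = - spray0 (T s) (th s).
Hypothesis E1 : forall s, J s ->
  thd s = - (2 * Td s *: (th s *m Dr (T s)) - spray (T s) (X s) (th s)).

Lemma geo_intro : geodesic_on g (@half_space R n) J (fun s => mk (T s) (X s)).
Proof.
pose U s := th s *m Em L (X s).
have d1 (s : R) : J s -> is_derive s (1 : R) (fun s => mk (T s) (X s)) (mk (Td s) (U s)).
  by move=> Js; apply: is_derive_mk; [exact: dT|exact: dX].
have dU (s : R) : J s -> is_derive s (1 : R) U (thd s *m Em L (X s)).
  move=> Js; have := is_derive_mulmx2 (dth Js) (Em_deriv (dX Js)).
  by rewrite /U th_Nm addr0.
move=> s Js.
have nJ : \forall r \near s, J r by apply: open_nbhs_nbhs; split.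
have n1 : \forall r \near s, mk (Td r) (U r) = derive1 (fun s => mk (T s) (X s)) r.
  by apply: filterS nJ => r Jr; rewrite derive1E; have [_ ->] := d1 r Jr.
have d2 : is_derive s (1 : R) (derive1 (fun s => mk (T s) (X s))) (mk (Tdd s) (thd s *m Em L (X s))).
  by apply: near_eq_is_derive n1 _; apply: is_derive_mk; [exact: dTd|exact: dU].
have e1 : derive1 (fun s => mk (T s) (X s)) s = mk (Td s) (U s) by rewrite derive1E; have [_ ->] := d1 s Js.
have e2 : derive1 (derive1 (fun s => mk (T s) (X s))) s = mk (Tdd s) (thd s *m Em L (X s)).
  by rewrite derive1E; case: d2.
have hp : half_space (mk (T s) (X s)) by rewrite /half_space /= tcoord_mk T0.
split; [exact: hp|by have [] := d1 s Js|by case: d2|].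
have thE : rsubmx (mk (Td s) (U s)) *m Jm L (rsubmx (mk (T s) (X s))) = th s.
  by rewrite !rsubmx_mk /U -mulmxA (EmJm c0) mulmx1.
move=> k; rewrite e1 e2; have [->|[k' ->]] := ord_tx k.
  by rewrite (contract_0 _ hp) thE !tcoord_mk -tcoordE tcoord_mk E0// addNr.
rewrite (contract_x _ _ hp) thE !tcoord_mk -rsubmxE !rsubmx_mk E1// mulNmx mxE.
by rewrite addNr.
Qed.
End Intro.

Section Elim.
Variables (J : set R) (cv : R -> V).
Hypothesis oJ : open J.
Hypothesis geo : geodesic_on g (@half_space R n) J cv.
Let T s := tcoord (cv s).
Let X s := rsubmx (cv s).
Let Td s := tcoord (derive1 cv s).
Let th s := rsubmx (derive1 cv s) *m Jm L (X s).

Lemma geo_elim s : J s -> [/\ 0 < T s, is_derive s (1 : R) T (Td s),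
  is_derive s (1 : R) Td (- spray0 (T s) (th s)),
  is_derive s (1 : R) X (th s *m Em L (X s)) &
  is_derive s (1 : R) th (- (2 * Td s *: (th s *m Dr (T s)) - spray (T s) (X s) (th s)))].
Proof.
move=> Js; have [hp d1 d2 E] := geo Js.
have D1 := derive1_is_derive d1.
have D2 : is_derive s (1 : R) (derive1 cv) (derive1 (derive1 cv) s).
  exact: derive1_is_derive.
have dX := is_derive_rsubmx D1.
have thE : th s *m Em L (X s) = rsubmx (derive1 cv s) by rewrite -mulmxA (JmEm c0) mulmx1.
split => //; first exact: is_derive_tcoord.
- have := is_derive_tcoord D2; move/is_derive_eq; apply.
  have := E (lshift n 0); rewrite (contract_0 _ hp) -tcoordE => /eqP.
  by rewrite addr_eq0 => /eqP.
- by rewrite thE.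
have := is_derive_mulmx2 (is_derive_rsubmx D2) (Jm_deriv dX); move/is_derive_eq; apply.
have Z : rsubmx (derive1 cv s) *m - Nm L (rsubmx (derive1 cv s)) = 0.
  by rewrite mulmxN mul_Nm bracketxx scaler0 oppr0.
rewrite Z addr0.
have -> : rsubmx (derive1 (derive1 cv) s) =
    - ((2 * Td s *: (th s *m Dr (T s)) - spray (T s) (X s) (th s)) *m Em L (X s)).
  apply/rowP => k; have := E (rshift 1 k); rewrite (contract_x _ _ hp) -rsubmxE => /eqP.
  by rewrite addr_eq0 => /eqP ->; rewrite [RHS]mxE.
by rewrite mulNmx -mulmxA (EmJm c0) mulmx1.
Qed.
End Elim.

End GeodesicEquations.

(** * Structure constants of the two Heisenberg factors *)

Section HeisenbergConstants.
Variables (R : realType) (n : nat).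
Implicit Types (i j k a b d e : nat).

(** Indexed by natural numbers, so that sums over ordinals can be evaluated at numerals. *)
Definition hs i j k : R := (heis2_rel i j k)%:R - (heis2_rel j i k)%:R.

Lemma hsP i j k : hs i j k = 0 \/
  (i, j, k) \in [:: (0, 1, 2); (1, 0, 2); (3, 4, 5); (4, 3, 5)]%N.
Proof.
have [|H] := boolP ((i, j, k) \in [:: (0, 1, 2); (1, 0, 2); (3, 4, 5); (4, 3, 5)]%N).
  by right.
left; rewrite /hs /heis2_rel; have : (i, j, k) \notin [:: (0, 1, 2); (3, 4, 5)]%N /\
    (j, i, k) \notin [:: (0, 1, 2); (3, 4, 5)]%N.
  move: H; rewrite !inE !xpair_eqE !negb_or => /and4P[-> h2 -> h4]; split => //.
  by rewrite (andbC (j == 0%N)) (andbC (j == 3%N)) h2 h4.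
by move=> [/negbTE-> /negbTE->]; rewrite subrr.
Qed.

Lemma hsN i j k : hs i j k = - hs j i k. Proof. by rewrite /hs opprB. Qed.

Ltac hs_cases H := rewrite !inE !xpair_eqE in H;
  repeat match type of H with
  | is_true (_ || _) => case/orP: H => H
  end; case/andP: H => /andP[/eqP ? /eqP ?] /eqP ?; subst.

Lemma hs0 i b a j k : hs i b a * hs j k b = 0.
Proof.
have [->|H1] := hsP i b a; first by rewrite mul0r.
have [->|H2] := hsP j k b; first by rewrite mulr0.
by hs_cases H1; hs_cases H2.
Qed.

Lemma hsD a d b e : a != d -> hs b e a * hs b e d = 0.
Proof.
have [->|H1] := hsP b e a; first by rewrite mul0r.
have [->|H2] := hsP b e d; first by rewrite mulr0.
by hs_cases H1; hs_cases H2.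
Qed.

Lemma hsE i j b d : i != j -> hs i b d * hs j b d = 0.
Proof.
have [->|H1] := hsP i b d; first by rewrite mul0r.
have [->|H2] := hsP j b d; first by rewrite mulr0.
by hs_cases H1; hs_cases H2.
Qed.

Lemma hs_big i j k : (6 <= i)%N || (6 <= j)%N || (6 <= k)%N -> hs i j k = 0.
Proof. by have [//|H] := hsP i j k; hs_cases H. Qed.

Lemma hs_noncentral i j k : k \notin [:: 2; 5]%N -> hs i j k = 0.
Proof. by have [//|H] := hsP i j k; hs_cases H. Qed.

Hypothesis n6 : (6 <= n)%N.

Lemma sum_hs1 (f : nat -> R) a : \sum_(d < n) \sum_(b < n) f d / f b * hs a b d ^+ 2 =
  nth 0 [:: f 2%N / f 1%N; f 2%N / f 0%N; 0; f 5%N / f 4%N; f 5%N / f 3%N; 0] a.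
Proof.
rewrite (sum6 (F := fun d => \sum_(b < n) f d / f b * hs a b d ^+ 2))//; last first.
  by move=> d d6; rewrite big1// => b _; rewrite hs_big ?d6 ?orbT// expr0n mulr0.
rewrite !(sum6 (F := fun b => f _ / f b * hs a b _ ^+ 2))//;
  try by move=> b b6; rewrite hs_big ?b6 ?orbT// expr0n mulr0.
by do 6![case: a => [|a]; first by rewrite /hs /heis2_rel /= !subr0 ?subrr ?sub0r ?sqrrN ?expr1n ?expr0n /= ?mulr0 ?mulr1 ?addr0 ?add0r];
  rewrite !hs_big// expr0n !mulr0 !addr0 /= nth_nil.
Qed.

Lemma sum_hs2 (f : nat -> R) a : \sum_(b < n) \sum_(e < n) hs b e a ^+ 2 / (f b * f e) =
  nth 0 [:: 0; 0; 2 / (f 0%N * f 1%N); 0; 0; 2 / (f 3%N * f 4%N)] a.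
Proof.
rewrite (sum6 (F := fun b => \sum_(e < n) hs b e a ^+ 2 / (f b * f e)))//; last first.
  by move=> d d6; rewrite big1// => b _; rewrite hs_big ?d6 ?orbT// expr0n mul0r.
rewrite !(sum6 (F := fun e => hs _ e a ^+ 2 / (f _ * f e)))//;
  try by move=> b b6; rewrite hs_big ?b6 ?orbT// expr0n mul0r.
by do 6![case: a => [|a]; first by rewrite /hs /heis2_rel /= !subr0 ?subrr ?sub0r ?sqrrN ?expr1n ?expr0n /= ?mul0r ?mul1r ?addr0 ?add0r
   // ?[f 1%N * _]mulrC ?[f 4%N * _]mulrC -?mulr2n mulr_natl];
  rewrite !hs_big// expr0n !mul0r !addr0 /= nth_nil.
Qed.

End HeisenbergConstants.

(** * The Einstein equations *)

Section Einstein.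
Variables (R : realType) (m : R) (n : nat).
Hypothesis m_bd : 3 <= m <= 6.
Hypothesis n6 : (6 <= n)%N.
Implicit Types (t : R) (i : nat).
Local Notation x := (@dll R).
Local Notation y := (@dkk R).
Local Notation q := (qe R).

Lemma dll_derive t : 0 < t -> is_derive t (1 : R) x ((- x t - 2 * y t) * x t).
Proof.
move=> t0; have := exp_lin_derive (-1) (-2) t0.
rewrite (_ : (fun t => _) = x); last by apply/funext => s; rewrite /dll; congr expR; ring.
by move/is_derive_eq; apply; rewrite /dll; congr (_ * expR _); ring.
Qed.

Lemma dkk_derive t : 0 < t -> is_derive t (1 : R) y (((2 * q - 1) * x t - 3 * y t) * y t).
Proof.
move=> t0; have := mon_derive (2 * q) (2 * q - 1) (-3) t0.
rewrite (_ : mon _ _ _ = y); last first.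
  by apply/funext => s; rewrite /dkk /mon; congr (_ * expR _); ring.
by move/is_derive_eq; apply; rewrite mulNr.
Qed.

(** The logarithmic derivative of [hh m i]. As x and y satisfy a closed quadratic system, all
    further derivatives are polynomials in them. *)
Definition ww i t : R := al m i * x t + be R i * y t.
Definition wd i t : R := al m i * ((- x t - 2 * y t) * x t) + be R i * (((2 * q - 1) * x t - 3 * y t) * y t).
Definition hh_d i t : R := ww i t * hh m i t.
Definition hdd i t : R := (wd i t + ww i t ^+ 2) * hh m i t.

Lemma hh_derive i t : 0 < t -> is_derive t (1 : R) (hh m i) (hh_d i t).
Proof. exact: mon_derive. Qed.

Lemma hd_derive i t : 0 < t -> is_derive t (1 : R) (hh_d i) (hdd i t).
Proof.
move=> t0; have dw : is_derive t (1 : R) (ww i) (wd i t).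
  exact: is_deriveD (is_deriveZ (al m i) (dll_derive t0)) (is_deriveZ (be R i) (dkk_derive t0)).
have := is_derive_mul dw (hh_derive i t0); move/is_derive_eq; apply.
rewrite /hdd /hh_d; ring.
Qed.

(** Turns a polynomial in the rates into a monomial, which the curvature terms are; it follows from
    y = 2 q x u / (1 + u). The exponent -19/39 is 2 (q - 1). *)
Lemma y_eq t : y t * (2 * q * x t - y t) = 4 * q ^+ 2 * expR (- (19 / 39) * ll t - 6 * kk t).
Proof.
set u := expR (2 * q * ll t).
have k1 : expR (kk t) = 1 + u := expR_kk t.
have yE : y t = 2 * q * x t * u * expR (- kk t).
  have -> : y t = 2 * q * (x t * u * expR (- kk t)); last by rewrite !mulrA.
  by rewrite /dkk /dll /u -!expRD; congr (_ * expR _); ring.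
have -> : expR (- (19 / 39) * ll t - 6 * kk t) = x t ^+ 2 * u * expR (- kk t) ^+ 2.
  by rewrite /dll /u -!expRM_natl -!expRD; congr expR; rewrite /qe; field.
rewrite yE expRN k1; have : 1 + u != 0 by rewrite -k1 gt_eqF ?expR_gt0.
by move: (x t) => X u1; field.
Qed.

Lemma hh_ratio t : hh m 2 t / (hh m 0 t * hh m 1 t) = 2 * (y t * (2 * q * x t - y t)) /\
  hh m 5 t / (hh m 3 t * hh m 4 t) = 2 * (y t * (2 * q * x t - y t)).
Proof.
rewrite y_eq /hh /mon /cf /al /be /= !mul1r.
have S (C a b c : R) : a - b - b = c -> C * expR a / (expR b * expR b) = C * expR c.
  by move=> <-; rewrite invfM -!expRN -!mulrA -!expRD addrA.
split; rewrite (S _ _ _ (- (19 / 39) * ll t - 6 * kk t)); by field.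
Qed.

Lemma sum_ww t : \sum_(i < n) 2^-1 * ww i t = x t + 2 * y t.
Proof.
rewrite (sum6 (F := fun i => 2^-1 * ww i t))//; last first.
  by do 6![case=> [//|]]; move=> i _; rewrite /ww /al /be /= !nth_nil !mul0r addr0 mulr0.
rewrite /ww /al /be /=; by field.
Qed.

(** This is 1 minus the sum of the p_i^2, with 6084 = 4 * 39^2. *)
Definition field_coef : R := (2520 - 348 * m - 12 * m ^+ 2) / 6084.

Lemma einstein_hmat (A : R) : A ^+ 2 = field_coef ->
  einstein_scalar_development (heis2 R n) (hmat m n) (fun t => A * ll t).
Proof.
move=> HA; split; [exact: hmat_smooth|exact: phi_smooth|by move=> t _; exact: hmat_inner|].
have h0 i t : 0 < t -> 0 < hh m i t by move=> _; exact: hh_gt0.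
have hn i t : hh m i t != 0 by rewrite gt_eqF ?hh_gt0.
have rE (i : 'I_n) t : rr (fun i : 'I_n => hh m i) (fun i : 'I_n => hh_d i) i t = 2^-1 * ww i t.
  by rewrite /rr /hh_d; field; rewrite hn.
have cN' (i j a : 'I_n) : sconst (heis2 R n) i j a = - sconst (heis2 R n) j i a by exact: hsN.
have c0' (i b a j k : 'I_n) : sconst (heis2 R n) i b a * sconst (heis2 R n) j k b = 0 by exact: hs0.
have cD' (a d b e : 'I_n) : a != d -> sconst (heis2 R n) b e a * sconst (heis2 R n) b e d = 0.
  exact: hsD.
have cE' (i j b d : 'I_n) : i != j -> sconst (heis2 R n) i b d * sconst (heis2 R n) j b d = 0.
  exact: hsE.
have Dp (t : R) : 0 < t -> is_derive t (1 : R) (fun t => A * ll t) (A * x t).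
  by move=> t0; exact: is_deriveZ (ll_derive t0).
apply: (ricci_scalar cN' c0' cD' cE' (fun (i : 'I_n) t => @h0 i t) (fun (i : 'I_n) t => @hh_derive i t)
  (fun (i : 'I_n) t => @hd_derive i t) Dp).
- move=> t t0; rewrite exprMn HA.
  have -> : \sum_(a < n) rrd (fun i : 'I_n => hh m i) (fun i : 'I_n => hh_d i) (fun i : 'I_n => hdd i) a t
      = \sum_(a < n) 2^-1 * wd a t.
    by apply: eq_bigr => a _; rewrite /rrd /hdd /hh_d; field; rewrite hn.
  under [X in _ - X]eq_bigr do rewrite rE.
  rewrite (sum6 (F := fun i => 2^-1 * wd i t))//; last first.
    by do 6![case=> [//|]]; move=> i _; rewrite /wd /al /be /= !nth_nil !mul0r addr0 mulr0.
  rewrite (sum6 (F := fun i => (2^-1 * ww i t) ^+ 2))//; last first.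
    by do 6![case=> [//|]]; move=> i _; rewrite /ww /al /be /= !nth_nil !mul0r addr0 mulr0 expr0n.
  rewrite /wd /ww /al /be /field_coef /qe /=; move: (x t) (y t) => X Y; by field.
move=> a t t0; under eq_bigr do rewrite rE.
rewrite sum_ww rE.
have -> : \sum_(d < n) \sum_(b < n) hh m d t / hh m b t * sconst (heis2 R n) a b d ^+ 2 =
   nth 0 [:: hh m 2 t / hh m 1 t; hh m 2 t / hh m 0 t; 0; hh m 5 t / hh m 4 t; hh m 5 t / hh m 3 t; 0] a.
  exact: (sum_hs1 n6 (fun i => hh m i t)).
have -> : \sum_(b < n) \sum_(e < n) sconst (heis2 R n) b e a ^+ 2 / (hh m b t * hh m e t) =
   nth 0 [:: 0; 0; 2 / (hh m 0 t * hh m 1 t); 0; 0; 2 / (hh m 3 t * hh m 4 t)] a.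
  exact: (sum_hs2 n6 (fun i => hh m i t)).
have [r1 r2] := hh_ratio t.
have S (H2 H0 H1 Y : R) : H0 != 0 -> H1 != 0 -> H2 / (H0 * H1) = Y ->
  [/\ H2 / H1 = Y * H0, H2 / H0 = Y * H1 & 2 / (H0 * H1) * H2 = 2 * Y].
  by move=> z0 z1 <-; split; field; rewrite ?z0 ?z1.
have [s1 s2 s3] := S _ _ _ _ (hn 0%N t) (hn 1%N t) r1.
have [s4 s5 s6] := S _ _ _ _ (hn 3%N t) (hn 4%N t) r2.
case: a => a an /=; rewrite /hdd /hh_d.
move: s1 s2 s3 s4 s5 s6; rewrite /wd /ww; move: (x t) (y t) => X Y.
(* Since X' = - (X + 2 Y) X, all terms with al cancel, and Y' + (X + 2 Y) Y = Y (2 q X - Y) leaves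
   the multiple of be that curvature must balance. *)
have F (al be h Z : R) : al = al -> 2^-1 * ((al * ((- X - 2 * Y) * X) + be * (((2 * q - 1) * X - 3 * Y) * Y) +
    (al * X + be * Y) ^+ 2) * h) + 2^-1 * (X + 2 * Y) * ((al * X + be * Y) * h) -
    2^-1 * (al * X + be * Y) * ((al * X + be * Y) * h) + 4^-1 * h ^+ 2 * Z =
    h * (2^-1 * be * (Y * (2 * q * X - Y)) + 4^-1 * (Z * h)).
  by move=> _; field.
move=> s1 s2 s3 s4 s5 s6; rewrite F//.
have [->|a0] := eqVneq a 0%N; first by rewrite /= s1 /be /=; field.
have [->|a1] := eqVneq a 1%N; first by rewrite /= s2 /be /=; field.
have [->|a2] := eqVneq a 2%N; first by rewrite /= s3 /be /=; field.
have [->|a3] := eqVneq a 3%N; first by rewrite /= s4 /be /=; field.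
have [->|a4] := eqVneq a 4%N; first by rewrite /= s5 /be /=; field.
have [->|a5] := eqVneq a 5%N; first by rewrite /= s6 /be /=; field.
move: a0 a1 a2 a3 a4 a5; clear; do 6![case: a => [//|a]] => *.
by rewrite /be /= !nth_nil; field.
Qed.

Lemma hmat_gq (p v : 'rV[R]_(1 + n)) : half_space p ->
  quad (st_metric (heis2 R n) (hmat m n) p) v = gq (heis2 R n) (fun i : 'I_n => hh m i) p v.
Proof.
move=> hp; rewrite gE /quad -[v]mk_eta /mk.
rewrite mul_row_block tr_row_mx mul_row_col !mulmx0 addr0 add0r mxE /gq -/(mk _ _) tcoord_mk; congr (_ + _).
  by rewrite -scalar_mxM tr_scalar_mx -scalar_mxM mxE eqxx mulr1n mulrN1 mulNr expr2.
rewrite /theta rsubmx_mk.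
have -> : rsubmx v - 2^-1 *: bracket (heis2 R n) (rsubmx p) (rsubmx v) =
  rsubmx v *m Jm (heis2 R n) (rsubmx p) by rewrite mulmxBr mulmx1 mul_Nm.
rewrite !mulmxA -(mulmxA _ (Jm _ _)^T) -trmx_mul -/(quad _ _) quad_hmat.
by apply: eq_bigr => i _.
Qed.

(** The direction whose length blows up is X1, index 0, along which brackets have no component. *)
Lemma hmat_inextendible (Gam : discrete_subgroup (heis2 R n)) :
  C0_inextendible (quotient_spacetime Gam (hmat m n)).
Proof.
have n0 : (0 < n)%N by apply: leq_trans n6.
apply: (@inextendible R n _ _ (fun i : 'I_n => hh m i) hmat_gq (@Bh R) (@bh R) _ _ _ _ _ (Ordinal n0)).
- by move=> t; exact: Bh_derive.
- by move=> t; exact: bh_gt0.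
- by move=> t i; exact: hh_bh.
- exact: Bh_bd.
- by move=> i k T; exact: hh_decay.
- move=> u v; rewrite mxE big1// => i _; rewrite big1// => j _.
  have -> : sconst (heis2 R n) i j (Ordinal n0) = hs R i j 0 by [].
  by rewrite hs_noncentral ?mul0r.
exact: hh0_infty.
Qed.

End Einstein.

Lemma Rintegral_bigsum (R : realType) (D : set (measurableTypeR R)) (J : Type) (s : seq J)
    (F : J -> R -> R) : measurable D ->
  (forall j, (@lebesgue_measure R).-integrable D (EFin \o F j)) ->
  (@lebesgue_measure R).-integrable D (EFin \o (fun t => \sum_(j <- s) F j t)) /\
  \int[@lebesgue_measure R]_(t in D) (\sum_(j <- s) F j t) =
    \sum_(j <- s) \int[@lebesgue_measure R]_(t in D) F j t.
Proof.
move=> mD HF; elim: s => [|j s [IH1 IH2]].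
  have -> : (fun t => \sum_(j <- [::]) F j t) = cst 0.
    by apply/funext => t; rewrite big_nil.
  split; first exact: integrable0.
  by rewrite big_nil Rintegral_cst// mul0r.
have E : (fun t => \sum_(j <- j :: s) F j t) = (fun t => F j t + \sum_(j <- s) F j t).
  by apply/funext => t; rewrite big_cons.
split; first by rewrite E; have := integrableD mD (HF j) IH1.
by rewrite big_cons -IH2 -RintegralD// E.
Qed.

(** * Filling constants *)

Section IntegralEstimates.
Variable R : realType.
Local Notation mu := (@lebesgue_measure R).
Variables (a b : R).
Hypothesis a0 : 0 < a.
Hypothesis ab : a < b.
Local Notation I := [set` `[a, b]].
Local Notation int f := (mu.-integrable I (EFin \o f)).
Implicit Types (f g v : R -> R).

Definition pos_continuous f := forall t : R, 0 < t -> {for t, continuous f}.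

Let mI : @measurable _ (measurableTypeR R) I. Proof. exact: measurable_itv. Qed.
Local Notation mfun g := (measurable_fun (I : set (measurableTypeR R)) (g : R -> R)).

Lemma pcV f : (forall t, 0 < t -> 0 < f t) -> pos_continuous f -> pos_continuous (fun t => (f t)^-1).
Proof. by move=> f0 cf t t0; apply: cvgV; [rewrite gt_eqF ?f0|exact: cf]. Qed.

Lemma pcM f g : pos_continuous f -> pos_continuous g -> pos_continuous (fun t => f t * g t).
Proof. by move=> cf cg t t0; apply: cvgM; [exact: cf|exact: cg]. Qed.

Lemma pcD f g : pos_continuous f -> pos_continuous g -> pos_continuous (fun t => f t + g t).
Proof. by move=> cf cg t t0; apply: cvgD; [exact: cf|exact: cg]. Qed.

Lemma pc_cst (k : R) : pos_continuous (fun=> k).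
Proof. by move=> t _; exact: cvg_cst. Qed.

Lemma pc_sqrt f : pos_continuous f -> pos_continuous (fun t => Num.sqrt (f t)).
Proof.
move=> cf t t0; apply: (@continuous_comp R R R f Num.sqrt t (cf t t0)).
exact: sqrt_continuous.
Qed.

Lemma pc_within f : pos_continuous f -> {within I, continuous f}.
Proof.
move=> cf; apply: continuous_in_subspaceT => t; rewrite inE /= in_itv /= => /andP[at_ _].
by apply: cf; exact: lt_le_trans at_.
Qed.

Lemma within_measurable f : {within I, continuous f} -> mfun f.
Proof. by move=> cf; apply: subspace_continuous_measurable_fun. Qed.

Lemma within_bounded f : {within I, continuous f} -> [bounded f x | x in I].
Proof.
move=> cf; have := continuous_compact cf (@segment_compact _ a b).
by move=> /compact_bounded [M [rM HM]]; exists M; split => // x xM y Iy; apply: HM => //; exists y.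
Qed.

Lemma within_int f : {within I, continuous f} -> int f.
Proof. by move=> cf; apply: continuous_compact_integrable => //; exact: segment_compact. Qed.

Lemma pc_int f : pos_continuous f -> int f.
Proof. by move=> /pc_within; exact: within_int. Qed.

Lemma within_mul_int f g : {within I, continuous f} -> int g -> int (fun t => f t * g t).
Proof.
by move=> cf ig; have := integrableMr mI (within_measurable cf) (within_bounded cf) ig.
Qed.

Lemma intD f g : int f -> int g -> int (fun t => f t + g t).
Proof. by move=> If Ig; have := integrableD mI If Ig. Qed.

Lemma intZ (k : R) f : int f -> int (fun t => k * f t).
Proof. by move=> If; have := integrableZl mI k If. Qed.

Lemma sq_int g : mfun g -> int (fun t => g t ^+ 2) -> int g.
Proof.
move=> mg ig; apply: (le_integrable mI (f := EFin \o g) (g := EFin \o (fun t => 1 + g t ^+ 2))).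
- exact/measurable_EFinP.
- move=> x _ /=; rewrite lee_fin [leRHS]ger0_norm ?addr_ge0 ?sqr_ge0//.
  rewrite -subr_ge0 -[g x ^+ 2]real_normK ?num_real//.
  have := sqr_ge0 (`|g x| - 2^-1); move: (`|g x|) => z; nra.
- by apply: intD => //; apply: pc_int; exact: pc_cst.
Qed.

Definition L2 g := mfun g /\ int (fun t => g t ^+ 2).

Lemma L2Z (k : R) g : L2 g -> L2 (fun t => k * g t).
Proof.
move=> [mg ig]; split.
  have mk : mfun (fun=> k) by exact: measurable_cst.
  by have := measurable_funM mk mg.
rewrite (_ : (fun t => _) = (fun t => k ^+ 2 * g t ^+ 2)); first exact: intZ.
by apply/funext => t; rewrite exprMn.
Qed.

Lemma L2D f g : L2 f -> L2 g -> L2 (fun t => f t + g t).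
Proof.
move=> [mf sf] [mg sg]; have ms : mfun (fun t => f t + g t).
  by have := measurable_funD mf mg.
split => //.
apply: (le_integrable mI (f := EFin \o (fun t => (f t + g t) ^+ 2))
  (g := EFin \o (fun t => 2 * f t ^+ 2 + 2 * g t ^+ 2))).
- by apply/measurable_EFinP; have := measurable_funM ms ms.
- have key (u w : R) : `|(u + w) ^+ 2| <= `|2 * u ^+ 2 + 2 * w ^+ 2|.
    have u0 := sqr_ge0 u; have w0 := sqr_ge0 w; have d0 := sqr_ge0 (u - w).
    rewrite (ger0_norm (sqr_ge0 (u + w))) ger0_norm; nra.
  by move=> x _; rewrite /= lee_fin; exact: key.
- by apply: intD; exact: intZ.
Qed.

Lemma L2_sum (J : Type) (s : seq J) (F : J -> R -> R) (k : J -> R) :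
  (forall j, L2 (F j)) -> L2 (fun t => \sum_(j <- s) F j t * k j).
Proof.
move=> HF; elim: s => [|j s IH].
  rewrite (_ : (fun t => _) = cst 0); last by apply/funext => t; rewrite big_nil.
  split; first exact: measurable_cst.
  rewrite (_ : EFin \o _ = cst 0%E); first exact: integrable0.
  by apply/funext => t; rewrite /= expr0n.
rewrite (_ : (fun t => _) = (fun t => k j * F j t + \sum_(j <- s) F j t * k j)).
  by apply: L2D => //; exact: L2Z.
by apply/funext => t; rewrite big_cons mulrC.
Qed.

Definition prim g t : R := \int[mu]_(s in `[a, t]) g s.

Lemma prim_within g : int g -> {within I, continuous (prim g)}.
Proof. by move=> ig; apply: parameterized_integral_continuous => //; exact: ltW. Qed.

Lemma prim_le g t : int g -> I t -> `|prim g t| <= \int[mu]_(s in I) `|g s|.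
Proof.
move=> ig; rewrite /= in_itv /= => /andP[at_ tb].
have ing := integrable_norm ig.
apply: (@le_trans _ _ (\int[mu]_(s in `[a, t]) `|g s|)).
  apply: le_normr_Rintegral => //; apply: integrableS ig => //.
  by apply: subset_itvl; rewrite bnd_simp.
have := @Rintegral_itvB R (fun s => `|g s|) (BLeft a) (BRight b) t ing.
rewrite !bnd_simp => /(_ at_ tb) E; rewrite -subr_ge0 E.
by apply: Rintegral_ge0 => s _.
Qed.

Lemma Rint_cst (k : R) : \int[mu]_(t in I) k = k * (b - a).
Proof.
rewrite (Rintegral_cst mu mI); congr (_ * _).
have := @lebesgue_measure_itv R `[a, b]; rewrite /= lte_fin ab => ->.
by rewrite -EFinB.
Qed.

(** The choice k = F / M turns the linear bounds into a Cauchy-Schwarz inequality. *)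
Lemma amgm_trick (M E F : R) : 0 <= M -> 0 <= E -> 0 < F ->
  (forall k, 0 < k -> 2 * M <= k * E + F / k) -> M ^+ 2 <= F * E.
Proof.
move=> M0 E0 F0 H; have [->|Mn] := eqVneq M 0; first by rewrite expr0n mulr_ge0 // ltW.
have Mp : 0 < M by rewrite lt_neqAle eq_sym Mn.
have := H (F / M) (divr_gt0 F0 Mp); rewrite invf_div mulrCA mulfV ?gt_eqF// mulr1 => h.
have : M <= F / M * E by move: h; lra.
by rewrite mulrAC ler_pdivlMr// expr2.
Qed.

Lemma Rint_gt0 f : pos_continuous f -> (forall t, 0 < t -> 0 < f t) -> 0 < \int[mu]_(t in I) f t.
Proof.
move=> cf f0; have [c Ic Hc] := EVT_min (ltW ab) (pc_within cf).
have c0 : 0 < c by move: Ic; rewrite in_itv /= => /andP[+ _]; exact: lt_le_trans.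
apply: (@lt_le_trans _ _ (\int[mu]_(t in I) f c)); last first.
  have H1 := pc_int (@pc_cst (f c)); have H2 := pc_int cf.
  have := le_Rintegral mI H1 H2; apply.
  by move=> x Ix; apply: Hc; rewrite in_itv.
have -> : \int[mu]_(t in I) f c = f c * (b - a); last by rewrite mulr_gt0 ?f0 ?subr_gt0.
exact: Rint_cst.
Qed.

Section Weighted.
Variable v : R -> R.
Hypothesis cv : pos_continuous v.
Hypothesis v0 : forall t, 0 < t -> 0 < v t.
Let Phi := \int[mu]_(t in I) (v t)^-1.

Lemma Phi_gt0 : 0 < Phi.
Proof. by apply: Rint_gt0; [exact: pcV|move=> t t0; rewrite invr_gt0 v0]. Qed.

Lemma cauchy_schwarz g : mfun g -> int (fun t => g t ^+ 2) ->
  (\int[mu]_(t in I) `|g t|) ^+ 2 <= Phi * \int[mu]_(t in I) (v t * g t ^+ 2).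
Proof.
move=> mg ig2; have ig := sq_int mg ig2; have ivg := within_mul_int (pc_within cv) ig2.
have iv : int (fun t => (v t)^-1) by apply: pc_int; exact: pcV.
have pI t : I t -> 0 < v t by rewrite /= in_itv /= => /andP[+ _] => /(lt_le_trans a0)/v0.
apply: amgm_trick.
- by apply: Rintegral_ge0.
- by apply: Rintegral_ge0 => t /pI vt; rewrite mulr_ge0 ?sqr_ge0// ltW.
- exact: Phi_gt0.
move=> k k0; rewrite -RintegralZl//; last exact: integrable_norm.
rewrite -RintegralZl// mulrC -RintegralZl// -RintegralD//; [|exact: intZ..].
apply: le_Rintegral => //.
- by apply: intZ; exact: integrable_norm.
- by apply: intD; exact: intZ.
move=> t /pI vt; rewrite -[g t ^+ 2]real_normK ?num_real//; move: (`|g t|) => z.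
have kv : 0 < k * v t by exact: mulr_gt0.
rewrite -subr_ge0 (_ : _ - _ = (k * v t)^-1 * (k * v t * z - 1) ^+ 2).
  by rewrite mulr_ge0 ?sqr_ge0// ltW// invr_gt0.
by field; rewrite !gt_eqF.
Qed.

(** Each primitive is bounded by the integral of |g|, and weighted Cauchy-Schwarz bounds the product
    of the two integrals. The constant is not the sharp isoperimetric one, but a limit equal to 0
    does not depend on it. *)
Lemma isoperimetric g0 g1 : mfun g0 -> mfun g1 ->
  int (fun t => g0 t ^+ 2) -> int (fun t => g1 t ^+ 2) ->
  `|\int[mu]_(t in I) (prim g0 t * g1 t - prim g1 t * g0 t)| <=
  Phi * \int[mu]_(t in I) (v t * (g0 t ^+ 2 + g1 t ^+ 2)).
Proof.
move=> m0 m1 s0 s1; have i0 := sq_int m0 s0; have i1 := sq_int m1 s1.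
have c0 := prim_within i0; have c1 := prim_within i1.
have j0 := within_mul_int c0 i1; have j1 := within_mul_int c1 i0.
set M0 := \int[mu]_(t in I) `|g0 t|; set M1 := \int[mu]_(t in I) `|g1 t|.
have B f g M : int f -> int g -> (forall t, I t -> `|f t| <= M) ->
    int (fun t => f t * g t) ->
   `|\int[mu]_(t in I) (f t * g t)| <= M * \int[mu]_(t in I) `|g t|.
  move=> If Ig fM ifg; apply: (le_trans (le_normr_Rintegral mI ifg)).
  rewrite -RintegralZl//; last exact: integrable_norm.
  apply: le_Rintegral => //; [exact: integrable_norm|by apply: intZ; exact: integrable_norm|].
  by move=> t It; rewrite normrM ler_wpM2r// fM.
have h0 : `|\int[mu]_(t in I) (prim g0 t * g1 t)| <= M0 * M1.
  by apply: B => //; [exact: within_int|move=> t It; exact: prim_le].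
have h1 : `|\int[mu]_(t in I) (prim g1 t * g0 t)| <= M1 * M0.
  by apply: B => //; [exact: within_int|move=> t It; exact: prim_le].
rewrite RintegralB//; apply: (le_trans (ler_normB _ _)).
have -> : \int[mu]_(t in I) (v t * (g0 t ^+ 2 + g1 t ^+ 2)) =
   \int[mu]_(t in I) (v t * g0 t ^+ 2) + \int[mu]_(t in I) (v t * g1 t ^+ 2).
  rewrite -RintegralD//; try exact: (within_mul_int (pc_within cv)).
  by apply: eq_Rintegral => t _; rewrite mulrDr.
have := cauchy_schwarz m0 s0; have := cauchy_schwarz m1 s1; rewrite -/M0 -/M1.
have := sqr_ge0 (M0 - M1); move: h0 h1; rewrite mulrDr.
move: (`|_|) (`|_|) (Phi * _) (Phi * _) => A B' C D; nra.
Qed.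

End Weighted.

End IntegralEstimates.

(** Inverse of the Gram matrix of a subspace that H preserves: B includes it, P reads coordinates on
    it, K projects onto it, and D is the inverse of H. *)
Lemma inv_gram (R : realType) n d (P : 'M[R]_(n, d)) (B : 'M[R]_(d, n)) (K H D : 'M[R]_n) :
  B *m P = 1%:M -> K *m P *m B = K -> K^T = K -> B *m K = B -> H *m D = 1%:M ->
  H *m K = K *m H -> invmx (B *m H *m B^T) = P^T *m (K *m D *m K) *m P.
Proof.
move=> BP KP KT BK HD HK.
have E : B *m H *m B^T *m (P^T *m (K *m D *m K) *m P) = 1%:M.
  have KB : B^T *m (P^T *m K) = K by rewrite -{1}KT -!trmx_mul KP.
  have -> : B *m H *m B^T *m (P^T *m (K *m D *m K) *m P) =
     B *m (H *m (B^T *m (P^T *m K)) *m D) *m K *m P by rewrite !mulmxA.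
  by rewrite KB HK -(mulmxA K) HD mulmx1 BK BK BP.
have [um _] := mulmx1_unit E.
by rewrite -[LHS]mulmx1 -E mulKmx.
Qed.

Lemma two_rows (R : realType) n d (A : 'M[R]_(n, d)) (x y : R) i j k :
  ((x *: delta_mx 0 i + y *: delta_mx 0 j) *m A) (0 : 'I_1) k = x * A i k + y * A j k.
Proof. by rewrite mulmxDl -!scalemxAl -!rowE !mxE. Qed.

(** * The centre and the quotient in coordinates *)

Section CenterAlgebra.
Variables (R : realType) (m : R) (n : nat).
Hypothesis m_bd : 3 <= m <= 6.
Hypothesis n6 : (6 <= n)%N.
Local Notation L := (heis2 R n).
Local Notation C := (Defs.center L).
Local Notation h := (hmat m n).
Local Notation e_ i := (delta_mx (0 : 'I_1) i : 'rV[R]_n).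
Implicit Types (i j k : 'I_n) (u : 'rV[R]_n).

(** The positions of X1, Y1, X2, Y2; the flat directions count as central. *)
Definition noncentral (i : nat) : bool := i \in [:: 0; 1; 3; 4]%N.

Lemma hs_central (i j k : nat) : ~~ noncentral i -> hs R i j k = 0.
Proof.
have [//|H] := hsP R i j k.
move: H; rewrite !inE !xpair_eqE => /or4P[] /andP[/andP[/eqP-> _] _] //.
Qed.

Definition oi (i : nat) (Hi : (i < 6)%N) : 'I_n := Ordinal (leq_trans Hi n6).
Local Notation o0 := (@oi 0 isT).
Local Notation o1 := (@oi 1 isT).
Local Notation o2 := (@oi 2 isT).
Local Notation o3 := (@oi 3 isT).
Local Notation o4 := (@oi 4 isT).
Local Notation o5 := (@oi 5 isT).

Lemma center_mul u :
  u *m (\matrix_(i < n) mxvec (\matrix_(j < n, k < n) sconst L i j k)) =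
  mxvec (\matrix_(j, k) \sum_i u 0 i * hs R i j k).
Proof.
rewrite mulmx_sum_row.
have -> : \sum_i u 0 i *: row i (\matrix_(i < n) mxvec (\matrix_(j < n, k < n) sconst L i j k)) =
   mxvec (\sum_i u 0 i *: (\matrix_(j < n, k < n) sconst L i j k)).
  by rewrite linear_sum; apply: eq_bigr => i _; rewrite rowK linearZ.
congr mxvec; apply/matrixP => j k; rewrite summxE mxE; apply: eq_bigr => i _.
by rewrite !mxE.
Qed.

Lemma centerP u : reflect (forall i, noncentral i -> u 0 i = 0) (u <= C)%MS.
Proof.
apply: (iffP idP) => [/sub_kermxP|H]; last first.
  apply/sub_kermxP; rewrite center_mul; apply/eqP; rewrite mxvec_eq0; apply/eqP/matrixP => j k.
  rewrite !mxE big1// => i _; have [ni|ci] := boolP (noncentral i); first by rewrite H ?mul0r.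
  by rewrite hs_central ?mulr0.
rewrite center_mul => /eqP; rewrite mxvec_eq0 => /eqP/matrixP H.
have one i j k : (forall i' : 'I_n, i' != i -> hs R i' j k = 0) -> hs R i j k != 0 -> u 0 i = 0.
  move=> H1 H2; have := H j k; rewrite !mxE (bigD1 i)//= big1 ?addr0; last first.
    by move=> i' ii; rewrite H1 ?mulr0.
  by move/eqP; rewrite mulf_eq0 (negbTE H2) orbF => /eqP.
have z (i' j k : nat) : (i', j, k) \notin [:: (0, 1, 2); (1, 0, 2); (3, 4, 5); (4, 3, 5)]%N -> hs R i' j k = 0.
  by move=> H'; have [//|] := hsP R i' j k; rewrite (negbTE H').
have nv (i j : 'I_n) : i != j -> (i : nat) != j by [].
move=> i; rewrite /noncentral !inE => /or4P[] /eqP iE.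
- apply: (one i o1 o2); last by rewrite iE /hs /heis2_rel /= subr0 oner_eq0.
  by move=> i' /nv; rewrite iE => i'0; apply: z; rewrite !inE !xpair_eqE /= (negbTE i'0) !andbF.
- apply: (one i o0 o2); last by rewrite iE /hs /heis2_rel /= sub0r oppr_eq0 oner_eq0.
  by move=> i' /nv; rewrite iE => i'0; apply: z; rewrite !inE !xpair_eqE /= (negbTE i'0) !andbF.
- apply: (one i o4 o5); last by rewrite iE /hs /heis2_rel /= subr0 oner_eq0.
  by move=> i' /nv; rewrite iE => i'0; apply: z; rewrite !inE !xpair_eqE /= (negbTE i'0) !andbF.
- apply: (one i o3 o5); last by rewrite iE /hs /heis2_rel /= sub0r oppr_eq0 oner_eq0.
  by move=> i' /nv; rewrite iE => i'0; apply: z; rewrite !inE !xpair_eqE /= (negbTE i'0) !andbF.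
Qed.

Lemma inf_min (A : set R) x : A x -> lbound A x -> inf A = x.
Proof.
move=> Ax lx; apply/eqP; rewrite eq_le; apply/andP; split.
  by apply: ge_inf => //; exists x.
by apply: lb_le_inf => //; exists x.
Qed.

Lemma factmod_coord u v i : in_factmod C u = in_factmod C v -> noncentral i -> u 0 i = v 0 i.
Proof.
move=> E ni; have /centerP /(_ i ni) : (u - v <= C)%MS.
  by rewrite -in_factmod_eq0 linearB /= E subrr.
by rewrite !mxE => /eqP; rewrite subr_eq0 => /eqP.
Qed.

Lemma sum_noncentral (f : 'I_n -> R) : (forall i, ~~ noncentral i -> f i = 0) ->
  \sum_i f i = f o0 + f o1 + f o3 + f o4.
Proof.
move=> f0; rewrite (bigD1 o0)//= (bigD1 o1)//= (bigD1 o3)//= (bigD1 o4)//= big1 ?addr0 ?addrA//.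
move=> i /andP[/andP[/andP[i0 i1] i3] i4]; apply: f0.
by rewrite /noncentral !inE; move: i0 i1 i3 i4; rewrite -!val_eqE /= => /negbTE-> /negbTE-> /negbTE-> /negbTE->.
Qed.

(** The metric is diagonal, so the infimum is attained at the representative without central
    coordinates. *)
Lemma quotV_hmat t (v : 'rV[R]_(dimV L)) : quotV (h t) v =
  \sum_(i < n | noncentral i) hh m i t * val_factmod (U := C) v 0 i ^+ 2.
Proof.
set w := val_factmod v.
apply: inf_min.
  exists (\row_i (if noncentral i then w 0 i else 0)) => /=.
    rewrite -[RHS](val_factmodK (U := C)) -/w; apply/eqP; rewrite -subr_eq0 -linearB /= in_factmod_eq0.
    by apply/centerP => i ni; rewrite !mxE ni subrr.
  rewrite quad_hmat [RHS]big_mkcond; apply: eq_bigr => i _; rewrite mxE.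
  by case: ifP => _ //; rewrite expr0n mulr0.
move=> _ [u /= uv <-]; rewrite quad_hmat big_mkcond; apply: ler_sum => i _.
case: ifP => ni; last by rewrite mulr_ge0 ?sqr_ge0// ltW// hh_gt0.
by rewrite (@factmod_coord w u)// /w val_factmodK.
Qed.

(** The centre is given through a kernel whose row basis is not explicit, so computations use the
    coordinate map [P], the inclusion [B] and the projection [K] in place of a basis. *)
Let P : 'M[R]_(n, dimZ L) := in_submod C 1%:M.
Let B : 'M[R]_(dimZ L, n) := val_submod (U := C) 1%:M.
Let K : 'M[R]_n := diag_mx (\row_i (~~ noncentral i)%:R).

Lemma BP : B *m P = 1%:M. Proof. by rewrite -in_submodE val_submodK. Qed.

Lemma row_sub_center (r0 : nat) (A : 'M[R]_(r0, n)) : A *m K = A -> (A <= C)%MS.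
Proof.
move=> <-; apply/row_subP => r; apply/centerP => i ni; rewrite mxE mul_mx_diag !mxE ni mulr0.
by [].
Qed.

Lemma KK : K *m K = K.
Proof. by rewrite mulmx_diag; congr diag_mx; apply/rowP => i; rewrite !mxE; case: noncentral; rewrite /= ?mul0r ?mulr1. Qed.

Lemma subPB (r : nat) (A : 'M[R]_(r, n)) : (A <= C)%MS -> A *m P *m B = A.
Proof. by move=> AC; rewrite -in_submodE -val_submodE in_submodK. Qed.

Lemma BK : B *m K = B.
Proof.
apply/matrixP => r i; rewrite mul_mx_diag; have := val_submodP (U := C) 1%:M.
rewrite -/B; move: B => B' BC; have /centerP /(_ i) : (row r B' <= C)%MS.
  by apply: submx_trans (row_sub _ _) BC.
rewrite !mxE; case: noncentral => H; rewrite ?mulr1//= mulr0.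
by rewrite H.
Qed.

(** For a central index i, the value of the functional lam on the i-th basis vector. *)
Definition dual (lam : 'rV[R]_(dimZ L)) i : R := (lam *m P^T) 0 i.

Lemma quad_metricZ t (w : 'rV[R]_(dimZ L)) : quad (metricZ L (h t)) w = quad (h t) (w *m B).
Proof. by rewrite quad_mulmx. Qed.

Lemma quad_inv_metricZ t (lam : 'rV[R]_(dimZ L)) :
  quad (invmx (metricZ L (h t))) lam =
  \sum_(i < n | ~~ noncentral i) dual lam i ^+ 2 / hh m i t.
Proof.
pose D' : 'M[R]_n := diag_mx (\row_(i < n) (hh m i t)^-1).
have DD : h t *m D' = 1%:M.
  rewrite mulmx_diag; apply/matrixP => i j; rewrite !mxE mulfV//.
  by rewrite gt_eqF ?hh_gt0.
have KC : (K <= C)%MS by apply: row_sub_center; exact: KK.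
have KP : K *m P *m B = K by apply: subPB.
have KT : K^T = K by rewrite tr_diag_mx.
have HK : h t *m K = K *m h t.
  by rewrite !mulmx_diag; congr diag_mx; apply/rowP => i; rewrite !mxE mulrC.
have E : invmx (metricZ L (h t)) = P^T *m (K *m D' *m K) *m P := inv_gram BP KP KT BK DD HK.
have -> : quad (invmx (metricZ L (h t))) lam = quad (K *m D' *m K) (lam *m P^T).
  by rewrite quad_mulmx trmxK E.
rewrite !mulmx_diag quad_diag [RHS]big_mkcond; apply: eq_bigr => i _.
rewrite -/(dual lam i) !mxE.
by case: noncentral; rewrite /= ?mul0r ?mul1r ?mulr1 ?mulr0 ?mul0r// mulrC.
Qed.

Section Curves.
Variables a b : R.
Hypothesis a0 : 0 < a.
Hypothesis ab : a < b.
Local Notation mu := (@lebesgue_measure R).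
Local Notation I := [set` `[a, b]].
Local Notation int f := (mu.-integrable I (EFin \o f)).

Section FromW.
Variables xi dxi : R -> 'rV[R]_(dimV L).
Hypothesis W : W12_0 a b xi dxi.

Definition dX (i : 'I_n) t : R := val_factmod (U := C) (dxi t) 0 i.

Let F : 'M[R]_(dimV L, n) := val_factmod (U := C) 1%:M.

Lemma val_factmod_sum (w : 'rV[R]_(dimV L)) i :
  val_factmod (U := C) w 0 i = \sum_k w 0 k * F k i.
Proof. by rewrite val_factmodE mxE. Qed.

Lemma dxi_L2 (k : 'I_(dimV L)) : L2 a b (fun t => dxi t 0 k).
Proof. by have [m1 m2 _ _] := W; split; [exact: m1|exact: m2]. Qed.

Lemma dX_L2 i : L2 a b (dX i).
Proof.
rewrite (_ : dX i = fun t => \sum_k dxi t 0 k * F k i); last first.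
  by apply/funext => t; exact: val_factmod_sum.
by apply: L2_sum => k; exact: dxi_L2.
Qed.

Lemma X_prim i t : a <= t <= b -> val_factmod (U := C) (xi t) 0 i = prim a (dX i) t.
Proof.
move=> tI; have [_ _ p _] := W; rewrite val_factmod_sum /prim.
have mD : @measurable _ (measurableTypeR R) [set` `[a, t]] by exact: measurable_itv.
have iD (k : 'I_(dimV L)) : mu.-integrable [set` `[a, t]] (EFin \o (fun t => dxi t 0 k)).
  have [mk sk] := dxi_L2 k; have ik := sq_int a0 mk sk.
  apply: integrableS ik => //.
  by apply: subset_itvl; rewrite bnd_simp; case/andP: tI.
have iF (k : 'I_(dimV L)) : mu.-integrable [set` `[a, t]] (EFin \o (fun t => dxi t 0 k * F k i)).
  have := integrableZr mD (F k i) (iD k).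
  by [].
have [_ E] := Rintegral_bigsum (index_enum _) mD iF.
transitivity (\int[mu]_(s in `[a, t]) (\sum_k dxi s 0 k * F k i)).
  rewrite E; apply: eq_bigr => k _; rewrite p// RintegralZr//.
by apply: eq_Rintegral => s _; rewrite /dX val_factmod_sum.
Qed.

(** The signed area enclosed by the projection of the loop to the (i, j)-plane; two such areas are
    the Z1 and Z2 components of Q. *)
Definition qf (i j : 'I_n) : R :=
  2^-1 * \int[mu]_(t in I) (prim a (dX i) t * dX j t - prim a (dX j) t * dX i t).

Lemma dX_int i : int (dX i).
Proof. by have [mk sk] := dX_L2 i; exact: sq_int mk sk. Qed.

Lemma prim_dX_int i j : int (fun t => prim a (dX i) t * dX j t - prim a (dX j) t * dX i t).
Proof.
have mI : @measurable _ (measurableTypeR R) I by exact: measurable_itv.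
have h (k l : 'I_n) := within_mul_int (prim_within ab (dX_int k)) (dX_int l).
by have := integrableB mI (h i j) (h j i).
Qed.

Definition Qvec : 'rV[R]_n := qf o0 o1 *: e_ o2 + qf o3 o4 *: e_ o5.

Lemma bracket_vec (u v : 'rV[R]_n) : bracket L u v =
  (u 0 o0 * v 0 o1 - u 0 o1 * v 0 o0) *: e_ o2 + (u 0 o3 * v 0 o4 - u 0 o4 * v 0 o3) *: e_ o5.
Proof.
apply/rowP => k.
transitivity (\sum_(i < n) \sum_(j < n) hs R i j k * u 0 i * v 0 j); first by rewrite mxE.
rewrite sum_noncentral => [|i ci]; last by rewrite big1// => j _; rewrite hs_central ?mul0r.
rewrite !sum_noncentral; try by move=> j cj; rewrite hsN hs_central ?oppr0 ?mul0r.
rewrite /hs /heis2_rel !inE !xpair_eqE /= !mxE eqxx /= -!val_eqE /=.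
by case: (_ == 2)%N; case: (_ == 5)%N; rewrite /=; ring.
Qed.

Lemma bV_val s : bV (L := L) (xi s) (dxi s) =
  bracket L (val_factmod (U := C) (xi s)) (val_factmod (U := C) (dxi s)) *m P.
Proof. by rewrite /bV in_submodE. Qed.

Lemma fillQ_vec : fillQ a b xi dxi = Qvec *m P.
Proof.
apply/rowP => k; rewrite [LHS]mxE.
have mI : @measurable _ (measurableTypeR R) I by exact: measurable_itv.
pose D i j t := prim a (dX i) t * dX j t - prim a (dX j) t * dX i t.
have E : \int[mu]_(t in I) bV (L := L) (xi t) (dxi t) 0 k =
   \int[mu]_(t in I) (P o2 k * D o0 o1 t + P o5 k * D o3 o4 t).
  apply: eq_Rintegral => t; rewrite inE /= in_itv /= => tI.
  rewrite bV_val bracket_vec !X_prim// two_rows -!/(dX _ _) /D; ring.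
rewrite E RintegralD//; try by apply: intZ; exact: prim_dX_int.
rewrite !RintegralZl//; try exact: prim_dX_int.
rewrite /Qvec two_rows /qf; ring.
Qed.

Lemma Qvec_center : (Qvec <= C)%MS.
Proof.
apply/centerP => i; rewrite !mxE eqxx /= -!val_eqE /= /noncentral !inE.
by case/or4P => /eqP->; rewrite !mulr0 addr0.
Qed.

Lemma dual_fillQ (lam : 'rV[R]_(dimZ L)) :
  (lam *m (fillQ a b xi dxi)^T) 0 0 = qf o0 o1 * dual lam o2 + qf o3 o4 * dual lam o5.
Proof.
rewrite fillQ_vec trmx_mul mulmxA /Qvec linearD /= !linearZ /= mulmxDr -!scalemxAr !trmx_delta -!colE /dual.
by move: (lam *m P^T) => w; rewrite !mxE.
Qed.

Lemma quad_fillQ t : quad (metricZ L (h t)) (fillQ a b xi dxi) =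
  hh m 2 t * qf o0 o1 ^+ 2 + hh m 5 t * qf o3 o4 ^+ 2.
Proof.
rewrite quad_metricZ fillQ_vec subPB ?Qvec_center// quad_hmat.
rewrite (bigD1 o2)//= (bigD1 o5)//= big1 => [|i /andP[i2 i5]]; last first.
  by rewrite !mxE (negbTE i2) (negbTE i5) !andbF !mulr0 addr0 expr0n mulr0.
by rewrite !mxE !eqxx /= !mulr1 !mulr0 !addr0 add0r.
Qed.

Lemma quotV_dxi t : quotV (h t) (dxi t) =
  hh m 0 t * dX o0 t ^+ 2 + hh m 1 t * dX o1 t ^+ 2 + hh m 3 t * dX o3 t ^+ 2 + hh m 4 t * dX o4 t ^+ 2.
Proof.
rewrite quotV_hmat big_mkcond sum_noncentral//.
by move=> i /negbTE ->.
Qed.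

End FromW.

End Curves.

End CenterAlgebra.

Section FTC.
Variable R : realType.
Local Notation mu := (@lebesgue_measure R).
Implicit Types (F f : R -> R) (a b : R).

Lemma pc_derive F f : (forall t : R, 0 < t -> is_derive t (1 : R) F (f t)) -> pos_continuous F.
Proof. by move=> H t t0; exact: is_derive_continuous (H t t0). Qed.

Lemma FTC_pos F f a b : 0 < a -> a <= b ->
  (forall t : R, 0 < t -> is_derive t (1 : R) F (f t)) -> pos_continuous f ->
  \int[mu]_(t in `[a, b]) f t = F b - F a.
Proof.
move=> a0; rewrite le_eqVlt => /predU1P[<- _ _|ab dF cf].
  by rewrite set_itv1 Rintegral_set1 subrr.
have cF := pc_derive dF.
have dF' : derivable_oo_LRcontinuous F a b.
  split.
  - move=> x; rewrite in_itv /= => /andP[ax _].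
    by case: (dF x (lt_trans a0 ax)).
  - by apply: cvg_at_right_filter; exact: cF.
  - by apply: cvg_at_left_filter; apply: cF; exact: lt_trans ab.
have := continuous_FTC2 ab (pc_within a0 cf) dF' _; rewrite /Rintegral => ->//.
move=> x; rewrite in_itv /= => /andP[ax _]; rewrite derive1E.
by case: (dF x (lt_trans a0 ax)).
Qed.

Lemma Rint_sub f a b c d : 0 < a -> a < b -> a <= c -> d <= b -> pos_continuous f ->
  (forall t, 0 < t -> 0 <= f t) ->
  \int[mu]_(t in `[c, d]) f t <= \int[mu]_(t in `[a, b]) f t.
Proof.
move=> a0 ab ac db cf f0.
have mI (x y : R) : @measurable _ (measurableTypeR R) `[x, y] by exact: measurable_itv.
have If := pc_int b a0 cf.
have sub : [set` `[c, d]] `<=` [set` `[a, b]].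
  move=> x; rewrite /= !in_itv /= => /andP[cx xd].
  by rewrite (le_trans ac cx) (le_trans xd db).
have If' := integrableS (mI a b) (mI c d) sub If.
apply: fine_le; [exact: (integrable_fin_num (mI c d) If')|exact: (integrable_fin_num (mI a b) If)|].
apply: ge0_subset_integral => //; first by case/integrableP: If.
move=> x; rewrite /= in_itv /= lee_fin => /andP[ax _]; apply: f0; exact: lt_le_trans ax.
Qed.

End FTC.

Lemma pc_sum (R : realType) (J : Type) (s : seq J) (F : J -> R -> R) :
  (forall j, pos_continuous (F j)) -> pos_continuous (fun t => \sum_(j <- s) F j t).
Proof.
move=> HF; elim: s => [|j s IH].
  rewrite (_ : (fun t => _) = cst 0); first exact: pc_cst.
  by apply/funext => t; rewrite big_nil.
rewrite (_ : (fun t => _) = (fun t => F j t + \sum_(j <- s) F j t)); first exact: pcD.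
by apply/funext => t; rewrite big_cons.
Qed.

Section Inequalities.
Variable R : realFieldType.

Lemma ineq_a (X Y Z : R) : 0 < X -> X <= Y * Z -> 3 * X <= 4 * Y * (59 / 78 * Z).
Proof. by nra. Qed.
Lemma ineq_b (A Y B C D : R) : A <= 4 * Y * (B - C) -> 0 < Y -> 0 < C -> B <= D ->
  2^-1 * A <= 2 * Y * D.
Proof. by nra. Qed.
Lemma ineq_c (l k K : R) : k <= K -> - (19 / 78) * l <= 2 * K + ((59 / 78 - 1) * l + - 2 * k).
Proof. by lra. Qed.

Lemma ineq_d (a b v : R) : 0 < a -> 0 < b -> v ^+ 2 * b <= a ^+ 2 -> a^-1 ^+ 2 * v ^+ 2 <= b^-1.
Proof.
move=> a0 b0 H; rewrite -(ler_pM2r b0) mulVf ?gt_eqF// -mulrA exprVn mulrC ler_pdivrMr ?exprn_gt0//.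
by rewrite mul1r.
Qed.

End Inequalities.

Lemma qe_ge0 (R : realType) : 0 <= qe R.
Proof. by rewrite /qe; lra. Qed.

(** * Upper bound for [kappa_opt] *)

Section KappaOpt.
Variables (R : realType) (m : R) (n : nat).
Hypothesis m_bd : 3 <= m <= 6.
Hypothesis n6 : (6 <= n)%N.
Local Notation L := (heis2 R n).
Local Notation C := (Defs.center L).
Local Notation h := (hmat m n).
Local Notation mu := (@lebesgue_measure R).
Local Notation o0 := (@oi n n6 0 isT).
Local Notation o1 := (@oi n n6 1 isT).
Local Notation o2 := (@oi n n6 2 isT).
Local Notation o3 := (@oi n n6 3 isT).
Local Notation o4 := (@oi n n6 4 isT).
Local Notation o5 := (@oi n n6 5 isT).
Implicit Types (t T a b : R).

Lemma mon_pc (A p q : R) : pos_continuous (mon A p q).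
Proof. by apply: pc_derive => t; exact: mon_derive. Qed.

Lemma hh_pc i : pos_continuous (hh m i).
Proof. exact: mon_pc. Qed.

(** A common lower bound for a_X a_Y / a_Z in the two factors: 19/78 = 1 - q, the powers of 1 + u
    only help, and 1/3 comes from 8 q^2 <= 9. *)
Definition vv : R -> R := mon (3^-1) (19 / 78) 0.

Lemma vv_gt0 t : 0 < vv t. Proof. by rewrite mulr_gt0 ?expR_gt0. Qed.

Lemma vv_bound t (i j : nat) : (i, j) \in [:: (0, 2); (1, 2); (3, 5); (4, 5)]%N ->
  vv t ^+ 2 * hh m j t <= hh m i t ^+ 2.
Proof.
move=> H; have [m1 m2] := mP m_bd.
have E (A x y z B : R) : 0 <= A -> A <= 9 * B -> 2 * x + y <= z ->
    (3^-1 * expR x) ^+ 2 * (A * expR y) <= B * expR z.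
  move=> A0 AB xyz; rewrite exprMn -expRM_natl mulrACA -expRD.
  have : expR (2 * x + y) <= expR z by rewrite ler_expR.
  have : 0 < expR (2 * x + y) by exact: expR_gt0.
  move: (expR _) (expR z) => X Z; nra.
have q9 : 8 * qe R ^+ 2 <= 9 * 1 by rewrite /qe; lra.
have q0 : 0 <= 8 * qe R ^+ 2 by rewrite mulr_ge0 ?sqr_ge0.
have k0 := kk_ge0 t.
have hs2 (x : R) : expR x ^+ 2 = 1 * expR (2 * x) by rewrite mul1r expRM_natl.
by move: H; rewrite !inE !xpair_eqE => /or4P[] /andP[/eqP-> /eqP->];
  rewrite /vv /hh /mon /cf /al /be /= mul1r hs2; apply: E => //; lra.
Qed.

(** Bounds half the integral of 1 / [vv] on (0, T): with dt = (1 + u)^2 ds this is an integral of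
    s^(q-1), up to the largest value of (1 + u)^2. *)
Definition Kb T : R := 2 * expR (2 * kk T) * expR (qe R * ll T).

Lemma Phi_bound a b T : 0 < a -> a < b -> b < T -> 2^-1 * \int[mu]_(t in `[a, b]) (vv t)^-1 <= Kb T.
Proof.
move=> a0 ab bT.
(* The derivative of s^q with respect to t. *)
pose f := mon (qe R) (qe R - 1) (- 2).
have dF (t : R) : 0 < t -> is_derive t (1 : R) (fun t => expR (qe R * ll t + 0 * kk t)) (f t).
  move=> t0; have := exp_lin_derive (qe R) 0 t0; move/is_derive_eq; apply.
  rewrite mul0r addr0 /dll /f /mon -mulrA -expRD; congr (_ * expR _); ring.
have E := FTC_pos a0 (ltW ab) dF (@mon_pc _ _ _).
have T0 : 0 < T by apply: lt_trans bT; exact: lt_trans ab.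
have vV t : (vv t)^-1 = 3 * expR (- (19 / 78) * ll t).
  by rewrite /vv /mon invfM invrK -expRN; congr (_ * expR _); ring.
have le1 : \int[mu]_(t in `[a, b]) (vv t)^-1 <= \int[mu]_(t in `[a, b]) (4 * expR (2 * kk T) * f t).
  apply: le_Rintegral => //.
  - by apply: pc_int => //; apply: pcV => [t _|]; [exact: vv_gt0|exact: mon_pc].
  - by apply: pc_int => //; apply: pcM; [exact: pc_cst|exact: mon_pc].
  move=> t; rewrite /= in_itv /= => /andP[at_ tb]; rewrite vV /f /mon.
  have t0 : 0 < t by exact: lt_le_trans at_.
  have kT : kk t <= kk T by apply: kk_mono => //; exact: ltW (le_lt_trans tb bT).
  have : expR (- (19 / 78) * ll t) <= expR (2 * kk T) * expR ((qe R - 1) * ll t + - 2 * kk t).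
    by rewrite -expRD ler_expR; exact: ineq_c kT.
  by move=> H; apply: ineq_a H; exact: expR_gt0.
have e2 : \int[mu]_(t in `[a, b]) (4 * expR (2 * kk T) * f t) =
    4 * expR (2 * kk T) * (expR (qe R * ll b + 0 * kk b) - expR (qe R * ll a + 0 * kk a)).
  by rewrite -E RintegralZl//; apply: pc_int => //; exact: mon_pc.
have lb : ll b <= ll T by apply: ll_mono; [exact: lt_trans ab|exact: ltW].
have : expR (qe R * ll b + 0 * kk b) <= expR (qe R * ll T).
  by rewrite ler_expR mul0r addr0 (ler_wpM2l (qe_ge0 R)).
move=> H; rewrite e2 in le1; exact: (ineq_b le1 (expR_gt0 _) (expR_gt0 _) H).
Qed.

Definition NN (lam : 'rV[R]_(dimZ L)) t : R := Num.sqrt (quad (invmx (metricZ L (h t))) lam).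

Lemma NN_pc lam : pos_continuous (NN lam).
Proof.
apply: pc_sqrt.
have -> : (fun t => quad (invmx (metricZ L (h t))) lam) =
    fun t => \sum_(i < n) (if ~~ noncentral i then dual lam i ^+ 2 * (hh m i t)^-1 else 0).
  by apply/funext => t; rewrite (quad_inv_metricZ m n6) big_mkcond.
apply: pc_sum => i; case: (noncentral i); first exact: pc_cst.
move=> t t0; apply: cvgM; first exact: cvg_cst.
by apply: cvgV; [rewrite gt_eqF ?hh_gt0|exact: hh_pc].
Qed.

(** One central coordinate already bounds the dual norm from below. This separates the two factors,
    and it has no analogue for the norm of Q in [kappa_an]. *)
Lemma NN_ge lam t (i j : nat) (k : 'I_n) : (i, j) \in [:: (0, 2); (1, 2); (3, 5); (4, 5)]%N ->
  k = j :> nat -> `|dual lam k| * vv t <= hh m i t * NN lam t.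
Proof.
move=> ij kj; have h0 := hh_gt0 m i t; have h1 := hh_gt0 m j t.
have v0 := vv_gt0 t.
rewrite -ler_pdivrMl//.
have -> : (hh m i t)^-1 * (`|dual lam k| * vv t) = Num.sqrt (((hh m i t)^-1 * (`|dual lam k| * vv t)) ^+ 2).
  have X0 : 0 <= (hh m i t)^-1 * (`|dual lam k| * vv t).
    by rewrite !mulr_ge0 ?invr_ge0 ?(ltW h0) ?(ltW v0).
  by rewrite sqrtr_sqr (ger0_norm X0).
apply: ler_wsqrtr; rewrite (quad_inv_metricZ m n6) (bigD1 k) /=; last first.
  by move: ij; rewrite kj !inE !xpair_eqE => /or4P[] /andP[_ /eqP->].
apply: (@le_trans _ _ (dual lam k ^+ 2 / hh m k t)); last first.
  by rewrite lerDl sumr_ge0// => i' _; rewrite mulr_ge0 ?sqr_ge0 ?invr_ge0 ?(ltW (hh_gt0 _ _ _)).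
rewrite kj (exprMn 2 _ (_ * vv t)) (exprMn 2 `|_| (vv t)) real_normK ?num_real//.
rewrite mulrCA; apply: ler_wpM2l; first exact: sqr_ge0.
by apply: ineq_d => //; exact: vv_bound.
Qed.

(** The pairing splits into two areas, each bounded by [isoperimetric] with weight [vv], and by
    [NN_ge] the denominator dominates both weighted energies together. *)
Lemma opt_bound a b T xi dxi lam : 0 < a -> a < b -> b < T -> W12_0 (L := L) a b xi dxi ->
  `|(lam *m (fillQ a b xi dxi)^T) 0 0| /
     \int[mu]_(t in `[a, b]) (quotV (h t) (dxi t) * NN lam t) <= Kb T.
Proof.
move=> a0 ab bT W; set D := \int[mu]_(t in _) _.
have cv : pos_continuous vv by exact: mon_pc.
have v0 t : 0 < t -> 0 < vv t by move=> _; exact: vv_gt0.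
set Phi := \int[mu]_(t in `[a, b]) (vv t)^-1.
have Phi0 : 0 < Phi := Phi_gt0 a0 ab cv v0.
have PK := Phi_bound a0 ab bT.
have l2 i := dX_L2 W i.
have q i j : `|qf a b dxi i j| <= 2^-1 * (Phi * \int[mu]_(t in `[a, b]) (vv t * (dX dxi i t ^+ 2 + dX dxi j t ^+ 2))).
  rewrite /qf normrM ger0_norm ?invr_ge0// ler_wpM2l ?invr_ge0//.
  have [mi si] := l2 i; have [mj sj] := l2 j.
  exact: (isoperimetric a0 ab cv v0 mi mj si sj).
have iv i : mu.-integrable `[a, b] (EFin \o (fun t => vv t * dX dxi i t ^+ 2)).
  by have [_ si] := l2 i; exact: within_mul_int (pc_within a0 cv) si.
have iv2 i j : mu.-integrable `[a, b] (EFin \o (fun t => vv t * (dX dxi i t ^+ 2 + dX dxi j t ^+ 2))).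
  rewrite (_ : (fun t => _) = (fun t => vv t * dX dxi i t ^+ 2 + vv t * dX dxi j t ^+ 2)); first exact: intD.
  by apply/funext => t; rewrite mulrDr.
have iN (i : nat) (j : 'I_n) : mu.-integrable `[a, b] (EFin \o (fun t => NN lam t * hh m i t * dX dxi j t ^+ 2)).
  have [_ si] := l2 j; apply: within_mul_int si; apply: (pc_within a0).
  by apply: pcM; [exact: NN_pc|exact: hh_pc].
set lam2 := `|dual lam o2|; set lam5 := `|dual lam o5|.
have DE : lam2 * \int[mu]_(t in `[a, b]) (vv t * (dX dxi o0 t ^+ 2 + dX dxi o1 t ^+ 2)) +
    lam5 * \int[mu]_(t in `[a, b]) (vv t * (dX dxi o3 t ^+ 2 + dX dxi o4 t ^+ 2)) <= D.
  rewrite -!RintegralZl// -RintegralD//; try exact: intZ.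
  have DD t : quotV (h t) (dxi t) * NN lam t = NN lam t * hh m 0 t * dX dxi o0 t ^+ 2 +
     NN lam t * hh m 1 t * dX dxi o1 t ^+ 2 + NN lam t * hh m 3 t * dX dxi o3 t ^+ 2 +
     NN lam t * hh m 4 t * dX dxi o4 t ^+ 2.
    rewrite (quotV_dxi m n6); ring.
  apply: le_Rintegral => //.
  - by apply: intD; exact: intZ.
  - rewrite (_ : (fun t => _) = (fun t => NN lam t * hh m 0 t * dX dxi o0 t ^+ 2 +
     NN lam t * hh m 1 t * dX dxi o1 t ^+ 2 + NN lam t * hh m 3 t * dX dxi o3 t ^+ 2 +
     NN lam t * hh m 4 t * dX dxi o4 t ^+ 2)); last by apply/funext => t; exact: DD.
    by apply: intD => //; apply: intD => //; apply: intD.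
  move=> t _; rewrite DD.
  have e0 := @NN_ge lam t 0 2 o2 isT erefl; have e1 := @NN_ge lam t 1 2 o2 isT erefl.
  have e3 := @NN_ge lam t 3 5 o5 isT erefl; have e4 := @NN_ge lam t 4 5 o5 isT erefl.
  have s0 := sqr_ge0 (dX dxi o0 t); have s1 := sqr_ge0 (dX dxi o1 t).
  have s3 := sqr_ge0 (dX dxi o3 t); have s4 := sqr_ge0 (dX dxi o4 t).
  have := ler_wpM2r s0 e0; have := ler_wpM2r s1 e1; have := ler_wpM2r s3 e3; have := ler_wpM2r s4 e4.
  rewrite -/lam2 -/lam5; lra.
have D0 : 0 <= D.
  apply: Rintegral_ge0 => t _; rewrite mulr_ge0 ?sqrtr_ge0// (quotV_dxi m n6).
  by rewrite !addr_ge0// mulr_ge0 ?sqr_ge0// ltW// hh_gt0.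
(* For a vanishing denominator the quotient is 0 by convention. *)
have [DZ|Dn] := eqVneq D 0.
  by rewrite DZ invr0 mulr0 /Kb !mulr_ge0 ?expR_ge0.
rewrite ler_pdivrMr; last by rewrite lt_neqAle eq_sym Dn.
rewrite (dual_fillQ n6 a0 ab W); apply: (le_trans (ler_normD _ _)).
rewrite (normrM (qf a b dxi o0 o1)) (normrM (qf a b dxi o3 o4)) -/lam2 -/lam5.
apply: (@le_trans _ _ (2^-1 * Phi * D)); last by rewrite ler_wpM2r.
have := q o0 o1; have := q o3 o4.
have l20 : 0 <= lam2 by exact: normr_ge0.
have l50 : 0 <= lam5 by exact: normr_ge0.
move: DE; move: (\int[mu]_(t in _) _) (\int[mu]_(t in _) _) => E1 E2 DE qa qb.
have h1 := ler_wpM2l l20 qb; have h2 := ler_wpM2l l50 qa.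
have h3 := ler_wpM2l (ltW Phi0) DE.
move: h1 h2 h3; lra.
Qed.

Lemma Kb_cvg e : 0 < e -> exists2 T0, 0 < T0 & forall T, 0 < T -> T < T0 -> Kb T < e.
Proof.
move=> e0; pose A := 2 * expR (2 * kk (1 : R)).
have A0 : 0 < A by rewrite mulr_gt0 ?expR_gt0.
exists (Num.min 1 (expR (ln (e / A) / qe R))); first by rewrite lt_min ltr01 expR_gt0.
move=> T T0; rewrite lt_min => /andP[T1 Te].
have q0 : 0 < qe R by rewrite /qe; lra.
have h1 : expR (qe R * ll T) < e / A.
  rewrite -[ltRHS]lnK ?posrE ?divr_gt0// ltr_expR mulrC -ltr_pdivlMr// -ltr_expR.
  by apply: lt_trans Te; exact: ll_lt.
have h2 : 2 * expR (2 * kk T) <= A.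
  rewrite /A; apply: ler_wpM2l; first exact: ler0n.
  rewrite ler_expR; apply: ler_wpM2l; first exact: ler0n.
  by apply: kk_mono => //; exact: ltW.
rewrite /Kb; apply: (@le_lt_trans _ _ (A * expR (qe R * ll T))); first by rewrite ler_wpM2r ?expR_ge0.
by rewrite mulrC -ltr_pdivlMr.
Qed.

End KappaOpt.

Lemma inv_le (R : numFieldType) (x y : R) : 0 < x -> x <= y -> y^-1 <= x^-1.
Proof. by move=> x0 xy; rewrite lef_pV2 ?posrE// (lt_le_trans x0). Qed.

Lemma div_mul (R : fieldType) (x y z : R) : x / (y * z) = x / y / z.
Proof. by rewrite invfM mulrA. Qed.

(** * A closed plane loop *)

Section Bump.
Variable R : realType.
Implicit Types (r x t : R).

(** The square makes the truncation continuously differentiable at 0. *)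
Definition pp r : R := Num.max 0 r ^+ 2.

Lemma max0_cts : continuous (fun r : R => Num.max 0 r).
Proof. by move=> r; apply: (@continuous_max R R (cst 0) id r); [exact: cst_continuous|exact: cvg_id]. Qed.

Lemma pp_derive r : is_derive r (1 : R) pp (2 * Num.max 0 r).
Proof.
have [r0|r0|->] := ltgtP r 0.
- have n1 : \forall s \near r, (cst 0 : R -> R) s = pp s.
    near=> s; rewrite /pp /=; have /ltW s0 : s < 0 by near: s; exact: lt_nbhsl.
    by rewrite max_l// expr0n.
  rewrite mulr0; apply: near_eq_is_derive n1 _; exact: is_derive_cst.
- have n1 : \forall s \near r, (fun s : R => s * s) s = pp s.
    near=> s; rewrite /pp /=; have /ltW s0 : 0 < s by near: s; exact: lt_nbhsr.
    by rewrite max_r// expr2.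
  apply: near_eq_is_derive n1 _.
  have := is_derive_mul (is_derive_id r (1 : R)) (is_derive_id r (1 : R)).
  by move/is_derive_eq; apply; ring.
rewrite mulr0.
have E (k : R) : k^-1 * (pp (k + 0) - pp 0) = Num.max 0 k.
  rewrite addr0 /pp maxxx expr0n subr0; have [k0|k0] := leP 0 k; last by rewrite expr0n mulr0.
  have [->|kn] := eqVneq k 0; first by rewrite expr0n mulr0.
  by rewrite expr2 mulrA mulVf// mul1r.
have C : (fun k : R => k^-1 *: ((pp \o shift (0 : R)) (k *: (1 : R)) - pp 0)) @ (0 : R)^' --> (0 : R).
  have -> : (fun k : R => k^-1 *: ((pp \o shift (0 : R)) (k *: (1 : R)) - pp 0)) = (fun k : R => Num.max 0 k).
    by apply/funext => k /=; rewrite -[RHS]E; congr (_ * (pp (_ + 0) - _)); exact: mulr1.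
  have M0 : Num.max (0 : R) 0 = 0 by rewrite /Num.max ltxx.
  have H : (fun k : R => Num.max 0 k) @ (0 : R) --> Num.max (0 : R) 0 := @max0_cts 0.
  by rewrite M0 in H; exact: cvg_within_filter H.
apply: DeriveDef; first by apply/cvg_ex; exists 0.
exact: cvg_lim C.
Unshelve. all: by end_near. Qed.

(** The loop ([bf], [bg]) is trivial outside [0, 1], and its area density is [bf] squared because
    the ratio of its coordinates is x. *)
Definition bf x : R := pp (x * (1 - x)).
Definition bg x : R := x * bf x.
Definition dbf x : R := 2 * Num.max 0 (x * (1 - x)) * (1 - 2 * x).
Definition dbg x : R := bf x + x * dbf x.

Lemma bf_derive x : is_derive x (1 : R) bf (dbf x).
Proof.
have d1 := is_derive_mul (is_derive_id x (1 : R)) (is_deriveB (is_derive_cst (1 : R) x (1 : R)) (is_derive_id x (1 : R))).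
have := @is_derive1_comp R pp (fun x => x * (1 - x)) x _ _ (pp_derive _) d1.
move/is_derive_eq; apply; rewrite /dbf; congr (_ * _).
have -> : (cst 1 - id) x = 1 - x :> R by [].
ring.
Qed.

Lemma bg_derive x : is_derive x (1 : R) bg (dbg x).
Proof.
have := is_derive_mul (is_derive_id x (1 : R)) (bf_derive x).
by move/is_derive_eq; apply; rewrite mul1r.
Qed.

Lemma bf_cts : continuous bf.
Proof. by move=> x; exact: is_derive_continuous (bf_derive x). Qed.

Lemma dbf_cts : continuous dbf.
Proof.
have px (y : R) : {for y, continuous (fun x : R => x * (1 - x))}.
  by apply: cvgM; [exact: cvg_id|apply: cvgB; [exact: cvg_cst|exact: cvg_id]].
move=> x; apply: cvgM; last by apply: cvgB; [exact: cvg_cst|apply: cvgM; [exact: cvg_cst|exact: cvg_id]].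
apply: cvgM; first exact: cvg_cst.
exact: (@continuous_comp R R R (fun x : R => x * (1 - x)) (fun r : R => Num.max 0 r) x (px x) (@max0_cts _)).
Qed.

Lemma dbg_cts : continuous dbg.
Proof.
move=> x; apply: cvgD; first exact: bf_cts.
by apply: cvgM; [exact: cvg_id|exact: dbf_cts].
Qed.

Lemma outside x : x <= 0 \/ 1 <= x -> bf x = 0 /\ dbf x = 0.
Proof.
move=> H; have p0 : x * (1 - x) <= 0 by case: H => H; nra.
by rewrite /bf /dbf /pp max_l// expr0n mulr0 mul0r.
Qed.

Lemma bump_bound x : dbf x ^+ 2 + dbg x ^+ 2 <= 2.
Proof.
have [x0|x0] := leP x 0; first by have [h1 h2] := outside (or_introl x0); rewrite /dbg h1 h2; nra.
have [x1|x1] := leP 1 x; first by have [h1 h2] := outside (or_intror x1); rewrite /dbg h1 h2; nra.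
have p0 : 0 <= x * (1 - x) by nra.
rewrite /dbg /dbf /bf /pp max_r//; set z := x * (1 - x).
have z1 : z <= 4^-1 by have := sqr_ge0 (x - 2^-1); rewrite /z; nra.
have w1 : 0 <= z * (2 * x) by exact: (mulr_ge0 p0 (mulr_ge0 (ler0n _ 2) (ltW x0))).
have x10 : 0 <= 1 - x by rewrite subr_ge0 ltW.
have w2 : 0 <= z * (2 * (1 - x)) by exact: (mulr_ge0 p0 (mulr_ge0 (ler0n _ 2) x10)).
have a1 : `|2 * z * (1 - 2 * x)| <= 2^-1.
  by rewrite ler_norml; apply/andP; split; move: w1 w2 z1; lra.
have a2 : `|z ^+ 2 + x * (2 * z * (1 - 2 * x))| <= 1.
  move: a1; rewrite !ler_norml => /andP[b1 b2].
  have z2 : z ^+ 2 <= 4^-1 * z by rewrite expr2 ler_wpM2r.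
  have z3 : 0 <= z ^+ 2 by exact: sqr_ge0.
  have x2 : 0 <= x * (2^-1 - 2 * z * (1 - 2 * x)) by rewrite mulr_ge0 ?subr_ge0// ltW.
  have x3 : 0 <= x * (2^-1 + 2 * z * (1 - 2 * x)) by rewrite mulr_ge0 ?(ltW x0)// -lerBlDl sub0r.
  by apply/andP; split; move: x2 x3 z2 z3 z1 x1; rewrite (mulrBr x) (mulrDr x); lra.
rewrite -[(2 * z * _) ^+ 2]real_normK ?num_real// -[(z ^+ 2 + _) ^+ 2]real_normK ?num_real//.
move: a1 a2; have := normr_ge0 (2 * z * (1 - 2 * x)); have := normr_ge0 (z ^+ 2 + x * (2 * z * (1 - 2 * x))).
move: (`|_|) (`|_|) => A B; nra.
Qed.

Lemma bump_area x : 4^-1 <= x <= 3 / 4 -> (3 / 16) ^+ 4 <= bf x ^+ 2.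
Proof.
move=> /andP[h1 h2].
have z1 : 3 / 16 <= x * (1 - x).
  have : 0 <= (x - 4^-1) * (3 / 4 - x) by rewrite mulr_ge0 ?subr_ge0.
  by lra.
have z0 : 0 <= 3 / 16 :> R by lra.
rewrite /bf /pp (max_r (le_trans z0 z1)) -exprM.
by rewrite ler_pXn2r ?nnegrE ?(le_trans z0 z1).
Qed.

Lemma wronskian x : bf x * dbg x - bg x * dbf x = bf x ^+ 2.
Proof. by rewrite /dbg /bg; ring. Qed.

Definition resc (f : R -> R) (rho tau de t : R) : R := rho * f ((t - tau) / de).

Lemma resc_derive f df rho tau de t : 0 < de -> (forall x : R, is_derive x (1 : R) f (df x)) ->
  is_derive t (1 : R) (resc f rho tau de) (resc df (rho / de) tau de t).
Proof.
move=> de0 H.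
have d0 := is_deriveB (is_derive_id t (1 : R)) (is_derive_cst tau t (1 : R)).
have d1 := is_derive_mul d0 (is_derive_cst de^-1 t (1 : R)).
have := is_deriveZ rho (@is_derive1_comp R f (fun t => (t - tau) / de) t _ _ (H _) d1).
move/is_derive_eq; apply; rewrite /resc /GRing.scale /= mulr0 addr0 subr0 mul1r; ring.
Qed.

Lemma resc_cts f rho tau de : continuous f -> continuous (resc f rho tau de).
Proof.
move=> cf t; apply: cvgM; first exact: cvg_cst.
have c1 : {for t, continuous (fun t : R => (t - tau) / de)}.
  by apply: cvgM; [apply: cvgB; [exact: cvg_id|exact: cvg_cst]|exact: cvg_cst].
exact: (@continuous_comp R R R (fun t : R => (t - tau) / de) f t c1 (cf _)).
Qed.

End Bump.

(** * Admissible curves from explicit loops *)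

Section Loops.
Variables (R : realType) (m : R) (n : nat).
Hypothesis m_bd : 3 <= m <= 6.
Hypothesis n6 : (6 <= n)%N.
Local Notation L := (heis2 R n).
Local Notation C := (Defs.center L).
Local Notation h := (hmat m n).
Local Notation mu := (@lebesgue_measure R).
Variables (a b : R).
Hypothesis a0 : 0 < a.
Hypothesis ab : a < b.
Variables (Y dY : 'I_n -> R -> R).
Hypothesis dYP : forall i (t : R), 0 < t -> is_derive t (1 : R) (Y i) (dY i t).
Hypothesis cdY : forall i, pos_continuous (dY i).
Hypothesis Ya : forall i, Y i a = 0.
Hypothesis Yb : forall i, Y i b = 0.

Definition xiY t : 'rV[R]_(dimV L) := in_factmod C (\row_i Y i t).
Definition dxiY t : 'rV[R]_(dimV L) := in_factmod C (\row_i dY i t).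

Let G : 'M[R]_(n, dimV L) := in_factmod C 1%:M.

Let in_sum (w : 'rV[R]_n) k : in_factmod C w 0 k = \sum_i w 0 i * G i k.
Proof. by rewrite in_factmodE mxE. Qed.

Lemma loop_W : W12_0 a b xiY dxiY.
Proof.
have dE k : (fun t => dxiY t 0 k) = fun t => \sum_i dY i t * G i k.
  by apply/funext => t; rewrite /dxiY in_sum; apply: eq_bigr => i _; rewrite mxE.
have xE k : (fun t => xiY t 0 k) = fun t => \sum_i Y i t * G i k.
  by apply/funext => t; rewrite /xiY in_sum; apply: eq_bigr => i _; rewrite mxE.
have cd k : pos_continuous (fun t => dxiY t 0 k).
  by rewrite dE; apply: pc_sum => i; apply: pcM; [exact: cdY|exact: pc_cst].
split.
- by move=> k; apply: within_measurable; exact: pc_within.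
- move=> k; have c2 : pos_continuous (fun t => dxiY t 0 k ^+ 2).
    rewrite (_ : (fun t => _) = (fun t => dxiY t 0 k * dxiY t 0 k)); first exact: pcM.
    by apply/funext => t; rewrite expr2.
  exact: (pc_int b a0 c2).
- move=> t k /andP[at_ tb].
  have dxi (s : R) : 0 < s -> is_derive s (1 : R) (fun t => xiY t 0 k) (dxiY s 0 k).
    move=> s0; rewrite xE; have := congr1 (fun f => f s) (dE k) => /= ->.
    apply: is_derive_bigsum => i.
    have := is_derive_mul (dYP i s0) (is_derive_cst (G i k) s (1 : R)).
    by rewrite mulr0 addr0.
  rewrite (FTC_pos a0 at_ dxi (cd k)).
  have -> : xiY a 0 k = 0.
    by rewrite /xiY in_sum big1// => i _; rewrite mxE Ya mul0r.
  by rewrite subr0.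
apply/rowP => k; rewrite /xiY in_sum mxE big1// => i _.
by rewrite mxE Yb mul0r.
Qed.

Lemma loop_dX (i : 'I_n) t : noncentral i -> dX dxiY i t = dY i t.
Proof.
move=> ni; rewrite /dX (factmod_coord n6 (v := \row_i dY i t) _ ni) ?mxE//.
by rewrite val_factmodK.
Qed.

Lemma loop_qf (i j : 'I_n) : noncentral i -> noncentral j ->
  qf a b dxiY i j = 2^-1 * \int[mu]_(t in `[a, b]) (Y i t * dY j t - Y j t * dY i t).
Proof.
move=> ni nj; congr (_ * _); apply: eq_Rintegral => t; rewrite inE /= in_itv /= => /andP[at_ tb].
have P (k : 'I_n) : noncentral k -> prim a (dX dxiY k) t = Y k t.
  move=> nk; transitivity (\int[mu]_(s in `[a, t]) dY k s).
    by apply: eq_Rintegral => s _; rewrite loop_dX.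
  by rewrite (FTC_pos a0 at_ (@dYP k) (@cdY k)) Ya subr0.
by rewrite !P// !loop_dX.
Qed.

End Loops.

(** * Two loops sharing their vertical length *)

Section KappaAn.
Variables (R : realType) (m : R) (n : nat).
Hypothesis m_bd : 3 <= m <= 6.
Hypothesis n6 : (6 <= n)%N.
Local Notation L := (heis2 R n).
Local Notation C := (Defs.center L).
Local Notation h := (hmat m n).
Local Notation mu := (@lebesgue_measure R).
Local Notation o0 := (@oi n n6 0 isT).
Local Notation o1 := (@oi n n6 1 isT).
Local Notation o3 := (@oi n n6 3 isT).
Local Notation o4 := (@oi n n6 4 isT).
Implicit Types (t : R).

(* An early loop of amplitude rho in the second Heisenberg factor, on [tau, 2 tau], followed by a
   loop of unit amplitude in the first factor, on [s, 2 s]. *)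
Definition two_loops (rho tau s : R) (i : 'I_n) t : R :=
  if i == 0%N :> nat then resc (@bf R) 1 s s t else
  if i == 1%N :> nat then resc (@bg R) 1 s s t else
  if i == 3%N :> nat then resc (@bf R) rho tau tau t else
  if i == 4%N :> nat then resc (@bg R) rho tau tau t else 0.

Definition dtwo_loops (rho tau s : R) (i : 'I_n) t : R :=
  if i == 0%N :> nat then resc (@dbf R) (1 / s) s s t else
  if i == 1%N :> nat then resc (@dbg R) (1 / s) s s t else
  if i == 3%N :> nat then resc (@dbf R) (rho / tau) tau tau t else
  if i == 4%N :> nat then resc (@dbg R) (rho / tau) tau tau t else 0.

Variables (rho tau s : R).
Hypothesis tau0 : 0 < tau.
Hypothesis ts : 2 * tau < s.
Let s0 : 0 < s. Proof. by apply: lt_trans ts; rewrite mulr_gt0. Qed.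
Let tau_s : tau < 2 * s. Proof. by move: tau0 ts; lra. Qed.

Local Notation Y := (two_loops rho tau s).
Local Notation dY := (dtwo_loops rho tau s).

Lemma Y_derive i t : 0 < t -> is_derive t (1 : R) (Y i) (dY i t).
Proof.
move=> t0; rewrite /two_loops /dtwo_loops.
case: ifP => _; first by apply: resc_derive => // x; exact: bf_derive.
case: ifP => _; first by apply: resc_derive => // x; exact: bg_derive.
case: ifP => _; first by apply: resc_derive => // x; exact: bf_derive.
case: ifP => _; first by apply: resc_derive => // x; exact: bg_derive.
exact: is_derive_cst.
Qed.

Lemma dY_pc i : pos_continuous (dY i).
Proof.
move=> t _; rewrite /dtwo_loops.
case: (_ == 0)%N; first by apply: resc_cts; exact: dbf_cts.
case: (_ == 1)%N; first by apply: resc_cts; exact: dbg_cts.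
case: (_ == 3)%N; first by apply: resc_cts; exact: dbf_cts.
case: (_ == 4)%N; first by apply: resc_cts; exact: dbg_cts.
exact: cvg_cst.
Qed.

Lemma resc_out (r T0 d t : R) : 0 < d -> t <= T0 \/ T0 + d <= t ->
  [/\ resc (@bf R) r T0 d t = 0, resc (@bg R) r T0 d t = 0,
      resc (@dbf R) r T0 d t = 0 & resc (@dbg R) r T0 d t = 0].
Proof.
move=> d0 H; have O : (t - T0) / d <= 0 \/ 1 <= (t - T0) / d.
  case: H => H; [left|right].
    by rewrite mulr_le0_ge0 ?subr_le0 ?invr_ge0 ?(ltW d0).
  by rewrite ler_pdivlMr// mul1r lerBrDl.
have [h1 h2] := outside O.
by rewrite /resc /bg /dbg h1 h2 !mulr0 !addr0 !mulr0.
Qed.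

Lemma Y_end : (forall i, Y i tau = 0) /\ (forall i, Y i (2 * s) = 0).
Proof.
have h1 : 2 * s = s + s by rewrite mulr_natl mulr2n.
have l1 : tau <= s by move: tau0 ts; lra.
have l2 : tau + tau <= 2 * s by move: tau0 ts; lra.
have [a1 a2 _ _] := @resc_out 1 s s tau s0 (or_introl l1).
have [b1 b2 _ _] := @resc_out rho tau tau tau tau0 (or_introl (lexx tau)).
have l3 : s + s <= 2 * s by rewrite h1.
have [c1 c2 _ _] := @resc_out 1 s s (2 * s) s0 (or_intror l3).
have [d1 d2 _ _] := @resc_out rho tau tau (2 * s) tau0 (or_intror l2).
by split => i; rewrite /two_loops; do 4?[case: ifP => _ //].
Qed.

Local Notation xi := (xiY Y).
Local Notation dxi := (dxiY dY).
Local Notation q1 := (qf tau (2 * s) dxi o0 o1).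
Local Notation q2 := (qf tau (2 * s) dxi o3 o4).
Local Notation I := [set` `[tau, 2 * s]].

Lemma two_loops_W : W12_0 tau (2 * s) xi dxi.
Proof. by apply: (loop_W tau0 Y_derive dY_pc); case: Y_end. Qed.

(** One half from the definition of Q, one half for the length of [1/4, 3/4], and (3/16)^4 as the
    lower bound of [bf] squared there. *)
Let k0 : R := 4^-1 * (3 / 16) ^+ 4.

Let k0_gt0 : 0 < k0. Proof. by rewrite mulr_gt0 ?exprn_gt0 ?divr_gt0. Qed.

Lemma loop_area r T0 d : 0 < d -> tau <= T0 -> T0 + d <= 2 * s ->
  k0 * r ^+ 2 <= 2^-1 * \int[mu]_(t in I) (resc (@bf R) r T0 d t * resc (@dbg R) (r / d) T0 d t -
     resc (@bg R) r T0 d t * resc (@dbf R) (r / d) T0 d t).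
Proof.
move=> d0 l1 l2.
pose f t : R := r ^+ 2 / d * bf ((t - T0) / d) ^+ 2.
have E : \int[mu]_(t in I) (resc (@bf R) r T0 d t * resc (@dbg R) (r / d) T0 d t -
     resc (@bg R) r T0 d t * resc (@dbf R) (r / d) T0 d t) = \int[mu]_(t in I) f t.
  by apply: eq_Rintegral => t _; rewrite /f -wronskian /resc; ring.
have r0 : 0 <= r ^+ 2 / d by rewrite mulr_ge0 ?sqr_ge0// invr_ge0 ltW.
have cf : pos_continuous f.
  move=> t t0; rewrite (_ : f = (fun t => r ^+ 2 / d * (resc (@bf R) 1 T0 d t * resc (@bf R) 1 T0 d t))).
    apply: cvgM; first exact: cvg_cst.
    by apply: cvgM; apply: resc_cts; exact: bf_cts.
  by apply/funext => x; rewrite /f /resc !mul1r expr2.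
have f0 t : 0 < t -> 0 <= f t by move=> _; rewrite mulr_ge0 ?sqr_ge0.
have c0 : 0 < T0 + d / 4 by rewrite addr_gt0 ?divr_gt0// (lt_le_trans tau0).
have cd : T0 + d / 4 < T0 + 3 / 4 * d by rewrite ltrD2l; move: d0; lra.
have la : tau <= T0 + d / 4 by rewrite (le_trans l1)// lerDl divr_ge0// ltW.
have lb : T0 + 3 / 4 * d <= 2 * s by apply: le_trans l2; rewrite lerD2l; move: d0; lra.
have := Rint_sub tau0 tau_s la lb cf f0.
have : \int[mu]_(t in `[T0 + d / 4, T0 + 3 / 4 * d]) (r ^+ 2 / d * (3 / 16) ^+ 4) <=
   \int[mu]_(t in `[T0 + d / 4, T0 + 3 / 4 * d]) f t.
  apply: le_Rintegral => //; [exact: (pc_int _ c0 (@pc_cst _ _))|exact: (pc_int _ c0 cf)|].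
  move=> t; rewrite /= in_itv /= => /andP[h1 h2]; rewrite /f ler_wpM2l// bump_area//.
  by rewrite ler_pdivlMr// ler_pdivrMr//; apply/andP; split; move: h1 h2; lra.
rewrite (Rint_cst cd) E => h1 h2.
have h3 := le_trans h1 h2.
have -> : k0 * r ^+ 2 = 2^-1 * (r ^+ 2 / d * (3 / 16) ^+ 4 * (T0 + 3 / 4 * d - (T0 + d / 4))).
  by rewrite /k0; field; rewrite gt_eqF.
by rewrite ler_wpM2l.
Qed.

Lemma q1_ge : k0 <= q1.
Proof.
rewrite (@loop_qf R n n6 tau (2 * s) tau0 Y dY Y_derive dY_pc (proj1 Y_end))//.
have s2 : s + s <= 2 * s by rewrite mulr_natl mulr2n.
have l1 : tau <= s by move: tau0 ts; lra.
by have := loop_area 1 s0 l1 s2; rewrite expr1n mulr1.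
Qed.

Lemma q2_ge : k0 * rho ^+ 2 <= q2.
Proof.
rewrite (@loop_qf R n n6 tau (2 * s) tau0 Y dY Y_derive dY_pc (proj1 Y_end))//.
have s2 : tau + tau <= 2 * s by move: tau0 ts; lra.
exact: (loop_area rho tau0 (lexx tau) s2).
Qed.

Lemma bump_energy r T0 d t : 0 < d ->
  resc (@dbf R) (r / d) T0 d t ^+ 2 + resc (@dbg R) (r / d) T0 d t ^+ 2 <= 2 * r ^+ 2 / d ^+ 2.
Proof.
move=> d0; rewrite /resc !(exprMn 2 (r / d)) -mulrDr mulrC (exprMn 2 r d^-1) (exprVn d 2) -(mulrA 2).
apply: ler_wpM2r; last exact: bump_bound.
by rewrite mulr_ge0 ?sqr_ge0// invr_ge0 sqr_ge0.
Qed.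

(** For the vertical directions 2 and 5, a lower bound for the square root of [hh m j], since 8 q^2
    >= 4. *)
Definition csqrt (j : nat) t : R := 2 * expR (al m j / 2 * ll t - kk t).

Lemma csqrt_gt0 j t : 0 < csqrt j t. Proof. by rewrite mulr_gt0 ?expR_gt0. Qed.

Lemma csqrt_le j t : j = 2%N \/ j = 5%N -> csqrt j t ^+ 2 <= hh m j t.
Proof.
have q4 : 4 <= 8 * qe R ^+ 2 by rewrite /qe; lra.
move=> H; have -> : hh m j t = 8 * qe R ^+ 2 * expR (2 * (al m j / 2 * ll t - kk t)).
  rewrite /hh /mon; have -> : cf R j = 8 * qe R ^+ 2 by case: H => ->.
  have -> : be R j = -2 by case: H => ->.
  by congr (_ * expR _); field.
rewrite /csqrt exprMn -expRM_natl; apply: ler_wpM2r; first exact: expR_ge0.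
by have -> : 2 ^+ 2 = 4 :> R by rewrite -natrX.
Qed.

Definition SS t : R := Num.sqrt (quad (metricZ L (h t)) (fillQ tau (2 * s) xi dxi)).

Lemma SSE t : SS t = Num.sqrt (hh m 2 t * q1 ^+ 2 + hh m 5 t * q2 ^+ 2).
Proof. by rewrite /SS (quad_fillQ m n6 tau0 tau_s two_loops_W). Qed.

Let q1_gt0 : 0 < q1. Proof. exact: lt_le_trans q1_ge. Qed.
Let q2_ge0 : 0 <= q2.
Proof. by apply: le_trans q2_ge; rewrite mulr_ge0 ?sqr_ge0// ltW. Qed.

Lemma SS_ge t : csqrt 2 t * q1 <= SS t /\ csqrt 5 t * q2 <= SS t.
Proof.
have E (x y : R) : 0 <= x -> x ^+ 2 <= y -> x <= Num.sqrt y.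
  by move=> x0 xy; rewrite -[leLHS](ger0_norm x0) -sqrtr_sqr; exact: ler_wsqrtr.
have h2 := hh_gt0 m 2 t; have h5 := hh_gt0 m 5 t.
have s1 := sqr_ge0 q1; have s2 := sqr_ge0 q2.
rewrite SSE; split; apply: E.
- by rewrite mulr_ge0 ?(ltW (csqrt_gt0 _ _)) ?(ltW q1_gt0).
- rewrite exprMn; apply: (@le_trans _ _ (hh m 2 t * q1 ^+ 2)).
    by rewrite ler_wpM2r// csqrt_le//; left.
  by rewrite lerDl mulr_ge0// ltW.
- by rewrite mulr_ge0 ?(ltW (csqrt_gt0 _ _)).
rewrite exprMn; apply: (@le_trans _ _ (hh m 5 t * q2 ^+ 2)).
  by rewrite ler_wpM2r// csqrt_le//; right.
by rewrite lerDr mulr_ge0// ltW.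
Qed.

Lemma SS_gt0 t : 0 < SS t.
Proof. by have [h1 _] := SS_ge t; apply: lt_le_trans h1; rewrite mulr_gt0 ?csqrt_gt0. Qed.

Lemma SSV_pc : pos_continuous (fun t => (SS t)^-1).
Proof.
apply: pcV => [t _|]; first exact: SS_gt0.
rewrite (_ : SS = fun t => Num.sqrt (hh m 2 t * q1 ^+ 2 + hh m 5 t * q2 ^+ 2)); last first.
  by apply/funext => t; exact: SSE.
by apply: pc_sqrt; apply: pcD; apply: pcM; solve [exact: hh_pc|exact: pc_cst].
Qed.

Definition W1 t : R := hh m 0 t * (dY o0 t ^+ 2 + dY o1 t ^+ 2) * (SS t)^-1.
Definition W2 t : R := hh m 3 t * (dY o3 t ^+ 2 + dY o4 t ^+ 2) * (SS t)^-1.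

Lemma W_pc : pos_continuous W1 /\ pos_continuous W2.
Proof.
have c2 i : pos_continuous (fun t => dY i t ^+ 2).
  rewrite (_ : (fun t => _) = (fun t => dY i t * dY i t)); first by apply: pcM; exact: dY_pc.
  by apply/funext => t; rewrite expr2.
by split; apply: pcM SSV_pc; apply: pcM (pcD (c2 _) (c2 _)); exact: hh_pc.
Qed.

Lemma W_ge0 t : 0 <= W1 t /\ 0 <= W2 t.
Proof.
by split; rewrite mulr_ge0 ?invr_ge0 ?(ltW (SS_gt0 _))// mulr_ge0 ?(ltW (hh_gt0 _ _ _))//
  addr_ge0 ?sqr_ge0.
Qed.

Lemma integrandE t : quotV (h t) (dxi t) / SS t = W1 t + W2 t.
Proof.
rewrite (quotV_dxi m n6) !(loop_dX n6)// /W1 /W2.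
have -> : hh m 1 t = hh m 0 t by [].
have -> : hh m 4 t = hh m 3 t by [].
ring.
Qed.

(** The estimate is crosswise: the loop in the first factor is divided by the vertical length due to
    the area of the second, and conversely. The first term decays as rho grows; the second is made
    small through tau afterwards. *)
Lemma energy_bound K1 K2 : 0 < rho ->
  (forall t, s <= t <= 2 * s -> hh m 0 t * (2 / s ^+ 2) / csqrt 5 t <= K1) ->
  (forall t, tau <= t <= 2 * tau -> hh m 3 t / csqrt 2 t <= K2) ->
  \int[mu]_(t in I) (quotV (h t) (dxi t) / SS t) <=
    2 * s * K1 / (k0 * rho ^+ 2) + 2 * rho ^+ 2 * K2 / (tau * k0).
Proof.
move=> r0 H1 H2; have [p1 p2] := W_pc.
have mI (x y : R) : @measurable _ (measurableTypeR R) [set` `[x, y]] by exact: measurable_itv.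
have r2 : 0 < rho ^+ 2 by rewrite exprn_gt0.
have q2p : 0 < q2 by apply: lt_le_trans q2_ge; rewrite mulr_gt0.
have i1 := pc_int (2 * s) tau0 p1; have i2 := pc_int (2 * s) tau0 p2.
have -> : \int[mu]_(t in I) (quotV (h t) (dxi t) / SS t) = \int[mu]_(t in I) W1 t + \int[mu]_(t in I) W2 t.
  by rewrite -RintegralD//; apply: eq_Rintegral => t _; exact: integrandE.
have sI : s <= s <= 2 * s by rewrite lexx /=; move: s0; lra.
have K10 : 0 <= K1.
  apply: le_trans (H1 s sI); rewrite !mulr_ge0 ?invr_ge0 ?(ltW (hh_gt0 _ _ _)) ?sqr_ge0//.
  exact: ltW (csqrt_gt0 _ _).
have tI : tau <= tau <= 2 * tau by rewrite lexx /=; move: tau0; lra.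
have K20 : 0 <= K2.
  apply: le_trans (H2 tau tI); rewrite !mulr_ge0 ?invr_ge0 ?(ltW (hh_gt0 _ _ _))//.
  exact: ltW (csqrt_gt0 _ _).
apply: lerD.
  have b1 t : tau <= t <= 2 * s -> W1 t <= K1 / q2.
    move=> /andP[ht1 ht2]; have [ts'|st] := leP t s.
      have [_ _ e1 e2] := @resc_out (1 / s) s s t s0 (or_introl ts').
      have z0 : dY o0 t = 0 := e1; have z1 : dY o1 t = 0 := e2.
      rewrite /W1 z0 z1 expr0n addr0 mulr0 mul0r.
      by rewrite mulr_ge0 ?invr_ge0 ?(ltW q2p).
    have ss0 := SS_gt0 t; have [_ ss5] := SS_ge t.
    have c5 := csqrt_gt0 5 t.
    have st2 : s <= t <= 2 * s by rewrite (ltW st).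
    have En : dY o0 t ^+ 2 + dY o1 t ^+ 2 <= 2 / s ^+ 2.
      by have := bump_energy 1 s t s0; rewrite expr1n mulr1.
    apply: (@le_trans _ _ (hh m 0 t * (2 / s ^+ 2) * (csqrt 5 t * q2)^-1)).
      apply: ler_pM; [|by rewrite invr_ge0 ltW| |].
      - by rewrite mulr_ge0 ?(ltW (hh_gt0 _ _ _))// addr_ge0 ?sqr_ge0.
      - by rewrite ler_wpM2l ?(ltW (hh_gt0 _ _ _)).
      exact: (inv_le (mulr_gt0 c5 q2p) ss5).
    rewrite div_mul; apply: ler_wpM2r; first by rewrite invr_ge0 ltW.
    exact: H1.
  apply: (@le_trans _ _ (\int[mu]_(t in I) (K1 / q2))).
    have := le_Rintegral (mI tau (2 * s)) i1 (pc_int (2 * s) tau0 (@pc_cst R (K1 / q2))); apply.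
    by move=> t; rewrite /= in_itv /=; exact: b1.
  rewrite (Rint_cst tau_s).
  apply: (@le_trans _ _ (K1 / q2 * (2 * s))).
    by rewrite ler_wpM2l ?mulr_ge0 ?invr_ge0 ?(ltW q2p)// gerBl ltW.
  rewrite mulrC -[leRHS]mulrA [leRHS]mulrA mulrA; apply: ler_wpM2l.
    by rewrite !mulr_ge0// ltW.
  exact: (inv_le (mulr_gt0 k0_gt0 r2) q2_ge).
have lb : 2 * tau <= 2 * s by move: tau0 ts; lra.
have lb' : tau <= 2 * tau by move: tau0; lra.
have -> : \int[mu]_(t in I) W2 t = \int[mu]_(t in `[tau, 2 * tau]) W2 t.
  have := @Rintegral_itvB R W2 (BLeft tau) (BRight (2 * s)) (2 * tau) i2.
  rewrite !bnd_simp => /(_ lb' lb) E.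
  apply/eqP; rewrite -subr_eq0 E; apply/eqP.
  transitivity (\int[mu]_(t in `]2 * tau, 2 * s]) (fun=> 0 : R) t); last first.
    by rewrite Rintegral_cst ?mul0r//; exact: measurable_itv.
  apply: eq_Rintegral => t; rewrite inE /= in_itv /= => /andP[h1 _].
  have t2 : tau + tau <= t by rewrite -mulr2n -mulr_natl ltW.
  have [_ _ e1 e2] := @resc_out (rho / tau) tau tau t tau0 (or_intror t2).
  have z0 : dY o3 t = 0 := e1; have z1 : dY o4 t = 0 := e2.
  by rewrite /W2 z0 z1 expr0n addr0 mulr0 mul0r.
have b2 t : tau <= t <= 2 * tau -> W2 t <= K2 * (2 * rho ^+ 2 / tau ^+ 2) / k0.
  move=> tI2; have ss0 := SS_gt0 t; have [ss2 _] := SS_ge t.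
  have c2 := csqrt_gt0 2 t.
  have En : dY o3 t ^+ 2 + dY o4 t ^+ 2 <= 2 * rho ^+ 2 / tau ^+ 2 by exact: bump_energy.
  apply: (@le_trans _ _ (hh m 3 t * (2 * rho ^+ 2 / tau ^+ 2) * (csqrt 2 t * k0)^-1)).
    apply: ler_pM; [|by rewrite invr_ge0 ltW| |].
    - by rewrite mulr_ge0 ?(ltW (hh_gt0 _ _ _))// addr_ge0 ?sqr_ge0.
    - by rewrite ler_wpM2l ?(ltW (hh_gt0 _ _ _)).
    apply: inv_le; first exact: mulr_gt0.
    by apply: le_trans ss2; rewrite ler_wpM2l ?(ltW c2) ?q1_ge.
  rewrite div_mul; apply: ler_wpM2r; first by rewrite invr_ge0 ltW.
  rewrite mulrAC; apply: ler_wpM2r; last exact: H2.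
  by apply: mulr_ge0; [apply: mulr_ge0; [exact: ler0n|exact: ltW]|rewrite invr_ge0 sqr_ge0].
have tt : tau < 2 * tau by move: tau0; lra.
apply: (@le_trans _ _ (\int[mu]_(t in `[tau, 2 * tau]) (K2 * (2 * rho ^+ 2 / tau ^+ 2) / k0))).
  have := le_Rintegral (mI tau (2 * tau)) (pc_int (2 * tau) tau0 p2)
    (pc_int (2 * tau) tau0 (@pc_cst R (K2 * (2 * rho ^+ 2 / tau ^+ 2) / k0))); apply.
  by move=> t; rewrite /= in_itv /=; exact: b2.
rewrite (Rint_cst tt) le_eqVlt; apply/orP; left; apply/eqP.
by field; rewrite !gt_eqF.
Qed.

(** A positive area forces positive energy by [isoperimetric]; without this the inverse in
    [kappa_an] could take its default value 0. *)
Lemma energy_gt0 : 0 < \int[mu]_(t in I) (quotV (h t) (dxi t) / SS t).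
Proof.
have [p1 p2] := W_pc; have [w1 w2] := (W_ge0, W_ge0).
have W := two_loops_W; pose v t : R := hh m 0 t * (SS t)^-1.
have cv : pos_continuous v by apply: pcM SSV_pc; exact: hh_pc.
have v0 t : 0 < t -> 0 < v t by move=> _; rewrite mulr_gt0 ?hh_gt0// invr_gt0 SS_gt0.
have [[m0 g0] [m1 g1]] := (dX_L2 W o0, dX_L2 W o1).
have Phi0 := Phi_gt0 tau0 tau_s cv v0.
have := isoperimetric tau0 tau_s cv v0 m0 m1 g0 g1.
have qE : \int[mu]_(t in I) (prim tau (dX dxi o0) t * dX dxi o1 t - prim tau (dX dxi o1) t * dX dxi o0 t) =
   2 * q1 by rewrite /qf mulrA mulfV// mul1r.
rewrite qE => H; have {}H := lt_le_trans (lt_le_trans (mulr_gt0 (ltr0n _ 2) q1_gt0) (ler_norm _)) H.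
have {H}H : 0 < \int[mu]_(t in I) W1 t.
  move: H; rewrite pmulr_rgt0// => H; apply: lt_le_trans H _; rewrite le_eqVlt; apply/orP; left; apply/eqP.
  apply: eq_Rintegral => t _; rewrite !(loop_dX n6)// /v /W1; ring.
apply: lt_le_trans H _; apply: le_Rintegral.
- exact: measurable_itv.
- exact: (pc_int _ tau0 p1).
- have := pc_int (2 * s) tau0 (pcD p1 p2).
  by rewrite (_ : (fun t => W1 t + W2 t) = (fun t => quotV (h t) (dxi t) / SS t))//; apply/funext => t; rewrite integrandE.
by move=> t _; rewrite integrandE lerDl; case: (W_ge0 t).
Qed.

Lemma fillQ_neq0 : fillQ tau (2 * s) xi dxi != 0.
Proof.
apply/eqP => E; have := SS_gt0 1; rewrite /SS E.
by rewrite /quad !mul0mx mxE sqrtr0 ltxx.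
Qed.

Lemma two_loops_neq0 : exists2 t, tau <= t <= 2 * s & xi t != 0.
Proof.
apply: contrapT => H; have /eqP := fillQ_neq0; apply; apply/rowP => k; rewrite !mxE.
have -> : \int[mu]_(t in I) bV (xi t) (dxi t) 0 k = \int[mu]_(t in I) (fun=> 0 : R) t; last first.
  by rewrite Rintegral_cst ?mul0r ?mulr0//; exact: measurable_itv.
apply: eq_Rintegral => t; rewrite inE /= in_itv /= => tI.
have -> : xi t = 0 by apply: contrapT => /eqP xn; apply: H; exists t.
by rewrite /bV linear0 -(scale0r 0) bracketZl scale0r linear0 mxE.
Qed.

End KappaAn.

(** * Limits of the filling constants *)

Section Kappa.
Variables (R : realType) (m : R) (n : nat).
Hypothesis m_bd : 3 <= m <= 6.
Hypothesis n6 : (6 <= n)%N.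
Local Notation L := (heis2 R n).
Local Notation h := (hmat m n).
Local Notation mu := (@lebesgue_measure R).

Lemma kappa_opt_lim : kappa_opt L h T @[T --> (0 : R)^'+] --> 0%E.
Proof.
(* An admissible curve and functional are exhibited so that the supremum is not the one of an empty
   set. *)
have lo T : 0 < T -> (0 <= kappa_opt L h T)%E.
  move=> T0; have tau0 : 0 < T / 16 by rewrite divr_gt0.
  have ts : 2 * (T / 16) < T / 4 by move: T0; lra.
  have W := two_loops_W n 1 tau0 ts.
  have dZ : exists lam : 'rV[R]_(dimZ L), lam != 0.
    by exists (fillQ (T / 16) (2 * (T / 4)) (xiY (two_loops 1 (T / 16) (T / 4))) (dxiY (dtwo_loops 1 (T / 16) (T / 4))));
      exact: (fillQ_neq0 m n6 1 tau0 ts).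
  have [lam lam0] := dZ.
  apply: le_trans (ereal_sup_ubound _); last first.
    do 5 eexists; split; [split; [exact: tau0| |]|exact: W|exact: (two_loops_neq0 m n6 1 tau0 ts)|exact: lam0|reflexivity].
    - by move: T0; lra.
    - by move: T0; lra.
  rewrite lee_fin mulr_ge0// invr_ge0; apply: Rintegral_ge0 => t _.
  rewrite mulr_ge0 ?sqrtr_ge0// (quotV_dxi m n6).
  by rewrite !addr_ge0// mulr_ge0 ?sqr_ge0// ltW// hh_gt0.
have hi T : 0 < T -> (kappa_opt L h T <= (Kb T)%:E)%E.
  move=> T0; apply: ge_ereal_sup => _ [a [b [xi [dxi [lam [[a0 ab bT] W _ _ ->]]]]]].
  rewrite lee_fin; exact: (opt_bound m_bd n6 lam a0 ab bT W).
have fin T : 0 < T -> (kappa_opt L h T = (fine (kappa_opt L h T))%:E)%E.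
  move=> T0; rewrite fineK// fin_numElt (lt_le_trans _ (lo T T0)) ?ltNy0//=.
  by rewrite (le_lt_trans (hi T T0)) ?ltry.
apply/fine_cvgP; split.
  near=> T; have T0 : 0 < T by near: T; exact: nbhs_right_gt.
  by rewrite (fin T T0).
apply/cvgrPdist_lt => e e0; have [T0 T00 HT] := Kb_cvg e0.
near=> T; have Tp : 0 < T by near: T; exact: nbhs_right_gt.
have TT : T < T0 by near: T; exact: nbhs_right_lt.
rewrite /= sub0r normrN ger0_norm ?fine_ge0 ?lo//.
apply: le_lt_trans (HT T Tp TT).
by rewrite -lee_fin -(fin T Tp) hi.
Unshelve. all: by end_near. Qed.

(** Here y plays the role of the logarithm of 2 tau, and 78/11 inverts the exponent gap 89/78 -
    1. *)
Lemma small_tau (e k : R) : 0 < e -> 0 < k -> exists y : R,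
  [/\ y <= 0, expR y < e & expR (89 / 78 * y - y) <= k].
Proof.
move=> e0 k0; exists (Num.min 0 (Num.min (ln e - 1) (78 / 11 * ln k))).
set y := Num.min _ _; have h1 : y <= 0 by rewrite /y ge_min lexx.
have h2 : y <= ln e - 1 by rewrite /y !ge_min lexx orbT.
have h3 : y <= 78 / 11 * ln k by rewrite /y !ge_min lexx !orbT.
split => //; first by rewrite -[ltRHS]lnK ?posrE// ltr_expR; move: h2; lra.
by rewrite -[leRHS]lnK ?posrE// ler_expR; move: h3; lra.
Qed.

(** First s is fixed, then rho is taken large to make the late loop cheap, then tau small in terms
    of rho to make the early loop cheap. *)
Lemma kappa_an_infty T : 0 < T -> kappa_an L h T = +oo%E.
Proof.
move=> T0; apply/eqyP => M0 _.
pose M := Num.max 1 M0; have M1 : 0 < M by rewrite lt_max ltr01.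
pose s := T / 4; have s0 : 0 < s by rewrite divr_gt0.
pose k0 : R := 4^-1 * (3 / 16) ^+ 4.
have k00 : 0 < k0 by rewrite mulr_gt0 ?exprn_gt0 ?divr_gt0.
have s2 : s <= 2 * s by move: s0; lra.
have c1 : pos_continuous (fun t => hh m 0 t * (2 / s ^+ 2) / csqrt m 5 t).
  apply: pcM; first by apply: pcM; [exact: hh_pc|exact: pc_cst].
  apply: pcV => [t _|]; first exact: csqrt_gt0.
  rewrite (_ : csqrt m 5 = mon 2 (al m 5 / 2) (-1)); first exact: mon_pc.
  by apply/funext => t; rewrite /csqrt /mon mulN1r.
have [c cI Hc] := EVT_max s2 (pc_within s0 c1).
pose K1 := hh m 0 c * (2 / s ^+ 2) / csqrt m 5 c.
have K10 : 0 < K1.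
  apply: divr_gt0; last exact: csqrt_gt0.
  apply: mulr_gt0; first exact: hh_gt0.
  exact: (divr_gt0 (ltr0n _ 2) (exprn_gt0 2 s0)).
(* Once rho^2 >= X, the first term of [energy_bound] is at most 1 / (4 M). *)
pose X := 4 * M * (2 * s * K1) / k0.
have X0 : 0 < X.
  exact: (divr_gt0 (mulr_gt0 (mulr_gt0 (ltr0n _ 4) M1) (mulr_gt0 (mulr_gt0 (ltr0n _ 2) s0) K10)) k00).
pose rho := 1 + X; have rho0 : 0 < rho by rewrite addr_gt0.
have rX : X <= rho ^+ 2 by rewrite /rho; nra.
have r20 : 0 < rho ^+ 2 by rewrite exprn_gt0.
(* The bound asked of [small_tau]: it makes the second term of [energy_bound] at most 1 / (4 M). *)
have kk0 : 0 < k0 / (8 * M * rho ^+ 2 * expR (3 * kk T)) by rewrite divr_gt0 ?mulr_gt0 ?expR_gt0.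
have [y [y0 ye yk]] := small_tau s0 kk0.
pose tau := expR y / 2; have tau0 : 0 < tau by rewrite divr_gt0 ?expR_gt0.
have t2 : 2 * tau = expR y by rewrite /tau mulrC divfK.
have ts : 2 * tau < s by rewrite t2.
pose K2 := 2^-1 * expR (89 / 78 * y + 3 * kk T).
have H1 t : s <= t <= 2 * s -> hh m 0 t * (2 / s ^+ 2) / csqrt m 5 t <= K1.
  by move=> tI; apply: Hc; rewrite in_itv.
have H2 t : tau <= t <= 2 * tau -> hh m 3 t / csqrt m 2 t <= K2.
  move=> /andP[h1 h2]; have t0 : 0 < t by exact: lt_le_trans h1.
  have [m1 m2] := mP m_bd.
  have ly : ll t <= y.
    have := ll_mono t0 h2; rewrite t2 => /le_trans; apply; rewrite -ler_expR ltW//.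
    exact: (ll_lt (expR_gt0 y)).
  have kT : kk t <= kk T.
    by apply: kk_mono => //; apply: (le_trans h2); rewrite ltW// (lt_trans ts)// /s; move: T0; lra.
  rewrite /csqrt invfM mulrCA -expRN /hh /mon /cf /al /be /= mul1r -expRD /K2.
  apply: ler_wpM2l; first by rewrite invr_ge0.
  rewrite ler_expR.
  (* The exponent of s in [hh m 3] / [csqrt m 2] is al 3 - al 2 / 2 = (77 + 4 m) / 78, which is at
     least 89/78 > 1. *)
  have h3 : (77 + 4 * m) / 78 * ll t <= 89 / 78 * y.
    apply: (@le_trans _ _ (89 / 78 * ll t)); last by rewrite ler_wpM2l.
    by apply: ler_wnM2r; [exact: le_trans ly y0|move: m1; lra].
  by move: h3 kT; lra.
have W := two_loops_W n rho tau0 ts.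
have E0 := energy_gt0 m n6 rho tau0 ts.
have EB := energy_bound n6 tau0 ts rho0 H1 H2.
set E := \int[mu]_(t in _) _ in E0 EB.
have B1 : 2 * s * K1 / (k0 * rho ^+ 2) <= (4 * M)^-1.
  have M4 : 0 < 4 * M by exact: (mulr_gt0 (ltr0n _ 4) M1).
  rewrite ler_pdivrMr; last exact: mulr_gt0.
  by rewrite ler_pdivlMl//; move: rX; rewrite /X ler_pdivrMr// (mulrC k0).
have B2 : 2 * rho ^+ 2 * K2 / (tau * k0) <= (4 * M)^-1.
  have -> : 2 * rho ^+ 2 * K2 / (tau * k0) = 2 * rho ^+ 2 * expR (3 * kk T) / k0 * expR (89 / 78 * y - y).
    rewrite /K2 /tau !expRD expRN; field; rewrite !gt_eqF ?expR_gt0//.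
  apply: (@le_trans _ _ (2 * rho ^+ 2 * expR (3 * kk T) / k0 * (k0 / (8 * M * rho ^+ 2 * expR (3 * kk T))))).
    by apply: ler_wpM2l => //; rewrite !mulr_ge0 ?invr_ge0 ?expR_ge0// ltW.
  rewrite le_eqVlt; apply/orP; left; apply/eqP; field.
  by rewrite !gt_eqF ?expR_gt0.
have EM : E <= (2 * M)^-1.
  apply: (le_trans EB); apply: (le_trans (lerD B1 B2)).
  rewrite le_eqVlt; apply/orP; left; apply/eqP; field; by rewrite gt_eqF.
apply: le_trans (ereal_sup_ubound _); last first.
  do 4 eexists; split; [split; [exact: tau0| |]|exact: W|exact: (fillQ_neq0 m n6 rho tau0 ts)|reflexivity].
  - by move: ts s0 tau0; lra.
  - by rewrite /s; move: T0; lra.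
rewrite lee_fin -/(SS _ _ _ _ _); apply: (@le_trans _ _ M); first by rewrite le_max lexx orbT.
apply: (@le_trans _ _ (E^-1)); last exact: lexx.
rewrite -[leLHS]invrK; apply: inv_le => //; apply: (le_trans EM).
by apply: inv_le => //; move: M1; lra.
Qed.

End Kappa.

Lemma inv_le_mul (R : realFieldType) (x y z : R) : 0 < x -> 0 < y -> y <= x * z -> x^-1 <= z * y^-1.
Proof. by move=> x0 y0 H; rewrite ler_pdivlMr// mulrC ler_pdivrMr// mulrC. Qed.

Lemma add_coord (R : nmodType) a b (A B : 'M[R]_(a, b)) i j : (A + B) i j = A i j + B i j.
Proof. by rewrite mxE. Qed.

Lemma opp_coord (R : zmodType) a b (A : 'M[R]_(a, b)) i j : (- A) i j = - A i j.
Proof. by rewrite mxE. Qed.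

Lemma diag_coord (R : pzSemiRingType) a b (A : 'M[R]_(a, b)) (f : 'I_b -> R) i j :
  (A *m diag_mx (\row_k f k)) i j = A i j * f j.
Proof. by rewrite mul_mx_diag !mxE. Qed.

Lemma rot_derive (R : realType) (om : R -> R) (w f a b t : R) : is_derive t (1 : R) om (w * f) ->
  is_derive t (1 : R) (fun t => a * cos (om t) - b * sin (om t)) (- (w * (a * sin (om t) + b * cos (om t))) * f) /\
  is_derive t (1 : R) (fun t => a * sin (om t) + b * cos (om t)) (w * (a * cos (om t) - b * sin (om t)) * f).
Proof.
move=> D; have c := @is_derive1_comp R cos om t _ _ (is_derive_cos _) D.
have s := @is_derive1_comp R sin om t _ _ (is_derive_sin _) D.
split.
  have := is_deriveB (is_deriveZ a c) (is_deriveZ b s).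
  by move/is_derive_eq; apply; rewrite /GRing.scale /=; ring.
have := is_deriveD (is_deriveZ a s) (is_deriveZ b c).
by move/is_derive_eq; apply; rewrite /GRing.scale /=; ring.
Qed.

Lemma rot_norm (R : realType) (a b w : R) :
  (a * cos w - b * sin w) ^+ 2 + (a * sin w + b * cos w) ^+ 2 = a ^+ 2 + b ^+ 2.
Proof.
transitivity ((a ^+ 2 + b ^+ 2) * (cos w ^+ 2 + sin w ^+ 2)); first by ring.
by rewrite cos2Dsin2 mulr1.
Qed.

Lemma quad_decay (R : realFieldType) n (k l P : 'I_n -> R) (q y : R) : 1 <= y -> 0 <= q ->
  (forall i, k i <= y * l i) -> q + \sum_(i < n) k i * P i ^+ 2 <= y * (q + \sum_(i < n) l i * P i ^+ 2).
Proof.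
move=> y1 q0 H; rewrite mulrDr; apply: lerD; first exact: ler_peMl.
rewrite mulr_sumr; apply: ler_sum => i _; rewrite mulrA.
by apply: ler_wpM2r (H i); exact: sqr_ge0.
Qed.

Lemma decay_factor (R : realFieldType) (k t a b : R) : 0 < k -> k <= t -> 0 < a -> 0 < b ->
  a <= b * (1 + 3 / 4 * ((t / k) ^+ 2 - 1)) -> b^-1 <= (t / k) ^+ 2 * a^-1.
Proof.
move=> k0 kt a0 b0 H; apply: inv_le_mul => //; apply: le_trans H _.
have : 1 <= (t / k) ^+ 2 by apply: exprn_ege1; rewrite ler_pdivlMr ?mul1r.
by move=> y2; apply: ler_wpM2l; [exact: ltW|lra].
Qed.

Lemma inv_rate (R : fieldType) (t1 F1 r : R) : t1 != 0 -> F1 != 0 -> r != 0 ->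
  (r / t1 * F1)^-1 = t1 / F1 * r^-1.
Proof. by move=> h1 h2 h3; field; rewrite h1 h2 h3. Qed.

Lemma pair_eq (R : fieldType) (k c x : R) : k != 0 -> c / k * (k * x) = c * x.
Proof. by move=> k0; rewrite mulrA divfK. Qed.

Lemma sq_cancel (R : fieldType) (k x y : R) : k != 0 -> x / k ^+ 2 * (k * y) ^+ 2 = x * y ^+ 2.
Proof. by move=> k0; field. Qed.

Lemma inv_sq (R : fieldType) (k y : R) : k != 0 -> k^-1 * (k * y) ^+ 2 = k * y ^+ 2.
Proof. by move=> k0; field. Qed.

(** * Geodesics *)

Section Primitives.
Variable R : realType.
Local Notation mu := (@lebesgue_measure R).
Implicit Types (A B t : R) (g : R -> R).

Definition cont_above A g := forall t : R, A < t -> {for t, continuous g}.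

(** It vanishes at t1, but the integration starts at a lower B so that the two-sided derivative
    exists at t1 too. *)
Definition primitive B (t1 : R) g t : R := \int[mu]_(s in `[B, t]) g s - \int[mu]_(s in `[B, t1]) g s.

Lemma primitive0 B (t1 : R) g : primitive B t1 g t1 = 0.
Proof. exact: subrr. Qed.

Lemma primitive_derive A B (t1 : R) g t : A < B -> cont_above A g -> B < t ->
  is_derive t (1 : R) (primitive B t1 g) (g t).
Proof.
move=> AB cg Bt.
have tt : t < t + 1 by rewrite ltrDl.
have cw : {within [set` `[B, t + 1]], continuous g}.
  apply: continuous_in_subspaceT => s; rewrite inE /= in_itv /= => /andP[Bs _].
  by apply: cg; exact: lt_le_trans Bs.
have ig : mu.-integrable [set` `[B, t + 1]] (EFin \o g).
  by apply: continuous_compact_integrable cw; exact: segment_compact.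
have Bt' : (BLeft B < BRight t)%E by rewrite lte_fin.
have [d1 d2] := continuous_FTC1 tt ig Bt' (cg t (lt_trans AB Bt)).
have D : is_derive t (1 : R) (fun x => \int[mu]_(s in `[B, x]) g s) (g t).
  by rewrite -d2; exact: derive1_is_derive.
have := is_deriveB D (is_derive_cst (\int[mu]_(s in `[B, t1]) g s) t (1 : R)).
by move/is_derive_eq; apply; rewrite subr0.
Qed.

Lemma const_derive (f : R -> R) (a b : R) : a <= b ->
  (forall s, a <= s <= b -> is_derive s (1 : R) f 0) -> f b = f a.
Proof.
move=> ab df; apply/eqP; rewrite eq_le; apply/andP; split.
  have dN (s : R) : a <= s <= b -> is_derive s (1 : R) (fun s => - f s) 0.
    by move=> sI; have := is_deriveN (df s sI); rewrite oppr0.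
  by have := mono_derive ab dN (fun _ _ => lexx 0); rewrite lerN2.
exact: (mono_derive ab df (fun _ _ => lexx 0)).
Qed.

Lemma rotation_norm (w f g : R -> R) (a b : R) : a <= b ->
  (forall s, a <= s <= b -> is_derive s (1 : R) f (- (w s * g s))) ->
  (forall s, a <= s <= b -> is_derive s (1 : R) g (w s * f s)) ->
  f b ^+ 2 + g b ^+ 2 = f a ^+ 2 + g a ^+ 2.
Proof.
move=> ab df dg; rewrite !expr2; apply: (const_derive (f := fun s => f s * f s + g s * g s)) => // s sI.
have := is_deriveD (is_derive_mul (df s sI) (df s sI)) (is_derive_mul (dg s sI) (dg s sI)).
by move/is_derive_eq; apply; ring.
Qed.

(** The difference of two solutions rotates as well, so its norm stays 0 whatever the angular rate
    w. *)
Lemma rotation_unique (w f g f' g' : R -> R) (a b : R) : a <= b -> f a = f' a -> g a = g' a ->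
  (forall s, a <= s <= b -> is_derive s (1 : R) f (- (w s * g s))) ->
  (forall s, a <= s <= b -> is_derive s (1 : R) g (w s * f s)) ->
  (forall s, a <= s <= b -> is_derive s (1 : R) f' (- (w s * g' s))) ->
  (forall s, a <= s <= b -> is_derive s (1 : R) g' (w s * f' s)) ->
  f b = f' b /\ g b = g' b.
Proof.
move=> ab fa ga df dg df' dg'.
have d1 (s : R) : a <= s <= b -> is_derive s (1 : R) (fun s => f s - f' s) (- (w s * (g s - g' s))).
  by move=> sI; have := is_deriveB (df s sI) (df' s sI); move/is_derive_eq; apply; ring.
have d2 (s : R) : a <= s <= b -> is_derive s (1 : R) (fun s => g s - g' s) (w s * (f s - f' s)).
  by move=> sI; have := is_deriveB (dg s sI) (dg' s sI); move/is_derive_eq; apply; ring.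
have := rotation_norm ab d1 d2; rewrite fa ga !subrr expr0n addr0 => /eqP.
by rewrite paddr_eq0 ?sqr_ge0// !sqrf_eq0 !subr_eq0 => /andP[/eqP-> /eqP->].
Qed.

Lemma geodesic_eq d (g : 'rV[R]_d -> 'M[R]_d) D (J : set R) (c c' : R -> 'rV[R]_d) : open J ->
  (forall s, J s -> c s = c' s) -> geodesic_on g D J c -> geodesic_on g D J c'.
Proof.
move=> oJ E G s Js; have [Dc d1 d2 Eq] := G s Js.
have nJ r : J r -> \forall x \near r, J x by move=> Jr; apply: open_nbhs_nbhs.
have n1 r : J r -> \forall x \near r, c x = c' x by move=> /nJ; apply: filterS => x /E.
have D1 r : J r -> is_derive r (1 : R) c' (derive1 c r).
  move=> Jr; have [_ dr _ _] := G r Jr.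
  exact: near_eq_is_derive (n1 r Jr) (derive1_is_derive dr).
have E1 r : J r -> derive1 c r = derive1 c' r.
  by move=> Jr; rewrite [RHS]derive1E; have [_ ->] := D1 r Jr.
have n2 : \forall x \near s, derive1 c x = derive1 c' x by apply: filterS (nJ s Js) => x /E1.
have D2 : is_derive s (1 : R) (derive1 c') (derive1 (derive1 c) s).
  exact: near_eq_is_derive n2 (derive1_is_derive d2).
have E2 : derive1 (derive1 c') s = derive1 (derive1 c) s.
  by rewrite derive1E; case: D2.
split; [by rewrite -E|by have [] := D1 s Js|by case: D2|].
by move=> k; have := Eq k; rewrite -E2 (E1 s Js) (E s Js).
Qed.

Lemma geodesic_glue d (g : 'rV[R]_d -> 'M[R]_d) D (a b r : R) (c1 c2 : R -> 'rV[R]_d) : r < b ->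
  geodesic_on g D `]a, b[ c1 -> geodesic_on g D `]r, +oo[ c2 ->
  (forall s, r < s < b -> c1 s = c2 s) ->
  geodesic_on g D `]a, +oo[ (fun s => if s < b then c1 s else c2 s).
Proof.
move=> rb g1 g2 E; pose c s := if s < b then c1 s else c2 s; rewrite -/c.
have G1 : geodesic_on g D `]a, b[ c.
  apply: geodesic_eq g1; first exact: interval_open.
  by move=> s; rewrite /= in_itv /= => /andP[_ sb]; rewrite /c sb.
have G2 : geodesic_on g D `]r, +oo[ c.
  apply: geodesic_eq g2; first exact: interval_open.
  move=> s; rewrite /= in_itv /= andbT => rs; rewrite /c; case: ifP => // sb.
  by rewrite E// rs.
move=> s sI; have as_ : a < s by move: sI; rewrite /= in_itv /= andbT.
have [sb|bs] := ltP s b; [apply: G1|apply: G2]; rewrite /= in_itv /=; first by rewrite as_.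
by rewrite andbT; exact: lt_le_trans bs.
Qed.

End Primitives.

(** * Forces on the frame momenta *)

Section Frame.
Variables (R : realType) (m : R) (n : nat).
Hypothesis m_bd : 3 <= m <= 6.
Hypothesis n6 : (6 <= n)%N.
Local Notation L := (heis2 R n).
Local Notation o0 := (@oi n n6 0 isT).
Local Notation o1 := (@oi n n6 1 isT).
Local Notation o2 := (@oi n n6 2 isT).
Local Notation o3 := (@oi n n6 3 isT).
Local Notation o4 := (@oi n n6 4 isT).
Local Notation o5 := (@oi n n6 5 isT).
Implicit Types (t s : R) (d : 'I_n) (th x u v : 'rV[R]_n).
Local Notation h := (fun i : 'I_n => hh m i).
Local Notation hd := (fun i : 'I_n => hh_d m i).

(** The coadjoint action: the central components w1, w2 rotate the two horizontal pairs and leave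
    the rest fixed. *)
Definition torque (w1 w2 : R) (p : 'I_n -> R) d : R :=
  if d == o0 then - (w1 * p o1) else if d == o1 then w1 * p o0 else
  if d == o3 then - (w2 * p o4) else if d == o4 then w2 * p o3 else 0.

Lemma spray_torque t x th d :
  spray L h t x th 0 d = torque (hh m 2 t * th 0 o2) (hh m 5 t * th 0 o5) (fun i => th 0 i) d / hh m d t.
Proof.
rewrite /spray summxE.
have E (a : 'I_n) : (th *m (Cm L a *m diag_mx (\row_i (hh m i t)^-1))) 0 d =
    (th 0 o0 * hs R 0 d a + th 0 o1 * hs R 1 d a + th 0 o3 * hs R 3 d a + th 0 o4 * hs R 4 d a) / hh m d t.
  rewrite mulmxA mul_mx_diag mxE [(\row__ _) 0 d]mxE; congr (_ / _); rewrite mxE.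
  rewrite (sum_noncentral n6) => [|i ci]; first by rewrite !mxE.
  by rewrite mxE (_ : sconst L i d a = hs R i d a)// hs_central ?mulr0.
rewrite (bigD1 o2)//= (bigD1 o5)//= big1 ?addr0; last first.
  move=> a /andP[a2 a5]; rewrite mxE E.
  have na : (a : nat) \notin [:: 2; 5]%N by rewrite !inE negb_or; apply/andP; split; [exact: a2|exact: a5].
  by rewrite !(hs_noncentral _ _ _ na) !mulr0 !addr0 mul0r mulr0.
rewrite !scale_coord !E mulrA mulrA -mulrDl; congr (_ / _).
rewrite /torque -!val_eqE /= /hs /heis2_rel !inE !xpair_eqE /=.
have [->|d0] := eqVneq (d : nat) 0%N; first by rewrite /=; ring.
have [->|d1] := eqVneq (d : nat) 1%N; first by rewrite /=; ring.
have [->|d3] := eqVneq (d : nat) 3%N; first by rewrite /=; ring.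
by case: (nat_of_ord d == 4%N); rewrite /=; ring.
Qed.

Lemma sum_split4 (f : 'I_n -> R) : \sum_(d < n) f d = f o0 + f o1 + f o3 + f o4 +
  \sum_(d < n | ~~ noncentral d) f d.
Proof.
rewrite (bigD1 o0)//= (bigD1 o1)//= (bigD1 o3)//= (bigD1 o4)//= !addrA; congr (_ + _).
apply: eq_bigl => d; rewrite /noncentral !inE -!val_eqE /= !negb_or.
by do 4!case: (_ == _)%N.
Qed.

Definition rotated (P p : 'I_n -> R) := [/\ p o0 ^+ 2 + p o1 ^+ 2 = P o0 ^+ 2 + P o1 ^+ 2,
  p o3 ^+ 2 + p o4 ^+ 2 = P o3 ^+ 2 + P o4 ^+ 2 & forall d, ~~ noncentral d -> p d = P d].

(** Since a_X = a_Y in each factor, energies see a rotating pair only through its norm; this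
    uncouples t from the rotation. *)
Lemma rotated_sum (k P p : 'I_n -> R) : k o0 = k o1 -> k o3 = k o4 -> rotated P p ->
  \sum_(d < n) k d * p d ^+ 2 = \sum_(d < n) k d * P d ^+ 2.
Proof.
move=> k01 k34 [e1 e2 e3]; rewrite !sum_split4; congr (_ + _).
  rewrite k01 k34; transitivity (k o1 * (p o0 ^+ 2 + p o1 ^+ 2) + k o4 * (p o3 ^+ 2 + p o4 ^+ 2)).
    by ring.
  by rewrite e1 e2; ring.
by apply: eq_bigr => d nd; rewrite e3.
Qed.

Lemma bracket_noncentral u v i : i \notin [:: o2; o5] -> bracket L u v 0 i = 0.
Proof.
rewrite !inE negb_or => /andP[i2 i5]; rewrite (bracket_vec n6) !mxE (negbTE i2) (negbTE i5).
by rewrite !andbF !mulr0 addr0.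
Qed.

Lemma bracket_noncentral_eq u v (w : 'rV[R]_n) : (forall i : 'I_n, noncentral i -> u 0 i = w 0 i) ->
  bracket L u v = bracket L w v.
Proof. by move=> H; rewrite !(bracket_vec n6) !H. Qed.

Lemma noncentralP d : noncentral d -> [\/ d = o0, d = o1, d = o3 | d = o4].
Proof.
rewrite /noncentral !inE => /or4P[] /eqP e;
  [apply: Or41|apply: Or42|apply: Or43|apply: Or44]; exact: val_inj.
Qed.

Lemma torque0 w1 w2 p : torque w1 w2 p o0 = - (w1 * p o1). Proof. by rewrite /torque eqxx. Qed.
Lemma torque1 w1 w2 p : torque w1 w2 p o1 = w1 * p o0. Proof. by []. Qed.
Lemma torque3 w1 w2 p : torque w1 w2 p o3 = - (w2 * p o4). Proof. by []. Qed.
Lemma torque4 w1 w2 p : torque w1 w2 p o4 = w2 * p o3. Proof. by []. Qed.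

Lemma torque_out w1 w2 p d : ~~ noncentral d -> torque w1 w2 p d = 0.
Proof.
rewrite /noncentral !inE !negb_or => /and4P[e0 e1 e3 e4].
by rewrite /torque -!val_eqE /= (negbTE e0) (negbTE e1) (negbTE e3) (negbTE e4).
Qed.

End Frame.

(** * Geodesics by quadrature *)

Section Development.
Variables (R : realType) (m : R) (n : nat).
Hypothesis m_bd : 3 <= m <= 6.
Hypothesis n6 : (6 <= n)%N.
Local Notation L := (heis2 R n).
Local Notation o0 := (@oi n n6 0 isT).
Local Notation o1 := (@oi n n6 1 isT).
Local Notation o2 := (@oi n n6 2 isT).
Local Notation o3 := (@oi n n6 3 isT).
Local Notation o4 := (@oi n n6 4 isT).
Local Notation o5 := (@oi n n6 5 isT).
Implicit Types (t s : R) (d i : 'I_n) (u v : 'rV[R]_n).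
Local Notation hd := (hh_d m).

Variables (t1 s1 q : R) (P : 'I_n -> R) (x1 : 'rV[R]_n).
Hypothesis t10 : 0 < t1.
Hypothesis q0 : q <= 0.

(** The square of the velocity of t, as a function of t, on a geodesic with squared velocity q and
    initial momenta P. *)
Definition F2 t : R := - q + \sum_(d < n) (hh m d t)^-1 * P d ^+ 2.
Hypothesis F20 : 0 < F2 t1.

Let hV0 d t : 0 < (hh m d t)^-1. Proof. by rewrite invr_gt0 hh_gt0. Qed.
Let term0 d t : 0 <= (hh m d t)^-1 * P d ^+ 2.
Proof. by rewrite mulr_ge0 ?sqr_ge0// ltW. Qed.

(** A zero anywhere would force q = 0 and P = 0, against positivity at t1. *)
Lemma F2_gt0 t : 0 < F2 t.
Proof.
rewrite ltNge; apply/negP => H.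
have S0 : 0 <= \sum_(d < n) (hh m d t)^-1 * P d ^+ 2 by apply: sumr_ge0.
have q00 : q = 0 by apply/eqP; rewrite eq_le q0 /=; move: H S0; rewrite /F2; lra.
have SZ : \sum_(d < n) (hh m d t)^-1 * P d ^+ 2 = 0.
  by apply/eqP; rewrite eq_le S0 andbT; move: H; rewrite /F2 q00 oppr0 add0r.
have PZ d : P d = 0.
  have /eqP := SZ; rewrite psumr_eq0// => /allP /(_ d (mem_index_enum _)) /eqP /eqP.
  by rewrite mulf_eq0 gt_eqF//= sqrf_eq0 => /eqP.
move: F20; rewrite /F2 q00 oppr0 add0r big1 ?ltxx// => d _.
by rewrite PZ expr0n mulr0.
Qed.

Definition F t : R := Num.sqrt (F2 t).
Definition dF2 t : R := - \sum_(d < n) hd d t / hh m d t ^+ 2 * P d ^+ 2.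

Lemma F_gt0 t : 0 < F t. Proof. by rewrite sqrtr_gt0 F2_gt0. Qed.
Lemma F_sqr t : F t ^+ 2 = F2 t. Proof. by rewrite /F (sqr_sqrtr (ltW (F2_gt0 t))). Qed.

Lemma F2_derive t : 0 < t -> is_derive t (1 : R) F2 (dF2 t).
Proof.
move=> t0; have hn d : hh m d t != 0 by rewrite gt_eqF ?hh_gt0.
have d1 d : is_derive t (1 : R) (fun t => (hh m d t)^-1 * P d ^+ 2) (- (hd d t / hh m d t ^+ 2 * P d ^+ 2)).
  have := is_derive_mul (is_deriveV (hn d) (hh_derive m d t0)) (is_derive_cst (P d ^+ 2) t (1 : R)).
  move/is_derive_eq; apply; rewrite mulr0 addr0 /GRing.scale /=; field; exact: hn.
have := is_deriveD (is_derive_cst (- q) t (1 : R)) (is_derive_bigsum (index_enum 'I_n) d1).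
by move/is_derive_eq; apply; rewrite add0r /dF2 sumrN.
Qed.

Lemma F_derive t : 0 < t -> is_derive t (1 : R) F (dF2 t / (2 * F t)).
Proof.
move=> t0; have := @is_derive1_comp R Num.sqrt F2 t _ _ (is_derive1_sqrt (F2_gt0 t)) (F2_derive t0).
by rewrite mulrC.
Qed.

Let FV_pc : pos_continuous (fun t => (F t)^-1).
Proof.
apply: pcV => [t _|]; first exact: F_gt0.
by apply: (@pc_derive R F (fun t => dF2 t / (2 * F t))) => t; exact: F_derive.
Qed.

(** Each quadrature integrates a function controlled only above the previous base point, so the base
    points increase, all below t1. *)
Definition base1 := t1 / 4. Definition base2 := t1 / 2. Definition base3 := 3 / 4 * t1.
Let lt01 : 0 < base1. Proof. by rewrite divr_gt0. Qed.
Let lt12 : base1 < base2. Proof. by rewrite /base1 /base2; move: t10; lra. Qed.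
Let lt23 : base2 < base3. Proof. by rewrite /base2 /base3; move: t10; lra. Qed.
Let lt3 : base3 < t1. Proof. by rewrite /base3; move: t10; lra. Qed.

(** The affine parameter as a function of t; [om1] and [om2] are the angles by which the two
    momentum pairs have turned. *)
Definition sig t : R := s1 + primitive base1 t1 (fun t => (F t)^-1) t.
Definition om1 : R -> R := primitive base1 t1 (fun t => P o2 * (hh m 0 t)^-1 * (F t)^-1).
Definition om2 : R -> R := primitive base1 t1 (fun t => P o5 * (hh m 3 t)^-1 * (F t)^-1).

Let pos_above (g : R -> R) : pos_continuous g -> cont_above 0 g. Proof. by []. Qed.

Lemma sig_derive t : base1 < t -> is_derive t (1 : R) sig (F t)^-1.
Proof.
move=> At; have := is_deriveD (is_derive_cst s1 t (1 : R)) (primitive_derive t1 lt01 (pos_above FV_pc) At).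
by rewrite add0r.
Qed.

Let hV_pc j : pos_continuous (fun t => (hh m j t)^-1).
Proof. by apply: pcV => [t _|]; [exact: hh_gt0|exact: hh_pc]. Qed.

Lemma om1_derive t : base1 < t -> is_derive t (1 : R) om1 (P o2 * (hh m 0 t)^-1 * (F t)^-1).
Proof.
apply: (primitive_derive t1 lt01 (pos_above _)).
by apply: pcM FV_pc; apply: pcM; [exact: pc_cst|exact: hV_pc].
Qed.

Lemma om2_derive t : base1 < t -> is_derive t (1 : R) om2 (P o5 * (hh m 3 t)^-1 * (F t)^-1).
Proof.
apply: (primitive_derive t1 lt01 (pos_above _)).
by apply: pcM FV_pc; apply: pcM; [exact: pc_cst|exact: hV_pc].
Qed.

Definition mom d t : R :=
  if d == o0 then P o0 * cos (om1 t) - P o1 * sin (om1 t) else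
  if d == o1 then P o0 * sin (om1 t) + P o1 * cos (om1 t) else
  if d == o3 then P o3 * cos (om2 t) - P o4 * sin (om2 t) else
  if d == o4 then P o3 * sin (om2 t) + P o4 * cos (om2 t) else P d.

Definition dmom t d : R :=
  torque n6 (P o2 * (hh m 0 t)^-1) (P o5 * (hh m 3 t)^-1) (fun d => mom d t) d * (F t)^-1.

Lemma mom_out d : ~~ noncentral d -> mom d = fun=> P d.
Proof.
rewrite /noncentral !inE !negb_or => /and4P[e0 e1 e3 e4].
by rewrite /mom -!val_eqE /= (negbTE e0) (negbTE e1) (negbTE e3) (negbTE e4).
Qed.

Lemma mom_derive d t : base1 < t -> is_derive t (1 : R) (mom d) (dmom t d).
Proof.
move=> At; rewrite /dmom.
have [a0 a1] := rot_derive (P o0) (P o1) (om1_derive At).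
have [a3 a4] := rot_derive (P o3) (P o4) (om2_derive At).
have [nd|nd] := boolP (noncentral d); last first.
  by rewrite (torque_out n6 _ _ _ nd) (mom_out nd) mul0r; exact: is_derive_cst.
case: (noncentralP n6 nd) => ->.
- by rewrite torque0; exact: a0.
- by rewrite torque1; exact: a1.
- by rewrite torque3; exact: a3.
by rewrite torque4; exact: a4.
Qed.

Lemma mom_t1 d : mom d t1 = P d.
Proof.
rewrite /mom /om1 /om2 !primitive0 cos0 sin0 !mulr1 !mulr0 !subr0 !add0r.
by do 4![case: eqP => [->//|_]].
Qed.

Lemma mom_rotated t : rotated n6 P (fun d => mom d t).
Proof.
split; [exact: rot_norm|exact: rot_norm|].
by move=> d nd; rewrite (mom_out nd).
Qed.

Definition vel t : 'rV[R]_n := \row_d (mom d t / hh m d t).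

Let cont_derive A (g g' : R -> R) : (forall t : R, A < t -> is_derive t (1 : R) g (g' t)) -> cont_above A g.
Proof. by move=> H t At; exact: is_derive_continuous (H t At). Qed.

Let above_le A B (g : R -> R) : A <= B -> cont_above A g -> cont_above B g.
Proof. by move=> AB cg t Bt; apply: cg; exact: le_lt_trans Bt. Qed.

Let cM A (f g : R -> R) : cont_above A f -> cont_above A g -> cont_above A (fun t => f t * g t).
Proof. by move=> cf cg t At; apply: cvgM; [exact: cf|exact: cg]. Qed.
Let cD A (f g : R -> R) : cont_above A f -> cont_above A g -> cont_above A (fun t => f t + g t).
Proof. by move=> cf cg t At; apply: cvgD; [exact: cf|exact: cg]. Qed.

Lemma vel_cont d : cont_above base1 (fun t => vel t 0 d).
Proof.
rewrite (_ : (fun t => _) = fun t => mom d t * (hh m d t)^-1); last by apply/funext => t; rewrite mxE.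
apply: cM; first by apply: cont_derive => t; exact: mom_derive.
by move=> t At; apply: hV_pc; exact: lt_trans lt01 At.
Qed.

(** The true position in its noncentral coordinates only, where x' has no bracket term. The bracket
    needs no others, so [xv] is the full coordinate velocity and [xt] the full position. *)
Definition xn t : 'rV[R]_n := \row_i (x1 0 i + primitive base2 t1 (fun t => vel t 0 i * (F t)^-1) t).

Lemma xn_derive i t : base2 < t -> is_derive t (1 : R) (fun t => xn t 0 i) (vel t 0 i * (F t)^-1).
Proof.
move=> At; rewrite (_ : (fun t => _) = (fun t => x1 0 i + primitive base2 t1 (fun t => vel t 0 i * (F t)^-1) t)).
  have cg : cont_above base1 (fun t => vel t 0 i * (F t)^-1).
    by apply: cM; [exact: vel_cont|exact: (above_le (ltW lt01) (pos_above FV_pc))].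
  by have := is_deriveD (is_derive_cst (x1 0 i) t (1 : R)) (primitive_derive t1 lt12 cg At); rewrite add0r.
by apply/funext => r; rewrite mxE.
Qed.

Definition xv t : 'rV[R]_n := vel t + 2^-1 *: bracket L (xn t) (vel t).

Lemma xv_cont i : cont_above base2 (fun t => xv t 0 i).
Proof.
have cx j : cont_above base2 (fun t => xn t 0 j) by apply: cont_derive => t; exact: xn_derive.
have cv j : cont_above base2 (fun t => vel t 0 j) by exact: (above_le (ltW lt12) (@vel_cont j)).
have cc (k : R) : cont_above base2 (fun=> k) by move=> t _; exact: cvg_cst.
pose e2 : R := (delta_mx 0 o2 : 'rV[R]_n) 0 i; pose e5 : R := (delta_mx 0 o5 : 'rV[R]_n) 0 i.
rewrite (_ : (fun t => _) = (fun t => vel t 0 i + 2^-1 * (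
  (xn t 0 o0 * vel t 0 o1 + -1 * (xn t 0 o1 * vel t 0 o0)) * e2 +
  (xn t 0 o3 * vel t 0 o4 + -1 * (xn t 0 o4 * vel t 0 o3)) * e5))).
  apply: cD => //; apply: cM => //; apply: cD; apply: cM => //; apply: cD; apply: cM => //; exact: cM.
apply/funext => t.
by rewrite /xv (bracket_vec n6) add_coord scale_coord add_coord !scale_coord -/e2 -/e5 !mulN1r.
Qed.

Definition xt t : 'rV[R]_n := \row_i (x1 0 i + primitive base3 t1 (fun t => xv t 0 i * (F t)^-1) t).

Lemma xt_derive i t : base3 < t -> is_derive t (1 : R) (fun t => xt t 0 i) (xv t 0 i * (F t)^-1).
Proof.
move=> At; rewrite (_ : (fun t => _) = (fun t => x1 0 i + primitive base3 t1 (fun t => xv t 0 i * (F t)^-1) t)).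
  have cg : cont_above base2 (fun t => xv t 0 i * (F t)^-1).
    by apply: cM; [exact: xv_cont|exact: (above_le (ltW (lt_trans lt01 lt12)) (pos_above FV_pc))].
  by have := is_deriveD (is_derive_cst (x1 0 i) t (1 : R)) (primitive_derive t1 lt23 cg At); rewrite add0r.
by apply/funext => r; rewrite mxE.
Qed.

Lemma sig_lt t t' : base1 < t -> t < t' -> sig t < sig t'.
Proof.
move=> At tt'; have t0 : 0 < t by exact: lt_trans lt01 At.
have [c cI Hc] := EVT_min (ltW tt') (pc_within t0 FV_pc).
pose k := (F c)^-1; have k0 : 0 < k by rewrite invr_gt0 F_gt0.
have D (s : R) : t <= s <= t' -> is_derive s (1 : R) (fun s => sig s - k * s) ((F s)^-1 - k).
  move=> /andP[ts _]; have := is_deriveB (sig_derive (lt_le_trans At ts)) (is_deriveZ k (is_derive_id s (1 : R))).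
  by move/is_derive_eq; apply; congr (_ - _); exact: mulr1.
have P0 (s : R) : t <= s <= t' -> 0 <= (F s)^-1 - k.
  by move=> sI; rewrite subr_ge0; apply: Hc; rewrite in_itv.
have := mono_derive (ltW tt') D P0; have : k * t < k * t' by rewrite ltr_pM2l.
by lra.
Qed.

Lemma sig_t1 : sig t1 = s1. Proof. by rewrite /sig primitive0 addr0. Qed.

(** The decay bound used for delayed curves also gives 1 / h(t) <= (t / t1)^2 / h(t1) for every
    coefficient. *)
Lemma F_bound t : t1 <= t -> F t <= t / t1 * F t1.
Proof.
move=> tt; have y0 : 0 <= t / t1 * F t1.
  apply: mulr_ge0 (ltW (F_gt0 t1)); apply: divr_ge0 (ltW t10); exact: le_trans (ltW t10) tt.
have y1 : 1 <= t / t1 by rewrite ler_pdivlMr// mul1r.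
have y2 : 1 <= (t / t1) ^+ 2 by exact: exprn_ege1.
have q00 : 0 <= - q by rewrite oppr_ge0.
have H : F2 t <= (t / t1) ^+ 2 * F2 t1.
  apply: (quad_decay P y2 q00) => d.
  exact: (decay_factor t10 tt (hh_gt0 m d t1) (hh_gt0 m d t) (hh_decay m_bd d t10 tt)).
rewrite -[leRHS](ger0_norm y0) -sqrtr_sqr exprMn F_sqr.
exact: ler_wsqrtr.
Qed.

(** By [F_bound] the derivative of [sig] is at least (t1 / F(t1)) / t, whose integral diverges: this
    is where completeness comes from. *)
Lemma sig_surj s : s1 <= s -> exists2 t, t1 <= t & sig t = s.
Proof.
move=> ss; pose k := t1 / F t1; have F1 := F_gt0 t1.
have k0 : 0 < k by exact: divr_gt0.
(* The time at which the logarithmic lower bound for [sig] reaches s. *)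
pose t' := t1 * expR ((s - s1) / k).
have tt' : t1 <= t'.
  by rewrite /t' ler_peMr ?(ltW t10)// -expR0 ler_expR divr_ge0 ?subr_ge0// ltW.
have D (r : R) : t1 <= r <= t' -> is_derive r (1 : R) (fun r => sig r - k * ln r) ((F r)^-1 - k * r^-1).
  move=> /andP[tr _]; have r0 : 0 < r by exact: lt_le_trans tr.
  have Ar : base1 < r by apply: lt_le_trans tr; exact: lt_trans lt12 (lt_trans lt23 lt3).
  exact: is_deriveB (sig_derive Ar) (is_deriveZ k (is_derive1_ln r0)).
have P0 (r : R) : t1 <= r <= t' -> 0 <= (F r)^-1 - k * r^-1.
  move=> /andP[tr _]; have r0 : 0 < r by exact: lt_le_trans tr.
  rewrite subr_ge0 /k -(inv_rate (lt0r_neq0 t10) (lt0r_neq0 F1) (lt0r_neq0 r0)).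
  exact: inv_le (F_gt0 r) (F_bound tr).
have st' : s <= sig t'.
  have := mono_derive tt' D P0; rewrite sig_t1 /t' lnM ?posrE ?expR_gt0// expRK.
  by rewrite mulrDr mulrCA mulfV ?gt_eqF// mulr1; lra.
have ct : {within `[t1, t'], continuous sig}.
  apply: continuous_in_subspaceT => r; rewrite inE /= in_itv /= => /andP[tr _].
  have Ar : base1 < r by apply: lt_le_trans tr; exact: lt_trans lt12 (lt_trans lt23 lt3).
  exact: is_derive_continuous (sig_derive Ar).
have sI : Num.min (sig t1) (sig t') <= s <= Num.max (sig t1) (sig t').
  by rewrite ge_min sig_t1 ss le_max st' orbT.
by have [t tI <-] := IVT tt' ct sI; exists t => //; move: tI; rewrite in_itv /= => /andP[].
Qed.

Definition Tinv s : R := xget t1 [set t | base1 < t /\ sig t = s].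

Lemma sigK t : base1 < t -> Tinv (sig t) = t.
Proof.
move=> At; rewrite /Tinv; case: xgetP => [t' _ [At' E]|/(_ t)[]//].
by have [h|h|//] := ltgtP t' t; [have := sig_lt At' h|have := sig_lt At h]; rewrite E ltxx.
Qed.

Lemma Tinv_gt s : s1 < s -> t1 < Tinv s /\ sig (Tinv s) = s.
Proof.
move=> ss; have [t tt ts] := sig_surj (ltW ss).
have At : base1 < t by apply: lt_le_trans tt; exact: lt_trans lt12 (lt_trans lt23 lt3).
rewrite -ts (sigK At); split => //; rewrite lt_neqAle tt andbT.
by apply: contraTneq ss => e; rewrite -ts -e sig_t1 ltxx.
Qed.

Let A3t1 : base1 < t1. Proof. exact: lt_trans lt12 (lt_trans lt23 lt3). Qed.

Lemma Tinv_derive (s : R) : s1 < s -> is_derive s (1 : R) Tinv (F (Tinv s)).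
Proof.
move=> /Tinv_gt [tt ts].
have At : base1 < Tinv s by exact: lt_trans A3t1 tt.
have nA : \forall t \near Tinv s, base1 < t by exact: lt_nbhsr.
have := @is_derive_inverse R sig Tinv (F (Tinv s))^-1 (Tinv s).
rewrite ts invrK; apply.
- by apply: filterS nA => t; exact: sigK.
- by apply: filterS nA => t At'; exact: is_derive_continuous (sig_derive At').
- exact: sig_derive.
- by rewrite invr_neq0// gt_eqF ?F_gt0.
Qed.

Lemma bracket_row2 u v i : noncentral i -> bracket L u v 0 i = 0.
Proof.
move=> ni; apply: bracket_noncentral.
by move: ni; rewrite /noncentral !inE -!val_eqE /= => /or4P[] /eqP->.
Qed.

Lemma xn_xt t i : noncentral i -> t1 <= t -> xt t 0 i = xn t 0 i.
Proof.
move=> ni tt; apply/eqP; rewrite -subr_eq0; apply/eqP.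
have D (s : R) : t1 <= s <= t -> is_derive s (1 : R) (fun t => xt t 0 i - xn t 0 i) 0.
  move=> /andP[ts _]; have := is_deriveB (xt_derive i (lt_le_trans lt3 ts))
    (xn_derive i (lt_le_trans (lt_trans lt23 lt3) ts)).
  by move/is_derive_eq; apply; rewrite /xv mxE scale_coord bracket_row2// mulr0 addr0 subrr.
have := const_derive tt D; rewrite /= => ->.
by rewrite !mxE !primitive0 subrr.
Qed.

Lemma xvE t : t1 <= t -> xv t = vel t *m Em L (xt t).
Proof.
move=> tt; rewrite /xv /Em mulmxDr mulmx1 mul_Nm; congr (_ + _ *: _).
by apply: (bracket_noncentral_eq n6) => i ni; rewrite (xn_xt ni tt).
Qed.

(* The geodesic through [(t1, x1)] at [s1] with squared velocity [q] and momenta [P]. *)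
Definition gam s : 'rV[R]_(1 + n) := mk (Tinv s) (xt (Tinv s)).

Lemma torque_h d t : torque n6 (P o2) (P o5) (fun i => vel t 0 i) d =
  torque n6 (P o2 * (hh m 0 t)^-1) (P o5 * (hh m 3 t)^-1) (fun i => mom i t) d.
Proof.
rewrite /torque !mxE; have -> : hh m o1 t = hh m 0 t by [].
have -> : hh m o4 t = hh m 3 t by [].
by do 4?[case: ifP => _]; rewrite //; ring.
Qed.

Lemma mom_c t : mom o2 t = P o2 /\ mom o5 t = P o5.
Proof. by have [_ _ H] := mom_rotated t; split; apply: H. Qed.

Lemma gam_geodesic : geodesic_on (st_metric L (hmat m n)) (@half_space R n) `]s1, +oo[ gam.
Proof.
have cN' (i j a : 'I_n) : sconst L i j a = - sconst L j i a by exact: hsN.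
have c0' (i b a j k : 'I_n) : sconst L i b a * sconst L j k b = 0 by exact: hs0.
have h0 (i : 'I_n) t : 0 < t -> 0 < hh m i t by move=> _; exact: hh_gt0.
have hD (i : 'I_n) (t : R) : 0 < t -> is_derive t (1 : R) (hh m i) (hd i t) by exact: hh_derive.
have JP s : `]s1, +oo[%classic s -> s1 < s by rewrite /= in_itv /= andbT.
have hn d t : hh m d t != 0 by rewrite gt_eqF ?hh_gt0.
pose dvel t d := dmom t d * (hh m d t)^-1 - mom d t * hd d t / hh m d t ^+ 2.
have vel_derive d t : base1 < t -> is_derive t (1 : R) (fun t => vel t 0 d) (dvel t d).
  move=> At; rewrite (_ : (fun t => _) = fun t => mom d t * (hh m d t)^-1); last by apply/funext => r; rewrite mxE.
  have := is_derive_mul (mom_derive d At) (is_deriveV (hn d t) (hh_derive m d (lt_trans lt01 At))).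
  by move/is_derive_eq; apply; rewrite /dvel /GRing.scale /=; field; exact: hn.
apply: (@geo_intro R n L cN' c0' (fun i : 'I_n => hh m i) (fun i : 'I_n => hd i) h0 hD `]s1, +oo[%classic
  Tinv (fun s => F (Tinv s)) (fun s => dF2 (Tinv s) / 2) (fun s => xt (Tinv s)) (fun s => vel (Tinv s))
  (fun s => \row_d (dvel (Tinv s) d * F (Tinv s)))).
- exact: interval_open.
- by move=> s /JP /Tinv_gt [h _]; exact: lt_trans h.
- by move=> s /JP; exact: Tinv_derive.
- move=> s /JP ss; have [tt _] := Tinv_gt ss.
  have := @is_derive1_comp R F Tinv s _ _ (F_derive (lt_trans t10 tt)) (Tinv_derive ss).
  by move/is_derive_eq; apply; field; rewrite gt_eqF ?F_gt0.
- move=> s /JP ss; have [tt _] := Tinv_gt ss; apply: is_derive_mx => i j; rewrite (ord1 i).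
  have := @is_derive1_comp R (fun t => xt t 0 j) Tinv s _ _ (xt_derive j (lt_trans lt3 tt)) (Tinv_derive ss).
  by move/is_derive_eq; apply; rewrite -xvE ?(ltW tt)// divfK// gt_eqF ?F_gt0.
- move=> s /JP ss; have [tt _] := Tinv_gt ss; apply: is_derive_mx => i j; rewrite (ord1 i).
  have := @is_derive1_comp R (fun t => vel t 0 j) Tinv s _ _ (vel_derive j _ (lt_trans A3t1 tt)) (Tinv_derive ss).
  by move/is_derive_eq; apply; rewrite [RHS]mxE.
- move=> s /JP ss; rewrite /spray0 /dF2.
  have -> : \sum_(a < n) hd a (Tinv s) * vel (Tinv s) 0 a ^+ 2 =
     \sum_(d < n) hd d (Tinv s) / hh m d (Tinv s) ^+ 2 * mom d (Tinv s) ^+ 2.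
    by apply: eq_bigr => d _; rewrite mxE; field; exact: hn.
  have k01 : hd o0 (Tinv s) / hh m o0 (Tinv s) ^+ 2 = hd o1 (Tinv s) / hh m o1 (Tinv s) ^+ 2 by [].
  have k34 : hd o3 (Tinv s) / hh m o3 (Tinv s) ^+ 2 = hd o4 (Tinv s) / hh m o4 (Tinv s) ^+ 2 by [].
  have -> := @rotated_sum R n n6 (fun d => hd d (Tinv s) / hh m d (Tinv s) ^+ 2) P
    (fun d => mom d (Tinv s)) k01 k34 (mom_rotated _).
  by rewrite mulNr mulrC.
move=> s /JP ss; have [tt _] := Tinv_gt ss; set t := Tinv s.
have [m2 m5] := mom_c t.
apply/rowP => d; rewrite mxE [RHS]mxE [X in _ = - X]mxE [X in _ = - (_ + X)]mxE spray_torque scale_coord.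
have -> : hh m 2 t * vel t 0 o2 = P o2 by rewrite mxE m2 mulrC divfK.
have -> : hh m 5 t * vel t 0 o5 = P o5 by rewrite mxE m5 mulrC divfK.
rewrite torque_h mul_mx_diag !mxE /dvel /dmom /rr.
move: (torque _ _ _ _ _) => tq; field.
by rewrite hn gt_eqF ?F_gt0.
Qed.

(** * Uniqueness through the constants of motion *)

Section Uniqueness.
Variables (b : R) (T Td : R -> R) (X th : R -> 'rV[R]_n).
Let p d (s : R) : R := hh m d (T s) * th s 0 d.
Hypothesis dT : forall s, s1 <= s < b -> is_derive s (1 : R) T (Td s).
Hypothesis T0 : forall s, s1 <= s < b -> 0 < T s.
Hypothesis Td0 : forall s, s1 <= s < b -> 0 < Td s.
Hypothesis dTd : forall s, s1 <= s < b ->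
  is_derive s (1 : R) Td (- spray0 (fun i : 'I_n => hd i) (T s) (th s)).
Hypothesis dX : forall s, s1 <= s < b -> is_derive s (1 : R) X (th s *m Em L (X s)).
Hypothesis dp : forall d s, s1 <= s < b ->
  is_derive s (1 : R) (p d) (torque n6 (p o2 s) (p o5 s) (fun i => th s 0 i) d).
Hypotheses (eT : T s1 = t1) (eX : X s1 = x1) (eP : forall d, p d s1 = P d).
Hypothesis eTd : Td s1 ^+ 2 = F2 t1.

Let sub s r : s1 <= s < b -> s1 <= r <= s -> s1 <= r < b.
Proof. by move=> /andP[_ sb] /andP[-> rs] /=; exact: le_lt_trans sb. Qed.

Let hn (i : nat) (t : R) : hh m i t != 0. Proof. exact: lt0r_neq0 (hh_gt0 m i t). Qed.

Lemma T_ge s : s1 <= s < b -> t1 <= T s.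
Proof.
move=> sI; have /andP[ss _] := sI; rewrite -eT.
exact: (mono_derive ss (fun r rI => dT (sub sI rI)) (fun r rI => ltW (Td0 (sub sI rI)))).
Qed.

Let AT s : s1 <= s < b -> base1 < T s. Proof. by move=> sI; exact: lt_le_trans A3t1 (T_ge sI). Qed.

Lemma p_const d s : ~~ noncentral d -> s1 <= s < b -> p d s = P d.
Proof.
move=> nd sI; have /andP[ss _] := sI; rewrite -(eP d).
apply: (const_derive ss) => r rI; have := dp d (sub sI rI).
by rewrite (torque_out n6 _ _ _ nd).
Qed.

Let nc2 : ~~ noncentral o2. Proof. by []. Qed.
Let nc5 : ~~ noncentral o5. Proof. by []. Qed.
Let w1 s := P o2 * (hh m 0 (T s))^-1.
Let w2 s := P o5 * (hh m 3 (T s))^-1.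

Lemma dp0 s : s1 <= s < b -> is_derive s (1 : R) (p o0) (- (w1 s * p o1 s)).
Proof.
move=> sI; have := dp o0 sI; move/is_derive_eq; apply; rewrite torque0 (p_const nc2 sI).
congr (- _); exact/esym/(pair_eq _ _ (hn 0 (T s))).
Qed.

Lemma dp1 s : s1 <= s < b -> is_derive s (1 : R) (p o1) (w1 s * p o0 s).
Proof.
move=> sI; have := dp o1 sI; move/is_derive_eq; apply; rewrite torque1 (p_const nc2 sI).
exact/esym/(pair_eq _ _ (hn 0 (T s))).
Qed.

Lemma dp3 s : s1 <= s < b -> is_derive s (1 : R) (p o3) (- (w2 s * p o4 s)).
Proof.
move=> sI; have := dp o3 sI; move/is_derive_eq; apply; rewrite torque3 (p_const nc5 sI).
congr (- _); exact/esym/(pair_eq _ _ (hn 3 (T s))).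
Qed.

Lemma dp4 s : s1 <= s < b -> is_derive s (1 : R) (p o4) (w2 s * p o3 s).
Proof.
move=> sI; have := dp o4 sI; move/is_derive_eq; apply; rewrite torque4 (p_const nc5 sI).
exact/esym/(pair_eq _ _ (hn 3 (T s))).
Qed.

Lemma p_rotated s : s1 <= s < b -> rotated n6 P (fun d => p d s).
Proof.
move=> sI; have /andP[ss _] := sI; split; last by move=> d nd; exact: p_const.
- rewrite -(eP o0) -(eP o1).
  exact: (rotation_norm ss (fun r rI => dp0 (sub sI rI)) (fun r rI => dp1 (sub sI rI))).
- rewrite -(eP o3) -(eP o4).
  exact: (rotation_norm ss (fun r rI => dp3 (sub sI rI)) (fun r rI => dp4 (sub sI rI))).
Qed.

Lemma dF2_th s : s1 <= s < b -> dF2 (T s) = - \sum_(d < n) hd d (T s) * th s 0 d ^+ 2.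
Proof.
move=> sI; rewrite /dF2; congr (- _).
have k01 : hd o0 (T s) / hh m o0 (T s) ^+ 2 = hd o1 (T s) / hh m o1 (T s) ^+ 2 by [].
have k34 : hd o3 (T s) / hh m o3 (T s) ^+ 2 = hd o4 (T s) / hh m o4 (T s) ^+ 2 by [].
have <- := @rotated_sum R n n6 (fun d => hd d (T s) / hh m d (T s) ^+ 2) P
  (fun d => p d s) k01 k34 (p_rotated sI).
by apply: eq_bigr => d _; exact: sq_cancel (hn d (T s)).
Qed.

(** Td^2 - F2(T) is conserved: by [rotated_sum] the acceleration of t depends on the momenta only
    through their invariants. *)
Lemma energy s : s1 <= s < b -> Td s = F (T s).
Proof.
move=> sI; have /andP[ss sb] := sI; have s1I : s1 <= s1 < b by rewrite lexx (le_lt_trans ss sb).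
have E : Td s * Td s - F2 (T s) = Td s1 * Td s1 - F2 (T s1).
  apply: (const_derive (f := fun r => Td r * Td r - F2 (T r)) ss) => r rI; have rJ := sub sI rI.
  have := is_deriveB (is_derive_mul (dTd rJ) (dTd rJ))
    (@is_derive1_comp R F2 T r _ _ (F2_derive (T0 rJ)) (dT rJ)).
  move/is_derive_eq; apply; rewrite (dF2_th rJ) /spray0.
  by move: (\sum_(_ < _) _) => S; field.
move: E; rewrite eT -!expr2 eTd subrr => /eqP; rewrite subr_eq0 => /eqP E.
by rewrite /F -E sqrtr_sqr (gtr0_norm (Td0 sI)).
Qed.

Lemma sig_T s : s1 <= s < b -> sig (T s) = s.
Proof.
move=> sI; have /andP[ss sb] := sI.
have E : sig (T s) - s = sig (T s1) - s1.
  apply: (const_derive (f := fun r => sig (T r) - r) ss) => r rI; have rJ := sub sI rI.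
  have := is_deriveB (@is_derive1_comp R sig T r _ _ (sig_derive (AT rJ)) (dT rJ)) (is_derive_id r (1 : R)).
  move/is_derive_eq; apply; rewrite (energy rJ) mulVf ?subrr//; exact: lt0r_neq0 (F_gt0 _).
by apply/eqP; rewrite -subr_eq0 E eT sig_t1 subrr.
Qed.

Lemma dmomT d s : s1 <= s < b -> is_derive s (1 : R) (fun r => mom d (T r))
  (torque n6 (w1 s) (w2 s) (fun d => mom d (T s)) d).
Proof.
move=> sI; have := @is_derive1_comp R (mom d) T s _ _ (mom_derive d (AT sI)) (dT sI).
move/is_derive_eq; apply; rewrite (energy sI) /dmom; apply: divfK; exact: lt0r_neq0 (F_gt0 _).
Qed.

Lemma momT d s : s1 <= s < b -> p d s = mom d (T s).
Proof.
move=> sI; have /andP[ss sb] := sI.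
have e1 i : p i s1 = mom i (T s1) by rewrite eT mom_t1 eP.
have m0 r : s1 <= r <= s -> is_derive r (1 : R) (fun r => mom o0 (T r)) (- (w1 r * mom o1 (T r))).
  by move=> rI; have := dmomT o0 (sub sI rI); rewrite torque0.
have m1 r : s1 <= r <= s -> is_derive r (1 : R) (fun r => mom o1 (T r)) (w1 r * mom o0 (T r)).
  by move=> rI; have := dmomT o1 (sub sI rI); rewrite torque1.
have m3 r : s1 <= r <= s -> is_derive r (1 : R) (fun r => mom o3 (T r)) (- (w2 r * mom o4 (T r))).
  by move=> rI; have := dmomT o3 (sub sI rI); rewrite torque3.
have m4 r : s1 <= r <= s -> is_derive r (1 : R) (fun r => mom o4 (T r)) (w2 r * mom o3 (T r)).
  by move=> rI; have := dmomT o4 (sub sI rI); rewrite torque4.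
have [r0 r1] := rotation_unique ss (e1 o0) (e1 o1) (fun r rI => dp0 (sub sI rI))
  (fun r rI => dp1 (sub sI rI)) m0 m1.
have [r3 r4] := rotation_unique ss (e1 o3) (e1 o4) (fun r rI => dp3 (sub sI rI))
  (fun r rI => dp4 (sub sI rI)) m3 m4.
have [nd|nd] := boolP (noncentral d); last by rewrite (p_const nd sI) (mom_out nd).
by case: (noncentralP n6 nd) => ->.
Qed.

Lemma th_vel s : s1 <= s < b -> th s = vel (T s).
Proof.
by move=> sI; apply/rowP => d; rewrite [RHS]mxE -(momT d sI) mulrC (mulKf (hn d _)).
Qed.

Let dXi i s : s1 <= s < b -> is_derive s (1 : R) (fun r => X r 0 i)
  (vel (T s) 0 i + 2^-1 * bracket L (X s) (vel (T s)) 0 i).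
Proof.
move=> sI; have := is_derive_coord 0 i (dX sI).
by rewrite (th_vel sI) /Em mulmxDr mulmx1 mul_Nm add_coord scale_coord.
Qed.

Lemma X_xn i s : noncentral i -> s1 <= s < b -> X s 0 i = xn (T s) 0 i.
Proof.
move=> ni sI; have /andP[ss sb] := sI; apply/eqP; rewrite -subr_eq0; apply/eqP.
have -> : X s 0 i - xn (T s) 0 i = X s1 0 i - xn (T s1) 0 i.
  apply: (const_derive (f := fun r => X r 0 i - xn (T r) 0 i) ss) => r rI; have rJ := sub sI rI.
  have AT2 : base2 < T r by exact: lt_le_trans (lt_trans lt23 lt3) (T_ge rJ).
  have := is_deriveB (dXi i rJ) (@is_derive1_comp R (fun t => xn t 0 i) T r _ _ (xn_derive i AT2) (dT rJ)).
  move/is_derive_eq; apply; rewrite (energy rJ) (bracket_row2 _ _ ni) mulr0 addr0.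
  by rewrite (divfK (lt0r_neq0 (F_gt0 _))) subrr.
by rewrite eT eX mxE primitive0 addr0 subrr.
Qed.

Lemma X_xt s : s1 <= s < b -> X s = xt (T s).
Proof.
move=> sI; have /andP[ss sb] := sI; apply/rowP => i; apply/eqP; rewrite -subr_eq0; apply/eqP.
have -> : X s 0 i - xt (T s) 0 i = X s1 0 i - xt (T s1) 0 i.
  apply: (const_derive (f := fun r => X r 0 i - xt (T r) 0 i) ss) => r rI; have rJ := sub sI rI.
  have AT3 : base3 < T r by exact: lt_le_trans lt3 (T_ge rJ).
  have := is_deriveB (dXi i rJ) (@is_derive1_comp R (fun t => xt t 0 i) T r _ _ (xt_derive i AT3) (dT rJ)).
  move/is_derive_eq; apply; rewrite (energy rJ) (divfK (lt0r_neq0 (F_gt0 _))) /xv add_coord scale_coord.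
  have -> : bracket L (X r) (vel (T r)) = bracket L (xn (T r)) (vel (T r)).
    by apply: (bracket_noncentral_eq n6) => j nj; exact: X_xn.
  exact: subrr.
by rewrite eT eX mxE primitive0 addr0 subrr.
Qed.

(** Energy determines T as the inverse of [sig], the rotation equations determine the momenta, and
    the position follows in the same two stages as [xn] and [xt]. *)
Lemma continuation : exists2 c, geodesic_on (st_metric L (hmat m n)) (@half_space R n) `]s1, +oo[ c &
  forall s, s1 <= s < b -> mk (T s) (X s) = c s.
Proof.
exists gam => [|s sI]; first exact: gam_geodesic.
by rewrite /gam -{3 4}(sig_T sI) (sigK (AT sI)) (X_xt sI).
Qed.

End Uniqueness.

End Development.

(** * Future completeness *)

Section Completeness.
Variables (R : realType) (m : R) (n : nat).
Hypothesis m_bd : 3 <= m <= 6.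
Hypothesis n6 : (6 <= n)%N.
Local Notation L := (heis2 R n).
Local Notation o2 := (@oi n n6 2 isT).
Local Notation o5 := (@oi n n6 5 isT).
Local Notation hd := (hh_d m).

Lemma momentum_rate (h th hd Td tq : R) : h != 0 ->
  hd * Td * th + h * - (2 * Td * (th * (hd / (2 * h))) - tq / h) = tq.
Proof. by move=> h0; field. Qed.

(** The constants of motion are read off at the midpoint of the interval, and the explicit solution
    with these data is glued on. [Pr] covers the timelike and the null case at once. *)
Lemma hmat_complete (Pr : R -> Prop) : (forall q, Pr q -> q <= 0) ->
  future_complete L (hmat m n) Pr.
Proof.
move=> Pq a b cv ab geo vl; pose s1 := (a + b) / 2.
have [as1 s1b] : a < s1 /\ s1 < b by rewrite !midf_lt.
have cN' (i j k : 'I_n) : sconst L i j k = - sconst L j i k by exact: hsN.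
have c0' (i e d j k : 'I_n) : sconst L i e d * sconst L j k e = 0 by exact: hs0.
have h0 (i : 'I_n) (t : R) : 0 < t -> 0 < hh m i t by move=> _; exact: hh_gt0.
have hD (i : 'I_n) (t : R) : 0 < t -> is_derive t (1 : R) (hh m i) (hd i t) by exact: hh_derive.
pose T s := tcoord (cv s); pose X s := rsubmx (cv s); pose Td s := tcoord (derive1 cv s).
pose th s := rsubmx (derive1 cv s) *m Jm L (X s).
have JP s : a < s < b -> `]a, b[%classic s by rewrite /= in_itv.
have G s (sI : a < s < b) := geo_elim cN' c0' h0 hD geo (JP s sI).
have sub s : s1 <= s < b -> a < s < b by move=> /andP[ss ->]; rewrite andbT; exact: lt_le_trans ss.
pose p (d : 'I_n) s : R := hh m d (T s) * th s 0 d.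
have dp d s : s1 <= s < b ->
    is_derive s (1 : R) (p d) (torque n6 (p o2 s) (p o5 s) (fun i => th s 0 i) d).
  move=> /sub sI; have [T0 dT _ _ dth] := G s sI.
  have := is_derive_mul (@is_derive1_comp R (hh m d) T s _ _ (hD d _ T0) dT) (is_derive_coord 0 d dth).
  move/is_derive_eq; apply; rewrite -/(T s) -/(X s) -/(th s) -/(Td s).
  rewrite opp_coord add_coord opp_coord (spray_torque m n6) scale_coord diag_coord.
  exact: (momentum_rate _ _ _ _ (lt0r_neq0 (hh_gt0 m d (T s)))).
have s1I : s1 <= s1 < b by rewrite lexx.
have s1J := sub s1 s1I.
pose q : R := - Td s1 ^+ 2 + \sum_(d < n) hh m d (T s1) * th s1 0 d ^+ 2.
have T10 : 0 < T s1 by case: (G s1 s1J).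
have q0 : q <= 0.
  apply: Pq; have [Ps _] := vl s1 s1J; move: Ps; rewrite hmat_gq//.
  congr (Pr _); rewrite /gq; congr (_ + _); apply: eq_bigr => d _; congr (_ * _ ^+ 2).
  by rewrite /theta /th /Jm mulmxBr mulmx1 mul_Nm.
have Td0 s : s1 <= s < b -> 0 < Td s by move=> /sub sI; have [] := vl s sI.
have eTd : Td s1 ^+ 2 = F2 m q (fun d => p d s1) (T s1).
  rewrite /F2 /q opprD opprK -addrA -[LHS]addr0; congr (_ + _); apply/esym/eqP.
  rewrite addrC subr_eq0; apply/eqP; apply: eq_bigr => d _.
  exact: inv_sq (lt0r_neq0 (hh_gt0 m d (T s1))).
have F20 : 0 < F2 m q (fun d => p d s1) (T s1) by rewrite -eTd exprn_gt0// Td0.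
have [c gc cE] := @continuation R m n m_bd n6 (T s1) s1 q (fun d => p d s1) (X s1) T10 q0 F20 b T Td X th
  (fun s sI => let: And5 _ H _ _ _ := G s (sub s sI) in H)
  (fun s sI => let: And5 H _ _ _ _ := G s (sub s sI) in H) Td0
  (fun s sI => let: And5 _ _ H _ _ := G s (sub s sI) in H)
  (fun s sI => let: And5 _ _ _ H _ := G s (sub s sI) in H) dp erefl erefl (fun _ => erefl) eTd.
exists (fun s => if s < b then cv s else c s); last by move=> s /andP[_ ->].
apply: (geodesic_glue s1b geo gc) => s /andP[ss sb].
by rewrite -cE ?sb ?(ltW ss)// mk_eta.
Qed.

End Completeness.

Lemma hmat_development (R : realType) (m : R) (n : nat) (A : R) :
  3 <= m <= 6 -> (6 <= n)%N -> A ^+ 2 = field_coef m ->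
  [/\ einstein_scalar_development (heis2 R n) (hmat m n) (fun t => A * ll t),
      expanding (hmat m n),
      (forall Gam : discrete_subgroup (heis2 R n),
         C0_inextendible (quotient_spacetime Gam (hmat m n))) &
      [/\ future_timelike_complete (heis2 R n) (hmat m n),
          future_null_complete (heis2 R n) (hmat m n),
          kappa_opt (heis2 R n) (hmat m n) T @[T --> 0^'+] --> 0%E &
          forall T : R, 0 < T -> kappa_an (heis2 R n) (hmat m n) T = +oo%E]].
Proof.
move=> m_bd n6 Am; split; [exact: einstein_hmat|exact: hmat_expanding|exact: hmat_inextendible|split].
- by apply: hmat_complete => // q /ltW.
- by apply: hmat_complete => // q ->.
- exact: kappa_opt_lim.
- exact: kappa_an_infty.
Qed.

Lemma field_coef6 (R : realType) : field_coef (6 : R) = 0.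
Proof. by rewrite /field_coef; lra. Qed.

Lemma field_coef3_gt0 (R : realType) : 0 < field_coef (3 : R).
Proof. by rewrite /field_coef; lra. Qed.

Theorem corollary8p12 (R : realType) (n : nat) (hn : (6 <= n)%N) :
  (exists (h : R -> 'M[R]_n) (phi : R -> R),
     [/\ einstein_scalar_development (heis2 R n) h phi,
         constant_field phi,
         expanding h,
         (forall Gam : discrete_subgroup (heis2 R n),
            C0_inextendible (quotient_spacetime Gam h)) &
         [/\ future_timelike_complete (heis2 R n) h,
             future_null_complete (heis2 R n) h,
             kappa_opt (heis2 R n) h T @[T --> 0^'+] --> 0%E &
             forall T : R, 0 < T -> kappa_an (heis2 R n) h T = +oo%E]]) /\
  (exists (h : R -> 'M[R]_n) (phi : R -> R),
     [/\ einstein_scalar_development (heis2 R n) h phi,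
         ~ constant_field phi,
         expanding h,
         (forall Gam : discrete_subgroup (heis2 R n),
            C0_inextendible (quotient_spacetime Gam h)) &
         [/\ future_timelike_complete (heis2 R n) h,
             future_null_complete (heis2 R n) h,
             kappa_opt (heis2 R n) h T @[T --> 0^'+] --> 0%E &
             forall T : R, 0 < T -> kappa_an (heis2 R n) h T = +oo%E]]).
Proof.
split.
  have bd : 3 <= (6 : R) <= 6 by rewrite lexx andbT ler_nat.
  have A0 : (0 : R) ^+ 2 = field_coef 6 by rewrite field_coef6 expr0n.
  have [e x i c] := hmat_development bd hn A0.
  exists (hmat 6 n), (fun t => 0 * ll t); split => //.
  by move=> s t _ _; rewrite !mul0r.
have bd : 3 <= (3 : R) <= 6 by rewrite lexx /= ler_nat.
have F0 := field_coef3_gt0 R; pose A := Num.sqrt (field_coef (3 : R)).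
have AE : A ^+ 2 = field_coef 3 by rewrite /A (sqr_sqrtr (ltW F0)).
have [e x i c] := hmat_development bd hn AE.
exists (hmat 3 n), (fun t => A * ll t); split => // C.
have A0 : A != 0 by apply: lt0r_neq0; rewrite sqrtr_gt0.
(* A constant field would give ll 1 = ll 2, hence 1 = 2 after applying [Tm]. *)
have /(mulfI A0) E := C 1 2 (ltr0n _ 1) (ltr0n _ 2).
have := llK (ltr0n R 1); rewrite E (llK (ltr0n R 2)) => /eqP.
by rewrite eqr_nat.
Qed.
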